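(* Let $\Omega\subset\mathbb{R}^2$ be a bounded domain with $C^2$ boundary, and let $S_t$, $t\in\mathbb{R}$, denote the solution map for Yudovich solutions of the 2D incompressible Euler equations in $\Omega$. Let $p\in[1,\infty)$. Let $\omega_0\in L^\infty(\Omega)$ and let $(\omega_0^n)_{n}$ be a sequence in $L^\infty(\Omega)$ which converges to $\omega_0$ in $L^p(\Omega)$. Then for all $T>0$, $$\lim_{n\to\infty}\ \sup_{t\in[-T,T]}\|S_t(\omega_0^n)-S_t(\omega_0)\|_{L^p(\Omega)}=0.$$
   Context: Let $\Omega\subset\mathbb{R}^2$ be a bounded domain with $C^2$ boundary and let $\Delta_D$ be the Dirichlet Laplacian on $\Omega$. The 2D incompressible Euler equations in vorticity form are $\partial_t\omega+u\cdot\nabla\omega=0$ in $\Omega\times(0,\infty)$, where the velocity is recovered by the Biot–Savart law $u=\nabla^\perp\Delta_D^{-1}\omega=:K*\omega$, with $\nabla^\perp=(-\partial_2,\partial_1)$; i.e. $u=\nabla^\perp\psi$ with $\Delta\psi=\omega$ in $\Omega$, $\psi=0$ on $\partial\Omega$, and $K*\omega(x)=\int_\Omega K(x,y)\omega(y)\,dy$ for the corresponding kernel $K$. When $\omega\in L^\infty(\Omega)$, $u=K*\omega$ is bounded and log-Lipschitz (hence extends continuously to $\overline\Omega$) and is tangent to $\partial\Omega$. Yudovich solution: given $\omega_0\in L^\infty(\Omega)$, it is a triple $(\omega,u,X_t)$ with $\omega\in L^\infty(\mathbb{R};L^\infty(\Omega))$, $u(t)=K*\omega(t)$, $X_t:\Omega\to\Omega$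 measure-preserving and invertible, $\frac{d}{dt}X_t(x)=u(X_t(x),t)$, $X_0(x)=x$ for all $x\in\overline\Omega$, and $\omega(x,t)=\omega_0(X_t^{-1}(x))$. It is a known theorem (Yudovich; Marchioro–Pulvirenti) that for each $\omega_0\in L^\infty(\Omega)$ there exists a unique such triple, and that $X_t:\overline\Omega\to\overline\Omega$ is Hölder continuous with exponent $\exp(-C|t|\|\omega_0\|_{L^\infty(\Omega)})$ for some $C=C(\Omega)$. The solution map is $S_t:L^\infty(\Omega)\to L^\infty(\Omega)$, $S_t(\omega_0)=\omega(t)$ (the function $x\mapsto\omega_0(X_t^{-1}(x))$), where $(\omega,u,X_t)$ is the Yudovich solution with initial data $\omega_0$. *)

(* Defs.v *)
From HB Require Import structures.
From mathcomp Require Import all_boot all_order all_algebra.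
From mathcomp Require Import all_classical all_reals all_analysis.

Set Implicit Arguments.
Unset Strict Implicit.
Unset Printing Implicit Defensive.

Import Order.TTheory GRing.Theory Num.Theory.
Import numFieldNormedType.Exports.

Local Open Scope classical_set_scope.
Local Open Scope ring_scope.

(* The plane is R * R.  Its library norm is the max norm, which has the same
   open, closed, bounded and compact sets as the Euclidean one.
   [mplane R] is the same type, with the sigma-algebra (the Borel one) for which
   the library defines the product of two copies of lebesgue_measure. *)

Definition mplane (R : realType) := (measurableTypeR R * measurableTypeR R)%type.

Definition leb2 (R : realType) : {measure set (mplane R) -> \bar R} :=
  (@lebesgue_measure R \x @lebesgue_measure R)%E.

(* Functions on Omega are represented by total functions on the plane, of which
   only the values on Omega matter: f \_ Omega is the extension by 0. *)

Definition LpNorm (R : realType) (Omega : set (R * R)) (p : \bar R)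
    (f : R * R -> R) : \bar R :=
  ('N[leb2 R]_p[EFin \o (f \_ Omega)])%E.

Definition in_Lp (R : realType) (Omega : set (R * R)) (p : \bar R)
    (f : R * R -> R) : Prop :=
  f \_ Omega \in Lfun (leb2 R) p.

Fixpoint Ck (R : realType) (V : normedModType R) (k : nat) (f : V -> R) : Prop :=
  match k with
  | 0 => continuous f
  | k'.+1 => (forall x v, derivable f x v) /\
             (forall v, Ck k' (fun x => 'D_v f x))
  end.

Definition smooth (R : realType) (V : normedModType R) (f : V -> R) : Prop :=
  forall k, Ck k f.

Definition bdry (R : realType) (Omega : set (R * R)) : set (R * R) :=
  closure Omega `\` interior Omega.

(* Near each boundary point, up to exchanging the two axes ([swap]) and
   reversing the second one ([s]), Omega is the strict epigraph of a C^2
   function of one variable. *)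
Definition C2_boundary (R : realType) (Omega : set (R * R)) : Prop :=
  forall x0, bdry Omega x0 ->
    exists (e : R) (gamma : R -> R) (swap s : bool),
      [/\ 0 < e, Ck 2 gamma &
        forall x, ball x0 e x ->
          let y := if swap then (x.2, x.1) else x in
          Omega x <-> 0 < (-1) ^+ s * (y.2 - gamma y.1)].

Definition bounded_C2_domain (R : realType) (Omega : set (R * R)) : Prop :=
  [/\ open Omega, connected Omega, Omega !=set0, bounded_set Omega &
      C2_boundary Omega].

Definition d1 (R : realType) (f : R * R -> R) (x : R * R) : R :=
  'D_((1, 0) : R * R) f x.

Definition d2 (R : realType) (f : R * R -> R) (x : R * R) : R :=
  'D_((0, 1) : R * R) f x.

Definition grad_perp (R : realType) (f : R * R -> R) (x : R * R) : R * R :=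
  (- d2 f x, d1 f x).

Definition laplacian (R : realType) (f : R * R -> R) (x : R * R) : R :=
  d1 (d1 f) x + d2 (d2 f) x.

Definition test_function (R : realType) (Omega : set (R * R))
    (phi : R * R -> R) : Prop :=
  smooth phi /\
  exists K : set (R * R),
    [/\ compact K, K `<=` Omega & forall x, ~ K x -> phi x = 0].

(* Since w is only bounded and measurable, Delta psi = w is understood in the
   sense of distributions on Omega. *)
Definition distr_laplacian (R : realType) (Omega : set (R * R))
    (psi w : R * R -> R) : Prop :=
  forall phi, test_function Omega phi ->
    \int[leb2 R]_(x in Omega) (psi x * laplacian phi x) =
    \int[leb2 R]_(x in Omega) (w x * phi x).

(* psi = Delta_D^-1 w *)
Definition dirichlet_solution (R : realType) (Omega : set (R * R))
    (w psi : R * R -> R) : Prop :=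
  [/\ {within closure Omega, continuous psi},
      forall x, bdry Omega x -> psi x = 0 &
      distr_laplacian Omega psi w].

(* u = K * w = grad^perp Delta_D^-1 w on Omega; on the boundary of Omega, u is
   the continuous extension. *)
Definition biot_savart (R : realType) (Omega : set (R * R))
    (w : R * R -> R) (u : R * R -> R * R) : Prop :=
  exists psi : R * R -> R,
    [/\ dirichlet_solution Omega w psi,
        forall x v, Omega x -> derivable psi x v,
        forall x, Omega x -> u x = grad_perp psi x &
        {within closure Omega, continuous u}].

Definition measure_preserving (R : realType) (Omega : set (R * R))
    (X : R * R -> R * R) : Prop :=
  measurable_fun (Omega : set (mplane R)) (X : mplane R -> mplane R) /\
  forall A : set (mplane R), measurable A -> A `<=` Omega ->
    leb2 R (Omega `&` X @^-1` A) = leb2 R A.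

(* L^oo(R; L^oo(Omega)), with measurability in time in the weak-* sense (for
   instance, vortex patches are not strongly measurable in L^oo(Omega)). *)
Definition in_LooLoo (R : realType) (Omega : set (R * R))
    (w : R -> R * R -> R) : Prop :=
  [/\ forall t, in_Lp Omega +oo%E (w t),
      forall phi, in_Lp Omega 1%E phi ->
        measurable_fun [set: R]
          (fun t => \int[leb2 R]_(x in Omega) (w t x * phi x)) &
      exists M : R,
        {ae @lebesgue_measure R, forall t, (LpNorm Omega +oo%E (w t) <= M%:E)%E}].

(* Since X t is a bijection of Omega, pinv Omega (X t) is its inverse on Omega. *)
Definition yudovich_solution (R : realType) (Omega : set (R * R))
    (w0 : R * R -> R) (w : R -> R * R -> R) (u : R -> R * R -> R * R)
    (X : R -> R * R -> R * R) : Prop :=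
  [/\ in_LooLoo Omega w,
      forall t, biot_savart Omega (w t) (u t),
      forall t, set_bij Omega Omega (X t) /\ measure_preserving Omega (X t),
      forall x, closure Omega x ->
        X 0 x = x /\
        forall t, closure Omega (X t x) /\
                  is_derive t 1 (fun s => X s x) (u t (X t x)) &
      forall t, {ae leb2 R, forall x, Omega x ->
        w t x = w0 (pinv Omega (X t) x)}].

(* S t w0 = w t, where (w, u, X) is the Yudovich solution with data w0. *)
Definition solution_map (R : realType) (Omega : set (R * R))
    (S : R -> (R * R -> R) -> (R * R -> R)) : Prop :=
  forall w0, in_Lp Omega +oo%E w0 ->
    exists (u : R -> R * R -> R * R) (X : R -> R * R -> R * R),
      yudovich_solution Omega w0 (fun t => S t w0) u X.

(* Main.v *)
(* The key point is that the velocity grad^perp psi is log-Lipschitz up to the boundary, uniformly over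
   vorticities bounded by M.  A difference of partial derivatives of psi at two points is the limit of the
   pairing of psi with the Laplacian of a difference of regularized kernels; near the boundary one subtracts
   the image of these kernels under a reflection across a level set of a defining function of the domain,
   so that the test function vanishes on the boundary.

   Let X and Y be the flows of w and w_n, e = |w_n(0) - w(0)|_1 and E = int |Y - X|^2.  Then
   |E'| <= K (sqrt e + F (A - ln F)) with F = E + sqrt e, and F is small uniformly on [-T, T] by Osgood's
   lemma.  In this estimate psi_n - psi is the sum of a part whose Laplacian is small in L^1, for which the
   test function arctan bounds the gradient in L^1, and of a part chi with a bounded Laplacian.  For the latter,
   int |grad chi|^2 is minus the integral of chi against a difference of two transported functions; moving
   both back to time 0 leaves a difference of initial data and the increments chi(Y) - chi(X).

   Osgood's lemma also gives a modulus of continuity of the inverse of X.  Approximating w(0) in L^1 by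
   Lipschitz functions, w(t, Y) is then close to w(0) in L^1, and in L^p since w is bounded.

   Uniqueness of Yudovich solutions is not an assumption.  The solvability of the Dirichlet problem for
   bounded data is read off the hypothesis on S at time 0. *)

Require Import Defs.
From HB Require Import structures.
From mathcomp Require Import all_boot all_order all_algebra.
From mathcomp Require Import all_classical all_reals all_analysis.
From mathcomp Require Import measurable_realfun ring lra.

Set Implicit Arguments.
Unset Strict Implicit.
Unset Printing Implicit Defensive.

Import Order.TTheory GRing.Theory Num.Theory.
Import numFieldNormedType.Exports.

Local Open Scope classical_set_scope.
Local Open Scope ring_scope.

(* [lra] is slow when the context holds many hypotheses that are not inequalities. *)
Ltac olra := repeat match goal with
  | H : ?T |- _ => lazymatch type of T with
     | Prop => lazymatch T with
         | is_true (@Order.le _ _ _ _) => fail | is_true (@Order.lt _ _ _ _) => fail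
         | is_true (andb _ _) => fail | @eq (prod _ _) _ _ => clear H | @eq _ _ _ => fail | _ => clear H end end
  end; lra.

(** * Measurability and integrability in the plane *)

Section plane_measure.
Context {R : realType}.
Implicit Types (A : set (R * R)) (f g : R * R -> R).

(** The approximating data are bounded one by one but not uniformly, so no constant may depend on
    their sup norms. Their transported vorticity is therefore clamped at the bound [M] of the limit:
    the clamped part has a velocity modulus depending on [M] only, while the rest is small in L^1
    and controls the gradient of its potential only in L^1. This is why the difference of the
    potentials has two parts, and why [sqrt e] rather than [e] enters.

    No Green function is constructed. The reflection is along a direction frozen at the singular
    point, hence as smooth as the defining function, which is only C^2. Where the image kernel is
    large it is compensated by the decay of the potential at the boundary, that is, by a bound on
    its gradient; so the modulus estimate contains the unknown gradient bound. The circle is closed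
    by absorption on small scales.

    The equation may only be tested with smooth functions of compact support. Truncation and
    mollification extend it to functions that are C^1 inside with bounded gradient and vanish at the
    boundary, whatever its shape. *)

Lemma open_mplane_measurable A : open A -> measurable (A : set (mplane R)).
Proof.
move=> oA.
(* Rational centres and radii [1 / (n + 1)]: the index set must be countable for the union to be
   measurable. *)
pose bx (i : rat * rat * nat) : set (mplane R) :=
  `]ratr i.1.1 - i.2.+1%:R^-1, ratr i.1.1 + i.2.+1%:R^-1[ `*`
  `]ratr i.1.2 - i.2.+1%:R^-1, ratr i.1.2 + i.2.+1%:R^-1[.
have -> : A = \bigcup_(i in [set i | bx i `<=` A]) bx i.
  apply/seteqP; split => [x Ax|x [i /= iA]]; last exact: iA.
  have /nbhs_ballP[e /= e0 eA] := open_nbhs_nbhs (conj oA Ax).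
  have [n _ /(_ n (leqnn n)) /= ne] := near_infty_natSinv_lt (PosNum (divr_gt0 e0 (ltr0n R 2))).
  have n0 : 0 < n.+1%:R^-1 :> R by rewrite invr_gt0.
  suff [q1 [q2 [h1 h2]]] : exists q1 q2 : rat,
      `|x.1 - ratr q1| < n.+1%:R^-1 /\ `|x.2 - ratr q2| < n.+1%:R^-1.
    exists (q1, q2, n); rewrite /bx /=; move: (n.+1%:R^-1) n0 ne h1 h2 => k n0 ne h1 h2.
      move=> y [/=]; rewrite !in_itv/= => /andP[y1 y2] /andP[y3 y4]; apply: eA.
      move: h1 h2; rewrite !ltr_norml => /andP[a1 a2] /andP[a3 a4].
      by split => /=; rewrite /ball/= ltr_norml; apply/andP; split; olra.
    move: h1 h2; rewrite !ltr_norml => /andP[a1 a2] /andP[a3 a4].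
    by split => /=; rewrite in_itv/=; apply/andP; split; olra.
  move: (n.+1%:R^-1) n0 => k n0.
  have rq (t : R) : exists q : rat, `|t - ratr q| < k.
    have := @dense_rat R `]t - k, t + k[%classic.
    case.
    - by exists t => /=; rewrite in_itv/=; apply/andP; split; olra.
    - exact: itv_open.
    - move=> _ [/=] /[swap] -[q _ <-]; rewrite in_itv/= => /andP[h1 h2].
      by exists q; rewrite ltr_norml; apply/andP; split; olra.
  by have [q1 h1] := rq x.1; have [q2 h2] := rq x.2; exists q1, q2.
rewrite bigcup_mkcond; apply: countable_bigcupT_measurable => [|i]; first exact: countableP.
by case: ifPn => _; [apply: measurableX; exact: measurable_itv|exact: measurable0].
Qed.

Lemma continuous_mplane_measurable A f : open A ->
  (forall x, A x -> {for x, continuous f}) ->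
  measurable_fun (A : set (mplane R)) f.
Proof.
move=> oA cf; apply: (@measurability _ _ (mplane R) (measurableTypeR R) _ _ (@RGenOpens.G R)).
  exact: RGenOpens.measurableE.
move=> _ [_ [a [b ->] <-]].
apply: open_mplane_measurable; rewrite openE /= => x [Ax fx].
have fn : nbhs x (f @^-1` `]a, b[).
  by apply: (cf _ Ax); apply: open_nbhs_nbhs; split => //; exact: itv_open.
have An : nbhs x A by apply: open_nbhs_nbhs.
by apply: filterS2 An fn => y.
Qed.

Definition box (r : R) : set (R * R) := `[- r, r] `*` `[- r, r].

Lemma measurable_box r : measurable (box r : set (mplane R)).
Proof. by apply: measurableX; exact: measurable_itv. Qed.

Lemma leb2_box_lty r : (leb2 R (box r) < +oo)%E.
Proof.
have mi : measurable (`[- r, r]%classic : set (measurableTypeR R)).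
  exact: measurable_itv.
have -> : leb2 R (box r) =
    (@lebesgue_measure R `[(- r)%R, r] * @lebesgue_measure R `[(- r)%R, r])%E.
  exact: (@product_measure1E _ _ (measurableTypeR R) (measurableTypeR R) R
    (@lebesgue_measure R) (@lebesgue_measure R) _ _ mi mi).
rewrite lebesgue_measure_itv/=.
by case: ifPn => _; rewrite ?mule0 ?ltry// -EFinM ltry.
Qed.

Lemma bounded_subset_box A : bounded_set A -> exists2 r, 0 < r & A `<=` box r.
Proof.
move=> [M [Mr bM]]; exists (`|M| + 1); first by rewrite ltr_pwDr.
move=> x Ax; have := bM (`|M| + 1) _ x Ax.
rewrite ltr_pwDr// ?ler_norm// => /(_ isT) xle.
rewrite /box/=; have : `|x.1| <= `|M| + 1 /\ `|x.2| <= `|M| + 1.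
  by move: xle; rewrite /= prod_normE ge_max => /andP[].
by rewrite !in_itv/= !ler_norml => -[].
Qed.

Lemma compact_box r : compact (box r).
Proof. by apply: compact_setX; exact: segment_compact. Qed.

Lemma compact_fun_bounded (T : topologicalType) (h : T -> R) (K : set T) :
  compact K -> {within K, continuous h} ->
  exists C : R, forall x, K x -> `|h x| <= C.
Proof.
move=> cK ch; have [->|K0] := eqVneq K set0; first by exists 0.
have ch' : {within K, continuous (fun x => `|h x|)}.
  by move=> x; apply: continuous_comp; [exact: ch|exact: norm_continuous].
have /set0P K0' := K0.
have [c _ cM] := @compact_EVT_max T R (fun x => `|h x|) K K0' cK ch'.
by exists `|h c| => x xb; apply: cM; rewrite inE.
Qed.

Lemma bounded_integrable A f C : measurable (A : set (mplane R)) ->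
  (leb2 R A < +oo)%E -> measurable_fun (A : set (mplane R)) f ->
  (forall x, A x -> `|f x| <= C) -> (leb2 R).-integrable A (EFin \o f).
Proof.
move=> mA finA mf fC; apply: measurable_bounded_integrable => //.
exists C; split; first exact: num_real.
by move=> M CM x Ax /=; exact: le_trans (fC _ Ax) (ltW CM).
Qed.

End plane_measure.

(** * Directional derivatives as derivatives along lines *)

Section lines.
Context {R : realType}.

Lemma is_derive_line (V W : normedModType R) (f : V -> W) a v s d :
  is_derive (a + s *: v) v f d -> is_derive s 1 (fun t => f (a + t *: v)) d.
Proof.
have E : (fun h : R => h^-1 *: (f (a + (h *: 1 + s) *: v) - f (a + s *: v))) =
  (fun h : R => h^-1 *: (f (h *: v + (a + s *: v)) - f (a + s *: v))).
  apply/funext => h; congr (_ *: (f _ - _)).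
  by rewrite -[h *: 1]/(h * 1) mulr1 scalerDl addrCA.
move=> [df <-]; split.
  by move: df; rewrite /derivable /= E.
by rewrite /derive /= E.
Qed.

Lemma line_is_derive (V W : normedModType R) (f : V -> W) a v d :
  is_derive (0 : R) 1 (fun t => f (a + t *: v)) d -> is_derive a v f d.
Proof.
have E : (fun h : R => h^-1 *: (f (a + (h *: 1 + 0) *: v) - f (a + 0 *: v))) =
  (fun h : R => h^-1 *: (f (h *: v + a) - f a)).
  apply/funext => h; rewrite scale0r addr0; congr (_ *: (f _ - _)).
    by rewrite -[h *: 1]/(h * 1) mulr1 addrC.
  by rewrite addr0.
move=> [df <-]; split.
  by move: df; rewrite /derivable /= E.
by rewrite /derive /= E.
Qed.

End lines.

Notation e1 := ((1, 0)).
Notation e2 := ((0, 1)).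

(** * Integrals of derivatives of compactly supported functions *)

Section compact_ftc.
Context {R : realType}.
Implicit Types (A : set (R * R)) (f g : R * R -> R).

Lemma FTC_compact_support (g g' : R -> R) (r : R) : 0 < r ->
  (forall t : R, is_derive t (1 : R) g (g' t)) -> continuous g' ->
  (forall t : R, r <= `|t| -> g t = 0 /\ g' t = 0) ->
  (\int[@lebesgue_measure R]_t (g' t)%:E = 0)%E.
Proof.
move=> r0 dg cg' gr.
have cg : continuous g.
  by move=> t; apply/differentiable_continuous/derivable1_diffP; case: (dg t).
transitivity (\int[@lebesgue_measure R]_(t in `[(- r)%R, r]) (g' t)%:E)%E.
  rewrite [RHS]integral_mkcond; apply: eq_integral => t _.
  rewrite patchE; case: ifPn => // /negP tr; rewrite (gr t _).2//.
  rewrite leNgt; apply/negP => tr'; apply: tr; rewrite inE/= in_itv/=.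
  by rewrite -ler_norml ltW.
have rr : - r < r by olra.
rewrite (continuous_FTC2 rr (F := g)).
- have [|-> _] := gr r; first by rewrite ger0_norm// ltW.
  have [|-> _] := gr (- r); first by rewrite normrN ger0_norm// ltW.
  by rewrite subee.
- exact: continuous_subspaceT.
- split; first by move=> t _; case: (dg t).
  + by apply: cvg_at_right_filter; exact: cg.
  + by apply: cvg_at_left_filter; exact: cg.
- by move=> t _; rewrite derive1E; case: (dg t).
Qed.

Lemma compact_support_integrable f (r : R) : 0 < r -> continuous f ->
  (forall x : R * R, r <= `|x| -> f x = 0) ->
  (leb2 R).-integrable setT (EFin \o f).
Proof.
move=> r0 cf fr.
have mf : measurable_fun (setT : set (mplane R)) f.
  by apply: continuous_mplane_measurable; [exact: openT|move=> x _; exact: cf].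
have mb : measurable (box r : set (mplane R)) by exact: measurable_box.
have [C fC] : exists C : R, forall x, box r x -> `|f x| <= C.
  by apply: compact_fun_bounded; [exact: compact_box|exact: continuous_subspaceT].
rewrite (_ : EFin \o f = (EFin \o f) \_ (box r)); last first.
  apply/funext => x; rewrite patchE; case: ifPn => //= /negP xb.
  rewrite fr// leNgt; apply/negP => xr; apply: xb; rewrite inE.
  by move: xr; rewrite prod_normE gt_max /box/= !in_itv/= -!ler_norml => /andP[/ltW-> /ltW->].
apply/integrable_restrict => //; rewrite setTI.
apply: (@bounded_integrable _ (box r) f C) => //.
- exact: leb2_box_lty.
- exact: measurable_funTS.
Qed.

Lemma continuous_pairl (y : R) : continuous (fun t : R => (t, y)).
Proof.
move=> t; apply: (@cvg_pair _ _ _ (nbhs t) (nbhs t) (nbhs y));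
  [exact: cvg_id|exact: cvg_cst].
Qed.

Lemma continuous_pairr (y : R) : continuous (fun t : R => (y, t)).
Proof.
move=> t; apply: (@cvg_pair _ _ _ (nbhs t) (nbhs y) (nbhs t));
  [exact: cvg_cst|exact: cvg_id].
Qed.

Lemma pair_scaleE (s a b : R) : s *: ((a, b) : R * R) = (s * a, s * b).
Proof. by []. Qed.

Lemma pair_addE (a b c d : R) : ((a, b) : R * R) + (c, d) = (a + c, b + d).
Proof. by []. Qed.

Lemma is_derive_sliceT (f : R * R -> R) (t y d : R) :
  is_derive ((t, y) : R * R) (e1 : R * R) f d ->
  is_derive t (1 : R) (fun s => f (s, y)) d.
Proof.
move=> df; have := @is_derive_line R _ _ f ((0, y) : R * R) ((1, 0) : R * R) t d.
have E s : ((0, y) : R * R) + s *: ((1, 0) : R * R) = (s, y).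
  by rewrite pair_scaleE pair_addE ?mulr0 ?mulr1 ?add0r ?addr0.
rewrite E => /(_ df).
by rewrite (_ : (fun _ => _) = (fun s => f (s, y)))//; apply/funext => s; rewrite E.
Qed.

Lemma is_derive_sliceB (f : R * R -> R) (t y d : R) :
  is_derive ((y, t) : R * R) (e2 : R * R) f d ->
  is_derive t (1 : R) (fun s => f (y, s)) d.
Proof.
move=> df; have := @is_derive_line R _ _ f ((y, 0) : R * R) ((0, 1) : R * R) t d.
have E s : ((y, 0) : R * R) + s *: ((0, 1) : R * R) = (y, s).
  by rewrite pair_scaleE pair_addE ?mulr0 ?mulr1 ?add0r ?addr0.
rewrite E => /(_ df).
by rewrite (_ : (fun _ => _) = (fun s => f (y, s)))//; apply/funext => s; rewrite E.
Qed.

Lemma integral_d1_compact f f1 (r : R) : 0 < r -> continuous f1 ->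
  (forall x : R * R, is_derive x (e1 : R * R) f (f1 x)) ->
  (forall x : R * R, r <= `|x| -> f x = 0 /\ f1 x = 0) ->
  \int[leb2 R]_x f1 x = 0.
Proof.
move=> r0 cf1 df fr.
have intf1 : (leb2 R).-integrable setT (EFin \o f1).
  by apply: (@compact_support_integrable _ r) => // x /fr[].
rewrite /Rintegral.
have := @integral21_prod_meas1 _ _ _ _ _ (@lebesgue_measure R) (@lebesgue_measure R) _ intf1.
rewrite /leb2 => <-.
rewrite (_ : (\int[_]_y _)%E = 0%E)//.
rewrite integral0_eq// => y _.
apply: (@FTC_compact_support (fun t => f (t, y)) _ r) => //.
- by move=> t; apply: is_derive_sliceT; exact: df.
- by move=> t; apply: continuous_comp; [exact: continuous_pairl|exact: cf1].
- by move=> t rt; apply: fr; rewrite prod_normE le_max rt.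
Qed.

Lemma integral_d2_compact f f2 (r : R) : 0 < r -> continuous f2 ->
  (forall x : R * R, is_derive x (e2 : R * R) f (f2 x)) ->
  (forall x : R * R, r <= `|x| -> f x = 0 /\ f2 x = 0) ->
  \int[leb2 R]_x f2 x = 0.
Proof.
move=> r0 cf2 df fr.
have intf2 : (leb2 R).-integrable setT (EFin \o f2).
  by apply: (@compact_support_integrable _ r) => // x /fr[].
rewrite /Rintegral.
have := @integral12_prod_meas1 _ _ _ _ _ (@lebesgue_measure R) (@lebesgue_measure R) _ intf2.
rewrite /leb2 => <-.
rewrite (_ : (\int[_]_x _)%E = 0%E)//.
rewrite integral0_eq// => y _.
apply: (@FTC_compact_support (fun t => f (y, t)) _ r) => //.
- by move=> t; apply: is_derive_sliceB; exact: df.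
- by move=> t; apply: continuous_comp; [exact: continuous_pairr|exact: cf2].
- by move=> t rt; apply: fr; rewrite prod_normE le_max rt orbT.
Qed.

End compact_ftc.

(** * Differentiation rules in the form of explicit derivatives *)

Section derive_rules.
Context {R : realType} (V : normedModType R).
Implicit Types (f g : V -> R) (x v : V) (a b : R).

Lemma dC c x v : is_derive x v (fun _ => c : R) 0.
Proof. exact: is_derive_cst. Qed.

Lemma dD f g x v a b : is_derive x v f a -> is_derive x v g b ->
  is_derive x v (fun t => f t + g t) (a + b).
Proof. by move=> df dg; exact: is_deriveD. Qed.

Lemma dN f x v a : is_derive x v f a -> is_derive x v (fun t => - f t) (- a).
Proof. by move=> df; exact: is_deriveN. Qed.

Lemma dB f g x v a b : is_derive x v f a -> is_derive x v g b ->
  is_derive x v (fun t => f t - g t) (a - b).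
Proof. by move=> df dg; exact: is_deriveB. Qed.

Lemma dM f g x v a b : is_derive x v f a -> is_derive x v g b ->
  is_derive x v (fun t => f t * g t) (a * g x + f x * b).
Proof.
move=> df dg; apply: is_derive_eq (is_deriveM df dg) _.
by rewrite addrC mulrC.
Qed.

Lemma dZ c f x v a : is_derive x v f a -> is_derive x v (fun t => c * f t) (c * a).
Proof. by move=> df; exact: is_deriveZ. Qed.

Lemma dV f x v a : f x != 0 -> is_derive x v f a ->
  is_derive x v (fun t => (f t)^-1) (- a / f x ^+ 2).
Proof.
move=> fx [df <-]; apply: DeriveDef; first exact: derivableV.
by rewrite deriveV// scaleNr mulNr mulrC.
Qed.

Lemma dX f n x v a : is_derive x v f a ->
  is_derive x v (fun t => f t ^+ n) (n%:R * f x ^+ n.-1 * a).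
Proof.
move=> df; rewrite (_ : (fun _ => _) = f ^+ n); first exact: is_deriveX.
by apply/funext => t; rewrite exprfctE.
Qed.

Lemma d_eq f x v a b : is_derive x v f a -> a = b -> is_derive x v f b.
Proof. by move=> df <-. Qed.

End derive_rules.

(** * One-variable tools: gluing, zeros, and a C^1 truncation *)

Section derivative_tools.
Context {R : realType}.

(** Meant for the gluing points of functions defined piecewise, where no single formula is available
    on both sides. *)
Lemma is_derive_quadratic (g : R -> R) (x C : R) :
  (forall h, `|g (x + h) - g x| <= C * h ^+ 2) -> is_derive x (1 : R) g 0.
Proof.
move=> H; have C0 : 0 <= C by have := H 1; rewrite expr1n mulr1; exact: le_trans.
apply/is_derive1_caratheodory.
exists (fun z => (g z - g x) / (z - x)); split.
- move=> z; have [->|zx] := eqVneq z x; first by rewrite !subrr mulr0.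
  by rewrite divfK// subr_eq0.
- apply/cvgrPdist_le => e e0; apply/nbhs_ballP.
  exists (e / (C + 1)) => [|z]; first by rewrite /= divr_gt0// ltr_wpDl.
  rewrite /ball/= ltr_pdivlMr ?ltr_wpDl// distrC => zx.
  rewrite subrr mul0r sub0r normrN.
  have [->|zx'] := eqVneq z x; first by rewrite subrr mul0r normr0 ltW.
  rewrite normrM normfV ler_pdivrMr ?normr_gt0 ?subr_eq0//.
  have := H (z - x); rewrite addrCA subrr addr0 => /le_trans; apply.
  rewrite -real_normK ?num_real// expr2 mulrA ler_wpM2r//.
  by rewrite mulrC; apply: le_trans (ltW zx); rewrite mulrDr mulr1 lerDl.
- by rewrite subrr mul0r.
Qed.

Lemma is_derive_compV (V : normedModType R) (f : V -> R) (tau : R -> R) x v d d' :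
  is_derive x v f d -> is_derive (f x) (1 : R) tau d' ->
  is_derive x v (fun y => tau (f y)) (d' * d).
Proof.
move=> df dt; apply: line_is_derive.
have df' : is_derive (0 : R) (1 : R) (fun t => f (x + t *: v)) d.
  by apply: is_derive_line; rewrite scale0r addr0.
have dt' : is_derive (f (x + (0 : R) *: v)) (1 : R) tau d'.
  by rewrite scale0r addr0.
exact: (@is_derive1_comp R tau (fun t => f (x + t *: v)) 0 d' d dt' df').
Qed.

(** The difference quotient is nonzero near a zero with nonzero derivative, so such a zero is alone
    in some interval with rational end points, and there are countably many of these intervals. *)
Lemma discrete_zeros_countable (g g' : R -> R) (O : set R) :
  (forall t : R, O t -> is_derive t (1 : R) g (g' t)) ->
  countable [set t | [/\ O t, g t = 0 & g' t != 0]].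
Proof.
move=> dg; set Z := [set _ | _].
pose I (i : rat * rat) := `]ratr i.1 : R, ratr i.2[%classic.
have ZI t : Z t -> exists i : rat * rat, I i t /\ forall s, I i s -> Z s -> s = t.
  move=> [Ot gt gt']; have /is_derive1_caratheodory[h [gh ch ht]] := dg _ Ot.
  have : \forall z \near t, h z != 0.
    by apply: cvgr_neq0 ch _; rewrite ht.
  move=> /nbhs_ballP[e /= e0 he].
  have [q1 hq1] : exists q : rat, t - e < ratr q < t.
    have [||_ [/=] /[swap] -[q _ <-]] := @dense_rat R `]t - e, t[%classic.
    - by exists (t - e / 2) => /=; rewrite in_itv/=; apply/andP; split; olra.
    - exact: itv_open.
    - by rewrite in_itv/=; exists q.
  have [q2 hq2] : exists q : rat, t < ratr q < t + e.
    have [||_ [/=] /[swap] -[q _ <-]] := @dense_rat R `]t, t + e[%classic.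
    - by exists (t + e / 2) => /=; rewrite in_itv/=; apply/andP; split; olra.
    - exact: itv_open.
    - by rewrite in_itv/=; exists q.
  exists (q1, q2); split; first by rewrite /I/= in_itv/=; olra.
  move=> s; rewrite /I/= in_itv/= => Is [_ gs _].
  have hs : h s != 0 by apply: he; rewrite /ball/= ltr_norml; olra.
  have := gh s; rewrite gs gt subrr => /esym/eqP.
  by rewrite mulf_eq0 (negbTE hs)/= subr_eq0 => /eqP.
apply: (@sub_countable _ _ _ (\bigcup_(i : rat * rat)
    [set t | I i t /\ Z t /\ forall s, I i s -> Z s -> s = t])).
  apply: subset_card_le => t Zt; have [i [It Hi]] := ZI t Zt; exists i => //.
apply: bigcup_countable => [|i _]; first exact: countableP.
have [->|/set0P[t [It [Zt Ht]]]] := eqVneq [set t | I i t /\ Z t /\ forall s, I i s -> Z s -> s = t] set0.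
  exact: countable0.
apply: (@sub_countable _ _ _ [set t]); last exact: countable1.
by apply: subset_card_le => s [Is [Zs _]] /=; exact: Ht.
Qed.

(* The C^1 truncation s |-> sgn s * max(|s| - e, 0)^2 / |s|. *)
Definition trunc (e s : R) := if `|s| <= e then 0 else (`|s| - e) ^+ 2 / s.
(** Outside [[-e, e]] the truncation equals [s - 2 e sgn s + e^2 / s], whose derivative is
    [1 - e^2 / s^2]; the maximum makes the same formula vanish inside. *)
Definition trunc' (e s : R) := 1 - e ^+ 2 / Num.max (e ^+ 2) (s ^+ 2).

Lemma trunc_le (e s : R) : 0 < e -> `|trunc e s| <= `|s|.
Proof.
move=> e0; rewrite /trunc; case: ifPn => [_|]; first by rewrite normr0.
rewrite -ltNge => es; have s0 : 0 < `|s| by olra.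
rewrite normrM normfV ler_pdivrMr// normrX ger0_norm; last olra.
by rewrite -expr2 ler_sqr ?nnegrE; olra.
Qed.

Lemma trunc_eq0 (e s : R) : `|s| <= e -> trunc e s = 0.
Proof. by rewrite /trunc => ->. Qed.

Lemma trunc'_eq0 (e s : R) : 0 < e -> `|s| <= e -> trunc' e s = 0.
Proof.
move=> e0 se; rewrite /trunc' max_l.
  by rewrite divff ?subrr// sqrf_eq0 gt_eqF.
by rewrite -(real_normK (num_real s)) ler_sqr ?nnegrE// ltW.
Qed.

Lemma trunc'_itv (e s : R) : 0 < e -> 0 <= trunc' e s <= 1.
Proof.
move=> e0; rewrite /trunc'; have e20 : 0 < e ^+ 2 by rewrite exprn_gt0.
have m0 : 0 < Num.max (e ^+ 2) (s ^+ 2) by rewrite lt_max e20.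
apply/andP; split; last by rewrite gerBl// divr_ge0 ?ltW.
by rewrite subr_ge0 ler_pdivrMr// mul1r le_max lexx.
Qed.

Lemma trunc'_continuous (e : R) : 0 < e -> continuous (trunc' e).
Proof.
move=> e0 s; apply: cvgB; first exact: cvg_cst.
apply: cvgM; first exact: cvg_cst.
apply: cvgV; first by rewrite gt_eqF// lt_max exprn_gt0.
apply: (@continuous_max _ _ (fun=> e ^+ 2) (fun x : R => x ^+ 2)).
  exact: cvg_cst.
exact: exprn_continuous.
Qed.

Lemma trunc_derive (e s : R) : 0 < e -> is_derive s (1 : R) (trunc e) (trunc' e s).
Proof.
move=> e0; have [se|se] := leP `|s| e.
  rewrite trunc'_eq0//; apply: (@is_derive_quadratic _ _ e^-1) => h.
  rewrite (trunc_eq0 se) subr0 /trunc; case: ifPn => [_|].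
    by rewrite normr0 mulr_ge0// ?sqr_ge0// invr_ge0 ltW.
  rewrite -ltNge => es; have s0 : 0 < `|s + h| by olra.
  have hh : `|s + h| - e <= `|h| by have := ler_normD s h; olra.
  rewrite normrM normfV normrX ger0_norm; last olra.
  rewrite mulrC ler_pM ?invr_ge0 ?sqr_ge0//.
    by rewrite lef_pV2 ?posrE// ltW.
  by rewrite -(real_normK (num_real h)) ler_sqr ?nnegrE; olra.
have s0 : s != 0 by apply/eqP => s0; move: se; rewrite s0 normr0; olra.
have -> : trunc' e s = 1 - e ^+ 2 / s ^+ 2.
  rewrite /trunc' max_r// -(real_normK (num_real s)) ler_sqr ?nnegrE; olra.
apply: (@near_eq_is_derive _ _ _ (fun t : R => t - 2 * e * Num.sg s + e ^+ 2 * t^-1)).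
  near=> t.
  have te : e < `|t|.
    near: t; apply: (cvgr_gt `|s|) => //; exact: norm_continuous.
  have -> : Num.sg s = Num.sg t.
    have : 0 < s * t by near: t; apply: (cvgr_gt (s * s));
      [apply: cvgM; [exact: cvg_cst|exact: cvg_id]|by rewrite -expr2 exprn_even_gt0].
    by case: (sgrP s); case: (sgrP t) => //; nra.
  have t0 : t != 0 by apply/eqP => t0; move: te; rewrite t0 normr0; olra.
  rewrite /trunc leNgt te/=; apply: (mulIf t0).
  rewrite mulfVK// !mulrDl mulfVK// [X in _ = X]sqrrB.
  rewrite real_normK ?num_real// normrEsg; ring.
apply: d_eq (dD (dB (is_derive_id s (1 : R)) (dC _ s (1 : R)))
  (dZ (e ^+ 2) (dV s0 (is_derive_id s (1 : R))))) _.
by rewrite subr0 mulNr mul1r mulrN.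
Unshelve. all: by end_near. Qed.

Lemma cvg_harmonic_bound (u : nat -> R) (l C : R) :
  (forall n, `|u n - l| <= C * n.+1%:R^-1) -> u n @[n --> \oo] --> l.
Proof.
move=> H; apply/subr_cvg0/norm_cvg0P.
have h0 : C * n.+1%:R^-1 @[n --> \oo] --> (0 : R).
  rewrite -[X in _ --> X](mulr0 C); apply: cvgM; first exact: cvg_cst.
  exact: cvg_harmonic.
apply: (squeeze_cvgr _ (cvg_cst 0) h0).
by apply: nearW => n; rewrite normr_ge0/= H.
Qed.

Lemma trunc_dist (e s : R) : 0 < e -> `|trunc e s - s| <= 2 * e.
Proof.
move=> e0; rewrite /trunc; case: ifPn => [se|]; first by rewrite sub0r normrN; olra.
rewrite -ltNge => es; have s0 : s != 0.
  by apply/eqP => s0; move: es; rewrite s0 normr0; olra.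
have n0 : 0 < `|s| by rewrite normr_gt0.
have -> : (`|s| - e) ^+ 2 / s - s = ((`|s| - e) ^+ 2 - s ^+ 2) / s.
  by rewrite mulrBl expr2 mulfK.
rewrite normrM normfV ler_pdivrMr// -(real_normK (num_real s)) ler_norml.
by apply/andP; split; nra.
Qed.

Lemma trunc'_dist (e s : R) : 0 < e -> s != 0 -> `|trunc' e s - 1| <= `|s|^-1 * e.
Proof.
move=> e0 s0; have n0 : 0 < `|s| by rewrite normr_gt0.
have e20 : 0 < e ^+ 2 by rewrite exprn_gt0.
have m0 : 0 < Num.max (e ^+ 2) (s ^+ 2) by rewrite lt_max e20.
rewrite /trunc' addrAC subrr sub0r normrN ger0_norm ?divr_ge0 ?(ltW e20) ?(ltW m0)//.
rewrite ler_pdivrMr// -mulrA ler_pdivlMl//.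
have M1 : e ^+ 2 <= Num.max (e ^+ 2) (s ^+ 2) by rewrite le_max lexx.
have M2 : s ^+ 2 <= Num.max (e ^+ 2) (s ^+ 2) by rewrite le_max lexx orbT.
move: M2; rewrite -[in X in X <= _](real_normK (num_real s)).
move: (Num.max _ _) M1 => M M1 M2.
rewrite expr2 mulrA mulrC ler_wpM2l ?(ltW e0)//.
by have := sqr_ge0 (`|s| - e); nra.
Qed.

Lemma trunc_cvg (s : R) : trunc n.+1%:R^-1 s @[n --> \oo] --> s.
Proof. by apply: cvg_harmonic_bound => n; apply: trunc_dist; rewrite invr_gt0. Qed.

Lemma trunc'_cvg (s : R) : s != 0 -> trunc' n.+1%:R^-1 s @[n --> \oo] --> (1 : R).
Proof.
move=> s0; apply: cvg_harmonic_bound => n.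
by apply: trunc'_dist => //; rewrite invr_gt0.
Qed.

End derivative_tools.

(** * What is special about the coordinate directions *)

Section axis_directions.
Context {R : realType}.

(** Fubini's theorem gives the integration by parts, and the smallness of sets that are countable on
    lines, only along the coordinate axes. Naming these two properties of a direction lets all later
    proofs treat both axes at once. *)
Definition ftc_dir (v : R * R) := forall (f fv : R * R -> R) (r : R), 0 < r ->
  continuous fv -> (forall x : R * R, is_derive x v f (fv x)) ->
  (forall x : R * R, r <= `|x| -> f x = 0 /\ fv x = 0) ->
  \int[leb2 R]_x fv x = 0.

Definition null_dir (v : R * R) := forall A : set (mplane R), measurable A ->
  (forall x : R * R, countable [set t : R | A (x + t *: v)]) -> leb2 R A = 0.

Definition axis (v : R * R) := [/\ v != 0, ftc_dir v & null_dir v].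

Lemma axis_e1 : axis (1, 0).
Proof.
split; first by apply/eqP => -[/eqP]; rewrite oner_eq0.
  by move=> f fv r; exact: integral_d1_compact.
move=> A mA cA.
have mf : measurable_fun [set: mplane R] (EFin \o \1_A : _ -> \bar R).
  by apply/measurable_EFinP; exact: measurable_indic.
have := @fubini_tonelli2 _ _ _ _ _ (@lebesgue_measure R) (@lebesgue_measure R) (EFin \o \1_A) mf.
rewrite integral_indic// setIT => ->; last by move=> x; rewrite /= lee_fin.
apply: integral0_eq => y _; rewrite /fubini_G.
transitivity (\int[@lebesgue_measure R]_x (\1_(ysection A y) x)%:E)%E.
  by apply: eq_integral => x _; rewrite /= !indicE mem_ysection.
rewrite integral_indic ?setIT//; last exact: measurable_ysection.
apply: countable_lebesgue_measure0.
have := cA (0, y); congr countable; apply/seteqP; split => t /=;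
by rewrite pair_scaleE pair_addE mulr0 mulr1 add0r addr0 ysectionP.
Qed.

Lemma axis_e2 : axis (0, 1).
Proof.
split; first by apply/eqP => -[/eqP]; rewrite oner_eq0.
  by move=> f fv r; exact: integral_d2_compact.
move=> A mA cA.
have mf : measurable_fun [set: mplane R] (EFin \o \1_A : _ -> \bar R).
  by apply/measurable_EFinP; exact: measurable_indic.
have := @fubini_tonelli1 _ _ _ _ _ (@lebesgue_measure R) (@lebesgue_measure R) (EFin \o \1_A) mf.
rewrite integral_indic// setIT => ->; last by move=> x; rewrite /= lee_fin.
apply: integral0_eq => y _; rewrite /fubini_F.
transitivity (\int[@lebesgue_measure R]_x (\1_(xsection A y) x)%:E)%E.
  by apply: eq_integral => x _; rewrite /= !indicE mem_xsection.
rewrite integral_indic ?setIT//; last exact: measurable_xsection.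
apply: countable_lebesgue_measure0.
have := cA (y, 0); congr countable; apply/seteqP; split => t /=;
by rewrite pair_scaleE pair_addE mulr0 mulr1 add0r addr0 xsectionP.
Qed.

End axis_directions.

(** * Bounded continuous functions on the domain, zero boundary values, integration by parts *)

Section domain_classes.
Context {R : realType}.
Variable Om : set (R * R).
Hypothesis oOm : open Om.
Hypothesis bOm : bounded_set Om.
Implicit Types (f g : R * R -> R) (K : set (R * R)).
Local Notation I h := (\int[leb2 R]_(x in Om) (h x)).

Lemma measurable_dom : measurable (Om : set (mplane R)).
Proof. exact: open_mplane_measurable. Qed.

Lemma leb2_dom_lty : (leb2 R Om < +oo)%E.
Proof.
have [r r0 Or] := bounded_subset_box bOm.
apply: le_lt_trans (leb2_box_lty r).
apply: le_measure => //; rewrite inE; first exact: measurable_dom.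
exact: measurable_box.
Qed.

(** Boundedness stands in for continuity up to the boundary: it is what dominated convergence asks
    for, and it is stable under sums, products and composition. *)
Definition bcont f := (forall x, Om x -> {for x, continuous f}) /\
  exists C : R, forall x, Om x -> `|f x| <= C.

Lemma bcont_measurable f : bcont f -> measurable_fun (Om : set (mplane R)) f.
Proof. by move=> [cf _]; exact: continuous_mplane_measurable. Qed.

Lemma bcont_integrable f : bcont f -> (leb2 R).-integrable Om (EFin \o f).
Proof.
move=> bf; have [_ [C fC]] := bf; apply: (@bounded_integrable _ _ _ C) => //.
- exact: measurable_dom.
- exact: leb2_dom_lty.
- exact: bcont_measurable.
Qed.

Lemma bcont_cst (c : R) : bcont (fun=> c).
Proof. by split=> [x _|]; [exact: cvg_cst|exists `|c|]. Qed.

Lemma bcontD f g : bcont f -> bcont g -> bcont (fun x => f x + g x).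
Proof.
move=> [cf [C fC]] [cg [D gD]]; split=> [x Ox|].
  by apply: cvgD; [exact: cf|exact: cg].
by exists (C + D) => x Ox; rewrite (le_trans (ler_normD _ _))// lerD ?fC ?gD.
Qed.

Lemma bcontM f g : bcont f -> bcont g -> bcont (fun x => f x * g x).
Proof.
move=> [cf [C fC]] [cg [D gD]]; split=> [x Ox|].
  by apply: cvgM; [exact: cf|exact: cg].
by exists (C * D) => x Ox; rewrite normrM ler_pM ?fC ?gD.
Qed.

Lemma bcontN f : bcont f -> bcont (fun x => - f x).
Proof.
move=> [cf [C fC]]; split=> [x Ox|]; first by apply: cvgN; exact: cf.
by exists C => x Ox; rewrite normrN fC.
Qed.

Lemma bcontB f g : bcont f -> bcont g -> bcont (fun x => f x - g x).
Proof. by move=> bf bg; apply: bcontD => //; exact: bcontN. Qed.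

Lemma bcont_norm f : bcont f -> bcont (fun x => `|f x|).
Proof.
move=> [cf [C fC]]; split=> [x Ox|].
  by apply: continuous_comp; [exact: cf|exact: norm_continuous].
by exists C => x Ox; rewrite normr_id fC.
Qed.

Lemma bcont_comp f (h : R -> R) : continuous h ->
  bcont f -> bcont (fun x => h (f x)).
Proof.
move=> ch [cf [C fC]]; split=> [x Ox|].
  by apply: (continuous_comp (cf _ Ox)); exact: ch.
have [D hD] : exists D : R, forall y, `[- C, C]%classic y -> `|h y| <= D.
  apply: compact_fun_bounded; first exact: segment_compact.
  exact: continuous_subspaceT.
by exists D => x Ox; apply: hD; rewrite /= in_itv/= -ler_norml fC.
Qed.

(** Zero boundary values without mentioning the boundary. The compact sets are such that truncating
    the function at height [e] leaves a compact support. *)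
Definition vanishing f := forall e : R, 0 < e ->
  exists K, [/\ compact K, K `<=` Om & forall x, Om x -> ~ K x -> `|f x| < e].

Lemma compact_plane_closed K : compact K -> closed K.
Proof. by apply: compact_closed; exact: norm_hausdorff. Qed.

Lemma ext0_continuous f K : compact K -> K `<=` Om ->
  (forall x, Om x -> {for x, continuous f}) ->
  (forall x, Om x -> ~ K x -> f x = 0) -> continuous (f \_ Om).
Proof.
move=> cK KO cf fK x; have [Ox|nOx] := pselect (Om x).
  have E : \forall y \near x, f y = (f \_ Om) y.
    have := open_nbhs_nbhs (conj oOm Ox); apply: filterS => y Oy.
    by rewrite patchE mem_set.
  rewrite /continuous_at patchE mem_set//.
  by apply: cvg_trans (cf _ Ox); apply: near_eq_cvg.
have nKx : (~` K) x by move=> /KO.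
have oK : open (~` K) by apply: closed_openC; exact: compact_plane_closed.
rewrite /continuous_at patchE memNset//.
suff : (f \_ Om) y @[y --> x] --> (0 : R) by [].
have E : \forall y \near x, (fun=> 0 : R) y = (f \_ Om) y.
  have := open_nbhs_nbhs (conj oK nKx); apply: filterS => y Ky.
  by rewrite patchE; case: ifPn => //; rewrite inE => Oy; rewrite fK.
exact: cvg_trans (near_eq_cvg E) (cvg_cst (0 : R)).
Qed.

Lemma ext0_derive f fv K v : v != 0 -> compact K -> K `<=` Om ->
  (forall x : R * R, Om x -> is_derive x v f (fv x)) ->
  (forall x, Om x -> ~ K x -> f x = 0 /\ fv x = 0) ->
  forall x : R * R, is_derive x v (f \_ Om) ((fv \_ Om) x).
Proof.
move=> v0 cK KO df fK x; have [Ox|nOx] := pselect (Om x).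
  rewrite patchE mem_set//; apply: near_eq_is_derive (df _ Ox) => //.
  have := open_nbhs_nbhs (conj oOm Ox); apply: filterS => y Oy.
  by rewrite patchE mem_set.
have nKx : (~` K) x by move=> /KO.
have oK : open (~` K) by apply: closed_openC; exact: compact_plane_closed.
rewrite patchE memNset//; apply: near_eq_is_derive (dC 0 x v) => //.
have := open_nbhs_nbhs (conj oK nKx); apply: filterS => y Ky.
by rewrite patchE; case: ifPn => //; rewrite inE => Oy; rewrite (fK _ Oy Ky).1.
Qed.

Lemma dom_norm : exists2 r : R, 0 < r & forall x, Om x -> `|x| < r.
Proof.
have [r r0 Or] := bounded_subset_box bOm; exists (r + 1); first olra.
move=> x /Or []; rewrite /= !in_itv/= -!ler_norml => h1 h2.
by rewrite prod_normE gt_max; apply/andP; split; olra.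
Qed.

Lemma I_setT f : I f = \int[leb2 R]_x (f \_ Om) x.
Proof. exact: Rintegral_mkcond. Qed.

Lemma trunc_ibp f fv v (e : R) : axis v -> 0 < e -> vanishing f ->
  (forall x : R * R, Om x -> [/\ is_derive x v f (fv x), {for x, continuous f} &
     {for x, continuous fv}]) ->
  I (fun x => trunc' e (f x) * fv x) = 0.
Proof.
move=> [v0 ftc _] e0 vf df; have [K [cK KO fK]] := vf _ e0.
have [r r0 Or] := dom_norm.
rewrite I_setT; apply: (ftc ((fun x => trunc e (f x)) \_ Om) _ r) => //.
- apply: (@ext0_continuous _ K) => // x Ox.
    have [_ cf cfv] := df _ Ox; apply: cvgM => //.
    by apply: (continuous_comp cf); exact: trunc'_continuous.
  by move=> Kx; rewrite trunc'_eq0 ?mul0r// ltW// fK.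
- apply: (@ext0_derive _ _ K) => // x Ox.
    have [dfx _ _] := df _ Ox.
    by apply: (is_derive_compV dfx); exact: trunc_derive.
  by move=> Kx; rewrite trunc_eq0 ?trunc'_eq0 ?mul0r// ltW// fK.
- move=> x rx; rewrite !patchE memNset// => /Or; rewrite ltNge rx//.
Qed.

(** On each line of direction [v] the exceptional points are zeros with nonzero derivative, hence
    countable, and [null_dir] applies. It is needed because [trunc' e] tends to 1 everywhere except
    at 0, where it stays 0. *)
Lemma zero_set_derive_ae f fv v : axis v ->
  (forall x : R * R, Om x -> [/\ is_derive x v f (fv x), {for x, continuous f} &
     {for x, continuous fv}]) ->
  {ae leb2 R, forall x, Om x -> f x = 0 -> fv x = 0}.
Proof.
move=> [v0 _ nd] df.
pose N : set (mplane R) := [set x | [/\ Om x, f x = 0 & fv x != 0]].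
have mO := measurable_dom.
have mf : measurable_fun (Om : set (mplane R)) f.
  by apply: continuous_mplane_measurable => // x /df[].
have mfv : measurable_fun (Om : set (mplane R)) fv.
  by apply: continuous_mplane_measurable => // x /df[].
have mN : measurable N.
  rewrite (_ : N = (Om `&` f @^-1` [set 0]) `&` (Om `&` fv @^-1` (~` [set 0]))).
    by apply: measurableI; [exact: mf|apply: mfv => //; exact: measurableC].
  by apply/seteqP; split => [x [? ? /eqP ?]|x [[? ?] [_ /eqP ?]]].
exists N; split => //; last first.
  move=> x /= /not_implyP[Ox /not_implyP[fx /eqP fvx]].
  by split.
apply: nd => // x.
apply: sub_countable (@discrete_zeros_countable R (fun t => f (x + t *: v))
  (fun t => fv (x + t *: v)) [set t | Om (x + t *: v)] _).
  by apply: subset_card_le => t [].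
by move=> t /= /df[dfx _ _]; exact: is_derive_line.
Qed.

(** The truncated function has compact support, so its derivative integrates to 0. When the
    truncation height tends to 0 the derivatives converge almost everywhere and stay dominated; no
    regularity of the boundary enters. *)
Lemma vanishing_ibp f fv v : axis v -> vanishing f -> bcont f -> bcont fv ->
  (forall x : R * R, Om x -> is_derive x v f (fv x)) -> I fv = 0.
Proof.
move=> av vf bf bfv df.
have df' : forall x : R * R, Om x -> [/\ is_derive x v f (fv x), {for x, continuous f} &
     {for x, continuous fv}].
  by move=> x Ox; split; [exact: df|exact: bf.1|exact: bfv.1].
have [C fC] := bfv.2.
pose g n x : \bar R := (trunc' n.+1%:R^-1 (f x) * fv x)%:E.
have n0 n : 0 < n.+1%:R^-1 :> R by rewrite invr_gt0.
have : (\int[leb2 R]_(x in Om) g n x)%E @[n --> \oo] --> (\int[leb2 R]_(x in Om) (fv x)%:E)%E.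
  have := @dominated_convergence _ _ _ (leb2 R) Om measurable_dom g
    (EFin \o fv) (fun=> C%:E).
  case => //.
  - move=> n; apply/measurable_EFinP; apply: bcont_measurable; apply: bcontM => //.
    by apply: bcont_comp => //; exact: trunc'_continuous.
  - by apply/measurable_EFinP; exact: bcont_measurable.
  - have [N [mN N0 subN]] := zero_set_derive_ae av df'.
    exists N; split => // x /= Hx; apply: subN => /= Hx'; apply: Hx => Ox.
    apply/cvg_EFin; first exact: nearW.
    have [f0|f0] := eqVneq (f x) 0.
      by rewrite /g /comp /= (Hx' Ox f0); under eq_fun do rewrite mulr0; exact: cvg_cst.
    rewrite -[X in _ --> X]mul1r; apply: cvgM; last exact: cvg_cst.
    exact: trunc'_cvg.
  - exact: (bcont_integrable (bcont_cst C)).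
  - apply: aeW => x n Ox; rewrite /g lee_fin normrM.
    have /andP[t0 t1] := trunc'_itv (f x) (n0 n).
    by rewrite (ger0_norm t0) (le_trans _ (fC x Ox))// ler_piMl.
rewrite (_ : (fun n => _) = fun=> 0%E); last first.
  apply/funext => n.
  have E := trunc_ibp av (n0 n) vf df'; rewrite /Rintegral in E.
  rewrite -[LHS]fineK ?E//.
  apply: integrable_fin_num; first exact: measurable_dom.
  apply: bcont_integrable; apply: bcontM => //.
  by apply: bcont_comp => //; exact: trunc'_continuous.
by move=> /(@cvg_unique _ (@ereal_hausdorff R) _ _ _ _ (cvg_cst 0%E)); rewrite /Rintegral => <-.
Qed.

End domain_classes.

(** * A smooth bump function *)

Section smooth_bump.
Context {R : realType}.

Lemma expR_dominates_exprn (n : nat) (y : R) : 0 < y ->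
  y ^+ n * expR (- y) <= n.+1%:R ^+ n.
Proof.
move=> y0; rewrite expRN ler_pdivrMr ?expR_gt0//.
have n0 : 0 < n.+1%:R :> R by [].
(* The exponential is an [(n + 1)]-st power; [n] of the factors each dominate [y / (n + 1)], and the
   last one is at least 1. *)
have -> : expR y = expR (y / n.+1%:R) ^+ n * expR (y / n.+1%:R).
  by rewrite -exprSr -expRM_natl mulrC divfK// gt_eqF.
have e1 : 1 <= expR (y / n.+1%:R) by rewrite -expR0 ler_expR divr_ge0 ?ltW.
have yn : y / n.+1%:R <= expR (y / n.+1%:R).
  by apply: le_trans (expR_ge1Dx _); rewrite lerDr.
have -> : y ^+ n = n.+1%:R ^+ n * (y / n.+1%:R) ^+ n.
  by rewrite -exprMn mulrC divfK// gt_eqF.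
rewrite ler_wpM2l ?exprn_ge0 ?(ltW n0)//.
apply: (@le_trans _ _ (expR (y / n.+1%:R) ^+ n)).
  by rewrite lerXn2r// nnegrE ?divr_ge0 ?expR_ge0// ltW.
by rewrite ler_peMr// exprn_ge0// expR_ge0.
Qed.

Lemma expR_dominates_poly (q : {poly R}) :
  exists C : R, forall y : R, 0 < y -> `|q.[y] * expR (- y)| <= C.
Proof.
exists (\sum_(i < size q) `|q`_i| * i.+1%:R ^+ i) => y y0.
rewrite horner_coef mulr_suml (le_trans (ler_norm_sum _ _ _))//.
apply: ler_sum => i _; rewrite -mulrA normrM ler_wpM2l//.
rewrite ger0_norm; first exact: expR_dominates_exprn.
by rewrite mulr_ge0 ?expR_ge0// exprn_ge0// ltW.
Qed.

(** The classical flat function [exp (-1/t)] with a polynomial in [1/t] as a factor, which makes the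
    family stable under differentiation. *)
Definition flat (q : {poly R}) (t : R) :=
  if 0 < t then q.[t^-1] * expR (- t^-1) else 0.

Lemma flat_derive q t :
  is_derive t (1 : R) (flat q) (flat ((q - q^`()) * 'X^2) t).
Proof.
have [t0|t0|->] := ltgtP t 0.
- rewrite /flat [in X in is_derive _ _ _ X]ltNge (ltW t0)/=.
  apply: near_eq_is_derive (dC 0 t (1 : R)).
  have := lt_nbhsl t0; apply: filterS => s s0.
  by rewrite ltNge (ltW s0).
- rewrite [in X in is_derive _ _ _ X]/flat t0.
  have tn : t != 0 by rewrite gt_eqF.
  have dI : is_derive t (1 : R) (fun s : R => s^-1) (- 1 / t ^+ 2).
    exact: (dV tn (is_derive_id t (1 : R))).
  have dq : is_derive t (1 : R) (fun s : R => q.[s^-1]) (q^`().[t^-1] * (- 1 / t ^+ 2)).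
    exact: (is_derive_compV dI (is_derive_poly q t^-1)).
  have dE : is_derive t (1 : R) (fun s : R => expR (- s^-1)) (expR (- t^-1) * - (- 1 / t ^+ 2)).
    exact: (is_derive_compV (dN dI) (is_derive_expR (- t^-1))).
  apply: near_eq_is_derive (d_eq (dM dq dE) _).
    by have := lt_nbhsr t0; apply: filterS => s s0; rewrite /flat s0.
  by rewrite hornerM hornerD hornerN hornerXn exprVn; field.
- rewrite [in X in is_derive _ _ _ X]/flat ltxx.
  (* Dividing by [h^2] amounts to multiplying the polynomial by ['X^2], so the quotient is still
     bounded and the derivative at 0 is 0. *)
  have [C HC] := expR_dominates_poly (q * 'X^2).
  apply: (@is_derive_quadratic _ _ _ `|C|) => h.
  rewrite add0r /flat ltxx subr0; case: ifPn => [h0|_]; last first.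
    by rewrite normr0 mulr_ge0// sqr_ge0.
  have hi : 0 < h^-1 by rewrite invr_gt0.
  have := HC _ hi; rewrite hornerM hornerXn exprVn.
  rewrite mulrAC normrM [X in _ * X <= _]ger0_norm ?invr_ge0 ?sqr_ge0//.
  rewrite ler_pdivrMr ?exprn_gt0// => /le_trans; apply.
  by rewrite ler_wpM2r ?sqr_ge0// ler_norm.
Qed.

Lemma flat_continuous q : continuous (flat q).
Proof.
move=> t; apply/differentiable_continuous/derivable1_diffP.
by case: (flat_derive q t).
Qed.

Lemma flat1_ge0 t : 0 <= flat 1 t.
Proof. by rewrite /flat; case: ifPn => // _; rewrite hornerC mul1r expR_ge0. Qed.

Lemma flat1_gt0 t : 0 < t -> 0 < flat 1 t.
Proof. by rewrite /flat => ->; rewrite hornerC mul1r expR_gt0. Qed.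

Lemma flat_eq0 q t : t <= 0 -> flat q t = 0.
Proof. by rewrite /flat leNgt => /negbTE ->. Qed.

(** An algebra stable under directional derivatives. Smoothness, which is a statement for every [k],
    then follows by induction without computing a single higher derivative. *)
Inductive flat_alg : (R * R -> R) -> Prop :=
| flat_alg_gen q a b c : flat_alg (fun z => flat q (a * z.1 + b * z.2 + c))
| flat_alg_mul f g : flat_alg f -> flat_alg g -> flat_alg (fun z => f z * g z)
| flat_alg_add f g : flat_alg f -> flat_alg g -> flat_alg (fun z => f z + g z)
| flat_alg_scale c f : flat_alg f -> flat_alg (fun z => c * f z).

Lemma is_derive_fst (x v : R * R) : is_derive x v (fun z : R * R => z.1) v.1.
Proof.
apply: line_is_derive => /=.
apply: d_eq (dD (dC x.1 0 (1 : R)) (dM (is_derive_id 0 (1 : R)) (dC v.1 0 (1 : R)))) _.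
by rewrite mulr0 addr0 mul1r add0r.
Qed.

Lemma is_derive_snd (x v : R * R) : is_derive x v (fun z : R * R => z.2) v.2.
Proof.
apply: line_is_derive => /=.
apply: d_eq (dD (dC x.2 0 (1 : R)) (dM (is_derive_id 0 (1 : R)) (dC v.2 0 (1 : R)))) _.
by rewrite mulr0 addr0 mul1r add0r.
Qed.

Lemma flat_alg_derive f : flat_alg f -> continuous f /\
  forall v, exists2 df, flat_alg df & forall x : R * R, is_derive x v f (df x).
Proof.
elim=> [q a b c|g h Ag0 [cg dg] Ah0 [ch dh]|g h _ [cg dg] _ [ch dh]|c g _ [cg dg]].
- split=> [x|v].
    apply: (@continuous_comp _ _ _ (fun z : R * R => a * z.1 + b * z.2 + c) (flat q));
      last exact: flat_continuous.
    apply: cvgD; last exact: cvg_cst.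
    by apply: cvgD; apply: cvgM; try exact: cvg_cst; [exact: cvg_fst|exact: cvg_snd].
  exists (fun z => (a * v.1 + b * v.2) * flat ((q - q^`()) * 'X^2) (a * z.1 + b * z.2 + c)).
    by apply: flat_alg_scale; exact: flat_alg_gen.
  move=> x; rewrite mulrC; apply: is_derive_compV; last exact: flat_derive.
  apply: d_eq (dD (dD (dZ a (is_derive_fst x v)) (dZ b (is_derive_snd x v))) (dC c x v)) _.
  by rewrite addr0.
- split=> [x|v]; first by apply: cvgM; [exact: cg|exact: ch].
  have [dg' Ag Dg] := dg v; have [dh' Ah Dh] := dh v.
  exists (fun z => dg' z * h z + g z * dh' z); last by move=> x; exact: dM.
  by apply: flat_alg_add; exact: flat_alg_mul.
- split=> [x|v]; first by apply: cvgD; [exact: cg|exact: ch].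
  have [dg' Ag Dg] := dg v; have [dh' Ah Dh] := dh v.
  by exists (fun z => dg' z + dh' z); [exact: flat_alg_add|move=> x; exact: dD].
- split=> [x|v]; first by apply: cvgM; [exact: cvg_cst|exact: cg].
  have [dg' Ag Dg] := dg v.
  by exists (fun z => c * dg' z); [exact: flat_alg_scale|move=> x; exact: dZ].
Qed.

Definition bump (r : R) (z : R * R) :=
  flat 1 (r - z.1) * flat 1 (r + z.1) * (flat 1 (r - z.2) * flat 1 (r + z.2)).

Lemma flat_alg_bump r : flat_alg (bump r).
Proof.
have -> : bump r = (fun z : R * R =>
   flat 1 (-1 * z.1 + 0 * z.2 + r) * flat 1 (1 * z.1 + 0 * z.2 + r) *
  (flat 1 (0 * z.1 + -1 * z.2 + r) * flat 1 (0 * z.1 + 1 * z.2 + r))).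
  by apply/funext => z; rewrite /bump; congr (flat _ _ * flat _ _ * (flat _ _ * flat _ _)); ring.
by do 2 apply: flat_alg_mul; exact: flat_alg_gen.
Qed.

Lemma bump_ge0 r z : 0 <= bump r z.
Proof. by rewrite !mulr_ge0 ?flat1_ge0. Qed.

Lemma bump_gt0 r z : `|z| < r -> 0 < bump r z.
Proof.
rewrite prod_normE gt_max !ltr_norml => /andP[/andP[a b] /andP[c d]].
by rewrite !mulr_gt0 ?flat1_gt0//; olra.
Qed.

Lemma bump_eq0 r z : r <= `|z| -> bump r z = 0.
Proof.
rewrite prod_normE le_max !ler_normr /bump.
move=> /orP[/orP[h|h]|/orP[h|h]].
- by rewrite (flat_eq0 _ (t := r - z.1)) ?mul0r//; olra.
- by rewrite (flat_eq0 _ (t := r + z.1)) ?mulr0 ?mul0r//; olra.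
- by rewrite (flat_eq0 _ (t := r - z.2)) ?mul0r ?mulr0//; olra.
- by rewrite (flat_eq0 _ (t := r + z.2)) ?mulr0//; olra.
Qed.

End smooth_bump.

(** * Mean value theorem and directional derivatives from the two partial derivatives *)

Section plane_mvt_theory.
Context {R : realType}.
Implicit Types (f g : R * R -> R).

Lemma norm_fst_le (z : R * R) : `|z.1| <= `|z|.
Proof. by rewrite [leRHS]prod_normE le_max lexx. Qed.

Lemma norm_snd_le (z : R * R) : `|z.2| <= `|z|.
Proof. by rewrite [leRHS]prod_normE le_max lexx orbT. Qed.

Lemma is_derive_scaledir f (x v : R * R) (c d : R) :
  is_derive x v f d -> is_derive x (c *: v) f (c * d).
Proof.
move=> df; apply: line_is_derive.
have -> : (fun t : R => f (x + t *: (c *: v))) =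
  (fun t : R => (fun s : R => f (x + s *: v)) (c * t)).
  by apply/funext => t; rewrite scalerA mulrC.
have dl : is_derive (0 : R) (1 : R) (fun s : R => f (x + s *: v)) d.
  by apply: is_derive_line; rewrite scale0r addr0.
rewrite mulrC.
apply: (is_derive_compV (f := fun t : R => c * t) (tau := fun s : R => f (x + s *: v))).
  by apply: d_eq (dZ c (is_derive_id (0 : R) (1 : R))) _; rewrite mulr1.
by rewrite mulr0.
Qed.

Lemma segment_mvt f fv (x v : R * R) :
  (forall t : R, 0 <= t <= 1 -> is_derive (x + t *: v) v f (fv (x + t *: v))) ->
  exists2 t : R, 0 < t < 1 & f (x + v) - f x = fv (x + t *: v).
Proof.
move=> df.
have dl (t : R) : 0 <= t <= 1 ->
    is_derive t (1 : R) (fun s : R => f (x + s *: v)) (fv (x + t *: v)).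
  by move=> /df; exact: is_derive_line.
have [||t t01] := @MVT R (fun s : R => f (x + s *: v)) (fun s => fv (x + s *: v)) 0 1 ltr01.
- by move=> t; rewrite in_itv/= => /andP[t0 t1]; apply: dl; rewrite !ltW.
- apply: derivable_within_continuous => t; rewrite in_itv/= => tI.
  by case: (dl _ tI).
rewrite scale1r scale0r addr0 subr0 mulr1 => E.
by exists t => //; move: t01; rewrite in_itv.
Qed.

(** Move along the first axis and then along the second. In the max norm both legs stay within [|h|]
    of [x]; the two partial derivatives are evaluated at different points, which is harmless when
    they are bounded or continuous. *)
Lemma plane_mvt f f1 f2 (x h : R * R) :
  (forall z : R * R, `|z - x| <= `|h| -> is_derive z (1, 0) f (f1 z) /\
     is_derive z (0, 1) f (f2 z)) ->
  exists z z' : R * R, [/\ `|z - x| <= `|h|, `|z' - x| <= `|h| &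
     f (x + h) - f x = h.1 * f1 z + h.2 * f2 z'].
Proof.
move=> df; case: h df => h1 h2 df /=.
have nh : `|((h1, h2) : R * R)| = Num.max `|h1| `|h2| by rewrite prod_normE.
have N1 (t : R) : 0 <= t <= 1 -> `|t *: ((h1, 0) : R * R)| <= `|((h1, h2) : R * R)|.
  move=> /andP[t0 t1]; rewrite pair_scaleE nh prod_normE/= mulr0 normr0.
  by rewrite ge_max !le_max normr_ge0 andbT normrM ger0_norm// ler_piMl.
have N2 (t : R) : 0 <= t <= 1 ->
    `|((h1, 0) : R * R) + t *: ((0, h2) : R * R)| <= `|((h1, h2) : R * R)|.
  move=> /andP[t0 t1]; rewrite pair_scaleE pair_addE nh prod_normE/= mulr0 addr0 add0r.
  by rewrite ge_max !le_max lexx/= normrM (ger0_norm t0) ler_piMl// orbT.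
have [t t01 E1] : exists2 t : R, 0 < t < 1 &
    f (x + (h1, 0)) - f x = h1 * f1 (x + t *: (h1, 0)).
  apply: (segment_mvt (fv := fun z => h1 * f1 z)) => t t01.
  have -> : ((h1, 0) : R * R) = h1 *: (1, 0) by rewrite pair_scaleE mulr1 mulr0.
  apply: is_derive_scaledir; apply: (df _ _).1.
  rewrite addrC addKr (_ : h1 *: _ = (h1, 0)); first exact: N1.
  by rewrite pair_scaleE mulr1 mulr0.
have [s s01 E2] : exists2 s : R, 0 < s < 1 &
    f (x + (h1, 0) + (0, h2)) - f (x + (h1, 0)) =
    h2 * f2 (x + (h1, 0) + s *: (0, h2)).
  apply: (segment_mvt (fv := fun z => h2 * f2 z)) => s s01.
  have -> : ((0, h2) : R * R) = h2 *: (0, 1) by rewrite pair_scaleE mulr1 mulr0.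
  apply: is_derive_scaledir; apply: (df _ _).2.
  rewrite addrC !addrA addNr add0r (_ : h2 *: _ = (0, h2)); first exact: N2.
  by rewrite pair_scaleE mulr1 mulr0.
exists (x + t *: (h1, 0)), (x + (h1, 0) + s *: (0, h2)); split.
- by rewrite addrC addKr N1//; case/andP: t01 => /ltW-> /ltW->.
- by rewrite addrC !addrA addNr add0r N2//; case/andP: s01 => /ltW-> /ltW->.
- rewrite -E1 -E2 (_ : x + (h1, h2) = x + (h1, 0) + (0, h2)); first ring.
  by rewrite -addrA pair_addE addr0 add0r.
Qed.

Lemma partials_lipschitz f f1 f2 (x : R * R) (d C : R) :
  (forall z : R * R, `|z - x| < d -> [/\ is_derive z (1, 0) f (f1 z),
     is_derive z (0, 1) f (f2 z), `|f1 z| <= C & `|f2 z| <= C]) ->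
  forall y : R * R, `|y - x| < d -> `|f y - f x| <= 2 * C * `|y - x|.
Proof.
move=> df y yx; have [|z [z' [zx zx' E]]] := @plane_mvt f f1 f2 x (y - x).
  by move=> z zx; have [] := df z (le_lt_trans zx yx).
have xy : x + (y - x) = y by rewrite addrCA subrr addr0.
rewrite xy in E; rewrite E.
have [_ _ f1z _] := df z (le_lt_trans zx yx).
have [_ _ _ f2z] := df z' (le_lt_trans zx' yx).
have C0 : 0 <= C by exact: le_trans f1z.
have n1 := norm_fst_le (y - x); have n2 := norm_snd_le (y - x).
rewrite (le_trans (ler_normD _ _))// !normrM.
have := ler_pM (normr_ge0 _) (normr_ge0 _) n1 f1z.
have := ler_pM (normr_ge0 _) (normr_ge0 _) n2 f2z.
olra.
Qed.

Lemma partials_continuous f f1 f2 (x : R * R) (d C : R) : 0 < d ->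
  (forall z : R * R, `|z - x| < d -> [/\ is_derive z (1, 0) f (f1 z),
     is_derive z (0, 1) f (f2 z), `|f1 z| <= C & `|f2 z| <= C]) ->
  {for x, continuous f}.
Proof.
move=> d0 df; have H := partials_lipschitz df.
have C0 : 0 <= C by have [|_ _ h _] := df x; rewrite ?subrr ?normr0//; exact: le_trans h.
apply/cvgrPdist_le => e e0.
have m0 : 0 < Num.min d (e / (2 * C + 1)).
  by rewrite lt_min d0 divr_gt0// ltr_wpDl// mulr_ge0.
apply: filterS (nbhsx_ballx x _ m0) => y; rewrite -ball_normE/= distrC lt_min => /andP[yd ye].
rewrite distrC (le_trans (H _ yd))//.
move: ye; rewrite ltr_pdivlMr ?ltr_wpDl ?mulr_ge0// => ye.
apply: le_trans (ltW ye); rewrite mulrC ler_wpM2l//; olra.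
Qed.

Lemma partials_directional f f1 f2 (x v : R * R) (d : R) : 0 < d ->
  (forall z : R * R, `|z - x| < d -> is_derive z (1, 0) f (f1 z) /\
     is_derive z (0, 1) f (f2 z)) ->
  {for x, continuous f1} -> {for x, continuous f2} ->
  is_derive x v f (v.1 * f1 x + v.2 * f2 x).
Proof.
move=> d0 df c1 c2; apply: line_is_derive.
apply/is_derive1_caratheodory.
pose q (t : R) := (f (x + t *: v) - f x) / t.
exists (fun t => if t == 0 then v.1 * f1 x + v.2 * f2 x else q t).
rewrite eqxx; split => //.
  move=> t; rewrite scale0r addr0 subr0.
  case: ifPn => [/eqP->|t0]; first by rewrite scale0r addr0 subrr mulr0.
  by rewrite /q divfK.
apply/cvgrPdist_lt => e e0; rewrite eqxx.
have e'0 : 0 < e / (2 * `|v| + 1) by rewrite divr_gt0// ltr_wpDl// mulr_ge0.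
move/cvgrPdist_lt : c1 => /(_ _ e'0) /nbhs_ballP[a /= a0 Ha].
move/cvgrPdist_lt : c2 => /(_ _ e'0) /nbhs_ballP[b /= b0 Hb].
pose m := Num.min d (Num.min a b).
have m0 : 0 < m by rewrite !lt_min d0 a0 b0.
apply/nbhs_ballP; exists (m / (`|v| + 1)) => /=; first by rewrite divr_gt0// ltr_wpDl.
move=> t; rewrite /ball/= sub0r normrN ltr_pdivlMr ?ltr_wpDl// => tm.
case: ifPn => [_|t0]; first by rewrite subrr normr0.
have tv : `|t *: v| < m.
  by rewrite normrZ; apply: le_lt_trans tm; rewrite ler_wpM2l// lerDl.
have [|z [z' [zx zx' E]]] := @plane_mvt f f1 f2 x (t *: v).
  move=> z zx; apply: df; apply: le_lt_trans zx _; apply: lt_le_trans tv _.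
  by rewrite /m ge_min lexx.
have qE : q t = v.1 * f1 z + v.2 * f2 z'.
  by rewrite /q E /= /GRing.scale/=; field.
have v1 := norm_fst_le v; have v2 := norm_snd_le v.
have F1 : `|f1 x - f1 z| < e / (2 * `|v| + 1).
  apply: Ha; rewrite -ball_normE/= distrC; apply: le_lt_trans zx _.
  by apply: lt_le_trans tv _; rewrite /m !ge_min lexx orbT.
have F2 : `|f2 x - f2 z'| < e / (2 * `|v| + 1).
  apply: Hb; rewrite -ball_normE/= distrC; apply: le_lt_trans zx' _.
  by apply: lt_le_trans tv _; rewrite /m !ge_min lexx !orbT.
rewrite qE (_ : _ - _ = v.1 * (f1 x - f1 z) + v.2 * (f2 x - f2 z')); last ring.
apply: le_lt_trans (ler_normD _ _) _; rewrite !normrM.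
have H1 := ler_pM (normr_ge0 _) (normr_ge0 _) v1 (ltW F1).
have H2 := ler_pM (normr_ge0 _) (normr_ge0 _) v2 (ltW F2).
apply: le_lt_trans (lerD H1 H2) _.
rewrite -mulrDl mulrA ltr_pdivrMr ?ltr_wpDl ?mulr_ge0//.
olra.
Qed.

End plane_mvt_theory.

Lemma dE {R : realType} (V : normedModType R) (f : V -> R) (x v : V) (a : R) :
  is_derive x v f a -> 'D_v f x = a.
Proof. by case. Qed.

Lemma d1E {R : realType} (f g : R * R -> R) :
  (forall x : R * R, is_derive x (1, 0) f (g x)) -> d1 f = g.
Proof. by move=> H; apply/funext => x; rewrite /d1; exact: dE. Qed.

Lemma d2E {R : realType} (f g : R * R -> R) :
  (forall x : R * R, is_derive x (0, 1) f (g x)) -> d2 f = g.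
Proof. by move=> H; apply/funext => x; rewrite /d2; exact: dE. Qed.

(** * Convolution over a bounded set with smooth kernels *)

Section convolution.
Context {R : realType}.
Implicit Types (rho : R * R -> R) (x y z v : R * R) (r : R).
Variables (D : set (R * R)) (phi : R * R -> R) (M C0 : R).
Hypothesis mD : measurable (D : set (mplane R)).
Hypothesis D_lty : (leb2 R D < +oo)%E.
Hypothesis DM : forall y, D y -> `|y| <= M.
Hypothesis mphi : measurable_fun (D : set (mplane R)) phi.
Hypothesis phiC : forall y, D y -> `|phi y| <= C0.

Definition conv (rho : R * R -> R) (x : R * R) :=
  \int[leb2 R]_(y in D) (rho (x - y) * phi y).

Lemma norm_box (z : R * R) r : `|z| <= r -> box r z.
Proof. by rewrite prod_normE ge_max !ler_norml /box/= !in_itv/= => /andP[]. Qed.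

Lemma box_norm (z : R * R) r : box r z -> `|z| <= r.
Proof. by rewrite prod_normE ge_max !ler_norml /box/= !in_itv/= => -[-> ->]. Qed.

Lemma locally_bounded (rho : R * R -> R) r : continuous rho ->
  exists C : R, forall z : R * R, `|z| <= r -> `|rho z| <= C.
Proof.
move=> cr; have [C HC] := compact_fun_bounded (@compact_box R r) (continuous_subspaceT cr).
by exists C => z /norm_box; exact: HC.
Qed.

Lemma continuous_subl (rho : R * R -> R) x : continuous rho -> continuous (fun y => rho (x - y)).
Proof.
move=> cr y; apply: (@continuous_comp _ _ _ (fun y => x - y) rho); last exact: cr.
by apply: cvgB; [exact: cvg_cst|exact: cvg_id].
Qed.

Lemma conv_integrable rho x : continuous rho ->
  (leb2 R).-integrable D (EFin \o (fun y => rho (x - y) * phi y)).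
Proof.
move=> cr; have [C HC] := locally_bounded (`|x| + M) cr.
apply: (@bounded_integrable _ D _ (C * C0)) => //.
  apply: measurable_funM => //.
  apply: measurable_funTS; apply: continuous_mplane_measurable; first exact: openT.
  by move=> y _; exact: continuous_subl.
move=> y Dy; rewrite normrM ler_pM ?phiC ?HC//.
by rewrite (le_trans (ler_normB _ _))// lerD// DM.
Qed.

Lemma conv_bounded rho r : continuous rho ->
  exists C : R, forall x : R * R, `|x| <= r -> `|conv rho x| <= C.
Proof.
move=> cr; have [C HC] := locally_bounded (r + M) cr.
exists (C * C0 * fine (leb2 R D)) => x xr.
rewrite (le_trans (le_normr_Rintegral mD (conv_integrable x cr)))//.
rewrite -(Rintegral_cst _ mD); apply: le_Rintegral => //.
- have /= := integrable_norm (conv_integrable x cr).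
  by apply.
- by apply: (@bounded_integrable _ D _ `|C * C0|).
- move=> y Dy; rewrite normrM ler_pM ?phiC ?HC//.
  by rewrite (le_trans (ler_normB _ _))// lerD// DM.
Qed.

Lemma conv_derive rho rhov x v : continuous rhov ->
  (forall z : R * R, is_derive z v rho (rhov z)) -> continuous rho ->
  is_derive x v (conv rho) (conv rhov x).
Proof.
move=> crv dr cr; apply: line_is_derive.
pose f (t : R) y := rho (x + t *: v - y) * phi y.
have df (t : R) y : is_derive t (1 : R) (f^~ y) (rhov (x + t *: v - y) * phi y).
  have := @is_derive_line R _ _ rho (x - y) v t (rhov (x - y + t *: v)) (dr _).
  move=> /(dM) /(_ (dC (phi y) _ _)) H.
  rewrite (_ : f^~ y = fun t : R => rho (x - y + t *: v) * phi y).
    by apply: d_eq H _; rewrite mulr0 addr0 addrAC.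
  by apply/funext => s; rewrite /f addrAC.
have [C HC] := locally_bounded (`|x| + `|v| + M) crv.
have I0 : `](-1 : R), 1[%classic 0 by rewrite /= in_itv/=; apply/andP; split; olra.
have intf (t : R) : `](-1 : R), 1[%classic t -> (leb2 R).-integrable D (EFin \o f t).
  by move=> _; exact: conv_integrable.
have der (t : R) y : `](-1 : R), 1[%classic t -> D y -> derivable (f^~ y) t 1.
  by move=> _ _; case: (df t y).
have G0 (y : R * R) : 0 <= `|C| * `|C0| by rewrite mulr_ge0.
have GI : (leb2 R).-integrable D (EFin \o (fun _ : R * R => `|C| * `|C0|)).
  apply: (@bounded_integrable _ D _ (`|C| * `|C0|)) => // y _.
  by rewrite ger0_norm.
have Gub (t : R) y : `](-1 : R), 1[%classic t -> D y -> `|partial1of2 f t y| <= `|C| * `|C0|.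
  rewrite /= in_itv/= => tI Dy; rewrite partial1of2E (dE (df t y)).
  rewrite normrM ler_pM//; last exact: le_trans (phiC Dy) (ler_norm _).
  apply: le_trans (ler_norm _); apply: HC.
  rewrite (le_trans (ler_normB _ _))// lerD ?DM//.
  rewrite (le_trans (ler_normD _ _))// lerD2l normrZ ler_piMl//.
  by case/andP: tI => /ltW a /ltW b; rewrite ler_norml a b.
apply: DeriveDef.
  exact: (@derivable_under_integral _ _ _ (leb2 R) f D mD 0 (-1) 1 I0 intf der _ G0 GI Gub).
have := @differentiation_under_integral _ _ _ (leb2 R) f D mD 0 (-1) 1 I0 intf der _ G0 GI Gub.
rewrite derive1E => ->; apply: eq_Rintegral => y _.
rewrite partial1of2E (dE (df 0 y)) scale0r addr0//.
Qed.

Lemma conv_continuous rho rho1 rho2 : continuous rho -> continuous rho1 -> continuous rho2 ->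
  (forall z : R * R, is_derive z (1, 0) rho (rho1 z)) ->
  (forall z : R * R, is_derive z (0, 1) rho (rho2 z)) -> continuous (conv rho).
Proof.
move=> cr c1 c2 d1 d2 x.
have [A HA] := conv_bounded (`|x| + 1) c1; have [B HB] := conv_bounded (`|x| + 1) c2.
apply: (@partials_continuous _ _ (conv rho1) (conv rho2) x 1 (Num.max A B)) => // z zx.
have zx1 : `|z| <= `|x| + 1.
  by rewrite -[z](subrK x) (le_trans (ler_normD _ _))// addrC lerD2l ltW.
split.
- exact: conv_derive.
- exact: conv_derive.
- by rewrite le_max HA.
- by rewrite le_max HB ?orbT.
Qed.

Lemma flat_alg_conv_continuous rho : flat_alg rho -> continuous (conv rho).
Proof.
move=> /flat_alg_derive[cr dr].
have [r1 /flat_alg_derive[c1 _] d1] := dr (1, 0).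
have [r2 /flat_alg_derive[c2 _] d2] := dr (0, 1).
exact: (conv_continuous cr c1 c2).
Qed.

Lemma flat_alg_conv_smooth rho : flat_alg rho -> smooth (conv rho).
Proof.
move=> + k; elim: k rho => [|k IH] rho Ar; first exact: flat_alg_conv_continuous.
have [cr dr] := flat_alg_derive Ar; split => [x v|v];
  have [rv /[dup] Av /flat_alg_derive[cv _] dv] := dr v.
  by case: (conv_derive x cv dv cr).
rewrite (_ : (fun x => _) = conv rv); first exact: IH.
by apply/funext => x; rewrite (dE (conv_derive x cv dv cr)).
Qed.

End convolution.

(** * The weak form of the equation for mollified test functions *)

Section weak_form.
Context {R : realType}.
Variable Om : set (R * R).
Hypothesis oOm : open Om.
Hypothesis bOm : bounded_set Om.
Implicit Types (f g rho phi psi w : R * R -> R) (K : set (R * R)) (x y z v : R * R) (r : R).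
Local Notation I h := (\int[leb2 R]_(x in Om) (h x)).
Let mO : measurable (Om : set (mplane R)) := measurable_dom oOm.

Lemma Rdominated_cvg (f_ : nat -> R * R -> R) f g :
  (forall n, measurable_fun (Om : set (mplane R)) (f_ n)) ->
  measurable_fun (Om : set (mplane R)) f ->
  {ae leb2 R, forall x, Om x -> f_ n x @[n --> \oo] --> f x} ->
  (leb2 R).-integrable Om (EFin \o g) ->
  (forall n x, Om x -> `|f_ n x| <= g x) ->
  I (f_ n) @[n --> \oo] --> I f.
Proof.
move=> mf_ mf ff ig fg; apply: fine_cvg.
have := @dominated_convergence _ _ _ (leb2 R) Om mO (fun n x => (f_ n x)%:E)
    (EFin \o f) (EFin \o g).
case => //.
- by move=> n; exact/measurable_EFinP.
- exact/measurable_EFinP.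
- have [N [mN N0 subN]] := ff.
  exists N; split => // x /= Hx; apply: subN => /= Hx'; apply: Hx => Ox.
  by apply/cvg_EFin; [exact: nearW|exact: Hx'].
- by apply: aeW => x n Ox; rewrite lee_fin fg.
- move=> ifo _ H; rewrite fineK//.
  exact: integrable_fin_num.
Qed.

Lemma compact_thickening K : compact K -> K `<=` Om ->
  exists2 r, 0 < r & forall x y, K x -> `|y - x| <= r -> Om y.
Proof.
move=> /compact_near_coveringP nK KO.
have := nK R (at_right (0 : R)) (fun r x => forall y, `|y - x| <= r -> Om y) _.
case.
  move=> x Kx; have [e /= e0 eO] : exists2 e : R, 0 < e & ball x e `<=` Om.
    by have /nbhs_ballP := open_nbhs_nbhs (conj oOm (KO _ Kx)).
  have e2 : 0 < e / 2 by rewrite divr_gt0.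
  exists (ball x (e / 2), [set r | r < e / 2]) => /=.
    by split; [exact: nbhsx_ballx|exact: nbhs_right_lt].
  move=> [z r] /= [xz re] y yz; apply: eO; rewrite -ball_normE/= distrC.
  move: xz; rewrite -ball_normE/= distrC => xz.
  apply: le_lt_trans (ler_distD z _ _) _; rewrite [e]splitr ltrD// distrC.
  exact: le_lt_trans yz re.
move=> e /= e0 He; exists (e / 2); first by rewrite divr_gt0.
move=> x y Kx; apply: (He (e / 2)) => //=.
  by rewrite sub0r normrN ger0_norm ?divr_ge0// ?ltW//; olra.
by rewrite divr_gt0.
Qed.

Lemma compact_nbhd K r : compact K -> 
  compact [set x | exists2 y, K y & `|x - y| <= r].
Proof.
move=> cK.
have -> : [set x | exists2 y, K y & `|x - y| <= r] =
    (fun p : (R * R) * (R * R) => p.1 + p.2) @` (K `*` box r).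
  apply/seteqP; split=> [x [y Ky xy]|_ [[y z] /= [Ky bz] <-]].
    by exists (y, x - y) => /=; [split => //; exact: norm_box|rewrite addrCA subrr addr0].
  by exists y => //; rewrite addrC addKr; exact: box_norm.
apply: continuous_compact; last by apply: compact_setX => //; exact: compact_box.
by apply: continuous_subspaceT => p; exact: add_continuous.
Qed.

Lemma bump_derive_eq0 r v rhov z : (forall z, is_derive z v (bump r) (rhov z)) ->
  r < `|z| -> rhov z = 0.
Proof.
move=> dr rz; rewrite -(dE (dr z)).
apply: dE; apply: near_eq_is_derive (dC (0 : R) z v).
have : \forall y \near z, r < `|y|.
  exact: (@cvgr_gt R _ (nbhs z) _ (fun y => `|y|) `|z| (@norm_continuous _ _ z) r rz).
by apply: filterS => y ry; rewrite bump_eq0// ltW.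
Qed.

Lemma is_derive_subl rho (d : R) x y v : is_derive (x - y) v rho d ->
  is_derive y v (fun y => rho (x - y)) (- d).
Proof.
move=> dr; apply: line_is_derive.
rewrite (_ : (fun t : R => _) = (fun t : R => rho (x - y + t *: (-1 *: v)))); last first.
  by apply/funext => t; rewrite opprD addrA scaleN1r scalerN.
apply: is_derive_line; rewrite scale0r addr0 -[- d]mulN1r.
exact: is_derive_scaledir.
Qed.

(** The mass does not depend on [x] because its partial derivatives in [x] are integrals of
    derivatives of a compactly supported function. The box of radius [M + r] contains the supports
    of all the translates in question. *)
Lemma bump_mass r (M : R) : 0 < r -> exists2 c : R, 0 < c &
  forall x, `|x| <= M -> \int[leb2 R]_(y in box (M + r)) bump r (x - y) = c.
Proof.
move=> r0.
have [cb db] := flat_alg_derive (flat_alg_bump r).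
pose D := box (M + r); pose c x := conv D (fun=> 1) (bump r) x.
have mD : measurable (D : set (mplane R)) := measurable_box _.
have DM y : D y -> `|y| <= M + r by exact: box_norm.
have m1 : measurable_fun (D : set (mplane R)) (fun _ : mplane R => 1 : R) by [].
have b1 y : D y -> `|1 : R| <= 1 by rewrite normr1.
have cE x : \int[leb2 R]_(y in D) bump r (x - y) = c x.
  by apply: eq_Rintegral => y _; rewrite mulr1.
have dc0 v : axis v -> forall x, `|x| <= M -> is_derive x v c 0.
  move=> [v0 ftc _] x xM; have [rv Av dv] := db v.
  have [cv _] := flat_alg_derive Av.
  have := @conv_derive R D _ _ _ mD (leb2_box_lty _) DM m1 b1 _ _ x v cv dv cb.
  move=> /d_eq; apply.
  have rv0 y : M + r < `|y| -> rv (x - y) = 0.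
    move=> yr; apply: (bump_derive_eq0 dv).
    by have := lerB_dist y x; rewrite distrC; olra.
  rewrite /conv Rintegral_mkcond.
  rewrite (_ : _ \_ _ = fun y => rv (x - y)); last first.
    apply/funext => y; rewrite patchE mulr1; case: ifPn => // /negP; rewrite inE => nD.
    rewrite rv0// ltNge; apply/negP => yM; apply: nD; exact: norm_box.
  have := ftc (fun y => - bump r (x - y)) (fun y => rv (x - y)) (`|M| + r + 1).
  apply.
  - by rewrite -addrA ltr_wpDl// addr_gt0.
  - by move=> y; exact: continuous_subl.
  - move=> y; rewrite -[rv _]opprK; apply: dN; exact: is_derive_subl.
  - move=> y yr; have := ler_norm M; split; last by apply: rv0; olra.
    rewrite bump_eq0 ?oppr0//.
    by have := lerB_dist y x; rewrite distrC; olra.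
have cc x : `|x| <= M -> c x = c 0.
  move=> xM; have [|z [z' [_ _ E]]] := @plane_mvt R c (fun=> 0) (fun=> 0) 0 x.
    move=> z; rewrite subr0 => zx; have zM := le_trans zx xM.
    by split; apply: dc0 => //; [exact: axis_e1|exact: axis_e2].
  by move: E; rewrite add0r !mulr0 addr0 => /eqP; rewrite subr_eq0 => /eqP.
(* For negative [M] no [x] qualifies and any positive constant will do. *)
have [M0|M0] := ltP M 0.
  by exists 1 => // x xM; move: (le_lt_trans xM M0); rewrite normr_lt0.
exists (c 0); last by move=> x xM; rewrite cE cc.
pose B := box (r / 2).
have [m m0 Bm] : exists2 m : R, 0 < m & forall y, B y -> m <= bump r (0 - y).
  have cB : {within B, continuous (fun y => bump r (0 - y))}.
    by apply: continuous_subspaceT; exact: continuous_subl.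
  have B0 : B !=set0 by exists 0; split; rewrite /= in_itv/=; olra.
  have [y yB Hy] := @compact_EVT_min _ R _ B B0 (@compact_box R _) cB.
  exists (bump r (0 - y)); last by move=> z Bz; apply: Hy; rewrite inE.
  apply: bump_gt0; rewrite sub0r normrN.
  by move: yB; rewrite inE => /box_norm; olra.
have BD : B `<=` D by move=> y /box_norm yr; apply: norm_box; olra.
have mB : measurable (B : set (mplane R)) := measurable_box _.
rewrite -cE; apply: (@lt_le_trans _ _ (\int[leb2 R]_(y in B) m)).
  rewrite Rintegral_cst// mulr_gt0//.
  have mi : measurable (`[- (r / 2), r / 2]%classic : set (measurableTypeR R)).
    exact: measurable_itv.
  have -> : leb2 R B =
    (@lebesgue_measure R `[(- (r / 2))%R, (r / 2)%R] * @lebesgue_measure R `[(- (r / 2))%R, (r / 2)%R])%E.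
    exact: (@product_measure1E _ _ (measurableTypeR R) (measurableTypeR R) R
      (@lebesgue_measure R) (@lebesgue_measure R) _ _ mi mi).
  rewrite lebesgue_measure_itv/= lte_fin ifT; last olra.
  by rewrite -EFinM/= mulr_gt0//; olra.
have ibr (A : set (R * R)) : measurable (A : set (mplane R)) -> A `<=` D ->
    (leb2 R).-integrable A (EFin \o (fun y => bump r (0 - y))).
  move=> mA AD; apply: (@integrableS _ _ R (leb2 R) D A) => //.
  have := @conv_integrable R D _ _ _ mD (leb2_box_lty _) DM m1 b1 (bump r) 0 cb.
  by under eq_fun do rewrite /= mulr1.
apply: (@le_trans _ _ (\int[leb2 R]_(y in B) bump r (0 - y))).
  apply: le_Rintegral => //; last exact: ibr.
  apply: (@bounded_integrable _ B _ `|m|) => //.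
  exact: leb2_box_lty.
rewrite Rintegral_mkcond [leRHS]Rintegral_mkcond.
apply: le_Rintegral => //.
- by rewrite -restrict_EFin; apply/(integrable_mkcond _ mB).1; exact: ibr.
- by rewrite -restrict_EFin; apply/(integrable_mkcond _ mD).1; exact: ibr.
- move=> y _; rewrite !patchE; case: ifPn => [|_].
    by rewrite inE => /BD yD; rewrite mem_set.
  by case: ifPn => // _; exact: bump_ge0.
Qed.

(** A classical stand-in for the Sobolev space of functions with zero trace: C^1 inside, bounded
    together with the gradient, zero at the boundary. The gradient is carried as explicit data. *)
Definition H10 f f1 f2 := [/\ bcont Om f, bcont Om f1, bcont Om f2, vanishing Om f &
  forall x, Om x -> is_derive x (1, 0) f (f1 x) /\ is_derive x (0, 1) f (f2 x)].

Lemma vanishingM f g : vanishing Om f -> bcont Om g -> vanishing Om (fun x => f x * g x).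
Proof.
move=> vf [_ [C gC]] e e0.
have C0 : 0 < `|C| + 1 by rewrite ltr_wpDl.
have [|K [cK KO fK]] := vf (e / (`|C| + 1)); first by rewrite divr_gt0.
exists K; split => // x Ox nKx; rewrite normrM.
have := fK x Ox nKx; rewrite ltr_pdivlMr//; apply: le_lt_trans.
rewrite ler_wpM2l// (le_trans (gC x Ox))// (le_trans (ler_norm C))//.
by rewrite lerDl.
Qed.

Lemma vanishing_ibpM v f fv g gv : axis v -> vanishing Om f ->
  bcont Om f -> bcont Om fv -> bcont Om g -> bcont Om gv ->
  (forall x, Om x -> is_derive x v f (fv x)) ->
  (forall x, Om x -> is_derive x v g (gv x)) ->
  I (fun x => f x * gv x) = - I (fun x => fv x * g x).
Proof.
move=> av vf bf bfv bg bgv df dg.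
have H := @vanishing_ibp R Om oOm bOm (fun x => f x * g x)
  (fun x => fv x * g x + f x * gv x) v av (vanishingM vf bg) (bcontM bf bg)
  (bcontD (bcontM bfv bg) (bcontM bf bgv)).
have {H} : I (fun x => fv x * g x + f x * gv x) = 0.
  by apply: H => x Ox; apply: dM; [exact: df|exact: dg].
rewrite RintegralD//; last 2 first.
- by apply: bcont_integrable => //; exact: bcontM.
- by apply: bcont_integrable => //; exact: bcontM.
by move=> /eqP; rewrite addr_eq0 => /eqP ->; rewrite opprK.
Qed.

(** The convolution of [phi] with a bump is an admissible test function when the set outside which
    [phi] vanishes keeps distance [r] from the complement. One derivative of the bump is integrated
    by parts back onto [phi] and the other onto [psi], so that no derivative of the bump remains and
    it can be shrunk. *)
Lemma weak_form_mollified psi psi1 psi2 phi phi1 phi2 w K r :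
  H10 psi psi1 psi2 -> H10 phi phi1 phi2 -> distr_laplacian Om psi w ->
  compact K -> (forall x y, K x -> `|y - x| <= r -> Om y) -> 0 < r ->
  (forall x, Om x -> ~ K x -> [/\ phi x = 0, phi1 x = 0 & phi2 x = 0]) ->
  I (fun x => psi1 x * conv Om phi1 (bump r) x) +
  I (fun x => psi2 x * conv Om phi2 (bump r) x) =
  - I (fun x => w x * conv Om phi (bump r) x).
Proof.
move=> [bpsi bpsi1 bpsi2 vpsi dpsi] [bphi bphi1 bphi2 vphi dphi] dl cK KO r0 phiK.
have [M M0 OM] := dom_norm bOm.
have OM' y : Om y -> `|y| <= M by move=> /OM/ltW.
have Olty := leb2_dom_lty oOm bOm.
have [C phiC] := bphi.2.
have mphi := bcont_measurable oOm bphi.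
have Ar := flat_alg_bump r.
have [cr dr] := flat_alg_derive Ar.
have csm f : bcont Om f -> forall rho, flat_alg rho -> bcont Om (conv Om f rho).
  move=> bf rho Arho; have [D fD] := bf.2; split.
    move=> x _; apply: (flat_alg_conv_continuous mO Olty OM' _ fD Arho).
    exact: bcont_measurable.
  have [B HB] := conv_bounded mO Olty OM' (bcont_measurable oOm bf) fD M (flat_alg_derive Arho).1.
  by exists B => x Ox; apply: HB; exact: OM'.
have conv_swap v (f fv rhov : R * R -> R) x : axis v -> vanishing Om f ->
    bcont Om f -> bcont Om fv ->
    flat_alg rhov -> (forall z, is_derive z v (bump r) (rhov z)) ->
    (forall x, Om x -> is_derive x v f (fv x)) ->
    conv Om f rhov x = conv Om fv (bump r) x.
  move=> av vf bf bfv Av dv df.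
  have [cv _] := flat_alg_derive Av.
  have bb rho : continuous rho -> bcont Om (fun y => rho (x - y)).
    move=> crho; split; first by move=> y _; exact: continuous_subl.
    have [B HB] := locally_bounded (`|x| + M) crho.
    exists B => y Oy; apply: HB.
    by rewrite (le_trans (ler_normB _ _))// lerD// OM'.
  have := vanishing_ibpM av vf bf bfv (bb _ cr) (bcontN (bb _ cv)) df
    (fun y _ => is_derive_subl (dv _)).
  move=> H; rewrite /conv.
  transitivity (- I (fun y => f y * - rhov (x - y))).
    rewrite -[RHS]mulN1r -RintegralZl//; last first.
      by apply: bcont_integrable => //; apply: bcontM => //; apply: bcontN; exact: bb.
    by apply: eq_Rintegral => y _; rewrite mulN1r mulrN opprK mulrC.
  rewrite H opprK; apply: eq_Rintegral => y _; exact: mulrC.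
have lapl v (psiv phiv : R * R -> R) : axis v -> bcont Om psiv -> bcont Om phiv ->
    (forall x, Om x -> is_derive x v psi (psiv x)) ->
    (forall x, Om x -> is_derive x v phi (phiv x)) ->
    exists L L' : R * R -> R, [/\ bcont Om L,
      forall x, is_derive x v (conv Om phi (bump r)) (L' x),
      forall x, is_derive x v L' (L x) &
      I (fun x => psiv x * conv Om phiv (bump r) x) = - I (fun x => psi x * L x)].
  move=> av bpsiv bphiv dpsiv dphiv.
  have [rv Av dv] := dr v; have [cv dv'] := flat_alg_derive Av.
  have [rvv Avv dvv] := dv' v; have [cvv _] := flat_alg_derive Avv.
  have dc x := conv_derive mO Olty OM' mphi phiC x cv dv cr.
  have dcc x := conv_derive mO Olty OM' mphi phiC x cvv dvv cv.
  exists (conv Om phi rvv), (conv Om phi rv); split => //; first exact: csm.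
  rewrite (vanishing_ibpM av vpsi bpsi bpsiv (csm _ bphi _ Av) (csm _ bphi _ Avv)) //.
  rewrite opprK; apply: eq_Rintegral => x _; congr (_ * _).
  by apply/esym; exact: conv_swap.
have [L1 [L1' [b1 dL1' dL1 E1]]] := lapl _ _ _ axis_e1 bpsi1 bphi1 (fun x Ox => (dpsi x Ox).1) (fun x Ox => (dphi x Ox).1).
have [L2 [L2' [b2 dL2' dL2 E2]]] := lapl _ _ _ axis_e2 bpsi2 bphi2 (fun x Ox => (dpsi x Ox).2) (fun x Ox => (dphi x Ox).2).
have /dl : test_function Om (conv Om phi (bump r)).
  split; first exact: (flat_alg_conv_smooth mO Olty OM' mphi phiC).
  exists [set x | exists2 y, K y & `|x - y| <= r]; split.
  - exact: compact_nbhd.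
  - by move=> x [y Ky xy]; exact: (KO y).
  - move=> x nx; rewrite /conv.
    transitivity (\int[leb2 R]_(y in Om) (0 : R)); last first.
      by rewrite Rintegral_cst// mul0r.
    apply: eq_Rintegral => y; rewrite inE => Oy.
    have [Ky|nKy] := pselect (K y); last by have [-> _ _] := phiK _ Oy nKy; rewrite mulr0.
    rewrite bump_eq0 ?mul0r// leNgt; apply/negP => xy; apply: nx.
    by exists y => //; exact: ltW.
move=> <-; rewrite E1 E2 -opprD -RintegralD//; last 2 first.
- by apply: bcont_integrable => //; exact: bcontM.
- by apply: bcont_integrable => //; exact: bcontM.
congr (- _); apply: eq_Rintegral => x _; rewrite -mulrDr; congr (_ * _).
by rewrite /laplacian (d1E dL1') (d1E dL1) (d2E dL2') (d2E dL2).
Qed.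

End weak_form.

(** * The weak form for functions vanishing at the boundary, and the Ladyzhenskaya inequality *)

Section weak_form_limit.
Context {R : realType}.
Variable Om : set (R * R).
Hypothesis oOm : open Om.
Hypothesis bOm : bounded_set Om.
Implicit Types (f g rho phi psi w : R * R -> R) (K : set (R * R)) (x y z v : R * R) (r : R).
Local Notation I h := (\int[leb2 R]_(x in Om) (h x)).
Let mO : measurable (Om : set (mplane R)) := measurable_dom oOm.

Lemma bcont_conv f rho : bcont Om f -> flat_alg rho -> bcont Om (conv Om f rho).
Proof.
move=> bf Ar; have [D fD] := bf.2.
have [M M0 OM] := dom_norm bOm.
have OM' y : Om y -> `|y| <= M by move=> /OM/ltW.
have Olty := leb2_dom_lty oOm bOm.
have mf := bcont_measurable oOm bf.
split; first by move=> x _; exact: (flat_alg_conv_continuous mO Olty OM' mf fD Ar).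
have [B HB] := conv_bounded mO Olty OM' mf fD M (flat_alg_derive Ar).1.
by exists B => x Ox; apply: HB; exact: OM'.
Qed.

Lemma bump_average (F : R * R -> R) r (M c a e : R) x : 0 < r -> continuous F ->
  \int[leb2 R]_(y in box (M + r)) bump r (x - y) = c ->
  (forall y, `|y - x| < r -> `|F y - a| <= e) ->
  `|\int[leb2 R]_(y in box (M + r)) (bump r (x - y) * F y) - c * a| <= e * c.
Proof.
move=> r0 cF cE Fa; set D := box (M + r).
have mD : measurable (D : set (mplane R)) := measurable_box _.
have cb : continuous (fun y => bump r (x - y)).
  by apply: continuous_subl; exact: (flat_alg_derive (flat_alg_bump r)).1.
have ic (h : R * R -> R) : continuous h -> (leb2 R).-integrable D (EFin \o h).
  move=> ch; have [C HC] := compact_fun_bounded (@compact_box R (M + r)) (continuous_subspaceT ch).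
  apply: (@bounded_integrable _ D _ C) => //; first exact: leb2_box_lty.
  by apply: measurable_funTS; apply: continuous_mplane_measurable; [exact: openT|move=> z _; exact: ch].
have cM (h g : R * R -> R) : continuous h -> continuous g -> continuous (fun y => h y * g y).
  by move=> ch cg y; apply: cvgM; [exact: ch|exact: cg].
have cc (k : R) : continuous (fun _ : R * R => k) by move=> y; exact: cvg_cst.
rewrite -cE -/D [_ * a]mulrC -(RintegralZl a mD (ic _ cb)).
rewrite -RintegralB//; [|exact: ic (cM _ _ cb cF)|exact: ic (cM _ _ (cc a) cb)].
have cd : continuous (fun y => bump r (x - y) * F y - a * bump r (x - y)).
  by move=> y; apply: cvgB; [exact: (cM _ _ cb cF)|exact: (cM _ _ (cc a) cb)].
rewrite (le_trans (le_normr_Rintegral mD (ic _ cd)))//.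
rewrite -RintegralZl//; last exact: ic.
apply: le_Rintegral => //.
- apply: (ic (fun y => `|bump r (x - y) * F y - a * bump r (x - y)|)).
  by move=> y; apply: (continuous_comp (cd y)); exact: norm_continuous.
- exact: ic (cM _ _ (cc e) cb).
- move=> y _; rewrite [a * _]mulrC -mulrBr normrM [e * _]mulrC (ger0_norm (bump_ge0 _ _)).
  have [xy|xy] := ltP `|y - x| r; first by rewrite ler_wpM2l ?bump_ge0// Fa.
  by rewrite bump_eq0 ?mul0r// distrC.
Qed.

Lemma conv_extE f r (M : R) x : (forall y, Om y -> `|y| <= M + r) ->
  conv Om f (bump r) x = \int[leb2 R]_(y in box (M + r)) (bump r (x - y) * (f \_ Om) y).
Proof.
move=> OM; rewrite /conv Rintegral_mkcond [RHS]Rintegral_mkcond.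
congr Rintegral; apply/funext => y; rewrite !patchE.
case: ifPn => [|nO]; first by rewrite inE => /OM /norm_box yb; rewrite mem_set.
by case: ifPn => // _; rewrite mulr0.
Qed.

(** Bumps normalised by their mass and shrinking to a point average a continuous function of compact
    support: the averages are uniformly bounded and converge pointwise, which suffices against an
    integrable [w]. *)
Lemma weak_form_compact psi psi1 psi2 phi phi1 phi2 w K :
  H10 Om psi psi1 psi2 -> H10 Om phi phi1 phi2 ->
  measurable_fun (Om : set (mplane R)) w -> (leb2 R).-integrable Om (EFin \o w) ->
  distr_laplacian Om psi w -> compact K -> K `<=` Om ->
  (forall x, Om x -> ~ K x -> [/\ phi x = 0, phi1 x = 0 & phi2 x = 0]) ->
  I (fun x => psi1 x * phi1 x) + I (fun x => psi2 x * phi2 x) = - I (fun x => w x * phi x).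
Proof.
move=> Hpsi Hphi mw iw dl cK KO phiK.
have [r0 r00 Kr] := compact_thickening oOm cK KO.
have [M M0 OM] := dom_norm bOm.
pose r n := r0 * n.+1%:R^-1.
have rp n : 0 < r n by rewrite mulr_gt0// invr_gt0.
have rr n : r n <= r0.
  by rewrite /r ler_piMr ?(ltW r00)// invf_le1// ler1n.
have [c Hc] := choice (fun n => let: ex_intro2 c c0 H := bump_mass M (rp n) in
  ex_intro (fun c => 0 < c /\ forall x, `|x| <= M ->
    \int[leb2 R]_(y in box (M + r n)) bump (r n) (x - y) = c) c (conj c0 H)).
(* The extension of [f] by 0 is continuous on the whole plane, so averages near the boundary of the
   domain need no separate treatment. *)
have cvgc f : bcont Om f -> (forall x, Om x -> ~ K x -> f x = 0) ->
  exists C : R, (forall n x, Om x -> `|(c n)^-1 * conv Om f (bump (r n)) x| <= C) /\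
   (forall x, Om x -> (c n)^-1 * conv Om f (bump (r n)) x @[n --> \oo] --> f x).
  move=> bf fK; have [C fC] := bf.2; exists `|C|.
  have cF := ext0_continuous oOm cK KO bf.1 fK.
  have OMr n y : Om y -> `|y| <= M + r n by move=> /OM yM; have := rp n; olra.
  split=> [n x Ox|x Ox].
    have [c0 cE] := Hc n; rewrite (@conv_extE f _ M)//; last exact: OMr.
    have := @bump_average _ _ M (c n) 0 `|C| x (rp n) cF (cE _ (ltW (OM _ Ox))).
    rewrite mulr0 subr0 normrM normfV (gtr0_norm c0) => H.
    rewrite ler_pdivrMl// mulrC; apply: H => y _; rewrite subr0 patchE.
    by case: ifPn => [|_]; [rewrite inE => /fC/le_trans; apply; exact: ler_norm|rewrite normr0].
  apply/cvgrPdist_le => e e0.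
  have := cF x => /cvgrPdist_le /(_ _ e0) /nbhs_ballP[d /= d0 Hd].
  have rd : \forall n \near \oo, r n < d.
    have : r n @[n --> \oo] --> (0 : R).
      rewrite -[X in _ --> X](mulr0 r0); apply: cvgM; first exact: cvg_cst.
      exact: cvg_harmonic.
    by move=> /cvgr_lt; apply.
  apply: filterS rd => n rd; have [c0 cE] := Hc n.
  rewrite (@conv_extE f _ M)//; last exact: OMr.
  have := @bump_average _ _ M (c n) (f x) e x (rp n) cF (cE _ (ltW (OM _ Ox))).
  move=> H; rewrite distrC.
  rewrite -[X in _ - X](mulKf (lt0r_neq0 c0)) -mulrBr normrM normfV (gtr0_norm c0).
  rewrite ler_pdivrMl// [c n * e]mulrC; apply: H => y yx.
  have fx : (f \_ Om) x = f x by rewrite patchE mem_set.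
  have Hy : ball x d y by rewrite -ball_normE/= distrC (lt_trans yx).
  by have := Hd y Hy; rewrite fx distrC.
have [bpsi bpsi1 bpsi2 vpsi dpsi] := Hpsi.
have [bphi bphi1 bphi2 vphi dphi] := Hphi.
have mconv f n : bcont Om f -> bcont Om (fun x => (c n)^-1 * conv Om f (bump (r n)) x).
  move=> bf; apply: bcontM; first exact: bcont_cst.
  by apply: bcont_conv => //; exact: flat_alg_bump.
have lim1 (p f : R * R -> R) : measurable_fun (Om : set (mplane R)) p ->
    (leb2 R).-integrable Om (EFin \o p) -> bcont Om f ->
    (forall x, Om x -> ~ K x -> f x = 0) ->
    I (fun x => p x * ((c n)^-1 * conv Om f (bump (r n)) x)) @[n --> \oo] -->
    I (fun x => p x * f x).
  move=> mp ip bf fK; have [C [bC cC]] := cvgc f bf fK.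
  apply: (Rdominated_cvg oOm (g := fun x => `|C| * `|p x|)).
  - by move=> n; apply: measurable_funM => //; apply: bcont_measurable => //; exact: mconv.
  - by apply: measurable_funM => //; exact: bcont_measurable.
  - by apply: aeW => x Ox; apply: cvgM; [exact: cvg_cst|exact: cC].
  - have /= := integrableZl mO `|C| (integrable_norm ip).
    by under [X in _.-integrable _ X -> _]eq_fun do rewrite -EFinM.
  - move=> n x Ox; rewrite normrM mulrC ler_wpM2r//.
    exact: le_trans (bC n x Ox) (ler_norm _).
have E n : I (fun x => psi1 x * ((c n)^-1 * conv Om phi1 (bump (r n)) x)) +
    I (fun x => psi2 x * ((c n)^-1 * conv Om phi2 (bump (r n)) x)) =
  - I (fun x => w x * ((c n)^-1 * conv Om phi (bump (r n)) x)).
  have Kr' x y : K x -> `|y - x| <= r n -> Om y.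
    by move=> Kx yx; apply: (Kr x) => //; exact: le_trans (rr n).
  have := weak_form_mollified oOm bOm Hpsi Hphi dl cK Kr' (rp n) phiK.
  have Z p f : (leb2 R).-integrable Om (EFin \o (fun x => p x * conv Om f (bump (r n)) x)) ->
      I (fun x => p x * ((c n)^-1 * conv Om f (bump (r n)) x)) =
      (c n)^-1 * I (fun x => p x * conv Om f (bump (r n)) x).
    by move=> H; rewrite -RintegralZl//; apply: eq_Rintegral => x _; rewrite mulrCA.
  have bi f : bcont Om f -> bcont Om (conv Om f (bump (r n))).
    by move=> bf; apply: bcont_conv => //; exact: flat_alg_bump.
  rewrite !Z; last 3 first.
  - have [C HC] := (bi _ bphi).2.
    apply: (@le_integrable _ _ _ (leb2 R) Om mO _ (fun x => (`|C|)%:E * (EFin \o w) x)%E).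
    + apply/measurable_EFinP; apply: measurable_funM => //.
      by apply: bcont_measurable => //; exact: bi.
    + move=> x Ox; rewrite /= lee_fin normrM mulrC [in leRHS]normrM normr_id.
      by rewrite ler_wpM2r// (le_trans (HC x Ox))// ler_norm.
    + exact: integrableZl.
  - by apply: bcont_integrable => //; apply: bcontM => //; exact: bi.
  - by apply: bcont_integrable => //; apply: bcontM => //; exact: bi.
  by rewrite -mulrDr => ->; rewrite mulrN.
have L1 := lim1 _ _ (bcont_measurable oOm bpsi1) (bcont_integrable oOm bOm bpsi1) bphi1
  (fun x Ox nK => let: And3 _ h _ := phiK x Ox nK in h).
have L2 := lim1 _ _ (bcont_measurable oOm bpsi2) (bcont_integrable oOm bOm bpsi2) bphi2
  (fun x Ox nK => let: And3 _ _ h := phiK x Ox nK in h).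
have L3 := lim1 _ _ mw iw bphi (fun x Ox nK => let: And3 h _ _ := phiK x Ox nK in h).
have H : - I (fun x => w x * ((c n)^-1 * conv Om phi (bump (r n)) x)) @[n --> \oo] -->
    I (fun x => psi1 x * phi1 x) + I (fun x => psi2 x * phi2 x).
  by under eq_fun do rewrite -E; exact: cvgD L1 L2.
exact: (@cvg_unique _ (@norm_hausdorff _ _) _ _ _ _ H (cvgN L3)).
Qed.

Lemma H10_trunc phi phi1 phi2 (e : R) : 0 < e -> H10 Om phi phi1 phi2 ->
  H10 Om (fun x => trunc e (phi x)) (fun x => trunc' e (phi x) * phi1 x)
    (fun x => trunc' e (phi x) * phi2 x).
Proof.
move=> e0 [b b1 b2 vphi dphi].
have bt : bcont Om (fun x => trunc' e (phi x)).
  by apply: bcont_comp => //; exact: trunc'_continuous.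
split.
- apply: bcont_comp => // t; apply/differentiable_continuous/derivable1_diffP.
  by case: (trunc_derive t e0).
- exact: bcontM.
- exact: bcontM.
- move=> a a0; have [K [cK KO H]] := vphi _ a0; exists K; split => // x Ox nK.
  by apply: le_lt_trans (trunc_le _ e0) _; exact: H.
- by move=> x Ox; have [d1 d2] := dphi x Ox; split;
    apply: is_derive_compV; eauto; exact: trunc_derive.
Qed.

(** Truncating [phi] gives compact support. The truncated gradients converge almost everywhere,
    because the gradient of [phi] vanishes almost everywhere on the zero set of [phi]. *)
Lemma weak_form psi psi1 psi2 phi phi1 phi2 w :
  H10 Om psi psi1 psi2 -> H10 Om phi phi1 phi2 ->
  measurable_fun (Om : set (mplane R)) w -> (leb2 R).-integrable Om (EFin \o w) ->
  distr_laplacian Om psi w ->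
  I (fun x => psi1 x * phi1 x) + I (fun x => psi2 x * phi2 x) = - I (fun x => w x * phi x).
Proof.
move=> Hpsi Hphi mw iw dl.
have [bpsi bpsi1 bpsi2 vpsi dpsi] := Hpsi.
have [bphi bphi1 bphi2 vphi dphi] := Hphi.
have n0 n : 0 < n.+1%:R^-1 :> R by rewrite invr_gt0.
have E n : I (fun x => psi1 x * (trunc' n.+1%:R^-1 (phi x) * phi1 x)) +
    I (fun x => psi2 x * (trunc' n.+1%:R^-1 (phi x) * phi2 x)) =
  - I (fun x => w x * trunc n.+1%:R^-1 (phi x)).
  have [K [cK KO HK]] := vphi _ (n0 n).
  apply: (weak_form_compact Hpsi (H10_trunc (n0 n) Hphi) mw iw dl cK KO).
  move=> x Ox nK; have h := ltW (HK x Ox nK).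
  by rewrite trunc_eq0// trunc'_eq0// !mul0r.
have lim1 v (p f : R * R -> R) : axis v -> bcont Om p -> bcont Om f ->
    (forall x, Om x -> is_derive x v phi (f x)) ->
    I (fun x => p x * (trunc' n.+1%:R^-1 (phi x) * f x)) @[n --> \oo] --> I (fun x => p x * f x).
  move=> av bp bf df; have [C fC] := bf.2.
  apply: (Rdominated_cvg oOm (g := fun x => `|p x| * `|f x|)).
  - move=> n; apply: bcont_measurable => //; apply: bcontM => //; apply: bcontM => //.
    by apply: bcont_comp => //; exact: trunc'_continuous.
  - by apply: bcont_measurable => //; exact: bcontM.
  - have [N [mN N0 subN]] := zero_set_derive_ae oOm av
      (fun x Ox => And3 (df x Ox) (bphi.1 x Ox) (bf.1 x Ox)).
    exists N; split => // x /= Hx; apply: subN => /= Hx'; apply: Hx => Ox.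
    apply: cvgM; first exact: cvg_cst.
    have [f0|f0] := eqVneq (phi x) 0.
      by rewrite (Hx' Ox f0); under eq_fun do rewrite mulr0; exact: cvg_cst.
    rewrite -[X in _ --> X]mul1r; apply: cvgM; last exact: cvg_cst.
    exact: trunc'_cvg.
  - by apply: bcont_integrable => //; apply: bcontM; exact: bcont_norm.
  - move=> n x Ox; rewrite normrM ler_wpM2l// normrM.
    have /andP[t0 t1] := trunc'_itv (phi x) (n0 n).
    by rewrite (ger0_norm t0) ler_piMl.
have L1 := lim1 _ _ _ axis_e1 bpsi1 bphi1 (fun x Ox => (dphi x Ox).1).
have L2 := lim1 _ _ _ axis_e2 bpsi2 bphi2 (fun x Ox => (dphi x Ox).2).
have [C phiC] := bphi.2.
have L3 : I (fun x => w x * trunc n.+1%:R^-1 (phi x)) @[n --> \oo] --> I (fun x => w x * phi x).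
  apply: (Rdominated_cvg oOm (g := fun x => `|C| * `|w x|)).
  - move=> n; apply: measurable_funM => //; apply: bcont_measurable => //.
    by have [] := H10_trunc (n0 n) Hphi.
  - by apply: measurable_funM => //; exact: bcont_measurable.
  - by apply: aeW => x Ox; apply: cvgM; [exact: cvg_cst|exact: trunc_cvg].
  - have /= := integrableZl mO `|C| (integrable_norm iw).
    by under [X in _.-integrable _ X -> _]eq_fun do rewrite -EFinM.
  - move=> n x Ox; rewrite normrM mulrC ler_wpM2r//.
    apply: le_trans (trunc_le _ (n0 n)) _.
    exact: le_trans (phiC x Ox) (ler_norm _).
have H : - I (fun x => w x * trunc n.+1%:R^-1 (phi x)) @[n --> \oo] -->
    I (fun x => psi1 x * phi1 x) + I (fun x => psi2 x * phi2 x).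
  by under eq_fun do rewrite -E; exact: cvgD L1 L2.
exact: (@cvg_unique _ (@norm_hausdorff _ _) _ _ _ _ H (cvgN L3)).
Qed.

(** The form in which kernels are inserted: a test function with bounded second derivatives and zero
    boundary values may carry both derivatives itself, since [psi] also vanishes at the boundary. *)
Lemma laplace_test psi psi1 psi2 (G G1 G2 G11 G22 : R * R -> R) w :
  H10 Om psi psi1 psi2 -> H10 Om G G1 G2 -> bcont Om G11 -> bcont Om G22 ->
  (forall x, Om x -> is_derive x (1, 0) G1 (G11 x)) ->
  (forall x, Om x -> is_derive x (0, 1) G2 (G22 x)) ->
  measurable_fun (Om : set (mplane R)) w -> (leb2 R).-integrable Om (EFin \o w) ->
  distr_laplacian Om psi w ->
  I (fun x => psi x * (G11 x + G22 x)) = I (fun x => w x * G x).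
Proof.
move=> Hpsi HG b11 b22 d11 d22 mw iw dl.
have [bpsi bpsi1 bpsi2 vpsi dpsi] := Hpsi.
have [bG bG1 bG2 vG dG] := HG.
rewrite -[RHS]opprK -(weak_form Hpsi HG mw iw dl).
have E1 := vanishing_ibpM oOm bOm axis_e1 vpsi bpsi bpsi1 bG1 b11 (fun x Ox => (dpsi x Ox).1) d11.
have E2 := vanishing_ibpM oOm bOm axis_e2 vpsi bpsi bpsi2 bG2 b22 (fun x Ox => (dpsi x Ox).2) d22.
rewrite opprD -E1 -E2 -RintegralD//; last 2 first.
- by apply: bcont_integrable => //; exact: bcontM.
- by apply: bcont_integrable => //; exact: bcontM.
by apply: eq_Rintegral => x _; rewrite mulrDr.
Qed.

Lemma FTC_line_bound (g g' : R -> R) (r t : R) :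
  (forall s : R, is_derive s (1 : R) g (g' s)) -> continuous g' ->
  (forall s : R, r <= `|s| -> g s = 0) ->
  ((`|g t|)%:E <= \int[@lebesgue_measure R]_s (`|g' s|)%:E)%E.
Proof.
move=> dg cg' gr.
have cg : continuous g.
  by move=> s; apply/differentiable_continuous/derivable1_diffP; case: (dg s).
pose a := Num.min (- `|r|) (t - 1).
have at_ : a < t by rewrite gt_min ltrBlDr ltrDl ltr01 orbT.
have ga : g a = 0.
  apply: gr; apply: le_trans (ler_norm r) _; rewrite ler_normr; apply/orP; right.
  by rewrite lerNr ge_min lexx.
have mg' (A : set R) : measurable A -> measurable_fun A (fun s => (`|g' s|)%:E).
  move=> mA; apply/measurable_EFinP; apply: measurableT_comp => //.
  by apply: measurable_funTS; exact: continuous_measurable_fun.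
have E : (\int[@lebesgue_measure R]_(s in `[a, t]) (g' s)%:E = (g t)%:E)%E.
  rewrite (continuous_FTC2 at_ (F := g)); first by rewrite ga sube0.
  - exact: continuous_subspaceT.
  - split; first by move=> s _; case: (dg s).
    + by apply: cvg_at_right_filter; exact: cg.
    + by apply: cvg_at_left_filter; exact: cg.
  - by move=> s _; rewrite derive1E; case: (dg s).
have -> : ((`|g t|)%:E = `| \int[@lebesgue_measure R]_(s in `[a, t]) (g' s)%:E |)%E.
  by rewrite E.
apply: le_trans (le_abse_integral _ _ _) _ => //.
  by apply/measurable_EFinP; apply: measurable_funTS; exact: continuous_measurable_fun.
by apply: ge0_subset_integral => //; exact: mg'.
Qed.

(** One factor [|F|] is bounded by the integral of [|F2|] over the vertical line, which depends on
    the first coordinate only, and the other by the integral of [|F1|] over the horizontal line; the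
    product separates under Tonelli's theorem. *)
Lemma ladyzhenskaya_compact (F F1 F2 : R * R -> R) r : 0 < r ->
  continuous F -> continuous F1 -> continuous F2 ->
  (forall x, is_derive x (1, 0) F (F1 x)) -> (forall x, is_derive x (0, 1) F (F2 x)) ->
  (forall x, r <= `|x| -> F x = 0) ->
  (\int[leb2 R]_z ((F z) ^+ 2)%:E <=
   (\int[leb2 R]_z (`|F1 z|)%:E) * (\int[leb2 R]_z (`|F2 z|)%:E))%E.
Proof.
move=> r0 cF cF1 cF2 d1F d2F Fr.
have mabs f : continuous f -> measurable_fun [set: mplane R] (fun z => (`|f z|)%:E).
  move=> cf; apply/measurable_EFinP; apply: measurableT_comp => //.
  by apply: continuous_mplane_measurable; [exact: openT|move=> z _; exact: cf].
have ge0 f (z : mplane R) : (0 <= (`|f z|)%:E)%E by rewrite lee_fin.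
pose A (y : R) := (\int[@lebesgue_measure R]_s (`|F1 (s, y)|)%:E)%E.
pose B (x : R) := (\int[@lebesgue_measure R]_s (`|F2 (x, s)|)%:E)%E.
have A0 (y : R) : (0 <= A y)%E by apply: integral_ge0 => s _; rewrite lee_fin.
have B0 (x : R) : (0 <= B x)%E by apply: integral_ge0 => s _; rewrite lee_fin.
have mA : measurable_fun [set: measurableTypeR R] A.
  have := @measurable_fun_fubini_tonelli_G _ _ _ _ _ (@lebesgue_measure R) _ (mabs _ cF1) (ge0 F1).
  exact.
have mB : measurable_fun [set: measurableTypeR R] B.
  have := @measurable_fun_fubini_tonelli_F _ _ _ _ _ (@lebesgue_measure R) _ (mabs _ cF2) (ge0 F2).
  exact.
have AE : (\int[leb2 R]_z (`|F1 z|)%:E = \int[@lebesgue_measure R]_y A y)%E.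
  have := @fubini_tonelli2 _ _ _ _ _ (@lebesgue_measure R) (@lebesgue_measure R) _ (mabs _ cF1) (ge0 F1).
  exact.
have BE : (\int[leb2 R]_z (`|F2 z|)%:E = \int[@lebesgue_measure R]_y B y)%E.
  have := @fubini_tonelli1 _ _ _ _ _ (@lebesgue_measure R) (@lebesgue_measure R) _ (mabs _ cF2) (ge0 F2).
  exact.
have csq : continuous (fun z => F z ^+ 2).
  by move=> z; apply: cvgM; exact: cF.
have msq : measurable_fun [set: mplane R] (fun z => ((F z) ^+ 2)%:E).
  apply/measurable_EFinP.
  by apply: continuous_mplane_measurable; [exact: openT|move=> z _; exact: csq].
have sq0 (z : mplane R) : (0 <= ((F z) ^+ 2)%:E)%E by rewrite lee_fin sqr_ge0.
have -> : (\int[leb2 R]_z ((F z) ^+ 2)%:E = \int[@lebesgue_measure R]_x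
     \int[@lebesgue_measure R]_y ((F (x, y)) ^+ 2)%:E)%E.
  have := @fubini_tonelli1 _ _ _ _ _ (@lebesgue_measure R) (@lebesgue_measure R) _ msq sq0.
  exact.
have FAB (x y : R) : (((F (x, y)) ^+ 2)%:E <= B x * A y)%E.
  rewrite -real_normK ?num_real// expr2 EFinM; apply: lee_pmul; rewrite ?lee_fin//.
  - apply: (@FTC_line_bound (fun s => F (x, s)) _ r) => [s||s rs].
    + by apply: is_derive_sliceB; exact: d2F.
    + by move=> s; apply: continuous_comp; [exact: continuous_pairr|exact: cF2].
    + by apply: Fr; rewrite prod_normE le_max rs orbT.
  - apply: (@FTC_line_bound (fun s => F (s, y)) _ r) => [s||s rs].
    + by apply: is_derive_sliceT; exact: d1F.
    + by move=> s; apply: continuous_comp; [exact: continuous_pairl|exact: cF1].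
    + by apply: Fr; rewrite prod_normE le_max rs.
rewrite AE BE.
apply: (@le_trans _ _ (\int[@lebesgue_measure R]_x (B x * \int[@lebesgue_measure R]_y A y)))%E.
  apply: ge0_le_integral => //.
  - by move=> x _; apply: integral_ge0 => y _; rewrite lee_fin sqr_ge0.
  - have := @measurable_fun_fubini_tonelli_F _ _ _ _ _ (@lebesgue_measure R) _ msq sq0.
    exact.
  - by apply: emeasurable_funM => //; exact: measurable_cst.
  - move=> x _; rewrite -ge0_integralZl//; apply: ge0_le_integral => //.
    + apply/measurable_EFinP; apply: continuous_measurable_fun => y.
      apply: (@continuous_comp _ _ _ (fun s : R => (x, s)) (fun z => F z ^+ 2) y (@continuous_pairr R x y)).
      exact: csq.
    + by apply: emeasurable_funM => //; exact: measurable_cst.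
by rewrite muleC ge0_integralZr// ?integral_ge0//.
Qed.

Lemma ladyzhenskaya f f1 f2 : H10 Om f f1 f2 ->
  I (fun x => f x ^+ 2) <= I (fun x => `|f1 x|) * I (fun x => `|f2 x|).
Proof.
move=> Hf; have [bf bf1 bf2 vf df] := Hf.
have n0 n : 0 < n.+1%:R^-1 :> R by rewrite invr_gt0.
have [r r0 Or] := dom_norm bOm.
have bsq g : bcont Om g -> bcont Om (fun x => g x ^+ 2) by move=> bg; exact: bcontM.
have IE g : (forall x, Om x -> 0 <= g x) -> bcont Om g ->
    (\int[leb2 R]_z ((g \_ Om) z)%:E = (I g)%:E)%E.
  move=> g0 bg; rewrite /Rintegral fineK; last first.
    by apply: integrable_fin_num => //; exact: bcont_integrable.
  by rewrite [RHS]integral_mkcond; apply: eq_integral => z _; rewrite !patchE; case: ifP.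
have H n : I (fun x => trunc n.+1%:R^-1 (f x) ^+ 2) <= I (fun x => `|f1 x|) * I (fun x => `|f2 x|).
  have [bt bt1 bt2 vt dt] := H10_trunc (n0 n) Hf.
  have [K [cK KO HK]] := vf _ (n0 n).
  have tK x : Om x -> ~ K x -> trunc n.+1%:R^-1 (f x) = 0 /\ trunc' n.+1%:R^-1 (f x) = 0.
    by move=> Ox nK; have h := ltW (HK x Ox nK); rewrite trunc_eq0// trunc'_eq0.
  pose F := (fun x => trunc n.+1%:R^-1 (f x)) \_ Om.
  pose F1 := (fun x => trunc' n.+1%:R^-1 (f x) * f1 x) \_ Om.
  pose F2 := (fun x => trunc' n.+1%:R^-1 (f x) * f2 x) \_ Om.
  have := @ladyzhenskaya_compact F F1 F2 r r0.
  have -> : (\int[leb2 R]_z ((F z) ^+ 2)%:E = (I (fun x => trunc n.+1%:R^-1 (f x) ^+ 2))%:E)%E.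
    rewrite -IE; [|by move=> x _; exact: sqr_ge0|exact: bsq].
    by apply: eq_integral => z _; rewrite /F !patchE; case: ifP => // _; rewrite expr0n.
  have -> : (\int[leb2 R]_z (`|F1 z|)%:E = (I (fun x => `|trunc' n.+1%:R^-1 (f x) * f1 x|))%:E)%E.
    rewrite -IE; [|by move=> x _|exact: bcont_norm].
    by apply: eq_integral => z _; rewrite /F1 !patchE; case: ifP => // _; rewrite normr0.
  have -> : (\int[leb2 R]_z (`|F2 z|)%:E = (I (fun x => `|trunc' n.+1%:R^-1 (f x) * f2 x|))%:E)%E.
    rewrite -IE; [|by move=> x _|exact: bcont_norm].
    by apply: eq_integral => z _; rewrite /F2 !patchE; case: ifP => // _; rewrite normr0.
  rewrite -EFinM lee_fin => HL; apply: le_trans (HL _ _ _ _ _ _) _.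
  - by apply: (ext0_continuous oOm cK KO bt.1) => x Ox nK; have [] := tK x Ox nK.
  - apply: (ext0_continuous oOm cK KO bt1.1) => x Ox nK.
    by have [_ ->] := tK x Ox nK; rewrite mul0r.
  - apply: (ext0_continuous oOm cK KO bt2.1) => x Ox nK.
    by have [_ ->] := tK x Ox nK; rewrite mul0r.
  - apply: (ext0_derive oOm _ cK KO) => [|x /dt[]//|x Ox nK]; first by have [] := @axis_e1 R.
    by have [-> ->] := tK x Ox nK; rewrite mul0r.
  - apply: (ext0_derive oOm _ cK KO) => [|x /dt[]//|x Ox nK]; first by have [] := @axis_e2 R.
    by have [-> ->] := tK x Ox nK; rewrite mul0r.
  - by move=> x rx; rewrite /F patchE memNset// => /Or; rewrite ltNge rx.
  have le1 g : bcont Om g -> I (fun x => `|trunc' n.+1%:R^-1 (f x) * g x|) <= I (fun x => `|g x|).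
    move=> bg; have bt' : bcont Om (fun x => trunc' n.+1%:R^-1 (f x)).
      by apply: bcont_comp => //; exact: trunc'_continuous.
    apply: le_Rintegral => //.
    - by apply: bcont_integrable => //; apply: bcont_norm; exact: bcontM.
    - by apply: bcont_integrable => //; exact: bcont_norm.
    - move=> x Ox; rewrite normrM; have /andP[t0 t1] := trunc'_itv (f x) (n0 n).
      by rewrite (ger0_norm t0) ler_piMl.
  by apply: ler_pM; rewrite ?le1// Rintegral_ge0.
have [C fC] := bf.2.
have L : I (fun x => trunc n.+1%:R^-1 (f x) ^+ 2) @[n --> \oo] --> I (fun x => f x ^+ 2).
  apply: (Rdominated_cvg oOm (g := fun x => `|f x| ^+ 2)).
  - move=> n; apply: bcont_measurable => //; apply: bsq.
    by have [] := H10_trunc (n0 n) Hf.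
  - by apply: bcont_measurable => //; exact: bsq.
  - by apply: aeW => x Ox; apply: cvgM; exact: trunc_cvg.
  - by apply: bcont_integrable => //; apply: bsq; exact: bcont_norm.
  - move=> n x Ox; rewrite normrX lerXn2r ?nnegrE//; exact: trunc_le.
rewrite -(cvg_lim (@norm_hausdorff _ _) L).
by apply: limr_le; [exact: cvgP L|exact: nearW].
Qed.

End weak_form_limit.

(** * Gradient of a potential whose Laplacian is small in L^1 *)

Section energy.
Context {R : realType}.
Variable Om : set (R * R).
Hypothesis oOm : open Om.
Hypothesis bOm : bounded_set Om.
Implicit Types (f g h phi psi chi w : R * R -> R) (x y z v : R * R).
Local Notation I h := (\int[leb2 R]_(x in Om) (h x)).
Let mO : measurable (Om : set (mplane R)) := measurable_dom oOm.
Let area := fine (leb2 R Om).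

Definition bmeas w (M : R) := measurable_fun (Om : set (mplane R)) w /\
  forall x, Om x -> `|w x| <= M.

Lemma bmeas_integrable w M : bmeas w M -> (leb2 R).-integrable Om (EFin \o w).
Proof.
by move=> [mw wM]; apply: (@bounded_integrable _ Om w M) => //; exact: leb2_dom_lty.
Qed.

Lemma bcont_bmeas f : bcont Om f -> exists M, bmeas f M.
Proof. by move=> bf; have [_ [C fC]] := bf; exists C; split => //; exact: bcont_measurable. Qed.

Lemma bmeasM f g (M N : R) : bmeas f M -> bmeas g N -> bmeas (fun x => f x * g x) (M * N).
Proof.
move=> [mf fM] [mg gN]; split; first exact: measurable_funM.
by move=> x Ox; rewrite normrM ler_pM ?fM ?gN.
Qed.

Lemma bmeas_norm f (M : R) : bmeas f M -> bmeas (fun x => `|f x|) M.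
Proof.
move=> [mf fM]; split; first exact: measurableT_comp.
by move=> x Ox; rewrite normr_id fM.
Qed.

Lemma bmeas_le f g (M N : R) : bmeas f M -> bmeas g N -> (forall x, Om x -> f x <= g x) -> I f <= I g.
Proof.
move=> bf bg fg; apply: le_Rintegral => //; first exact: bmeas_integrable bf.
exact: bmeas_integrable bg.
Qed.

Lemma I_le f g : bcont Om f -> bcont Om g -> (forall x, Om x -> f x <= g x) -> I f <= I g.
Proof. by move=> bf bg fg; apply: le_Rintegral => //; exact: bcont_integrable. Qed.

Lemma I_add f g : bcont Om f -> bcont Om g -> I (fun x => f x + g x) = I f + I g.
Proof. by move=> bf bg; rewrite RintegralD//; exact: bcont_integrable. Qed.

Lemma I_scale (c : R) f : bcont Om f -> I (fun x => c * f x) = c * I f.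
Proof. by move=> bf; rewrite RintegralZl//; exact: bcont_integrable. Qed.

Lemma area_ge0 : 0 <= area. Proof. exact: fine_ge0. Qed.

Lemma I_cst (c : R) : I (fun=> c) = c * area.
Proof. exact: Rintegral_cst. Qed.

Lemma atan_le_norm (t : R) : `|atan t| <= `|t|.
Proof.
wlog t0 : t / 0 <= t.
  move=> H; have [/H//|t0] := leP 0 t.
  by have := H (- t); rewrite atanN !normrN; apply; rewrite oppr_ge0 ltW.
have [->|tn] := eqVneq t 0; first by rewrite atan0.
have tp : 0 < t by rewrite lt_neqAle eq_sym tn.
have [|c c0] := @MVT R atan (fun s => (1 + s ^+ 2)^-1) 0 t tp.
  by apply: derivable_within_continuous => s _; exact: derivable_atan.
rewrite atan0 !subr0 => ->; rewrite normrM ler_piMl//.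
rewrite ger0_norm ?invr_ge0 ?addr_ge0 ?sqr_ge0//.
by rewrite invf_le1 ?lerDl ?sqr_ge0// ltr_wpDr ?sqr_ge0.
Qed.

Lemma atan_le2 (t : R) : `|atan t| <= 2.
Proof.
have := @pihalf_02 R; have := atan_gtNpi2 t; have := atan_ltpi2 t.
by rewrite ler_norml => a b /andP[c d]; olra.
Qed.

(** Since arctan is bounded, testing with [atan chi] costs only the L^1 norm of [f]; it controls
    [|grad chi|^2 / (1 + chi^2)]. Young's inequality removes the weight at the price of the integral
    of [chi^2], which the Ladyzhenskaya inequality bounds by the square of the quantity to be
    estimated. That square can be absorbed because it comes with a small factor. *)
Lemma L1_data_gradient chi chi1 chi2 f M (e : R) : 0 < e -> e <= 1 / 4 ->
  H10 Om chi chi1 chi2 -> bmeas f M -> distr_laplacian Om chi f ->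
  I (fun x => `|f x|) <= e ->
  I (fun x => `|chi1 x|) + I (fun x => `|chi2 x|) <= (4 * area + 1) * Num.sqrt e.
Proof.
move=> e0 e4 Hchi bf dl fe; have [b b1 b2 v d] := Hchi.
pose q (x : R * R) := (1 + chi x ^+ 2)^-1.
have pos x : 0 < 1 + chi x ^+ 2 by rewrite ltr_wpDr ?sqr_ge0.
have bq : bcont Om q.
  apply: (@bcont_comp R Om chi (fun t => (1 + t ^+ 2)^-1)) => // t.
  apply: cvgV; first by rewrite gt_eqF// ltr_wpDr ?sqr_ge0.
  by apply: cvgD; [exact: cvg_cst|exact: exprn_continuous].
have Hat : H10 Om (fun x => atan (chi x)) (fun x => q x * chi1 x) (fun x => q x * chi2 x).
  split.
  - by apply: bcont_comp => //; exact: continuous_atan.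
  - exact: bcontM.
  - exact: bcontM.
  - move=> a a0; have [K [cK KO H]] := v _ a0; exists K; split => // x Ox nK.
    by apply: le_lt_trans (atan_le_norm _) _; exact: H.
  - by move=> x Ox; have [dx dy] := d x Ox; split; apply: is_derive_compV; eauto;
      exact: is_derive1_atan.
have E := weak_form oOm bOm Hchi Hat bf.1 (bmeas_integrable bf) dl.
have [Ca bCa] : exists C, bmeas (fun x => atan (chi x)) C by apply: bcont_bmeas; case: Hat.
have EL : I (fun x => chi1 x * (q x * chi1 x)) + I (fun x => chi2 x * (q x * chi2 x)) <= 2 * e.
  rewrite E; apply: le_trans (ler_norm _) _; rewrite normrN.
  apply: le_trans (le_normr_Rintegral mO (bmeas_integrable (bmeasM bf bCa))) _.
  apply: le_trans (_ : I (fun x => 2 * `|f x|) <= _); last first.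
    rewrite RintegralZl//; first by rewrite ler_wpM2l.
    exact: (bmeas_integrable (bmeas_norm bf)).
  apply: (bmeas_le (bmeas_norm (bmeasM bf bCa)) (N := 2 * M)).
    split; first by apply: measurable_funM => //; exact: (bmeas_norm bf).1.
    by move=> x Ox; rewrite normrM normr_id ger0_norm// ler_wpM2l// bf.2.
  by move=> x Ox; rewrite normrM mulrC ler_wpM2r// atan_le2.
have L := ladyzhenskaya oOm bOm Hchi.
set g1 := I (fun x => `|chi1 x|) in L *; set g2 := I (fun x => `|chi2 x|) in L *.
have g10 : 0 <= g1 by exact: Rintegral_ge0.
have g20 : 0 <= g2 by exact: Rintegral_ge0.
set se := Num.sqrt e.
have se0 : 0 < se by rewrite sqrtr_gt0.
have see : se ^+ 2 = e by rewrite sqr_sqrtr// ltW.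
have se2 : se <= 1 / 2 by nra.
(* The Young parameter is scaled so that [lam * (1 + g1 + g2) = 2 * se]. Then [lam] times the
   integral of [chi^2] is at most [se * (g1 + g2) / 2]; together with the equal contribution of the
   data it amounts to at most half of the left side, because [se <= 1 / 2]. *)
pose lam := 2 * se / (1 + (g1 + g2)).
have gp : 0 < 1 + (g1 + g2) by olra.
have lam0 : 0 < lam by rewrite /lam divr_gt0// mulr_gt0.
have bsq : bcont Om (fun x => chi x ^+ 2) by exact: bcontM.
have b1sq : bcont Om (fun x => 1 + chi x ^+ 2) by apply: bcontD => //; exact: bcont_cst.
have H (h : R * R -> R) : bcont Om h ->
    I (fun x => `|h x|) <= lam / 2 * (area + I (fun x => chi x ^+ 2)) +
      (2 * lam)^-1 * I (fun x => h x * (q x * h x)).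
  move=> bh; have bqh : bcont Om (fun x => h x * (q x * h x)) by apply: bcontM => //; exact: bcontM.
  rewrite -[area]mul1r -I_cst -(I_add (bcont_cst Om 1) bsq) -!I_scale//.
  rewrite -I_add; [|by apply: bcontM => //; exact: bcont_cst|by apply: bcontM => //; exact: bcont_cst].
  apply: I_le; first exact: bcont_norm.
    by apply: bcontD; apply: bcontM => //; exact: bcont_cst.
  move=> x _; rewrite /q; have px := pos x.
  set s := 1 + chi x ^+ 2 in px *.
  have : 0 <= (lam * s - `|h x|) ^+ 2 / (2 * lam * s).
    have p2 : 0 < 2 * lam * s by apply: mulr_gt0 => //; apply: mulr_gt0.
    by rewrite divr_ge0 ?sqr_ge0// ltW.
  rewrite (_ : _ / _ = lam / 2 * s + (2 * lam)^-1 * (h x * (s^-1 * h x)) - `|h x|); first by rewrite subr_ge0.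
  have -> : h x * (s^-1 * h x) = s^-1 * `|h x| ^+ 2 by rewrite real_normK ?num_real//; ring.
  by field; rewrite !gt_eqF.
have H1 := H _ b1; have H2 := H _ b2.
rewrite -/g1 in H1; rewrite -/g2 in H2.
have HS : g1 + g2 <= lam * (area + I (fun x => chi x ^+ 2)) + lam^-1 * e.
  have : (2 * lam)^-1 * (I (fun x => chi1 x * (q x * chi1 x)) + I (fun x => chi2 x * (q x * chi2 x))) <= lam^-1 * e.
    rewrite (_ : lam^-1 * e = (2 * lam)^-1 * (2 * e)); last by field; rewrite gt_eqF.
    by rewrite ler_wpM2l// invr_ge0 mulr_ge0// ltW.
  olra.
have l1 : lam * (1 + (g1 + g2)) = 2 * se by rewrite /lam divfK// gt_eqF.
have l2 : lam^-1 * e = (1 + (g1 + g2)) * se / 2.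
  by rewrite /lam -see; field; rewrite !gt_eqF.
rewrite l2 in HS; clear H H1 H2 l2; move: L HS l1 lam0.
move: (I (fun x => chi x ^+ 2)) lam => B l L HS l1 l0.
have A0 := area_ge0.
have h1 : l * area <= 2 * se * area.
  by rewrite ler_wpM2r// -l1 ler_peMr ?(ltW l0)//; olra.
have h2 : l * B <= se * (g1 + g2) / 2.
  apply: (@le_trans _ _ (l * ((g1 + g2) ^+ 2 / 4))).
    by rewrite ler_wpM2l ?(ltW l0)//; apply: le_trans L _; have := sqr_ge0 (g1 - g2); olra.
  have h : l * (g1 + g2) <= 2 * se by rewrite -l1 ler_wpM2l ?(ltW l0)//; olra.
  have := ler_wpM2r (addr_ge0 g10 g20) h; olra.
have h3 : se * (g1 + g2) <= (g1 + g2) / 2 by nra.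
rewrite mulrDr in HS; olra.
Qed.

End energy.

(** * Chain rule for functions of two variables *)

Section plane_chain_rule.
Context {R : realType}.
Implicit Types (g p : R * R -> R) (x y z v h : R * R).

Lemma plane_frechet g g1 g2 x :
  (forall z, is_derive z (1, 0) g (g1 z) /\ is_derive z (0, 1) g (g2 z)) ->
  {for x, continuous g1} -> {for x, continuous g2} ->
  forall e : R, 0 < e -> exists2 d : R, 0 < d & forall h, `|h| < d ->
    `|g (x + h) - g x - (h.1 * g1 x + h.2 * g2 x)| <= e * `|h|.
Proof.
move=> dg c1 c2 e e0; have e2 : 0 < e / 2 by rewrite divr_gt0.
move/cvgrPdist_lt : c1 => /(_ _ e2) /nbhs_ballP[a /= a0 Ha].
move/cvgrPdist_lt : c2 => /(_ _ e2) /nbhs_ballP[b /= b0 Hb].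
exists (Num.min a b); first by rewrite lt_min a0 b0.
move=> h; rewrite lt_min => /andP[ha hb].
have [z [z' [zx zx' E]]] := @plane_mvt R g g1 g2 x h (fun z _ => dg z).
have F1 : `|g1 x - g1 z| < e / 2.
  by apply: Ha; rewrite -ball_normE/= distrC; exact: le_lt_trans ha.
have F2 : `|g2 x - g2 z'| < e / 2.
  by apply: Hb; rewrite -ball_normE/= distrC; exact: le_lt_trans hb.
rewrite E distrC (_ : _ - _ = h.1 * (g1 x - g1 z) + h.2 * (g2 x - g2 z')); last ring.
apply: le_trans (ler_normD _ _) _; rewrite !normrM.
have := ler_pM (normr_ge0 _) (normr_ge0 _) (norm_fst_le h) (ltW F1).
have := ler_pM (normr_ge0 _) (normr_ge0 _) (norm_snd_le h) (ltW F2).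
move: (`|h|) (`|h.1| * _) (`|h.2| * _) => n m1 m2; olra.
Qed.

Lemma plane_chain g g1 g2 (p1 p2 : R * R -> R) y v (a b : R) :
  (forall z, is_derive z (1, 0) g (g1 z) /\ is_derive z (0, 1) g (g2 z)) ->
  continuous g1 -> continuous g2 ->
  is_derive y v p1 a -> is_derive y v p2 b ->
  is_derive y v (fun y => g (p1 y, p2 y)) (a * g1 (p1 y, p2 y) + b * g2 (p1 y, p2 y)).
Proof.
move=> dg c1 c2 d1 d2; apply: line_is_derive.
have dl1 : is_derive (0 : R) (1 : R) (fun t => p1 (y + t *: v)) a.
  by apply: is_derive_line; rewrite scale0r addr0.
have dl2 : is_derive (0 : R) (1 : R) (fun t => p2 (y + t *: v)) b.
  by apply: is_derive_line; rewrite scale0r addr0.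
have /is_derive1_caratheodory[s1 [E1 cs1 s10]] := dl1.
have /is_derive1_caratheodory[s2 [E2 cs2 s20]] := dl2.
rewrite scale0r addr0 in E1 E2.
apply/is_derive1_caratheodory.
pose x : R * R := (p1 y, p2 y).
pose H t : R * R := (t * s1 t, t * s2 t).
have HE t : (p1 (y + t *: v), p2 (y + t *: v)) = x + H t.
  have := E1 t; have := E2 t; rewrite !subr0 => /eqP; rewrite subr_eq => /eqP ->.
  by move=> /eqP; rewrite subr_eq => /eqP ->; rewrite /x /H pair_addE !(addrC (_ * t)) !(mulrC t).
exists (fun t => if t == 0 then a * g1 x + b * g2 x else (g (x + H t) - g x) / t).
rewrite eqxx; split => //.
  move=> t; rewrite scale0r addr0 subr0 HE -/x.
  case: ifPn => [/eqP->|t0]; last by rewrite divfK.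
  by rewrite /H !mul0r addr0 subrr mulr0.
apply/cvgrPdist_le => e e0; rewrite eqxx.
pose K := `|a| + `|b| + 2 + `|g1 x| + `|g2 x|.
have K0 : 0 < K.
  have := normr_ge0 a; have := normr_ge0 b; have := normr_ge0 (g1 x); have := normr_ge0 (g2 x).
  by rewrite /K; olra.
pose e' := e / (3 * K).
have e'0 : 0 < e' by rewrite divr_gt0// mulr_gt0.
have [d d0 Hd] := plane_frechet dg (c1 x) (c2 x) e'0.
have m1 : 0 < Num.min 1 e' by rewrite lt_min ltr01.
move/cvgrPdist_lt : cs1 => /(_ _ m1) /nbhs_ballP[r1 /= r10 Hr1].
move/cvgrPdist_lt : cs2 => /(_ _ m1) /nbhs_ballP[r2 /= r20 Hr2].
apply/nbhs_ballP; exists (Num.min (d / K) (Num.min r1 r2)) => /=.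
  by rewrite !lt_min divr_gt0// r10 r20.
move=> t; rewrite /ball/= sub0r normrN !lt_min => /and3P[td t1 t2].
case: ifPn => [_|t0]; first by rewrite subrr normr0 ltW.
have := Hr1 t; rewrite /ball/= sub0r normrN s10 lt_min => /(_ t1) /andP[A1 A2].
have := Hr2 t; rewrite /ball/= sub0r normrN s20 lt_min => /(_ t2) /andP[B1 B2].
have S1 : `|s1 t| <= K.
  have := ler_distD a (s1 t) 0; rewrite !subr0 distrC /K.
  by have := normr_ge0 b; have := normr_ge0 (g1 x); have := normr_ge0 (g2 x); olra.
have S2 : `|s2 t| <= K.
  have := ler_distD b (s2 t) 0; rewrite !subr0 distrC /K.
  by have := normr_ge0 a; have := normr_ge0 (g1 x); have := normr_ge0 (g2 x); olra.
have Ht : `|H t| <= `|t| * K.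
  by rewrite prod_normE/= ge_max !normrM !ler_wpM2l.
have Htd : `|H t| < d by apply: le_lt_trans Ht _; rewrite -ltr_pdivlMr.
have F := Hd _ Htd.
have tp : 0 < `|t| by rewrite normr_gt0.
have F' : `|(g (x + H t) - g x) / t - (s1 t * g1 x + s2 t * g2 x)| <= e' * K.
  rewrite (_ : _ - _ = (g (x + H t) - g x - ((H t).1 * g1 x + (H t).2 * g2 x)) / t); last first.
    by rewrite /H /=; field.
  rewrite normrM normfV ler_pdivrMr//; apply: le_trans F _.
  apply: le_trans (ler_wpM2l (ltW e'0) Ht) _.
  by rewrite (_ : e' * (`|t| * K) = e' * K * `|t|)//; ring.
have G1 : `|(a - s1 t) * g1 x| <= e' * K.
  rewrite normrM ler_pM// ?ltW//; rewrite /K.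
  by have := normr_ge0 a; have := normr_ge0 b; have := normr_ge0 (g2 x); olra.
have G2 : `|(b - s2 t) * g2 x| <= e' * K.
  rewrite normrM ler_pM// ?ltW//; rewrite /K.
  by have := normr_ge0 a; have := normr_ge0 b; have := normr_ge0 (g1 x); olra.
have eK : e = e' * K + e' * K + e' * K by rewrite /e'; field; rewrite gt_eqF.
rewrite (_ : _ - _ = (a - s1 t) * g1 x + (b - s2 t) * g2 x -
   ((g (x + H t) - g x) / t - (s1 t * g1 x + s2 t * g2 x))); last ring.
rewrite eK; apply: le_trans (ler_normB _ _) _; rewrite lerD//.
by apply: le_trans (ler_normD _ _) _; rewrite lerD.
Qed.

End plane_chain_rule.

(** * Derivatives of the regularized Newtonian potential and their orders of magnitude *)

Section newton_kernel.
Context {R : realType}.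
Implicit Types (x y z v k c : R * R) (e : R).

(** The squared Euclidean length, to be distinguished from [|z|], which is the max norm. *)
Definition nsq z : R := z.1 ^+ 2 + z.2 ^+ 2.
Definition ker_den e z : R := nsq z + e ^+ 2.

Lemma nsq_ge0 z : 0 <= nsq z. Proof. by rewrite addr_ge0 ?sqr_ge0. Qed.

Lemma norm_le_nsq z : `|z| ^+ 2 <= nsq z.
Proof.
rewrite prod_normE /nsq.
by have [_|_] := leP `|z.1| `|z.2|; rewrite real_normK ?num_real// ?lerDl ?lerDr sqr_ge0.
Qed.

Lemma nsq_le_norm z : nsq z <= 2 * `|z| ^+ 2.
Proof.
rewrite mulr_natl mulr2n /nsq -(real_normK (num_real z.1)) -(real_normK (num_real z.2)).
by rewrite lerD// lerXn2r ?nnegrE// ?norm_fst_le ?norm_snd_le.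
Qed.

(* c . z / (|z|^2 + e^2): the derivative of the regularized Newtonian potential in direction c *)
Definition ker e c z := (c.1 * z.1 + c.2 * z.2) / ker_den e z.
Definition ker1 e c z := c.1 / ker_den e z - 2 * (c.1 * z.1 + c.2 * z.2) * z.1 / ker_den e z ^+ 2.
Definition ker2 e c z := c.2 / ker_den e z - 2 * (c.1 * z.1 + c.2 * z.2) * z.2 / ker_den e z ^+ 2.
Definition ker11 e c z := - 4 * c.1 * z.1 / ker_den e z ^+ 2
  - 2 * (c.1 * z.1 + c.2 * z.2) / ker_den e z ^+ 2
  + 8 * (c.1 * z.1 + c.2 * z.2) * z.1 ^+ 2 / ker_den e z ^+ 3.
Definition ker12 e c z := - 2 * (c.1 * z.2 + c.2 * z.1) / ker_den e z ^+ 2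
  + 8 * (c.1 * z.1 + c.2 * z.2) * z.1 * z.2 / ker_den e z ^+ 3.
Definition ker22 e c z := - 4 * c.2 * z.2 / ker_den e z ^+ 2
  - 2 * (c.1 * z.1 + c.2 * z.2) / ker_den e z ^+ 2
  + 8 * (c.1 * z.1 + c.2 * z.2) * z.2 ^+ 2 / ker_den e z ^+ 3.
(* The mollifier: its derivative in direction c is the Laplacian of [ker e c] *)
Definition ker_mass e z := 2 * e ^+ 2 / ker_den e z ^+ 2.
Definition ker_lap e c z := - 8 * e ^+ 2 * (c.1 * z.1 + c.2 * z.2) / ker_den e z ^+ 3.

Lemma ker_den_gt0 e z : 0 < e -> 0 < ker_den e z.
Proof. by move=> e0; rewrite ltr_wpDl ?nsq_ge0// exprn_gt0. Qed.

Lemma ker_laplacian e c z : 0 < e -> ker11 e c z + ker22 e c z = ker_lap e c z.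
Proof.
move=> e0; have S0 := ker_den_gt0 z e0.
have Sn : ker_den e z != 0 by rewrite gt_eqF.
rewrite /ker11 /ker22 /ker_lap.
have -> : e ^+ 2 = ker_den e z - z.1 ^+ 2 - z.2 ^+ 2 by rewrite /ker_den /nsq; ring.
by field.
Qed.

Lemma is_derive_den e z v : is_derive z v (ker_den e) (2 * (z.1 * v.1 + z.2 * v.2)).
Proof.
apply: d_eq (dD (dD (dX 2 (is_derive_fst z v)) (dX 2 (is_derive_snd z v))) (dC (e ^+ 2) z v)) _.
by rewrite /= !expr1; ring.
Qed.

Lemma is_derive_lin c z v :
  is_derive z v (fun z => c.1 * z.1 + c.2 * z.2) (c.1 * v.1 + c.2 * v.2).
Proof. exact: dD (dZ c.1 (is_derive_fst z v)) (dZ c.2 (is_derive_snd z v)). Qed.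

Lemma is_derive_denV e z v n : 0 < e -> is_derive z v (fun z => (ker_den e z ^+ n)^-1)
  (- (n%:R * ker_den e z ^+ n.-1 * (2 * (z.1 * v.1 + z.2 * v.2))) / (ker_den e z ^+ n) ^+ 2).
Proof.
move=> e0; apply: dV; last exact: dX (is_derive_den e z v).
by rewrite expf_neq0// gt_eqF// ker_den_gt0.
Qed.

Lemma is_derive_ker e c z v : 0 < e ->
  is_derive z v (ker e c) (v.1 * ker1 e c z + v.2 * ker2 e c z).
Proof.
move=> e0; have Sn : ker_den e z != 0 by rewrite gt_eqF// ker_den_gt0.
apply: d_eq (dM (is_derive_lin c z v) (is_derive_denV z v 1 e0)) _.
by rewrite /ker1 /ker2 /= !expr1 expr0; field.
Qed.

Lemma is_derive_ker1 e c z v : 0 < e ->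
  is_derive z v (ker1 e c) (v.1 * ker11 e c z + v.2 * ker12 e c z).
Proof.
move=> e0; have Sn : ker_den e z != 0 by rewrite gt_eqF// ker_den_gt0.
apply: d_eq (dB (dM (dC c.1 z v) (is_derive_denV z v 1 e0))
  (dM (dM (dZ 2 (is_derive_lin c z v)) (is_derive_fst z v)) (is_derive_denV z v 2 e0))) _.
by rewrite /ker11 /ker12 /= !expr1 expr0; field.
Qed.

Lemma is_derive_ker2 e c z v : 0 < e ->
  is_derive z v (ker2 e c) (v.1 * ker12 e c z + v.2 * ker22 e c z).
Proof.
move=> e0; have Sn : ker_den e z != 0 by rewrite gt_eqF// ker_den_gt0.
apply: d_eq (dB (dM (dC c.2 z v) (is_derive_denV z v 1 e0))
  (dM (dM (dZ 2 (is_derive_lin c z v)) (is_derive_snd z v)) (is_derive_denV z v 2 e0))) _.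
by rewrite /ker22 /ker12 /= !expr1 expr0; field.
Qed.

Lemma is_derive_mass e z v : 0 < e -> is_derive z v (ker_mass e) (ker_lap e v z).
Proof.
move=> e0; have Sn : ker_den e z != 0 by rewrite gt_eqF// ker_den_gt0.
apply: d_eq (dM (dC (2 * e ^+ 2) z v) (is_derive_denV z v 2 e0)) _.
by rewrite /ker_lap /= !expr1; field.
Qed.

(* Families of kernels which are homogeneous of degree a at scales larger than e *)
Definition sing_ord (a : int) (f : R -> R * R -> R) := exists2 C : R, 0 <= C &
  forall e z, 0 < e -> `|f e z| <= C * (`|z| + e) ^ a /\
    forall k, `|k| <= (`|z| + e) / 2 ->
      `|f e (z - k) - f e z| <= C * `|k| * (`|z| + e) ^ (a - 1).

Lemma sing_ordD a f g : sing_ord a f -> sing_ord a g -> sing_ord a (fun e z => f e z + g e z).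
Proof.
move=> [C C0 Hf] [D D0 Hg]; exists (C + D); first exact: addr_ge0.
move=> e z e0; have [f1 f2] := Hf e z e0; have [g1 g2] := Hg e z e0; split.
  by rewrite mulrDl (le_trans (ler_normD _ _))// lerD.
move=> k hk; rewrite opprD addrACA !mulrDl.
by rewrite (le_trans (ler_normD _ _))// lerD// ?f2 ?g2.
Qed.

Lemma sing_ordM a b f g : sing_ord a f -> sing_ord b g ->
  sing_ord (a + b) (fun e z => f e z * g e z).
Proof.
move=> [C C0 Hf] [D D0 Hg]; exists (3 * C * D); first by rewrite !mulr_ge0.
move=> e z e0; have [f1 f2] := Hf e z e0; have [g1 g2] := Hg e z e0.
have r0 : 0 < `|z| + e by rewrite ltr_wpDl.
have rn : `|z| + e != 0 by rewrite gt_eqF.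
have pa : 0 < (`|z| + e) ^ a by rewrite exprz_gt0.
have pb : 0 < (`|z| + e) ^ b by rewrite exprz_gt0.
have CD0 : 0 <= C * D * ((`|z| + e) ^ a * (`|z| + e) ^ b) by rewrite !mulr_ge0// ltW.
rewrite expfzDr//; split.
  rewrite normrM; apply: le_trans (ler_pM _ _ f1 g1) _ => //.
  rewrite mulrACA; move: CD0; olra.
move=> k hk; have F := f2 k hk; have G := g2 k hk.
have E (m : int) : (`|z| + e) ^ (m - 1) = (`|z| + e) ^ m / (`|z| + e).
  by rewrite expfzDr// expN1r.
rewrite E in F; rewrite E in G.
rewrite -addrA expfzDr// E.
set r := `|z| + e in r0 rn pa pb CD0 f1 g1 F G hk *.
set pa' := r ^ a in pa CD0 f1 F *; set pb' := r ^ b in pb CD0 g1 G *.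
have kr : `|k| / r <= 1 / 2 by rewrite ler_pdivrMr//; olra.
have kr0 : 0 <= `|k| / r by rewrite divr_ge0// ltW.
have F' : `|f e (z - k) - f e z| <= C * pa' * (`|k| / r) by apply: le_trans F _; olra.
have G' : `|g e (z - k) - g e z| <= D * pb' * (`|k| / r) by apply: le_trans G _; olra.
(* For increments of at most half the scale the shifted factor exceeds its bound by at most the
   ratio 3/2; the sum of 3/2 and 1 explains the constant 3 with some room. *)
have gk : `|g e (z - k)| <= 3 / 2 * (D * pb').
  have := ler_distD (g e z) (g e (z - k)) 0; rewrite !subr0 => h.
  have : D * pb' * (`|k| / r) <= D * pb' * (1 / 2) by rewrite ler_wpM2l// mulr_ge0// ltW.
  by olra.
rewrite (_ : _ - _ = (f e (z - k) - f e z) * g e (z - k) + f e z * (g e (z - k) - g e z)); last ring.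
apply: le_trans (ler_normD _ _) _; rewrite !normrM.
have X1 := ler_pM (normr_ge0 _) (normr_ge0 _) F' gk.
have X2 := ler_pM (normr_ge0 _) (normr_ge0 _) f1 G'.
apply: le_trans (lerD X1 X2) _.
have : 0 <= C * D * (pa' * pb') * (`|k| / r) by rewrite mulr_ge0.
rewrite (_ : 3 * C * D * `|k| * (pa' * (pb' / r)) = 3 * (C * D * (pa' * pb') * (`|k| / r))); last by ring.
rewrite (_ : _ + _ = 5 / 2 * (C * D * (pa' * pb') * (`|k| / r))); last by field.
olra.
Qed.

Lemma sing_ord_scale a f (c : R) : sing_ord a f -> sing_ord a (fun e z => c * f e z).
Proof.
move=> [C C0 Hf]; exists (`|c| * C); first by rewrite mulr_ge0.
move=> e z e0; have [f1 f2] := Hf e z e0; split.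
  by rewrite normrM -mulrA ler_wpM2l.
by move=> k hk; rewrite -mulrBr normrM -!mulrA ler_wpM2l// mulrA f2.
Qed.

Lemma sing_ord_fst : sing_ord 1 (fun _ z => z.1).
Proof.
exists 1 => // e z e0; rewrite mul1r expr1z; split.
  by rewrite (le_trans (norm_fst_le z))// lerDl ltW.
by move=> k _; rewrite /= addrAC subrr sub0r normrN subrr expr0z mulr1 mul1r norm_fst_le.
Qed.

Lemma sing_ord_snd : sing_ord 1 (fun _ z => z.2).
Proof.
exists 1 => // e z e0; rewrite mul1r expr1z; split.
  by rewrite (le_trans (norm_snd_le z))// lerDl ltW.
by move=> k _; rewrite /= addrAC subrr sub0r normrN subrr expr0z mulr1 mul1r norm_snd_le.
Qed.

Lemma ker_den_ge e z : 0 < e -> (`|z| + e) ^+ 2 / 2 <= ker_den e z.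
Proof.
by move=> e0; have := norm_le_nsq z; rewrite /ker_den; have := sqr_ge0 (`|z| - e); nra.
Qed.

Lemma sing_ord_denV : sing_ord (-2) (fun e z => (ker_den e z)^-1).
Proof.
exists 80 => // e z e0.
(* The constant 80 is 5 times 16: the two denominators differ by at most [5 * |k| * (|z| + e)], and
   their product is at least [(|z| + e)^4 / 16]. *)
have r0 : 0 < `|z| + e by rewrite ltr_wpDl.
have S0 := ker_den_gt0 z e0; have Sge := ker_den_ge z e0.
have E2 : (`|z| + e) ^ (-2) = ((`|z| + e) ^+ 2)^-1 by rewrite -exprnN.
have E3 : (`|z| + e) ^ (-2 - 1) = ((`|z| + e) ^+ 3)^-1 by rewrite (_ : -2 - 1 = - (3%:Z))// -exprnN.
split.
  rewrite ger0_norm ?invr_ge0 ?(ltW S0)// E2.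
  rewrite -[leLHS]mul1r ler_pdivrMr// mulrAC ler_pdivlMr ?exprn_gt0//.
  by rewrite mul1r; move: Sge S0; clear; olra.
move=> k hk; rewrite E3; clear E2 E3; have S0' := ker_den_gt0 (z - k) e0; have Sge' := ker_den_ge (z - k) e0.
have rk : (`|z| + e) / 2 <= `|z - k| + e.
  by have := lerB_dist z k; olra.
have Sge2 : (`|z| + e) ^+ 2 / 8 <= ker_den e (z - k) by nra.
rewrite (_ : _ - _ = (ker_den e z - ker_den e (z - k)) / (ker_den e z * ker_den e (z - k))); last first.
  by field; rewrite !gt_eqF.
have dS : `|ker_den e z - ker_den e (z - k)| <= 5 * `|k| * (`|z| + e).
  have -> : ker_den e z - ker_den e (z - k) = k.1 * (2 * z.1 - k.1) + k.2 * (2 * z.2 - k.2).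
    by rewrite /ker_den /nsq /=; ring.
  apply: le_trans (ler_normD _ _) _; rewrite !normrM.
  have B1 : `|2 * z.1 - k.1| <= 5 / 2 * (`|z| + e).
    apply: le_trans (ler_normB _ _) _; rewrite normrM ger0_norm//.
    by have := norm_fst_le z; have := norm_fst_le k; olra.
  have B2 : `|2 * z.2 - k.2| <= 5 / 2 * (`|z| + e).
    apply: le_trans (ler_normB _ _) _; rewrite normrM ger0_norm//.
    by have := norm_snd_le z; have := norm_snd_le k; olra.
  have := ler_pM (normr_ge0 _) (normr_ge0 _) (norm_fst_le k) B1.
  have := ler_pM (normr_ge0 _) (normr_ge0 _) (norm_snd_le k) B2.
  olra.
have SS : (`|z| + e) ^+ 4 / 16 <= ker_den e z * ker_den e (z - k).
  have -> : (`|z| + e) ^+ 4 / 16 = ((`|z| + e) ^+ 2 / 2) * ((`|z| + e) ^+ 2 / 8) by field.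
  by apply: ler_pM => //; rewrite divr_ge0// sqr_ge0.
rewrite normrM normfV [`|_ * ker_den _ _|]ger0_norm ?mulr_ge0 ?(ltW S0) ?(ltW S0')//.
rewrite ler_pdivrMr ?mulr_gt0//; apply: le_trans dS _.
rewrite [leRHS]mulrAC ler_pdivlMr ?exprn_gt0//.
have := ler_wpM2l (normr_ge0 k) SS.
rewrite (_ : _ * _ * _ ^+ 3 = 80 * (`|k| * ((`|z| + e) ^+ 4 / 16))); last by field.
olra.
Qed.

Lemma sing_ord_ext a f g : (forall e z, f e z = g e z) -> sing_ord a f -> sing_ord a g.
Proof.
move=> fg [C C0 H]; exists C => // e z e0; have [H1 H2] := H e z e0.
by rewrite -fg; split => // k kz; rewrite -!fg H2.
Qed.

Lemma sing_ord_den2 : sing_ord (-4) (fun e z => (ker_den e z ^+ 2)^-1).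
Proof.
apply: sing_ord_ext (sing_ordM sing_ord_denV sing_ord_denV) => e z.
by rewrite expr2 invfM.
Qed.

Lemma sing_ord_den3 : sing_ord (-6) (fun e z => (ker_den e z ^+ 3)^-1).
Proof.
apply: sing_ord_ext (sing_ordM sing_ord_denV sing_ord_den2) => e z.
by rewrite -invfM -exprS.
Qed.

Lemma sing_ord_lin c : sing_ord 1 (fun _ z => c.1 * z.1 + c.2 * z.2).
Proof. exact: sing_ordD (sing_ord_scale c.1 sing_ord_fst) (sing_ord_scale c.2 sing_ord_snd). Qed.

Lemma sing_ord_ker c : sing_ord (-1) (fun e z => ker e c z).
Proof. exact: sing_ordM (sing_ord_lin c) sing_ord_denV. Qed.

Lemma sing_ord_ker1 c : sing_ord (-2) (fun e z => ker1 e c z).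
Proof.
have := sing_ordD (sing_ord_scale c.1 sing_ord_denV)
  (sing_ord_scale (-2) (sing_ordM (sing_ordM (sing_ord_lin c) sing_ord_fst) sing_ord_den2)).
by apply: sing_ord_ext => e z; rewrite /ker1; ring.
Qed.

Lemma sing_ord_ker2 c : sing_ord (-2) (fun e z => ker2 e c z).
Proof.
have := sing_ordD (sing_ord_scale c.2 sing_ord_denV)
  (sing_ord_scale (-2) (sing_ordM (sing_ordM (sing_ord_lin c) sing_ord_snd) sing_ord_den2)).
by apply: sing_ord_ext => e z; rewrite /ker2; ring.
Qed.

Let sing_ord_cubic c (f g : R -> R * R -> R) : sing_ord 1 f -> sing_ord 1 g ->
  sing_ord (-3) (fun e z => (c.1 * z.1 + c.2 * z.2) * f e z * g e z / ker_den e z ^+ 3).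
Proof.
by move=> hf hg; exact: (sing_ordM (sing_ordM (sing_ordM (sing_ord_lin c) hf) hg) sing_ord_den3).
Qed.

Lemma sing_ord_ker11 c : sing_ord (-3) (fun e z => ker11 e c z).
Proof.
have := sing_ordD (sing_ordM (sing_ord_lin (-4 * c.1 - 2 * c.1, -2 * c.2)) sing_ord_den2)
  (sing_ord_scale 8 (sing_ord_cubic c sing_ord_fst sing_ord_fst)).
by apply: sing_ord_ext => e z; rewrite /ker11/=; ring.
Qed.

Lemma sing_ord_ker12 c : sing_ord (-3) (fun e z => ker12 e c z).
Proof.
have := sing_ordD (sing_ordM (sing_ord_lin (-2 * c.2, -2 * c.1)) sing_ord_den2)
  (sing_ord_scale 8 (sing_ord_cubic c sing_ord_fst sing_ord_snd)).
by apply: sing_ord_ext => e z; rewrite /ker12/=; ring.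
Qed.

Lemma sing_ord_ker22 c : sing_ord (-3) (fun e z => ker22 e c z).
Proof.
have := sing_ordD (sing_ordM (sing_ord_lin (-2 * c.1, -4 * c.2 - 2 * c.2)) sing_ord_den2)
  (sing_ord_scale 8 (sing_ord_cubic c sing_ord_snd sing_ord_snd)).
by apply: sing_ord_ext => e z; rewrite /ker22/=; ring.
Qed.

(** The factor [e^2] is the point: at a fixed distance from the singularity the Laplacian of the
    kernel is negligible, so the reflected kernel is almost harmonic inside the domain. *)
Lemma ker_lap_bound c e z : 0 < e ->
  `|ker_lap e c z| <= 64 * (`|c.1| + `|c.2|) * e ^+ 2 / (`|z| + e) ^+ 5.
Proof.
move=> e0; have S0 := ker_den_gt0 z e0; have Sge := ker_den_ge z e0.
have r0 : 0 < `|z| + e by rewrite ltr_wpDl.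
have S3 : (`|z| + e) ^+ 6 / 8 <= ker_den e z ^+ 3.
  rewrite (_ : _ / _ = ((`|z| + e) ^+ 2 / 2) ^+ 3); last by field.
  by rewrite lerXn2r// nnegrE ?(ltW S0)// divr_ge0// sqr_ge0.
have lin : `|c.1 * z.1 + c.2 * z.2| <= (`|c.1| + `|c.2|) * (`|z| + e).
  apply: le_trans (ler_normD _ _) _; rewrite !normrM mulrDl; apply: lerD.
    by rewrite ler_wpM2l//; have := norm_fst_le z; olra.
  by rewrite ler_wpM2l//; have := norm_snd_le z; olra.
rewrite /ker_lap normrM normfV [`|ker_den e z ^+ 3|]ger0_norm ?exprn_ge0 ?(ltW S0)//.
rewrite ler_pdivrMr ?exprn_gt0// normrM.
rewrite (_ : `|- 8 * e ^+ 2| = 8 * e ^+ 2); last first.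
  by rewrite mulNr normrN ger0_norm// mulr_ge0// sqr_ge0.
have h0 : 0 <= 8 * e ^+ 2 by rewrite mulr_ge0// sqr_ge0.
apply: le_trans (ler_wpM2l h0 lin) _.
rewrite -subr_ge0 (_ : _ - _ = 64 * (`|c.1| + `|c.2|) * e ^+ 2 / (`|z| + e) ^+ 5 *
   (ker_den e z ^+ 3 - (`|z| + e) ^+ 6 / 8)); last by field; rewrite gt_eqF.
apply: mulr_ge0; last by rewrite subr_ge0.
apply: divr_ge0; last exact: exprn_ge0 (ltW r0).
by apply: mulr_ge0; rewrite ?sqr_ge0// mulr_ge0// addr_ge0.
Qed.

End newton_kernel.

(** * Divergence theorem on a square *)

Section divergence.
Context {R : realType}.
Implicit Types (f g V : R * R -> R) (a b x y z : R * R) (r : R).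
Notation mu := (@lebesgue_measure R).

Definition cbox a r : set (R * R) := `[a.1 - r, a.1 + r] `*` `[a.2 - r, a.2 + r].

Lemma cboxE a r y : cbox a r y <-> `|y - a| <= r.
Proof.
rewrite prod_normE ge_max /cbox/= !in_itv/= !ler_norml; split.
  by move=> [/andP[h1 h2] /andP[h3 h4]]; apply/andP; split; apply/andP; split; olra.
by move=> /andP[/andP[h1 h2] /andP[h3 h4]]; split; apply/andP; split; olra.
Qed.

Lemma measurable_cbox a r : measurable (cbox a r : set (mplane R)).
Proof. by apply: measurableX; exact: measurable_itv. Qed.

Lemma compact_cbox a r : compact (cbox a r).
Proof. by apply: compact_setX; exact: segment_compact. Qed.

Lemma leb2_cbox_lty a r : (leb2 R (cbox a r) < +oo)%E.
Proof.
apply: le_lt_trans (leb2_box_lty (`|a| + r)).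
apply: le_measure; rewrite ?inE; [exact: measurable_cbox|exact: measurable_box|].
move=> y /cboxE yr; apply: norm_box; rewrite -(subrK a y) addrC.
by apply: le_trans (ler_normD _ _) _; rewrite lerD2l.
Qed.

Lemma cbox_integrable f a r : continuous f -> (leb2 R).-integrable (cbox a r) (EFin \o f).
Proof.
move=> cf; have [C fC] : exists C : R, forall x, cbox a r x -> `|f x| <= C.
  by apply: compact_fun_bounded; [exact: compact_cbox|exact: continuous_subspaceT].
apply: (@bounded_integrable _ _ _ C) => //; [exact: measurable_cbox|exact: leb2_cbox_lty|].
apply: measurable_funTS; apply: continuous_mplane_measurable; [exact: openT|].
by move=> x _; exact: cf.
Qed.

Lemma FTC_segment (g g' : R -> R) (a b : R) : a < b ->
  (forall t : R, is_derive t (1 : R) g (g' t)) -> continuous g' ->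
  (\int[mu]_(t in `[a, b]) (g' t)%:E = (g b - g a)%:E)%E.
Proof.
move=> ab dg cg'; have cg : continuous g.
  by move=> t; apply/differentiable_continuous/derivable1_diffP; case: (dg t).
rewrite (continuous_FTC2 ab (F := g))//.
- exact: continuous_subspaceT.
- split; first by move=> t _; case: (dg t).
  + by apply: cvg_at_right_filter; exact: cg.
  + by apply: cvg_at_left_filter; exact: cg.
- by move=> t _; rewrite derive1E; case: (dg t).
Qed.

Lemma cbox_d1 V V1 a r : 0 < r -> continuous V1 ->
  (forall x, is_derive x (1, 0) V (V1 x)) ->
  \int[leb2 R]_(x in cbox a r) V1 x =
  \int[mu]_(t in `[a.2 - r, a.2 + r]) (V (a.1 + r, t) - V (a.1 - r, t)).
Proof.
move=> r0 cV1 dV; have int1 := @cbox_integrable V1 a r cV1.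
rewrite /Rintegral; congr fine; rewrite [LHS]integral_mkcond [RHS]integral_mkcond.
have i2 := (integrable_mkcond _ (measurable_cbox a r)).1 int1.
have := @integral21_prod_meas1 _ _ _ _ _ mu mu _ i2.
rewrite /leb2 => <-; apply: eq_integral => y _.
rewrite patchE; case: ifPn => [|/negP] yI.
  transitivity (\int[mu]_(x in `[(a.1 - r)%R, (a.1 + r)%R]) (V1 (x, y))%:E)%E.
    rewrite [RHS]integral_mkcond; apply: eq_integral => x _; rewrite !patchE.
    suff -> : ((x, y) \in cbox a r) = (x \in (`[a.1 - r, a.1 + r]%classic : set R)) by [].
    apply/idP/idP; rewrite !inE; first by case.
    by move=> ?; split => //; move: yI; rewrite inE.
  have := @FTC_segment (fun x : R => V (x, y : R)) (fun x : R => V1 (x, y : R)) (a.1 - r) (a.1 + r); apply; first by olra.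
    by move=> t; apply: is_derive_sliceT; exact: dV.
  by move=> t; apply: continuous_comp; [exact: continuous_pairl|exact: cV1].
apply: integral0_eq => x _; rewrite patchE ifF//.
by apply/negbTE/negP; rewrite inE => -[/= _ yI']; apply: yI; rewrite inE.
Qed.

Lemma cbox_d2 V V2 a r : 0 < r -> continuous V2 ->
  (forall x, is_derive x (0, 1) V (V2 x)) ->
  \int[leb2 R]_(x in cbox a r) V2 x =
  \int[mu]_(t in `[a.1 - r, a.1 + r]) (V (t, a.2 + r) - V (t, a.2 - r)).
Proof.
move=> r0 cV2 dV; have int1 := @cbox_integrable V2 a r cV2.
rewrite /Rintegral; congr fine; rewrite [LHS]integral_mkcond [RHS]integral_mkcond.
have i2 := (integrable_mkcond _ (measurable_cbox a r)).1 int1.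
have := @integral12_prod_meas1 _ _ _ _ _ mu mu _ i2.
rewrite /leb2 => <-; apply: eq_integral => y _.
rewrite patchE; case: ifPn => [|/negP] yI.
  transitivity (\int[mu]_(x in `[(a.2 - r)%R, (a.2 + r)%R]) (V2 (y, x))%:E)%E.
    rewrite [RHS]integral_mkcond; apply: eq_integral => x _; rewrite !patchE.
    suff -> : ((y, x) \in cbox a r) = (x \in (`[a.2 - r, a.2 + r]%classic : set R)) by [].
    apply/idP/idP; rewrite !inE; first by case.
    by move=> ?; split => //; move: yI; rewrite inE.
  have := @FTC_segment (fun x : R => V (y : R, x)) (fun x : R => V2 (y : R, x)) (a.2 - r) (a.2 + r); apply; first by olra.
    by move=> t; apply: is_derive_sliceB; exact: dV.
  by move=> t; apply: continuous_comp; [exact: continuous_pairr|exact: cV2].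
apply: integral0_eq => x _; rewrite patchE ifF//.
by apply/negbTE/negP; rewrite inE => -[/= yI' _]; apply: yI; rewrite inE.
Qed.

Lemma segment_integral_le (g : R -> R) (u v B : R) : u < v -> continuous g ->
  (forall t, u <= t <= v -> g t <= B) -> \int[mu]_(t in `[u, v]) g t <= B * (v - u).
Proof.
move=> uv cg gB.
have mI : measurable (`[u, v] : set (measurableTypeR R)) by exact: measurable_itv.
have i1 (h : R -> R) : continuous h -> mu.-integrable `[u, v] (EFin \o h).
  by move=> ch; apply: continuous_compact_integrable; [exact: segment_compact|exact: continuous_subspaceT].
have E : \int[mu]_(t in `[u, v]) (B : R) = B * (v - u).
  rewrite Rintegral_cst//; congr (_ * _); have := @lebesgue_measure_itv R `[u, v].
  by rewrite /= lte_fin uv => ->.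
rewrite -E; apply: le_Rintegral => //; first exact: i1.
  by apply: (i1 (fun=> B)) => t; exact: cvg_cst.
Qed.

(** This replaces polar coordinates in the estimates of singular integrals: it is enough to exhibit
    a vector field whose divergence dominates the integrand and which is bounded on the sides. The
    perimeter of the square is [8 * r]. *)
Lemma cbox_divergence_le V1 V2 W1 W2 f a r B : 0 < r ->
  continuous V1 -> continuous V2 -> continuous W1 -> continuous W2 -> continuous f ->
  (forall x, is_derive x (1, 0) V1 (W1 x)) -> (forall x, is_derive x (0, 1) V2 (W2 x)) ->
  (forall x, `|x - a| = r -> `|V1 x| <= B /\ `|V2 x| <= B) ->
  (forall x, cbox a r x -> f x <= W1 x + W2 x) ->
  \int[leb2 R]_(x in cbox a r) f x <= 8 * r * B.
Proof.
move=> r0 cV1 cV2 cW1 cW2 cf d1 d2 VB fW.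
have cW : continuous (fun x => W1 x + W2 x).
  by move=> x; apply: (@continuousD _ _ _ W1 W2); [exact: cW1|exact: cW2].
apply: (@le_trans _ _ (\int[leb2 R]_(x in cbox a r) (W1 x + W2 x))).
  apply: le_Rintegral; [exact: measurable_cbox| | |exact: fW].
  - exact: cbox_integrable.
  - exact: cbox_integrable.
rewrite RintegralD; [|exact: measurable_cbox|exact: cbox_integrable|exact: cbox_integrable].
rewrite (cbox_d1 _ r0 cW1 d1) (cbox_d2 _ r0 cW2 d2).
have nr x : (`|x.1 - a.1| = r /\ `|x.2 - a.2| <= r) \/ (`|x.2 - a.2| = r /\ `|x.1 - a.1| <= r) ->
    `|V1 x| <= B /\ `|V2 x| <= B.
  move=> h; apply: VB; rewrite prod_normE/=.
  by case: h => -[-> h]; [rewrite (max_idPl h)|rewrite (max_idPr h)].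
have e1 : `|a.1 + r - a.1| = r by rewrite addrAC subrr add0r ger0_norm// ltW.
have e2 : `|a.1 - r - a.1| = r by rewrite addrAC subrr add0r normrN ger0_norm// ltW.
have e3 : `|a.2 + r - a.2| = r by rewrite addrAC subrr add0r ger0_norm// ltW.
have e4 : `|a.2 - r - a.2| = r by rewrite addrAC subrr add0r normrN ger0_norm// ltW.
have L1 : \int[mu]_(t in `[a.2 - r, a.2 + r]) (V1 (a.1 + r, t) - V1 (a.1 - r, t)) <=
    (2 * B) * ((a.2 + r) - (a.2 - r)).
  apply: segment_integral_le; first by olra.
    move=> t; apply: (@continuousB _ _ _ (fun t => V1 (a.1 + r, t)) (fun t => V1 (a.1 - r, t)));
      by apply: continuous_comp; [exact: continuous_pairr|exact: cV1].
  move=> t tr; have t1 : `|t - a.2| <= r by rewrite ler_norml; apply/andP; split; olra.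
  have [+ _] := nr (a.1 + r, t) (or_introl (conj e1 t1)).
  have [+ _] := nr (a.1 - r, t) (or_introl (conj e2 t1)).
  by rewrite !ler_norml => /andP[h1 h2] /andP[h3 h4]; olra.
have L2 : \int[mu]_(t in `[a.1 - r, a.1 + r]) (V2 (t, a.2 + r) - V2 (t, a.2 - r)) <=
    (2 * B) * ((a.1 + r) - (a.1 - r)).
  apply: segment_integral_le; first by olra.
    move=> t; apply: (@continuousB _ _ _ (fun t => V2 (t, a.2 + r)) (fun t => V2 (t, a.2 - r)));
      by apply: continuous_comp; [exact: continuous_pairl|exact: cV2].
  move=> t tr; have t1 : `|t - a.1| <= r by rewrite ler_norml; apply/andP; split; olra.
  have [_ +] := nr (t, a.2 + r) (or_intror (conj e3 t1)).
  have [_ +] := nr (t, a.2 - r) (or_intror (conj e4 t1)).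
  by rewrite !ler_norml => /andP[h1 h2] /andP[h3 h4]; olra.
apply: le_trans (lerD L1 L2) _; olra.
Qed.

End divergence.

(** * Continuity rules for real functions *)

Section continuity_rules.
Context {R : realType} (V : topologicalType).
Implicit Types f g : V -> R.

Lemma kC (c : R) : continuous (fun _ : V => c).
Proof. by move=> x; exact: cvg_cst. Qed.

Lemma kD f g : continuous f -> continuous g -> continuous (fun x => f x + g x).
Proof. by move=> cf cg x; apply: (@continuousD _ _ _ f g); [exact: cf|exact: cg]. Qed.

Lemma kB f g : continuous f -> continuous g -> continuous (fun x => f x - g x).
Proof. by move=> cf cg x; apply: (@continuousB _ _ _ f g); [exact: cf|exact: cg]. Qed.

Lemma kM f g : continuous f -> continuous g -> continuous (fun x => f x * g x).
Proof. by move=> cf cg x; apply: (@continuousM _ _ f g); [exact: cf|exact: cg]. Qed.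

Lemma kX f n : continuous f -> continuous (fun x => f x ^+ n).
Proof.
move=> cf; elim: n => [|n ih]; first exact: kC.
rewrite (_ : (fun x => _) = (fun x => f x * f x ^+ n)); first exact: kM.
by apply/funext => x; rewrite exprS.
Qed.

Lemma kV f : (forall x, f x != 0) -> continuous f -> continuous (fun x => (f x)^-1).
Proof. by move=> f0 cf x; apply: (@continuousV _ _ f); [exact: f0|exact: cf]. Qed.

Lemma kcomp (h : R -> R) f : (forall x, {for f x, continuous h}) -> continuous f ->
  continuous (fun x => h (f x)).
Proof. by move=> ch cf x; apply: continuous_comp; [exact: cf|exact: ch]. Qed.

End continuity_rules.

(** * Translations *)

Section shift.
Context {R : realType} (V : normedModType R).
Implicit Types f g : V -> R.

Lemma is_derive_shift f (y a v : V) (d : R) : is_derive (y - a) v f d ->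
  is_derive y v (fun y => f (y - a)) d.
Proof.
move=> df; apply: line_is_derive; have := @is_derive_line _ _ _ f (y - a) v 0 d.
rewrite scale0r addr0 => /(_ df).
by rewrite (_ : (fun t => f (y - a + t *: v)) = (fun t => f (y + t *: v - a)))//; apply/funext => t; rewrite addrAC.
Qed.

Lemma continuous_shift f (a : V) : continuous f -> continuous (fun y => f (y - a)).
Proof.
move=> cf y; apply: (@continuous_comp _ _ _ (fun y => y - a) f); last exact: cf.
by apply: cvgB; [exact: cvg_id|exact: cvg_cst].
Qed.

End shift.

(** * Integrals of the kernels over squares, by explicit vector fields *)

Section kernel_integrals.
Context {R : realType}.
Implicit Types (a x y z v : R * R) (e r k : R).
Notation mu := (@lebesgue_measure R).

Lemma continuous_fst : continuous (fun z : R * R => z.1).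
Proof. by move=> z; exact: cvg_fst. Qed.

Lemma continuous_snd : continuous (fun z : R * R => z.2).
Proof. by move=> z; exact: cvg_snd. Qed.

Lemma continuous_den e : continuous (ker_den e : R * R -> R).
Proof.
by apply: kD; [apply: kD; apply: kX; [exact: continuous_fst|exact: continuous_snd]|exact: kC].
Qed.

Lemma continuous_denV e : 0 < e -> continuous (fun z : R * R => (ker_den e z)^-1).
Proof. by move=> e0; apply: kV; [move=> z; rewrite gt_eqF// ker_den_gt0|exact: continuous_den]. Qed.

Lemma ker_den_sphere e z r : `|z| = r -> r ^+ 2 + e ^+ 2 <= ker_den e z <= 2 * r ^+ 2 + e ^+ 2.
Proof. by move=> <-; rewrite /ker_den !lerD2r norm_le_nsq nsq_le_norm. Qed.

(** The origin of the logarithm in the modulus of continuity: the integral of [1 / (|z|^2 + k^2)]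
    grows like the logarithm of [r / k]. *)
Lemma cbox_integral_inv_den a r k : 0 < r -> 0 < k ->
  \int[leb2 R]_(y in cbox a r) (ker_den k (y - a))^-1 <=
  4 * (1 + ln ((2 * r ^+ 2 + k ^+ 2) / k ^+ 2)).
Proof.
move=> r0 k0; have k20 : 0 < k ^+ 2 by exact: exprn_gt0.
have S0 (z : R * R) := ker_den_gt0 z k0.
have Sn (z : R * R) : ker_den k z != 0 by rewrite gt_eqF.
have Sk0 (z : R * R) : 0 < ker_den k z / k ^+ 2 by rewrite divr_gt0.
pose l (z : R * R) := ln (ker_den k z / k ^+ 2).
have cl : continuous l.
  rewrite /l; apply: kcomp.
    by move=> z; exact: continuous_ln.
  by apply: kM; [exact: continuous_den|exact: kC].
have dl z v : is_derive z v l (2 * (z.1 * v.1 + z.2 * v.2) / ker_den k z).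
  have d1 : is_derive z v (fun z : R * R => ker_den k z / k ^+ 2) (2 * (z.1 * v.1 + z.2 * v.2) / k ^+ 2).
    by apply: d_eq (dM (is_derive_den k z v) (dC (k ^+ 2)^-1 z v)) _; rewrite mulr0 addr0.
  apply: d_eq (is_derive_compV d1 (is_derive1_ln (Sk0 z))) _.
  by field; rewrite Sn gt_eqF// k0.
(* The field is [z * g z]. Its divergence equals [1 / ker_den k z + k^2 * l z / ker_den k z ^ 2],
   which exceeds the integrand because [l] is nonnegative. *)
pose g (z : R * R) := (1 / 2 * l z + 1 / 2) * (ker_den k z)^-1.
have cg : continuous g.
  apply: kM; last exact: continuous_denV.
  by apply: kD; [apply: kM => //; exact: kC|exact: kC].
have dg z v : is_derive z v g (- (z.1 * v.1 + z.2 * v.2) * l z / ker_den k z ^+ 2).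
  apply: d_eq (dM (dD (dZ (1 / 2) (dl z v)) (dC (1 / 2) z v)) (dV (Sn z) (is_derive_den k z v))) _.
  by field.
pose U1 (z : R * R) := z.1 * g z; pose U2 (z : R * R) := z.2 * g z.
pose W1 (z : R * R) := g z - z.1 ^+ 2 * l z * ((ker_den k z)^-1) ^+ 2.
pose W2 (z : R * R) := g z - z.2 ^+ 2 * l z * ((ker_den k z)^-1) ^+ 2.
have dU1 z : is_derive z (1, 0) U1 (W1 z).
  by apply: d_eq (dM (is_derive_fst z _) (dg z _)) _; rewrite /W1/=; field.
have dU2 z : is_derive z (0, 1) U2 (W2 z).
  by apply: d_eq (dM (is_derive_snd z _) (dg z _)) _; rewrite /W2/=; field.
have cW1 : continuous W1.
  apply: kB => //; apply: kM; first by apply: kM => //; apply: kX; exact: continuous_fst.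
  by apply: kX; exact: continuous_denV.
have cW2 : continuous W2.
  apply: kB => //; apply: kM; first by apply: kM => //; apply: kX; exact: continuous_snd.
  by apply: kX; exact: continuous_denV.
pose B := (1 / 2 + 1 / 2 * ln ((2 * r ^+ 2 + k ^+ 2) / k ^+ 2)) / r.
rewrite (_ : 4 * _ = 8 * r * B); last by rewrite /B; field; rewrite gt_eqF.
apply: (@cbox_divergence_le _ (fun y => U1 (y - a)) (fun y => U2 (y - a))
    (fun y => W1 (y - a)) (fun y => W2 (y - a))) => //.
- by apply: continuous_shift; apply: kM => //; exact: continuous_fst.
- by apply: continuous_shift; apply: kM => //; exact: continuous_snd.
- exact: continuous_shift.
- exact: continuous_shift.
- by apply: (@continuous_shift _ _ (fun z => (ker_den k z)^-1)); exact: continuous_denV.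
- by move=> x; apply: is_derive_shift; exact: dU1.
- by move=> x; apply: is_derive_shift; exact: dU2.
- move=> x xr; set z := x - a in xr *; have /andP[Sl Su] := ker_den_sphere k xr.
  have l0 : 0 <= l z.
    rewrite /l ln_ge0// ler_pdivlMr// mul1r; apply: le_trans Sl.
    by rewrite lerDr sqr_ge0.
  have lB : l z <= ln ((2 * r ^+ 2 + k ^+ 2) / k ^+ 2).
    rewrite /l ler_ln ?posrE//; last by rewrite divr_gt0// ltr_wpDl// mulr_ge0// sqr_ge0.
    by rewrite ler_pM2r// invr_gt0.
  have gB : `|g z| <= (1 / 2 + 1 / 2 * ln ((2 * r ^+ 2 + k ^+ 2) / k ^+ 2)) / r ^+ 2.
    rewrite ger0_norm; last by rewrite mulr_ge0 ?invr_ge0 ?(ltW (S0 z))//; olra.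
    apply: ler_pM; [olra|by rewrite invr_ge0 (ltW (S0 z))|olra|].
    rewrite lef_pV2 ?posrE ?exprn_gt0//; apply: le_trans Sl; rewrite lerDl; exact: ltW.
  have E : B = r * ((1 / 2 + 1 / 2 * ln ((2 * r ^+ 2 + k ^+ 2) / k ^+ 2)) / r ^+ 2).
    by rewrite /B; field; rewrite gt_eqF.
  rewrite E /U1 /U2 (normrM z.1) (normrM z.2).
  by split; apply: ler_pM => //; rewrite -xr; [exact: norm_fst_le|exact: norm_snd_le].
- move=> x _; set z := x - a; rewrite /W1 /W2 /g.
  have l0 : 0 <= l z.
    by rewrite /l ln_ge0// ler_pdivlMr// mul1r /ker_den lerDr nsq_ge0.
  have Ek : z.2 ^+ 2 = ker_den k z - k ^+ 2 - z.1 ^+ 2 by rewrite /ker_den /nsq; ring.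
  rewrite -subr_ge0 (_ : _ - _ = k ^+ 2 * l z / ker_den k z ^+ 2).
    by rewrite divr_ge0 ?exprn_ge0 ?(ltW (S0 z))// mulr_ge0// ltW.
  by rewrite Ek; field; exact: Sn.
Qed.

(** The integrand behaves like [1 / (k * |z|)] for [|z|] between [e] and [k] and decays like
    [|z|^-4] far away, so its mass is bounded independently of both scales. *)
Lemma cbox_integral_sing a r e k : 0 < r -> 0 < e -> 0 < k ->
  \int[leb2 R]_(y in cbox a r) (k ^+ 2 * ((Num.sqrt (ker_den e (y - a)))^-1 *
    (Num.sqrt (ker_den k (y - a)))^-1 * (ker_den k (y - a))^-1)) <= 8.
Proof.
move=> r0 e0 k0.
have S0 m (z : R * R) : 0 < m -> 0 < Num.sqrt (ker_den m z).
  by move=> m0; rewrite sqrtr_gt0 ker_den_gt0.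
have SS m (z : R * R) : 0 < m -> ker_den m z = Num.sqrt (ker_den m z) ^+ 2.
  by move=> m0; rewrite sqr_sqrtr// ltW// ker_den_gt0.
have cs m : 0 < m -> continuous (fun z : R * R => (Num.sqrt (ker_den m z))^-1).
  move=> m0; apply: kV; first by move=> z; rewrite gt_eqF// S0.
  by apply: kcomp; [move=> z; exact: sqrt_continuous|exact: continuous_den].
have ds m z v : 0 < m -> is_derive z v (fun z : R * R => (Num.sqrt (ker_den m z))^-1)
    (- (z.1 * v.1 + z.2 * v.2) * (Num.sqrt (ker_den m z))^-1 ^+ 3).
  move=> m0; have d1 := is_derive_compV (is_derive_den m z v) (is_derive1_sqrt (ker_den_gt0 z m0)).
  apply: d_eq (dV _ d1) _; first by rewrite gt_eqF// S0.
  by field; rewrite gt_eqF// S0.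
pose A (z : R * R) := (Num.sqrt (ker_den e z))^-1.
pose K (z : R * R) := (Num.sqrt (ker_den k z))^-1.
have cA : continuous A by exact: cs.
have cK : continuous K by exact: cs.
have A0 z : 0 < A z by rewrite invr_gt0 S0.
have K0 z : 0 < K z by rewrite invr_gt0 S0.
have cAK : continuous (fun z => A z * K z) by exact: kM.
(* The field is [z * (A z * K z)]. Since the squared Euclidean length times [A^2] is
   [1 - e^2 * A^2], and similarly for [K], its divergence is [A * K * (e^2 * A^2 + k^2 * K^2)]. *)
pose W1 z := A z * K z - z.1 ^+ 2 * (A z * K z) * (A z ^+ 2 + K z ^+ 2).
pose W2 z := A z * K z - z.2 ^+ 2 * (A z * K z) * (A z ^+ 2 + K z ^+ 2).
have cS : continuous (fun z => A z ^+ 2 + K z ^+ 2) by apply: kD; exact: kX.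
have cW1 : continuous W1.
  apply: kB => //; apply: kM => //; apply: kM => //; apply: kX; exact: continuous_fst.
have cW2 : continuous W2.
  apply: kB => //; apply: kM => //; apply: kM => //; apply: kX; exact: continuous_snd.
rewrite (_ : 8 = 8 * r * r^-1); last by rewrite mulfK// gt_eqF.
have KE z : (ker_den k z)^-1 = K z ^+ 2 by rewrite (SS k z k0) /K exprVn.
have AE z : A z ^+ 2 * ker_den e z = 1.
  by rewrite {1}/A exprVn -(SS e z e0) mulVf// gt_eqF// ker_den_gt0.
have KE' z : K z ^+ 2 * ker_den k z = 1.
  by rewrite {1}/K exprVn -(SS k z k0) mulVf// gt_eqF// ker_den_gt0.
apply: (@cbox_divergence_le _ (fun y => (y - a).1 * (A (y - a) * K (y - a)))
    (fun y => (y - a).2 * (A (y - a) * K (y - a)))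
    (fun y => W1 (y - a)) (fun y => W2 (y - a))) => //.
- apply: (@continuous_shift _ _ (fun z => z.1 * (A z * K z))).
  by apply: kM => //; exact: continuous_fst.
- apply: (@continuous_shift _ _ (fun z => z.2 * (A z * K z))).
  by apply: kM => //; exact: continuous_snd.
- exact: continuous_shift.
- exact: continuous_shift.
- apply: (@continuous_shift _ _ (fun z => k ^+ 2 * (A z * K z * (ker_den k z)^-1))).
  by apply: kM; [exact: kC|apply: kM => //; exact: continuous_denV].
- move=> x; apply: (@is_derive_shift _ _ (fun z => z.1 * (A z * K z))).
  apply: d_eq (dM (is_derive_fst _ _) (dM (ds e _ _ e0) (ds k _ _ k0))) _.
  by rewrite /W1 /A /K /=; ring.
- move=> x; apply: (@is_derive_shift _ _ (fun z => z.2 * (A z * K z))).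
  apply: d_eq (dM (is_derive_snd _ _) (dM (ds e _ _ e0) (ds k _ _ k0))) _.
  by rewrite /W2 /A /K /=; ring.
- move=> x xr; set z := x - a in xr *.
  have le1 m : 0 < m -> (Num.sqrt (ker_den m z))^-1 <= r^-1.
    move=> m0; rewrite lef_pV2 ?posrE ?S0//.
    rewrite -(ger0_norm (ltW r0)) -sqrtr_sqr ler_sqrt; last exact: ltW (ker_den_gt0 _ _).
    by have /andP[+ _] := ker_den_sphere m xr; have := sqr_ge0 m; olra.
  have AK : A z * K z <= r^-1 * r^-1 by apply: (ler_pM _ _ (le1 e e0) (le1 k k0)); apply: ltW; [exact: A0|exact: K0].
  have E : r^-1 = r * (r^-1 * r^-1) by rewrite mulrA mulfV ?mul1r// gt_eqF.
  have AK0 : `|A z * K z| <= r^-1 * r^-1 by rewrite ger0_norm// mulr_ge0// ltW.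
  rewrite (normrM z.1) (normrM z.2); split; rewrite [leRHS]E; apply: ler_pM => //; rewrite -xr.
    exact: norm_fst_le.
  exact: norm_snd_le.
- move=> x _; set z := x - a; rewrite -/(A z) -/(K z) KE /W1 /W2.
  have p : 0 <= e ^+ 2 * A z ^+ 2 * (A z * K z).
    by rewrite !mulr_ge0 ?exprn_ge0 ?ltW.
  rewrite -subr_ge0 (_ : _ - _ = e ^+ 2 * A z ^+ 2 * (A z * K z))//.
  have h1 : (z.1 ^+ 2 + z.2 ^+ 2) * A z ^+ 2 = 1 - e ^+ 2 * A z ^+ 2.
    by rewrite -(AE z) /ker_den /nsq; ring.
  have h2 : (z.1 ^+ 2 + z.2 ^+ 2) * K z ^+ 2 = 1 - k ^+ 2 * K z ^+ 2.
    by rewrite -(KE' z) /ker_den /nsq; ring.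
  transitivity (2 * (A z * K z) - (A z * K z) * ((z.1 ^+ 2 + z.2 ^+ 2) * A z ^+ 2 +
    (z.1 ^+ 2 + z.2 ^+ 2) * K z ^+ 2) - k ^+ 2 * (A z * K z * K z ^+ 2)); first by ring.
  by rewrite h1 h2; ring.
Qed.

Let mass_d1 e z : 0 < e -> is_derive z (1, 0) (fun z : R * R => z.1 * (ker_den e z)^-1)
  ((ker_den e z)^-1 - 2 * z.1 ^+ 2 * (ker_den e z)^-1 ^+ 2).
Proof.
move=> e0; have Sn : ker_den e z != 0 by rewrite gt_eqF// ker_den_gt0.
by apply: d_eq (dM (is_derive_fst z _) (dV Sn (is_derive_den e z _))) _ => /=; field.
Qed.

Let mass_d2 e z : 0 < e -> is_derive z (0, 1) (fun z : R * R => z.2 * (ker_den e z)^-1)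
  ((ker_den e z)^-1 - 2 * z.2 ^+ 2 * (ker_den e z)^-1 ^+ 2).
Proof.
move=> e0; have Sn : ker_den e z != 0 by rewrite gt_eqF// ker_den_gt0.
by apply: d_eq (dM (is_derive_snd z _) (dV Sn (is_derive_den e z _))) _ => /=; field.
Qed.

(** The mollifier is the divergence of [z / ker_den e z], so its mass in a square is a flux, and
    each side of the square contributes an arctangent. *)
Let massE e z : 0 < e -> ker_mass e z =
  ((ker_den e z)^-1 - 2 * z.1 ^+ 2 * (ker_den e z)^-1 ^+ 2) +
  ((ker_den e z)^-1 - 2 * z.2 ^+ 2 * (ker_den e z)^-1 ^+ 2).
Proof.
move=> e0; have Sn : ker_den e z != 0 by rewrite gt_eqF// ker_den_gt0.
rewrite /ker_mass (_ : e ^+ 2 = ker_den e z - z.1 ^+ 2 - z.2 ^+ 2); last by rewrite /ker_den /nsq; ring.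
by field.
Qed.

Let mass_c1 e : 0 < e ->
  continuous (fun z : R * R => (ker_den e z)^-1 - 2 * z.1 ^+ 2 * (ker_den e z)^-1 ^+ 2).
Proof.
move=> e0; apply: kB; first exact: continuous_denV.
apply: kM; last by apply: kX; exact: continuous_denV.
by apply: kM; [exact: kC|apply: kX; exact: continuous_fst].
Qed.

Let mass_c2 e : 0 < e ->
  continuous (fun z : R * R => (ker_den e z)^-1 - 2 * z.2 ^+ 2 * (ker_den e z)^-1 ^+ 2).
Proof.
move=> e0; apply: kB; first exact: continuous_denV.
apply: kM; last by apply: kX; exact: continuous_denV.
by apply: kM; [exact: kC|apply: kX; exact: continuous_snd].
Qed.

Lemma continuous_mass e : 0 < e -> continuous (ker_mass e : R * R -> R).
Proof.
move=> e0; rewrite (_ : ker_mass e = fun z => 2 * e ^+ 2 * ((ker_den e z)^-1 ^+ 2)).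
  by apply: kM; [exact: kC|apply: kX; exact: continuous_denV].
by apply/funext => z; rewrite /ker_mass exprVn.
Qed.

(** The flux of [z / ker_den e z] through the four sides of the square of half-side [r]. It tends to
    2 pi as [e] tends to 0. *)
Definition mass_const r e := 8 * (r / Num.sqrt (r ^+ 2 + e ^+ 2)) * atan (r / Num.sqrt (r ^+ 2 + e ^+ 2)).

Let atan_segment (c r e : R) : 0 < r -> 0 < e ->
  \int[mu]_(t in `[c - r, c + r]) (2 * r / (r ^+ 2 + (t - c) ^+ 2 + e ^+ 2)) = mass_const r e / 2.
Proof.
move=> r0 e0; set A := Num.sqrt (r ^+ 2 + e ^+ 2).
have r2 : 0 < r ^+ 2 + e ^+ 2 by rewrite addr_gt0// exprn_gt0.
have A0 : 0 < A by rewrite sqrtr_gt0.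
have AA : r ^+ 2 + e ^+ 2 = A ^+ 2 by rewrite sqr_sqrtr// ltW.
have D0 (t : R) : 0 < r ^+ 2 + (t - c) ^+ 2 + e ^+ 2 by rewrite addrAC ltr_wpDr// sqr_ge0.
pose g (t : R) := 2 * r / A * atan ((t - c) / A).
pose g' (t : R) := 2 * r / (r ^+ 2 + (t - c) ^+ 2 + e ^+ 2).
have dg (t : R) : is_derive t (1 : R) g (g' t).
  have d1 : is_derive t (1 : R) (fun t : R => (t - c) / A) (A^-1).
    apply: d_eq (dM (dB (is_derive_id t 1) (dC c t 1)) (dC A^-1 t 1)) _.
    by rewrite subr0 mul1r mulr0 addr0.
  apply: d_eq (dZ (2 * r / A) (is_derive_compV d1 (is_derive1_atan _))) _.
  have n2 : A ^+ 2 + (t - c) ^+ 2 != 0 by have := D0 t; rewrite addrAC AA => /lt0r_neq0.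
  rewrite /g' addrAC AA; field; rewrite n2 gt_eqF//= .
have cg' : continuous g'.
  apply: kM; first exact: kC.
  apply: kV; first by move=> t; rewrite gt_eqF.
  apply: kD; last exact: kC.
  apply: kD; first exact: kC.
  by apply: kX; apply: kB; [move=> t; exact: cvg_id|exact: kC].
rewrite /Rintegral (FTC_segment (g := g)) //=; last by olra.
rewrite /g /mass_const -/A.
have -> : (c - r - c) / A = - (r / A) by field; rewrite gt_eqF.
have -> : (c + r - c) / A = r / A by field; rewrite gt_eqF.
by rewrite atanN; field; rewrite gt_eqF.
Qed.

Lemma cbox_mass a r e : 0 < r -> 0 < e ->
  \int[leb2 R]_(y in cbox a r) ker_mass e (y - a) = mass_const r e.
Proof.
move=> r0 e0; under eq_Rintegral do rewrite massE//.
rewrite RintegralD; [|exact: measurable_cbox| |]; last first.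
- by apply: cbox_integrable; exact: continuous_shift (mass_c2 e0).
- by apply: cbox_integrable; exact: continuous_shift (mass_c1 e0).
have d1 x : is_derive x (1, 0) (fun y => (y - a).1 * (ker_den e (y - a))^-1)
    ((ker_den e (x - a))^-1 - 2 * (x - a).1 ^+ 2 * (ker_den e (x - a))^-1 ^+ 2).
  by apply: (@is_derive_shift _ _ (fun z => z.1 * (ker_den e z)^-1)); exact: mass_d1.
have d2 x : is_derive x (0, 1) (fun y => (y - a).2 * (ker_den e (y - a))^-1)
    ((ker_den e (x - a))^-1 - 2 * (x - a).2 ^+ 2 * (ker_den e (x - a))^-1 ^+ 2).
  by apply: (@is_derive_shift _ _ (fun z => z.2 * (ker_den e z)^-1)); exact: mass_d2.
rewrite (cbox_d1 a r0 (continuous_shift (a := a) (mass_c1 e0)) d1).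
rewrite (cbox_d2 a r0 (continuous_shift (a := a) (mass_c2 e0)) d2).
rewrite [RHS](_ : _ = mass_const r e / 2 + mass_const r e / 2); last by field.
congr (_ + _).
  rewrite -(@atan_segment a.2)//; apply: eq_Rintegral => t _; rewrite /ker_den /nsq /=.
  rewrite (_ : a.1 + r - a.1 = r); last by ring.
  by rewrite (_ : a.1 - r - a.1 = - r); [rewrite sqrrN; ring|ring].
rewrite -(@atan_segment a.1)//; apply: eq_Rintegral => t _; rewrite /ker_den /nsq /=.
rewrite (_ : a.2 + r - a.2 = r); last by ring.
rewrite (_ : a.2 - r - a.2 = - r); last by ring.
by rewrite sqrrN [_ ^+ 2 + r ^+ 2]addrC; ring.
Qed.

(** A positive lower bound independent of [e] is enough to divide by the mass later; its limit is
    never computed. *)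
Lemma mass_const_ge r e : 0 < e -> e <= r -> 4 * atan (1 / 2) <= mass_const r e.
Proof.
move=> e0 er; have r0 : 0 < r by exact: lt_le_trans er.
have r2 : 0 < r ^+ 2 + e ^+ 2 by rewrite addr_gt0// exprn_gt0.
have A0 : 0 < Num.sqrt (r ^+ 2 + e ^+ 2) by rewrite sqrtr_gt0.
have Ar : Num.sqrt (r ^+ 2 + e ^+ 2) <= 2 * r.
  rewrite -(@ler_pXn2r _ 2)// ?nnegrE ?(ltW A0) ?mulr_ge0 ?(ltW r0)//.
  by rewrite sqr_sqrtr ?(ltW r2)//; nra.
have q : 1 / 2 <= r / Num.sqrt (r ^+ 2 + e ^+ 2) by rewrite ler_pdivlMr//; olra.
rewrite /mass_const; move: q; set s := r / _ => q.
have at0 : 0 <= atan (1 / 2 : R) by rewrite -atan0; apply/ltW/lt_atan.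
have : atan (1 / 2) <= atan s.
  by move: q; rewrite le_eqVlt => /orP[/eqP->//|q]; exact/ltW/lt_atan.
move=> h; rewrite (_ : 4 * _ = 8 * (1 / 2) * atan (1 / 2)); last by field.
by apply: ler_pM => //; rewrite ler_wpM2l.
Qed.

Lemma cbox_mass_le a r e : 0 < r -> 0 < e ->
  \int[leb2 R]_(y in cbox a r) ker_mass e (y - a) <= 16.
Proof.
move=> r0 e0; rewrite cbox_mass// /mass_const.
have r2 : 0 < r ^+ 2 + e ^+ 2 by rewrite addr_gt0// exprn_gt0.
have A0 : 0 < Num.sqrt (r ^+ 2 + e ^+ 2) by rewrite sqrtr_gt0.
have q : r / Num.sqrt (r ^+ 2 + e ^+ 2) <= 1.
  rewrite ler_pdivrMr// mul1r -{1}(ger0_norm (ltW r0)) -sqrtr_sqr ler_sqrt ?ltW//.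
  by rewrite ltrDl exprn_gt0.
have q0 : 0 <= r / Num.sqrt (r ^+ 2 + e ^+ 2) by rewrite divr_ge0 ?(ltW r0) ?(ltW A0).
have := atan_le2 (r / Num.sqrt (r ^+ 2 + e ^+ 2)); rewrite ler_norml => /andP[_ h].
rewrite (_ : 16 = 8 * 1 * 2); last by ring.
apply: (@le_trans _ _ (8 * (r / Num.sqrt (r ^+ 2 + e ^+ 2)) * 2)).
  by rewrite ler_wpM2l// mulr_ge0.
by rewrite ler_wpM2r// ler_wpM2l.
Qed.

End kernel_integrals.

(** * Continuity of the kernels and pointwise bounds of their increments *)

Section kernel_continuity.
Context {R : realType}.
Implicit Types (a b k x y z v c : R * R) (e : R).

Let klin c : continuous (fun z : R * R => c.1 * z.1 + c.2 * z.2).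
Proof. exact: kD (kM (@kC _ _ _) continuous_fst) (kM (@kC _ _ _) continuous_snd). Qed.

Let kden e n : 0 < e -> continuous (fun z : R * R => (ker_den e z ^+ n)^-1).
Proof.
move=> e0; apply: kV; first by move=> z; rewrite expf_neq0// gt_eqF// ker_den_gt0.
exact: kX (@continuous_den _ e).
Qed.

Lemma continuous_ker e c : 0 < e -> continuous (ker e c).
Proof. by move=> e0; exact: kM (@klin c) (continuous_denV e0). Qed.

Lemma continuous_ker1 e c : 0 < e -> continuous (ker1 e c).
Proof.
move=> e0; exact: kB (kM (@kC _ _ _) (continuous_denV e0))
  (kM (kM (kM (@kC _ _ _) (@klin c)) continuous_fst) (@kden e 2 e0)).
Qed.

Lemma continuous_ker2 e c : 0 < e -> continuous (ker2 e c).
Proof.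
move=> e0; exact: kB (kM (@kC _ _ _) (continuous_denV e0))
  (kM (kM (kM (@kC _ _ _) (@klin c)) continuous_snd) (@kden e 2 e0)).
Qed.

Lemma continuous_ker11 e c : 0 < e -> continuous (ker11 e c).
Proof.
move=> e0; exact: kD (kB (kM (kM (@kC _ _ _) continuous_fst) (@kden e 2 e0))
  (kM (kM (@kC _ _ _) (@klin c)) (@kden e 2 e0)))
  (kM (kM (kM (@kC _ _ _) (@klin c)) (kX (n := 2) continuous_fst)) (@kden e 3 e0)).
Qed.

Lemma continuous_ker12 e c : 0 < e -> continuous (ker12 e c).
Proof.
move=> e0; exact: kD (kM (kM (@kC _ _ _)
  (kD (kM (@kC _ _ _) continuous_snd) (kM (@kC _ _ _) continuous_fst))) (@kden e 2 e0))
  (kM (kM (kM (kM (@kC _ _ _) (@klin c)) continuous_fst) continuous_snd) (@kden e 3 e0)).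
Qed.

Lemma continuous_ker22 e c : 0 < e -> continuous (ker22 e c).
Proof.
move=> e0; exact: kD (kB (kM (kM (@kC _ _ _) continuous_snd) (@kden e 2 e0))
  (kM (kM (@kC _ _ _) (@klin c)) (@kden e 2 e0)))
  (kM (kM (kM (@kC _ _ _) (@klin c)) (kX (n := 2) continuous_snd)) (@kden e 3 e0)).
Qed.

Lemma continuous_ker_lap e c : 0 < e -> continuous (ker_lap e c).
Proof. by move=> e0; exact: kM (kM (@kC _ _ _) (@klin c)) (@kden e 3 e0). Qed.

(** The integrand of [cbox_integral_sing]. On [|z| <= 3 * k] the product [k * sing e k z] dominates
    a multiple of [1 / (|z| + e)]. *)
Definition sing e (k : R) (z : R * R) : R := k ^+ 2 * ((Num.sqrt (ker_den e z))^-1 *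
    (Num.sqrt (ker_den k z))^-1 * (ker_den k z)^-1).

Lemma continuous_sing e (k : R) : 0 < e -> 0 < k -> continuous (sing e k).
Proof.
move=> e0 k0; have cs m : 0 < m -> continuous (fun z : R * R => (Num.sqrt (ker_den m z))^-1).
  move=> m0; apply: kV; first by move=> z; rewrite gt_eqF// sqrtr_gt0 ker_den_gt0.
  by apply: kcomp; [move=> z; exact: sqrt_continuous|exact: continuous_den].
by apply: kM; [exact: kC|apply: kM; [apply: kM; exact: cs|exact: continuous_denV]].
Qed.

Lemma sing_ge0 e (k : R) z : 0 < e -> 0 < k -> 0 <= sing e k z.
Proof.
move=> e0 k0; rewrite mulr_ge0 ?sqr_ge0// !mulr_ge0// invr_ge0 ?sqrtr_ge0//.
exact: ltW (ker_den_gt0 _ _).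
Qed.

Lemma inv_le_sing e (k : R) z : 0 < e -> 0 < k -> `|z| <= 3 * k ->
  (`|z| + e)^-1 <= 10 * 25 * (k * sing e k z).
Proof.
move=> e0 k0 zk; have r0 : 0 < `|z| + e by rewrite ltr_wpDl.
have Se0 := ker_den_gt0 z e0; have Sk0 := ker_den_gt0 z k0.
set s := Num.sqrt (ker_den e z); set t := Num.sqrt (ker_den k z).
have s0 : 0 < s by rewrite sqrtr_gt0.
have t0 : 0 < t by rewrite sqrtr_gt0.
have zz := nsq_le_norm z.
have sle : s <= 2 * (`|z| + e).
  rewrite -(@ler_pXn2r _ 2)// ?nnegrE ?(ltW s0) ?mulr_ge0 ?(ltW r0)//.
  rewrite sqr_sqrtr ?(ltW Se0)// /ker_den; have := normr_ge0 z.
  by move: zz; move: (nsq z) (`|z|) => n m h1 h2; nra.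
have Sk : ker_den k z <= (5 * k) ^+ 2.
  rewrite /ker_den; apply: (@le_trans _ _ (2 * `|z| ^+ 2 + k ^+ 2)); first by rewrite lerD2r.
  have := normr_ge0 z; move: zk; move: (`|z|) => m h1 h2; nra.
have tle : t <= 5 * k.
  by rewrite -(@ler_pXn2r _ 2)// ?nnegrE ?(ltW t0) ?mulr_ge0 ?(ltW k0)// sqr_sqrtr ?(ltW Sk0).
have tS : t * ker_den k z <= 5 * 25 * k ^+ 3.
  rewrite (_ : 5 * 25 * k ^+ 3 = (5 * k) * (5 * k) ^+ 2); last by ring.
  by apply: ler_pM => //; exact: ltW.
rewrite -subr_ge0 /sing -/s -/t.
rewrite (_ : _ - _ = ((10 * 25 * k ^+ 3) * (`|z| + e) - s * (t * ker_den k z)) /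
   (s * t * ker_den k z * (`|z| + e))); last by field; rewrite !gt_eqF.
apply: divr_ge0; last by rewrite !mulr_ge0// ltW.
rewrite subr_ge0 (_ : 10 * 25 * k ^+ 3 * (`|z| + e) = (2 * (`|z| + e)) * (5 * 25 * k ^+ 3)); last by ring.
by apply: ler_pM => //; rewrite ?mulr_ge0 ?ltW.
Qed.

(** Two regimes. When [|k|] is at most half the scale [|z| + e], the increment is [|k|] times a
    derivative of order -2. Otherwise both arguments lie within [3 * |k|] of the singularity and the
    two values are bounded separately by [sing]. *)
Lemma ker_diff_bound c : exists2 C : R, 0 <= C & forall e k z, 0 < e -> 0 < `|k| -> e <= `|k| ->
  `|ker e c (z - k) - ker e c z| <=
  C * `|k| * ((ker_den `|k| z)^-1 + (sing e `|k| z + sing e `|k| (z - k))).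
Proof.
have [C C0 HC] := sing_ord_ker c; exists (10 * 25 * C); first exact: mulr_ge0.
move=> e k z e0; set m := `|k| => m0 em.
have [H1 H2] := HC e z e0; have [H1' _] := HC e (z - k) e0.
have r0 : 0 < `|z| + e by rewrite ltr_wpDl.
have Sk0 := ker_den_gt0 z m0.
have s1 := sing_ge0 z e0 m0; have s2 := sing_ge0 (z - k) e0 m0.
have [h|h] := leP m ((`|z| + e) / 2).
  apply: le_trans (H2 _ h) _; rewrite -/m.
  have -> : (-1 - 1 : int) = - (2%:Z) by [].
  rewrite -exprnN; clear H1 H1' H2 HC.
  have Sle : ker_den m z <= 3 * (`|z| + e) ^+ 2.
    have := nsq_le_norm z; rewrite /ker_den => zz.
    apply: (@le_trans _ _ (2 * `|z| ^+ 2 + m ^+ 2)); first by rewrite lerD2r.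
    by have := normr_ge0 z; clear -h e0 m0; move: (`|z|) h => n h n0; nra.
  have : (`|z| + e) ^- 2 <= 3 * (ker_den m z)^-1.
    rewrite -[leLHS]mul1r ler_pdivrMr ?exprn_gt0// mulrAC ler_pdivlMr// mul1r.
    exact: Sle.
  have Sv : 0 < (ker_den m z)^-1 by rewrite invr_gt0.
  move=> h3; have h4 : (`|z| + e) ^- 2 <= 10 * 25 * ((ker_den m z)^-1 + (sing e m z + sing e m (z - k))) by olra.
  rewrite (_ : 10 * 25 * C * m * _ = C * m * (10 * 25 * ((ker_den m z)^-1 + (sing e m z + sing e m (z - k))))); last by ring.
  by rewrite ler_wpM2l// mulr_ge0// ltW.
clear H2 HC; rewrite exprN1 in H1; rewrite exprN1 in H1'.
have zk : `|z| <= 3 * m by have := normr_ge0 z; olra.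
have zk' : `|z - k| <= 3 * m by apply: le_trans (ler_normB _ _) _; rewrite -/m; olra.
have I1 := inv_le_sing e0 m0 zk; have I2 := inv_le_sing e0 m0 zk'.
apply: le_trans (ler_normB _ _) _.
apply: le_trans (lerD H1' H1) _; rewrite -mulrDr; clear H1 H1'.
rewrite (_ : 10 * 25 * C * m * _ = C * (10 * 25 * (m * sing e m (z - k)) + 10 * 25 * (m * sing e m z) + 10 * 25 * m * (ker_den m z)^-1)); last by ring.
have : 0 < m * (ker_den m z)^-1 by rewrite divr_gt0.
by move=> h5; rewrite ler_wpM2l//; olra.
Qed.

End kernel_continuity.

(** * Kernel integrals over the domain and the approximate identity *)

Section kernel_on_domain.
Context {R : realType}.
Variable Om : set (R * R).
Hypothesis oOm : open Om.
Hypothesis bOm : bounded_set Om.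
Implicit Types (a b k x y z v c : R * R) (f g : R * R -> R) (e : R).
Local Notation I h := (\int[leb2 R]_(x in Om) (h x)).
Let mO : measurable (Om : set (mplane R)) := measurable_dom oOm.
Let area := fine (leb2 R Om).

Lemma bcont_continuous f : continuous f -> bcont Om f.
Proof.
move=> cf; split; first by move=> x _; exact: cf.
have [r _ Or] := dom_norm bOm; have [C HC] := locally_bounded r cf.
by exists C => x Ox; apply: HC; exact/ltW/Or.
Qed.

Lemma I_le_cbox f a (r : R) : continuous f -> (forall x, 0 <= f x) ->
  (forall x, Om x -> `|x| <= r) -> Om a -> I f <= \int[leb2 R]_(x in cbox a (2 * r)) f x.
Proof.
move=> cf f0 Or Oa; have sub : Om `<=` cbox a (2 * r).
  move=> x Ox; apply/cboxE; apply: le_trans (ler_normB _ _) _.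
  by have := Or _ Ox; have := Or _ Oa; olra.
have i1 := @cbox_integrable _ f a (2 * r) cf.
apply: fine_le.
- by have := bcont_integrable oOm bOm (bcont_continuous cf); exact: integrable_fin_num.
- by apply: integrable_fin_num => //; exact: measurable_cbox.
- apply: ge0_subset_integral => //; first exact: measurable_cbox.
  + by case/integrableP: i1.
  + by move=> x _; rewrite lee_fin.
Qed.

Lemma mass_tail e z (r : R) : 0 < e -> 0 < r -> r <= `|z| -> ker_mass e z <= 2 * e ^+ 2 / r ^+ 4.
Proof.
move=> e0 r0 rz; have t0 : 0 <= 2 * e ^+ 2 by rewrite mulr_ge0// sqr_ge0.
rewrite /ker_mass ler_wpM2l//.
have S0 := ker_den_gt0 z e0.
have h : r ^+ 2 <= ker_den e z.
  apply: (@le_trans _ _ (`|z| ^+ 2)); first by rewrite lerXn2r ?nnegrE// ltW.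
  by apply: le_trans (norm_le_nsq z) _; rewrite lerDl sqr_ge0.
rewrite lef_pV2 ?posrE ?exprn_gt0// (exprM r 2 2).
by rewrite lerXn2r ?nnegrE ?exprn_ge0// ltW.
Qed.

Lemma mass_ge0 e z : 0 <= ker_mass e z.
Proof. by rewrite divr_ge0 ?sqr_ge0// mulr_ge0// sqr_ge0. Qed.

Lemma I_mass_dist a (r e : R) : 0 < r -> 0 < e -> cbox a r `<=` Om ->
  `|I (fun y => ker_mass e (y - a)) - mass_const r e| <= 2 * e ^+ 2 / r ^+ 4 * area.
Proof.
move=> r0 e0 sub; pose f y := ker_mass e (y - a).
have cf : continuous f by exact: continuous_shift (continuous_mass e0).
have mb := @measurable_cbox _ a r.
have mD : measurable (Om `\` cbox a r : set (mplane R)) by exact: measurableD.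
have fO := bcont_integrable oOm bOm (bcont_continuous cf).
have E : I f = \int[leb2 R]_(x in cbox a r) f x + \int[leb2 R]_(x in Om `\` cbox a r) f x.
  rewrite -[in LHS](setDUK sub) Rintegral_setU//; last first.
    by apply/disj_setPS => x [xb [_]].
  by rewrite setDUK.
rewrite E cbox_mass// addrAC subrr add0r ger0_norm; last first.
  by apply: Rintegral_ge0 => x _; exact: mass_ge0.
have iD : (leb2 R).-integrable (Om `\` cbox a r) (EFin \o f).
  by apply: integrableS fO => //; exact: subDsetl.
have lty : (leb2 R (Om `\` cbox a r) < +oo)%E.
  apply: le_lt_trans (leb2_dom_lty oOm bOm); apply: le_measure; rewrite ?inE//.
have t0 : 0 <= 2 * e ^+ 2 / r ^+ 4 by rewrite divr_ge0 ?exprn_ge0 ?(ltW r0)// mulr_ge0// sqr_ge0.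
apply: (@le_trans _ _ (\int[leb2 R]_(x in Om `\` cbox a r) (2 * e ^+ 2 / r ^+ 4))).
  apply: le_Rintegral => //.
    by apply: (@bounded_integrable _ _ (cst _) `|2 * e ^+ 2 / r ^+ 4|) => //; exact: measurable_cst.
  move=> x [_ nx]; apply: mass_tail => //; rewrite leNgt; apply/negP => xr.
  by apply: nx; apply/cboxE; exact: ltW.
rewrite Rintegral_cst// ler_wpM2l//; apply: fine_le.
- by rewrite ge0_fin_numE.
- by rewrite ge0_fin_numE// leb2_dom_lty.
- by apply: le_measure; rewrite ?inE.
Qed.

Lemma approx_identity g a (r : R) : bcont Om g -> 0 < r -> cbox a r `<=` Om ->
  forall t : R, 0 < t -> exists2 e0 : R, 0 < e0 & forall e, 0 < e -> e < e0 ->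
  `|I (fun y => g y * ker_mass e (y - a)) - g a * mass_const r e| <= t.
Proof.
move=> bg r0 sub t t0.
have Oa : Om a by apply: sub; apply/cboxE; rewrite subrr normr0 ltW.
have [N HN] := bg.2.
have N0 : 0 <= N by apply: le_trans (HN a Oa).
have [M M0 OM] := dom_norm bOm.
(* The total mass is at most 16, so an oscillation of [t / 64] near [a] contributes at most [t / 4];
   the tails contribute at most another [t / 4] once [e] is small. *)
have t20 : 0 < t / 64 by rewrite divr_gt0.
move: (bg.1 a Oa) => /cvgrPdist_lt /(_ _ t20) /nbhs_ballP[s /= s0 Hs].
pose B := 2 * N * 2 / s ^+ 4 * area + N * (2 / r ^+ 4 * area).
have A0 : 0 <= area by exact: area_ge0.
have B0 : 0 <= B.
  by rewrite addr_ge0// !mulr_ge0// invr_ge0 exprn_ge0// ltW.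
exists (Num.min 1 (t / (4 * (B + 1)))).
  by rewrite lt_min ltr01 divr_gt0// mulr_gt0// ltr_wpDl.
move=> e e0; rewrite lt_min => /andP[e1 et].
have eB : e ^+ 2 * B <= t / 4.
  have h1 : e * (B + 1) < t / 4.
    rewrite (_ : t / 4 = t / (4 * (B + 1)) * (B + 1)); last by field; rewrite gt_eqF// ltr_wpDl.
    by rewrite ltr_pM2r// ltr_wpDl.
  have h2 : e ^+ 2 * B <= e * B by rewrite ler_wpM2r// expr2 ger_pMl// ltW.
  by apply: le_trans h2 _; olra.
have cP : continuous (fun y => ker_mass e (y - a)) by exact: continuous_shift (continuous_mass e0).
have bP := bcont_continuous cP.
have bc := bcont_cst Om (g a).
have bgP : bcont Om (fun y => (g y - g a) * ker_mass e (y - a)) by apply: bcontM => //; exact: bcontB.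
have -> : I (fun y => g y * ker_mass e (y - a)) =
    I (fun y => (g y - g a) * ker_mass e (y - a)) + g a * I (fun y => ker_mass e (y - a)).
  rewrite -(I_scale oOm bOm _ bP) -(I_add oOm bOm bgP); last by exact: bcontM.
  by apply: eq_Rintegral => y _; ring.
rewrite -addrA -mulrBr; apply: le_trans (ler_normD _ _) _.
have H2 : `|g a * (I (fun y => ker_mass e (y - a)) - mass_const r e)| <= N * (2 * e ^+ 2 / r ^+ 4 * area).
  by rewrite normrM; apply: ler_pM => //; [exact: HN|exact: I_mass_dist].
have H1 : `|I (fun y => (g y - g a) * ker_mass e (y - a))| <=
    t / 64 * I (fun y => ker_mass e (y - a)) + 2 * N * (2 * e ^+ 2 / s ^+ 4) * area.
  apply: le_trans (le_normr_Rintegral _ _) _ => //; first exact: bcont_integrable.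
  rewrite -(I_cst oOm) -(I_scale oOm bOm _ bP) -(I_add oOm bOm); last 2 first.
    by apply: bcontM => //; exact: bcont_cst.
    exact: bcont_cst.
  apply: (I_le oOm bOm); first exact: bcont_norm.
    by apply: bcontD; [apply: bcontM => //; exact: bcont_cst|exact: bcont_cst].
  move=> y Oy; rewrite normrM [`|ker_mass _ _|]ger0_norm ?mass_ge0//.
  have c0 : 0 <= 2 * N * (2 * e ^+ 2 / s ^+ 4).
    by rewrite !mulr_ge0 ?invr_ge0 ?exprn_ge0 ?(ltW s0) ?(ltW e0).
  have [ys|ys] := ltP `|y - a| s.
    apply: ler_wpDr => //; apply: ler_wpM2r; first exact: mass_ge0.
    by rewrite distrC ltW//; apply: Hs; rewrite -ball_normE/= distrC.
  apply: ler_wpDl; first by rewrite mulr_ge0 ?mass_ge0// ltW.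
  apply: ler_pM => //; first exact: mass_ge0.
    by apply: le_trans (ler_normB _ _) _; have := HN _ Oy; have := HN _ Oa; olra.
  exact: mass_tail.
have H3 : I (fun y => ker_mass e (y - a)) <= 16.
  apply: le_trans (cbox_mass_le a (_ : 0 < 2 * M) e0); last by rewrite mulr_gt0.
  apply: (I_le_cbox cP) => //; first by move=> y; exact: mass_ge0.
  by move=> x /OM /ltW.
apply: le_trans (lerD H1 H2) _.
have -> : t / 64 * I (fun y => ker_mass e (y - a)) + 2 * N * (2 * e ^+ 2 / s ^+ 4) * area +
    N * (2 * e ^+ 2 / r ^+ 4 * area) = t / 64 * I (fun y => ker_mass e (y - a)) + e ^+ 2 * B.
  by rewrite /B; ring.
have : t / 64 * I (fun y => ker_mass e (y - a)) <= t / 64 * 16 by rewrite ler_wpM2l// ltW.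
olra.
Qed.

(** The essential feature is that the bound does not depend on [e], so it survives the removal of
    the regularization. *)
Lemma I_ker_diff c (r : R) : 0 < r -> (forall x, Om x -> `|x| <= r) ->
  exists2 C : R, 0 <= C & forall e a k, 0 < e -> 0 < `|k| -> e <= `|k| -> Om a -> Om (a + k) ->
  I (fun y => `|ker e c (y - (a + k)) - ker e c (y - a)|) <=
  C * `|k| * (1 + ln ((2 * (2 * r) ^+ 2 + `|k| ^+ 2) / `|k| ^+ 2)).
Proof.
move=> r0 Or; have [C C0 HC] := ker_diff_bound c; exists (20 * C); first exact: mulr_ge0.
move=> e a k e0 k0 ek Oa Ob; set L := ln _.
have rr0 : 0 < 2 * r by rewrite mulr_gt0.
have cS : continuous (fun y => (ker_den `|k| (y - a))^-1).
  exact: continuous_shift (continuous_denV k0).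
have cF b : continuous (fun y => sing e `|k| (y - b)) by exact: continuous_shift (continuous_sing e0 k0).
have bS := bcont_continuous cS; have bF b := bcont_continuous (cF b).
have L0 : 0 <= L.
  by rewrite ln_ge0// ler_pdivlMr ?exprn_gt0// mul1r lerDr mulr_ge0// sqr_ge0.
have bk b : bcont Om (fun y => ker e c (y - b)).
  by apply: bcont_continuous; exact: continuous_shift (continuous_ker (c := c) e0).
apply: (@le_trans _ _ (C * `|k| * (I (fun y => (ker_den `|k| (y - a))^-1) +
    (I (fun y => sing e `|k| (y - a)) + I (fun y => sing e `|k| (y - (a + k))))))).
  rewrite -(I_add oOm bOm (bF _) (bF _)) -(I_add oOm bOm bS); last exact: bcontD.
  rewrite -(I_scale oOm bOm); last by apply: bcontD => //; exact: bcontD.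
  apply: (I_le oOm bOm); first by apply: bcont_norm; exact: bcontB.
    by apply: bcontM; [exact: bcont_cst|apply: bcontD => //; exact: bcontD].
  move=> y _; have := HC e k (y - a) e0 k0 ek.
  by rewrite (_ : y - a - k = y - (a + k))// opprD addrA.
have h1 : I (fun y => (ker_den `|k| (y - a))^-1) <= 4 * (1 + L).
  apply: le_trans (cbox_integral_inv_den a rr0 k0).
  by apply: (I_le_cbox cS) => // x; rewrite invr_ge0 ltW// ker_den_gt0.
have h2 b : Om b -> I (fun y => sing e `|k| (y - b)) <= 8.
  move=> Ob'; apply: le_trans (cbox_integral_sing b rr0 e0 k0).
  by apply: (I_le_cbox (cF b)) => // x; exact: sing_ge0.
have h3 := h2 _ Oa; have h4 := h2 _ Ob.
rewrite (_ : 20 * C * `|k| * _ = C * `|k| * (20 * (1 + L))); last by ring.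
by rewrite ler_wpM2l ?mulr_ge0//; olra.
Qed.

End kernel_on_domain.

(** * Cutoffs, reflections, and the difference of gradients as a limit of kernel pairings *)

Section key_estimate.
Context {R : realType}.
Variable Om : set (R * R).
Hypothesis oOm : open Om.
Hypothesis bOm : bounded_set Om.
Implicit Types (a b k x y z v c : R * R) (f g : R * R -> R) (e d : R).
Local Notation I h := (\int[leb2 R]_(x in Om) (h x)).
Let mO : measurable (Om : set (mplane R)) := measurable_dom oOm.
Let area := fine (leb2 R Om).

(** Mixed second derivatives are left out because only Laplacians of these functions are used; where
    a composition needs one, it is supplied separately. *)
Record C2_fun (f f1 f2 f11 f22 : R * R -> R) : Prop := C2Fun {
  C2_d1 : forall x, is_derive x (1, 0) f (f1 x);
  C2_d2 : forall x, is_derive x (0, 1) f (f2 x);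
  C2_d11 : forall x, is_derive x (1, 0) f1 (f11 x);
  C2_d22 : forall x, is_derive x (0, 1) f2 (f22 x);
  C2_c : continuous f; C2_c1 : continuous f1; C2_c2 : continuous f2;
  C2_c11 : continuous f11; C2_c22 : continuous f22 }.

Record cutoff (N rho : R) (U : set (R * R)) a (eta eta1 eta2 eta11 eta22 : R * R -> R) : Prop := Cutoff {
  cutoff_C2 : C2_fun eta eta1 eta2 eta11 eta22;
  cutoff_bound : forall y, [/\ `|eta y| <= 1, `|eta1 y| <= N, `|eta2 y| <= N &
    `|eta11 y + eta22 y| <= N];
  cutoff_near : forall y, `|y - a| < rho -> [/\ eta y = 1, eta1 y = 0, eta2 y = 0 &
    eta11 y + eta22 y = 0];
  cutoff_far : forall y, ~ U y -> [/\ eta y = 0, eta1 y = 0, eta2 y = 0 &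
    eta11 y + eta22 y = 0] }.

(* [Phi = (p, q)] plays the role of the reflection across the boundary: near [a] it is almost
   isometric and it sends [Om] to points far from [a]. *)
Record reflection (N c0 d : R) (U : set (R * R)) a (p p1 p2 p11 p22 q q1 q2 q11 q22 : R * R -> R) : Prop := Reflection {
  refl_p : C2_fun p p1 p2 p11 p22;
  refl_q : C2_fun q q1 q2 q11 q22;
  refl_bound : forall y, Om y -> U y -> [/\ `|p1 y| <= N, `|p2 y| <= N, `|q1 y| <= N & `|q2 y| <= N];
  refl_lap : forall y, Om y -> U y -> `|p11 y + p22 y| <= N /\ `|q11 y + q22 y| <= N;
  refl_far : forall y, Om y -> U y -> c0 * (`|y - a| + d) <= `|(p y, q y) - a|;
  refl_iso : forall y, Om y -> U y -> [/\
    `|p1 y ^+ 2 + p2 y ^+ 2 - 1| <= N * `|(p y, q y) - a|,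
    `|q1 y ^+ 2 + q2 y ^+ 2 - 1| <= N * `|(p y, q y) - a| &
    `|p1 y * q1 y + p2 y * q2 y| <= N * `|(p y, q y) - a|] }.

Lemma sum3_le (x1 x2 x3 u1 u2 u3 : R) : `|x1| <= u1 -> `|x2| <= u2 -> `|x3| <= u3 ->
  `|x1 + x2 + x3| <= u1 + u2 + u3.
Proof. by move=> h1 h2 h3; rewrite (le_trans (ler_normD _ _))// lerD// (le_trans (ler_normD _ _))// lerD. Qed.

Lemma mul_le (x1 x2 u1 u2 : R) : `|x1| <= u1 -> `|x2| <= u2 -> `|x1 * x2| <= u1 * u2.
Proof. by move=> h1 h2; rewrite normrM ler_pM. Qed.

Definition dker (f : R * R -> R) a k y := f (y - (a + k)) - f (y - a).

Lemma dker_C2 e c a k : 0 < e -> C2_fun (dker (ker e c) a k) (dker (ker1 e c) a k)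
  (dker (ker2 e c) a k) (dker (ker11 e c) a k) (dker (ker22 e c) a k).
Proof.
move=> e0.
have D (f fv : R * R -> R) v : (forall z, is_derive z v f (fv z)) ->
    forall y, is_derive y v (dker f a k) (dker fv a k y).
  by move=> df y; apply: dB; apply: is_derive_shift.
have K f : continuous f -> continuous (dker f a k).
  by move=> cf; apply: kB; exact: continuous_shift.
split.
- by apply: D => z; apply: d_eq (is_derive_ker c z _ e0) _; rewrite /=; ring.
- by apply: D => z; apply: d_eq (is_derive_ker c z _ e0) _; rewrite /=; ring.
- by apply: D => z; apply: d_eq (is_derive_ker1 c z _ e0) _; rewrite /=; ring.
- by apply: D => z; apply: d_eq (is_derive_ker2 c z _ e0) _; rewrite /=; ring.
- by apply: K; exact: continuous_ker.
- by apply: K; exact: continuous_ker1.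
- by apply: K; exact: continuous_ker2.
- by apply: K; exact: continuous_ker11.
- by apply: K; exact: continuous_ker22.
Qed.

Lemma dker_sing (n : nat) (f : R -> R * R -> R) : sing_ord (- (n%:Z)) f -> exists2 C : R, 0 <= C &
  forall e a k z (r : R), 0 < e -> 0 < r -> r <= `|z - a| -> `|k| <= r / 2 ->
  `|dker (f e) a k z| <= C * (`|k| / r ^+ n.+1).
Proof.
move=> [C C0 HC]; exists C => // e a k z r e0 r0 rz kr.
have [_ H] := HC e (z - a) e0.
have kr' : `|k| <= (`|z - a| + e) / 2 by olra.
rewrite /dker opprD addrA; apply: le_trans (H _ kr') _; clear H HC.
have -> : - n%:Z - 1 = - (n.+1%:Z) by rewrite intS opprD addrC.
rewrite -exprnN -mulrA ler_wpM2l// ler_wpM2l//.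
have p0 : 0 < `|z - a| + e by rewrite ltr_wpDl.
rewrite lef_pV2 ?posrE ?exprn_gt0// lerXn2r// ?nnegrE ?(ltW r0) ?(ltW p0)//.
by apply: le_trans rz _; rewrite lerDl ltW.
Qed.

Lemma axis_dir c f f1 f2 x : c = (1, 0) \/ c = (0, 1) ->
  is_derive x (1, 0) f (f1 x) -> is_derive x (0, 1) f (f2 x) ->
  is_derive x c f (c.1 * f1 x + c.2 * f2 x).
Proof.
by move=> [->|->] h1 h2 /=; [apply: d_eq h1 _|apply: d_eq h2 _]; ring.
Qed.

(* An integration by parts turns the Laplacian of the difference of kernels
   into a difference of mollified gradients. *)
Lemma leading_term c a k (r : R) psi psi1 psi2 (N rho : R) U eta eta1 eta2 eta11 eta22 :
  c = (1, 0) \/ c = (0, 1) -> 0 < r -> cbox a r `<=` Om -> cbox (a + k) r `<=` Om ->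
  0 < rho -> `|k| < rho ->
  H10 Om psi psi1 psi2 -> cutoff N rho U a eta eta1 eta2 eta11 eta22 ->
  forall t : R, 0 < t -> exists2 e0 : R, 0 < e0 & forall e, 0 < e -> e < e0 ->
  4 * atan (1 / 2) * `|(c.1 * psi1 (a + k) + c.2 * psi2 (a + k)) - (c.1 * psi1 a + c.2 * psi2 a)| <=
  `|I (fun y => psi y * eta y * dker (ker_lap e c) a k y)| + t.
Proof.
move=> hc r0 suba subb rho0 krho hpsi hcut t t0.
have [b0 b1 b2 van dpsi] := hpsi; have [[d1 d2 d11 d22 c0 c1 c2 _ _] _ near _] := hcut.
pose psic y := c.1 * psi1 y + c.2 * psi2 y; pose etac y := c.1 * eta1 y + c.2 * eta2 y.
have bpsic : bcont Om psic := bcontD (bcontM (bcont_cst Om c.1) b1) (bcontM (bcont_cst Om c.2) b2).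
have beta : bcont Om eta by exact: bcont_continuous.
have betac : bcont Om etac.
  by apply: bcontD; apply: bcontM; (exact: bcont_cst || exact: bcont_continuous).
(* The derivative of [psi * eta] along [c]. At [a] and at [a + k] it agrees with that of [psi],
   because [eta] is 1 on the ball of radius [rho], which contains both points. *)
pose g y := psic y * eta y + psi y * etac y.
have bg : bcont Om g by apply: bcontD; exact: bcontM.
have t4 : 0 < t / 2 by rewrite divr_gt0.
have [ea ea0 Ha] := approx_identity oOm bOm bg r0 suba t4.
have [eb eb0 Hb] := approx_identity oOm bOm bg r0 subb t4.
exists (Num.min r (Num.min ea eb)); first by rewrite !lt_min r0 ea0 eb0.
move=> e e0; rewrite !lt_min => /and3P[er eea eeb].
have {}Ha := Ha _ e0 eea; have {}Hb := Hb _ e0 eeb.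
have axc : axis c by case: hc => ->; [exact: axis_e1|exact: axis_e2].
have E : I (fun y => psi y * eta y * dker (ker_lap e c) a k y) =
    - I (fun y => g y * dker (ker_mass e) a k y).
  apply: (@vanishing_ibpM _ Om oOm bOm c) => //.
  - exact: vanishingM.
  - exact: bcontM.
  - apply: bcont_continuous => //; apply: kB; exact: continuous_shift (continuous_mass e0).
  - apply: bcont_continuous => //; apply: kB; exact: continuous_shift (continuous_ker_lap e0).
  - move=> x Ox; have [p1 p2] := dpsi x Ox.
    by apply: d_eq (dM (axis_dir hc p1 p2) (axis_dir hc (d1 x) (d2 x))) _.
  - by move=> x _; apply: dB; apply: is_derive_shift; exact: is_derive_mass.
have bP b : bcont Om (fun y => g y * ker_mass e (y - b)).
  by apply: bcontM => //; apply: bcont_continuous => //; exact: continuous_shift (continuous_mass e0).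
have E2 : I (fun y => g y * dker (ker_mass e) a k y) =
    I (fun y => g y * ker_mass e (y - (a + k))) - I (fun y => g y * ker_mass e (y - a)).
  rewrite -[X in _ = _ + X]mulN1r -(I_scale oOm bOm _ (bP _)) -(I_add oOm bOm (bP _)).
    by apply: eq_Rintegral => y _; rewrite /dker; ring.
  exact: (bcontM (bcont_cst Om _) (bP _)).
have ga : g a = psic a.
  have [|h0 h1 h2 _] := near a; first by rewrite subrr normr0.
  by rewrite /g /etac h0 h1 h2; ring.
have gb : g (a + k) = psic (a + k).
  have [|h0 h1 h2 _] := near (a + k); first by rewrite addrAC subrr add0r.
  by rewrite /g /etac h0 h1 h2; ring.
have j := mass_const_ge e0 (ltW er).
rewrite E normrN E2 -/(psic a) -/(psic (a + k)) -ga -gb; move: Ha Hb.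
set Ia := I (fun y => g y * ker_mass e (y - a)); set Ib := I (fun y => g y * ker_mass e (y - (a + k))).
move=> Ha Hb; apply: (@le_trans _ _ (mass_const r e * `|g (a + k) - g a|)).
  by rewrite ler_wpM2r.
have at0 : 0 <= atan (1 / 2 : R) by rewrite -atan0; apply/ltW/lt_atan.
rewrite -[mass_const r e]ger0_norm; last by apply: le_trans j; rewrite mulr_ge0.
rewrite -normrM; have -> : mass_const r e * (g (a + k) - g a) =
  (Ib - Ia) + (- (Ib - g (a + k) * mass_const r e)) + (Ia - g a * mass_const r e) by ring.
apply: le_trans (sum3_le (lexx _) (_ : _ <= t / 2) Ha) _; first by rewrite normrN.
olra.
Qed.

Lemma C2_mul f f1 f2 f11 f22 g g1 g2 g11 g22 : C2_fun f f1 f2 f11 f22 -> C2_fun g g1 g2 g11 g22 ->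
  C2_fun (fun y => f y * g y) (fun y => f1 y * g y + f y * g1 y) (fun y => f2 y * g y + f y * g2 y)
    (fun y => (f11 y * g y + f1 y * g1 y) + (f1 y * g1 y + f y * g11 y))
    (fun y => (f22 y * g y + f2 y * g2 y) + (f2 y * g2 y + f y * g22 y)).
Proof.
move=> [d1 d2 d11 d22 c0 c1 c2 c11 c22] [d1' d2' d11' d22' c0' c1' c2' c11' c22']; split.
- by move=> x; exact: dM.
- by move=> x; exact: dM.
- by move=> x; apply: dD; exact: dM.
- by move=> x; apply: dD; exact: dM.
- exact: kM.
- by apply: kD; exact: kM.
- by apply: kD; exact: kM.
- by apply: kD; apply: kD; exact: kM.
- by apply: kD; apply: kD; exact: kM.
Qed.

Lemma C2_sub f f1 f2 f11 f22 g g1 g2 g11 g22 : C2_fun f f1 f2 f11 f22 -> C2_fun g g1 g2 g11 g22 ->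
  C2_fun (fun y => f y - g y) (fun y => f1 y - g1 y) (fun y => f2 y - g2 y)
    (fun y => f11 y - g11 y) (fun y => f22 y - g22 y).
Proof.
move=> [d1 d2 d11 d22 c0 c1 c2 c11 c22] [d1' d2' d11' d22' c0' c1' c2' c11' c22'].
by split; try (by move=> x; exact: dB); exact: kB.
Qed.

Lemma continuous_pair f (p q : R * R -> R) : continuous f -> continuous p -> continuous q ->
  continuous (fun y => f (p y, q y)).
Proof.
move=> cf cp cq y; apply: (@continuous_comp _ _ _ (fun y => (p y, q y)) f); last exact: cf.
by have := cvg_pair (cp y) (cq y); exact.
Qed.

Lemma C2_comp f f1 f2 f11 f12 f22 p p1 p2 p11 p22 q q1 q2 q11 q22 :
  C2_fun f f1 f2 f11 f22 ->
  (forall x, is_derive x (0, 1) f1 (f12 x)) -> (forall x, is_derive x (1, 0) f2 (f12 x)) ->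
  continuous f12 -> C2_fun p p1 p2 p11 p22 -> C2_fun q q1 q2 q11 q22 ->
  let P g := fun y => g (p y, q y) in
  C2_fun (P f) (fun y => p1 y * P f1 y + q1 y * P f2 y) (fun y => p2 y * P f1 y + q2 y * P f2 y)
    (fun y => (p11 y * P f1 y + p1 y * (p1 y * P f11 y + q1 y * P f12 y)) +
              (q11 y * P f2 y + q1 y * (p1 y * P f12 y + q1 y * P f22 y)))
    (fun y => (p22 y * P f1 y + p2 y * (p2 y * P f11 y + q2 y * P f12 y)) +
              (q22 y * P f2 y + q2 y * (p2 y * P f12 y + q2 y * P f22 y))).
Proof.
move=> [d1 d2 d11 d22 c0 c1 c2 c11 c22] d12 d21 c12
  [pd1 pd2 pd11 pd22 pc0 pc1 pc2 pc11 pc22] [qd1 qd2 qd11 qd22 qc0 qc1 qc2 qc11 qc22] P.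
have cP g : continuous g -> continuous (P g) by move=> cg; exact: continuous_pair.
have dP g g1 g2 y v (u u' : R) : (forall x, is_derive x (1, 0) g (g1 x)) ->
    (forall x, is_derive x (0, 1) g (g2 x)) -> continuous g1 -> continuous g2 ->
    is_derive y v p u -> is_derive y v q u' -> is_derive y v (P g) (u * P g1 y + u' * P g2 y).
  by move=> dg1 dg2 cg1 cg2 dp dq; apply: plane_chain.
split.
- by move=> x; exact: dP.
- by move=> x; exact: dP.
- by move=> x; apply: dD; apply: dM => //; exact: dP.
- by move=> x; apply: dD; apply: dM => //; exact: dP.
- exact: cP.
- by apply: kD; apply: kM => //; exact: cP.
- by apply: kD; apply: kM => //; exact: cP.
- exact: kD (kD (kM pc11 (cP _ c1)) (kM pc1 (kD (kM pc1 (cP _ c11)) (kM qc1 (cP _ c12)))))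
    (kD (kM qc11 (cP _ c2)) (kM qc1 (kD (kM pc1 (cP _ c12)) (kM qc1 (cP _ c22))))).
- exact: kD (kD (kM pc22 (cP _ c1)) (kM pc2 (kD (kM pc2 (cP _ c11)) (kM qc2 (cP _ c12)))))
    (kD (kM qc22 (cP _ c2)) (kM qc2 (kD (kM pc2 (cP _ c12)) (kM qc2 (cP _ c22))))).
Qed.

Lemma vanishing_le f g (B : R) : 0 <= B -> vanishing Om g ->
  (forall x, Om x -> `|f x| <= B * `|g x|) -> vanishing Om f.
Proof.
move=> B0 vg fg e e0; have e'0 : 0 < e / (B + 1) by rewrite divr_gt0// ltr_wpDl.
have [K [cK KO HK]] := vg _ e'0; exists K; split => // x Ox nK.
apply: le_lt_trans (fg x Ox) _; have := HK x Ox nK; rewrite ltr_pdivlMr ?ltr_wpDl// => h.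
by apply: le_lt_trans h; rewrite mulrC ler_wpM2l// lerDl.
Qed.

(** The constant deteriorates as [e] tends to 0. It is only used at fixed [e], to see that a kernel
    minus its image vanishes at the boundary. *)
Lemma kernel_lipschitz e c a k : 0 < e -> exists2 B : R, 0 <= B &
  forall x y, `|dker (ker e c) a k x - dker (ker e c) a k y| <= B * `|x - y|.
Proof.
move=> e0; have [d1 d2 _ _ _ _ _ _ _] := dker_C2 c a k e0.
have bd (f : R -> R * R -> R) : sing_ord (-2) f -> exists2 B : R, 0 <= B &
    forall z, `|dker (f e) a k z| <= B.
  move=> [C C0 HC]; exists (2 * C * e ^- 2); first by rewrite mulr_ge0 ?mulr_ge0// invr_ge0 exprn_ge0// ltW.
  have h z : `|f e z| <= C * e ^- 2.
    have [h _] := HC e z e0; apply: le_trans h _; rewrite -exprnN ler_wpM2l//.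
    have p0 : 0 < `|z| + e by rewrite ltr_wpDl.
    rewrite lef_pV2 ?posrE ?exprn_gt0// lerXn2r// ?nnegrE ?(ltW e0) ?(ltW p0)//.
    by rewrite lerDr.
  move=> z; rewrite /dker; apply: le_trans (ler_normB _ _) _.
  by have := h (z - (a + k)); have := h (z - a); clear h HC; olra.
have [B1 B10 H1] := bd _ (sing_ord_ker1 c); have [B2 B20 H2] := bd _ (sing_ord_ker2 c).
exists (2 * (B1 + B2)); first by rewrite mulr_ge0// addr_ge0.
move=> x y; apply: (@partials_lipschitz _ _ (dker (ker1 e c) a k) (dker (ker2 e c) a k) y (`|x - y| + 1)).
  move=> z _; split => //.
    by apply: le_trans (H1 z) _; rewrite lerDl.
  by apply: le_trans (H2 z) _; rewrite lerDr.
by rewrite ltrDl.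
Qed.

Lemma dker_lap_bound e c a k z (r : R) : 0 < e -> c = (1, 0) \/ c = (0, 1) -> 0 < r ->
  r <= `|z - a| -> `|k| <= r / 2 -> `|dker (ker_lap e c) a k z| <= 64 * 64 * e ^+ 2 / r ^+ 5.
Proof.
move=> e0 hc r0 ra kr.
have h y : r / 2 <= `|y| -> `|ker_lap e c y| <= 64 * 32 * e ^+ 2 / r ^+ 5.
  move=> ry; apply: le_trans (ker_lap_bound c y e0) _.
  have -> : `|c.1| + `|c.2| = 1 by case: hc => -> /=; rewrite normr0 normr1 ?addr0 ?add0r.
  rewrite mulr1; have -> : 64 * 32 * e ^+ 2 / r ^+ 5 = 64 * e ^+ 2 / (r / 2) ^+ 5.
    by field; rewrite gt_eqF.
  rewrite ler_wpM2l//; first by rewrite mulr_ge0// sqr_ge0.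
  have p0 : 0 < `|y| + e by rewrite ltr_wpDl.
  have r2 : 0 < r / 2 by rewrite divr_gt0.
  rewrite lef_pV2 ?posrE ?exprn_gt0// lerXn2r// ?nnegrE ?(ltW r2) ?(ltW p0)//.
  by apply: le_trans ry _; rewrite lerDl ltW.
have h1 : `|ker_lap e c (z - (a + k))| <= 64 * 32 * e ^+ 2 / r ^+ 5.
  apply: h; rewrite opprD addrA; have := lerB_dist (z - a) k; olra.
have h2 : `|ker_lap e c (z - a)| <= 64 * 32 * e ^+ 2 / r ^+ 5 by apply: h; olra.
apply: le_trans (ler_normB _ _) _; apply: le_trans (lerD h1 h2) _.
by rewrite -!mulrDl; rewrite !mulrA; apply: ler_wpM2r; [rewrite invr_ge0 exprn_ge0// ltW|nra].
Qed.

End key_estimate.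

(** * Oscillation of the gradient by testing with a kernel minus its image *)

Section reflected_estimate.
Context {R : realType}.
Variable Om : set (R * R).
Hypothesis oOm : open Om.
Hypothesis bOm : bounded_set Om.
Implicit Types (a b k x y z v c : R * R) (f g : R * R -> R) (e d : R).
Local Notation I h := (\int[leb2 R]_(x in Om) (h x)).
Let mO : measurable (Om : set (mplane R)) := measurable_dom oOm.
Let area := fine (leb2 R Om).

(* The remainder after the leading term, at one point: [C] bounds the kernels, [D] is |k| / delta^2
   with delta the distance of the reflected point to [a]. *)
Lemma reflected_laplacian_bound (N C D delta : R) (pl ql pp qq pq f1 f2 f11 f12 f22 L : R) :
  0 < delta -> 0 <= N -> 0 <= C -> 0 <= D ->
  `|pl| <= N -> `|ql| <= N -> `|pp - 1| <= N * delta -> `|qq - 1| <= N * delta -> `|pq| <= N * delta ->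
  `|f1| <= C * (D / delta) -> `|f2| <= C * (D / delta) ->
  `|f11| <= C * (D / delta ^+ 2) -> `|f12| <= C * (D / delta ^+ 2) -> `|f22| <= C * (D / delta ^+ 2) ->
  `|f11 + f22| <= L * (D / delta) ->
  `|pl * f1 + ql * f2 + pp * f11 + 2 * pq * f12 + qq * f22| <= (6 * N * C + L) * (D / delta).
Proof.
move=> d0 N0 C0 D0 hpl hql hpp hqq hpq h1 h2 h11 h12 h22 hl.
rewrite (_ : _ + _ = (pl * f1 + ql * f2 + (pp - 1) * f11) + (qq - 1) * f22 + (2 * (pq * f12) + (f11 + f22))); last by ring.
have m1 := mul_le hpl h1; have m2 := mul_le hql h2; have m3 := mul_le hpp h11.
have m4 := mul_le hqq h22; have m5 := mul_le hpq h12.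
have E : N * delta * (C * (D / delta ^+ 2)) = N * C * (D / delta) by field; rewrite gt_eqF.
rewrite E in m3 m4 m5.
have m6 : `|2 * (pq * f12) + (f11 + f22)| <= 2 * (N * C * (D / delta)) + L * (D / delta).
  apply: le_trans (ler_normD _ _) _; apply: lerD => //.
  by rewrite normrM ger0_norm// ler_wpM2l.
apply: le_trans (sum3_le (sum3_le m1 m2 m3) m4 m6) _; olra.
Qed.

(** The test function is [eta * (f - J)] with [f] the difference of two kernels and [J] its image
    under the reflection. The pairing with [w] costs [M]. The Laplacian of [eta * f] contains the
    leading term. The Laplacian of [J] is too large by one power of the distance, which is exactly
    what the decay of [psi] with constant [A] regains. Terms with derivatives of the cutoff live
    away from [a] and cost only [m]. *)
Lemma reflection_gradient_bound c (N c0 rho r0 : R) : c = (1, 0) \/ c = (0, 1) -> 0 < c0 -> c0 <= 1 ->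
  0 < rho -> 0 <= N -> 0 < r0 -> (forall x, Om x -> `|x| <= r0) ->
  exists2 C : R, 0 <= C & forall a k d U eta eta1 eta2 eta11 eta22
    p p1 p2 p11 p22 q q1 q2 q11 q22 psi psi1 psi2 w (M A m : R),
  Om a -> Om (a + k) -> 0 < `|k| -> `|k| <= c0 * d / 2 -> `|k| <= rho / 2 -> 0 < d ->
  cutoff N rho U a eta eta1 eta2 eta11 eta22 ->
  reflection Om N c0 d U a p p1 p2 p11 p22 q q1 q2 q11 q22 ->
  vanishing Om (fun y => eta y * `|y - (p y, q y)|) ->
  H10 Om psi psi1 psi2 -> bmeas Om w M -> distr_laplacian Om psi w ->
  0 <= M -> 0 <= A -> 0 <= m -> (forall y, Om y -> `|psi y| <= m) ->
  (forall y, Om y -> U y -> `|psi y| <= A * `|(p y, q y) - a|) ->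
  `|(c.1 * psi1 (a + k) + c.2 * psi2 (a + k)) - (c.1 * psi1 a + c.2 * psi2 a)| <=
  C * (M + A + m) * `|k| * (1 + ln ((2 * (2 * r0) ^+ 2 + `|k| ^+ 2) / `|k| ^+ 2)).
Proof.
move=> hc c00 c01 rho0 N0 r00 Or.
have [Ci Ci0 HCi] := I_ker_diff oOm bOm c r00 Or.
have [C0 C00 H0] := dker_sing (n := 1) (sing_ord_ker c).
have [C1 C10 H1] := dker_sing (n := 2) (sing_ord_ker1 c).
have [C2 C20 H2] := dker_sing (n := 2) (sing_ord_ker2 c).
have [C3 C30 H3] := dker_sing (n := 3) (sing_ord_ker11 c).
have [C4 C40 H4] := dker_sing (n := 3) (sing_ord_ker12 c).
have [C5 C50 H5] := dker_sing (n := 3) (sing_ord_ker22 c).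
pose C := C0 + C1 + C2 + C3 + C4 + C5.
have Cs : [/\ C0 <= C, C1 <= C, C2 <= C & [/\ C3 <= C, C4 <= C & C5 <= C]] by move: C00 C10 C20 C30 C40 C50; rewrite /C; clear - area mO bOm; move=> *; split; try split; olra.
have C_ge0 : 0 <= C by rewrite /C; olra.
pose K0 := 2 / c0 ^+ 2; have K00 : 0 <= K0 by rewrite divr_ge0// sqr_ge0.
pose B1 := C * K0.
(* Bounds the terms in which the cutoff is differentiated: they are supported at distance at least
   [rho] from [a], hence at reflected distance at least [c0 * rho]. *)
pose BB := N * (C / rho ^+ 2 + C / (c0 * rho) ^+ 2) +
  4 * N * (C / rho ^+ 3 + 2 * N * (C / (c0 * rho) ^+ 3)).
have BB0 : 0 <= BB.
  have i2 : 0 <= C / rho ^+ 2 by rewrite divr_ge0// exprn_ge0// ltW.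
  have i3 : 0 <= C / rho ^+ 3 by rewrite divr_ge0// exprn_ge0// ltW.
  have cr : 0 <= c0 * rho by rewrite mulr_ge0// ltW.
  have j2 : 0 <= C / (c0 * rho) ^+ 2 by rewrite divr_ge0// exprn_ge0.
  have j3 : 0 <= C / (c0 * rho) ^+ 3 by rewrite divr_ge0// exprn_ge0.
  by rewrite /BB addr_ge0// !mulr_ge0// addr_ge0// mulr_ge0// mulr_ge0.
pose B2 := BB * (12 * r0 ^+ 2).
have [K4 K40 HL] : exists2 K : R, 0 <= K & forall e a k z (r : R), 0 < e -> 0 < r ->
    r <= `|z - a| -> `|k| <= r / 2 -> `|dker (ker_lap e c) a k z| <= K * e ^+ 2 / r ^+ 5.
  by exists (64 * 64) => [|e a k z r e0 rr0 h1 h2]; [exact: mulr_ge0|exact: dker_lap_bound].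
pose B3 := (6 * N * C + K4) * K0.
have B10 : 0 <= B1 by rewrite mulr_ge0.
have B20 : 0 <= B2 by rewrite mulr_ge0// mulr_ge0// sqr_ge0.
have B30 : 0 <= B3 by rewrite mulr_ge0// addr_ge0// !mulr_ge0.
have at0 : 0 < atan (1 / 2 : R) by rewrite -atan0 lt_atan.
pose CC := (Ci + 4 * (B1 + B2 + B3)) / (4 * atan (1 / 2)).
exists CC; first by rewrite divr_ge0 ?mulr_ge0 ?(ltW at0)// addr_ge0// mulr_ge0// !addr_ge0.
move=> a k d U eta eta1 eta2 eta11 eta22 p p1 p2 p11 p22 q q1 q2 q11 q22 psi psi1 psi2 w M A m.
move=> Oa Ob k0 kd krho d0 hcut href hvan hpsi hw hdist M0 A0 m0 psim psiA.
set kap := `|k| in k0 kd krho *.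
have krho' : kap < rho by move: krho rho0; clear - area mO bOm; lra.
have kd2 : kap <= d / 2 by apply: le_trans kd _; rewrite -mulrA ger_pMl//; move: d0; clear - area mO bOm; lra.
set Lam := ln _.
have [b0 b1 b2 vpsi dpsi] := hpsi.
have [ceta beta near far] := hcut; have [cp cq rb rl rf ri] := href.
have nb y r : `|y - a| <= r -> cbox a r y by move=> ?; apply/cboxE.
have [ra ra0 Ha] : exists2 r : R, 0 < r & cbox a r `<=` Om.
  have [r r0' Hr] := (nbhs_ballP a _).1 (open_nbhs_nbhs (conj oOm Oa)).
  exists (r / 2); first exact: divr_gt0.
  move=> y /cboxE ya; apply: Hr; rewrite -ball_normE/= distrC; apply: le_lt_trans ya _.
  by move: r0' => /=; clear - area mO bOm; lra.
have [rb' rb0 Hb] : exists2 r : R, 0 < r & cbox (a + k) r `<=` Om.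
  have [r r0' Hr] := (nbhs_ballP (a + k) _).1 (open_nbhs_nbhs (conj oOm Ob)).
  exists (r / 2); first exact: divr_gt0.
  move=> y /cboxE ya; apply: Hr; rewrite -ball_normE/= distrC; apply: le_lt_trans ya _.
  by move: r0' => /=; clear - area mO bOm; lra.
pose r := Num.min ra rb'.
have r0' : 0 < r by rewrite lt_min ra0.
have Ha' : cbox a r `<=` Om by move=> y /cboxE h; apply: Ha; apply/cboxE; apply: le_trans h _; rewrite ge_min lexx.
have Hb' : cbox (a + k) r `<=` Om by move=> y /cboxE h; apply: Hb; apply/cboxE; apply: le_trans h _; rewrite ge_min lexx orbT.
suff main : forall t : R, 0 < t -> 4 * atan (1 / 2) *
    `|(c.1 * psi1 (a + k) + c.2 * psi2 (a + k)) - (c.1 * psi1 a + c.2 * psi2 a)| <=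
    (Ci + 4 * (B1 + B2 + B3)) * (M + A + m) * kap * (1 + Lam) + t.
  rewrite (_ : CC * _ * _ * _ = (Ci + 4 * (B1 + B2 + B3)) * (M + A + m) * kap * (1 + Lam) / (4 * atan (1 / 2))); last first.
    by rewrite /CC; field; rewrite gt_eqF.
  rewrite ler_pdivlMr ?mulr_gt0// mulrC; exact/ler_addgt0Pr.
move=> t t0.
have [e0 e00 He] := leading_term oOm bOm hc r0' Ha' Hb' rho0 krho' hpsi hcut t0.
have cd0 : 0 < c0 * d by rewrite mulr_gt0.
(* The regularization lies below the threshold of the leading term and below [|k|], as [I_ker_diff]
   requires; the last two bounds give [e^2 <= |k| * (c0 * d)^2], so that the Laplacian of the kernel
   at reflected points is of the order of the other remainders. *)
pose e := Num.min (Num.min (e0 / 2) kap) (Num.min 1 (kap * (c0 * d) ^+ 2)).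
have e_gt0 : 0 < e by rewrite !lt_min divr_gt0// k0 ltr01 mulr_gt0// exprn_gt0.
have ee0 : e < e0 by apply: (@le_lt_trans _ _ (e0 / 2)); [rewrite /e !ge_min lexx|move: e00; clear - area mO bOm; lra].
have ek : e <= kap by rewrite /e !ge_min lexx orbT.
have e1 : e <= 1 by rewrite /e !ge_min lexx !orbT.
have ecd : e <= kap * (c0 * d) ^+ 2 by rewrite /e !ge_min lexx !orbT.
have e2 : e ^+ 2 <= kap * (c0 * d) ^+ 2.
  by apply: le_trans ecd; rewrite expr2 ger_pMl.
clearbody e.
apply: le_trans (He e e_gt0 ee0) _; rewrite lerD2r {He}.
pose f := dker (ker e c) a k; pose f1 := dker (ker1 e c) a k; pose f2 := dker (ker2 e c) a k.
pose f11 := dker (ker11 e c) a k; pose f12 := dker (ker12 e c) a k; pose f22 := dker (ker22 e c) a k.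
have cf : C2_fun f f1 f2 f11 f22 := dker_C2 c a k e_gt0.
have d12 x : is_derive x (0, 1) f1 (f12 x).
  apply: dB; apply: is_derive_shift; apply: d_eq (is_derive_ker1 c _ _ e_gt0) _; rewrite /=; ring.
have d21 x : is_derive x (1, 0) f2 (f12 x).
  apply: dB; apply: is_derive_shift; apply: d_eq (is_derive_ker2 c _ _ e_gt0) _; rewrite /=; ring.
have c12 : continuous f12 by apply: kB; exact: continuous_shift (continuous_ker12 e_gt0).
have cJ := C2_comp cf d12 d21 c12 cp cq; cbv zeta in cJ.
have cG := C2_mul ceta (C2_sub cf cJ).
have [G_1 G_2 G_11 G_22 G_c G_c1 G_c2 G_c11 G_c22] := cG.
have lapf y : f11 y + f22 y = dker (ker_lap e c) a k y.
  by rewrite /f11 /f22 /dker -!ker_laplacian//; ring.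
have [B Bge0 HB] := kernel_lipschitz c a k e_gt0.
have vG : vanishing Om (fun y => eta y * (f y - f (p y, q y))).
  apply: (vanishing_le Bge0 hvan) => x _.
  by rewrite (normrM (eta x)) (normrM (eta x)) normr_id mulrCA; apply: ler_wpM2l.
have hG : H10 Om (fun y => eta y * (f y - f (p y, q y))) _ _ :=
  And5 (bcont_continuous bOm G_c) (bcont_continuous bOm G_c1) (bcont_continuous bOm G_c2) vG
    (fun x _ => conj (G_1 x) (G_2 x)).
have [mw wM] := hw.
have T := laplace_test oOm bOm hpsi hG (bcont_continuous bOm G_c11) (bcont_continuous bOm G_c22)
  (fun x _ => G_11 x) (fun x _ => G_22 x) mw (bmeas_integrable oOm bOm hw) hdist.
set J := fun y => f (p y, q y) in G_c T vG hG.
(* All remainders are compared with [u]: [|k| / del^2 <= K0 * u] when [del] is the distance of the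
   reflected point to [a], and [|k| <= 12 * r0^2 * u] throughout the domain. The integral of [u]
   produces the logarithm. *)
pose u y := kap * (ker_den kap (y - a))^-1.
have u0 y : 0 <= u y by rewrite mulr_ge0 ?invr_ge0// ltW// ker_den_gt0.
have cu : continuous u by apply: kM; [exact: kC|exact: continuous_shift (continuous_denV k0)].
have kapu y : Om y -> kap <= 12 * r0 ^+ 2 * u y.
  move=> Oy; have S0 := ker_den_gt0 (y - a) k0.
  have kr : kap <= 2 * r0.
    rewrite /kap (_ : k = (a + k) - a); last by rewrite addrAC subrr add0r.
    by apply: le_trans (ler_normB _ _) _; move: (Or _ Oa) (Or _ Ob); clear - area mO bOm; lra.
  have zr : `|y - a| <= 2 * r0.
    by apply: le_trans (ler_normB _ _) _; move: (Or _ Oa) (Or _ Oy); clear - area mO bOm; lra.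
  have S12 : ker_den kap (y - a) <= 12 * r0 ^+ 2.
    apply: (@le_trans _ _ (2 * `|y - a| ^+ 2 + kap ^+ 2)); first by rewrite lerD2r nsq_le_norm.
    by have := normr_ge0 (y - a); move: zr kr k0 r00; clear - area mO bOm; move: (`|y - a|) => n; nra.
  rewrite /u mulrCA mulrA -[leLHS]mulr1 -mulrA ler_wpM2l ?(ltW k0)//.
  by rewrite ler_pdivlMr// mul1r.
have delta_facts y : Om y -> U y -> let del := `|(p y, q y) - a| in
   [/\ 0 < del, c0 * d <= del, c0 * `|y - a| <= del, kap <= del / 2 & kap / del ^+ 2 <= K0 * u y].
  move=> Oy Uy; have h := rf y Oy Uy; set del := `|(p y, q y) - a|.
  have z0 := normr_ge0 (y - a).
  have h1 : c0 * d <= del by apply: le_trans h; rewrite mulrDr lerDr mulr_ge0// ltW.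
  have h2 : c0 * `|y - a| <= del by apply: le_trans h; rewrite mulrDr lerDl ltW.
  have del0 : 0 < del by apply: lt_le_trans h1.
  have S0 := ker_den_gt0 (y - a) k0.
  split => //; first by apply: le_trans kd _; rewrite ler_pM2r.
  rewrite /u mulrCA ler_wpM2l ?(ltW k0)// /K0.
  have S2 : c0 ^+ 2 * ker_den kap (y - a) <= 2 * del ^+ 2.
    have s1 : ker_den kap (y - a) <= 2 * (`|y - a| + d) ^+ 2.
      apply: (@le_trans _ _ (2 * `|y - a| ^+ 2 + kap ^+ 2)); first by rewrite lerD2r nsq_le_norm.
      by move: z0 kd2 k0 d0; clear - area mO bOm; move: (`|y - a|) => n; nra.
    have s2 : (c0 * (`|y - a| + d)) ^+ 2 <= del ^+ 2.
      by rewrite lerXn2r// nnegrE ?(ltW del0)// mulr_ge0 ?(ltW c00)// addr_ge0// ltW.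
    apply: le_trans (ler_wpM2l (sqr_ge0 c0) s1) _; move: s2; rewrite exprMn; clear - area mO bOm; lra.
  rewrite -subr_ge0 (_ : _ - _ = (2 * del ^+ 2 - c0 ^+ 2 * ker_den kap (y - a)) /
    (c0 ^+ 2 * ker_den kap (y - a) * del ^+ 2)); last by field; rewrite !gt_eqF.
  by rewrite divr_ge0 ?subr_ge0// !mulr_ge0 ?exprn_ge0 ?(ltW c00) ?(ltW S0) ?(ltW del0).
have [Cs0 Cs1 Cs2 [Cs3 Cs4 Cs5]] := Cs.
have up (x X Y : R) : 0 <= x -> X <= Y -> X * x <= Y * x by move=> ? ?; rewrite ler_wpM2r.
have kk (n : nat) (s : R) : 0 < s -> 0 <= kap / s ^+ n by move=> s0; rewrite divr_ge0 ?exprn_ge0 ?(ltW s0) ?(ltW k0).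
have Jb y : Om y -> U y -> `|J y| <= B1 * u y.
  move=> Oy Uy; have [del0 _ _ kdel ku] := delta_facts y Oy Uy.
  apply: le_trans (H0 e a k (p y, q y) _ e_gt0 del0 (lexx _) kdel) _.
  apply: le_trans (up _ _ _ (kk 2%N _ del0) Cs0) _.
  by rewrite /B1 -mulrA ler_wpM2l.
have PW1 y : Om y -> `|eta y * (f y - J y)| <= `|f y| + B1 * u y.
  move=> Oy; have [Uy|nU] := pselect (U y); last first.
    have [-> _ _ _] := far y nU; rewrite mul0r normr0 addr_ge0// mulr_ge0//.
  have [e_1 _ _ _] := beta y; rewrite normrM.
  apply: (@le_trans _ _ `|f y - J y|); first by rewrite ler_piMl.
  by apply: le_trans (ler_normB _ _) _; rewrite lerD2l Jb.
(* [J1], [J2] and [LJ] are the gradient and the Laplacian of [J] given by the chain rule; [T1]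
   collects the terms containing a derivative of the cutoff. *)
pose J1 y := p1 y * f1 (p y, q y) + q1 y * f2 (p y, q y).
pose J2 y := p2 y * f1 (p y, q y) + q2 y * f2 (p y, q y).
pose LJ y := (p11 y + p22 y) * f1 (p y, q y) + (q11 y + q22 y) * f2 (p y, q y) +
  (p1 y ^+ 2 + p2 y ^+ 2) * f11 (p y, q y) + 2 * (p1 y * q1 y + p2 y * q2 y) * f12 (p y, q y) +
  (q1 y ^+ 2 + q2 y ^+ 2) * f22 (p y, q y).
pose T1 y := (eta11 y + eta22 y) * (f y - J y) + 2 * (eta1 y * (f1 y - J1 y) + eta2 y * (f2 y - J2 y)).
have PW2 y : Om y -> `|psi y * (T1 y - eta y * LJ y)| <= (m * B2 + A * B3) * u y.
  move=> Oy; have [Uy|nU] := pselect (U y); last first.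
    have [h0 h1 h2 h3] := far y nU; have -> : psi y * (T1 y - eta y * LJ y) = 0.
      by rewrite /T1 h0 h1 h2 h3; ring.
    by rewrite normr0 mulr_ge0// addr_ge0// mulr_ge0.
  have [del0 cdel zdel kdel ku] := delta_facts y Oy Uy; set del := `|_| in del0 cdel zdel kdel ku.
  have F1 : `|f1 (p y, q y)| <= C * (kap / del ^+ 3).
    exact: le_trans (H1 e a k (p y, q y) _ e_gt0 del0 (lexx _) kdel) (up _ _ _ (kk 3%N _ del0) Cs1).
  have F2 : `|f2 (p y, q y)| <= C * (kap / del ^+ 3).
    exact: le_trans (H2 e a k (p y, q y) _ e_gt0 del0 (lexx _) kdel) (up _ _ _ (kk 3%N _ del0) Cs2).
  have T1b : `|T1 y| <= BB * kap.
    have [ya|ya] := ltP `|y - a| rho.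
      have [_ h1 h2 h3] := near y ya; have -> : T1 y = 0 by rewrite /T1 h1 h2 h3; ring.
      by rewrite normr0 mulr_ge0// ltW.
    have [_ E1 E2 E3] := beta y; have [P1 P2 Q1 Q2] := rb y Oy Uy.
    have crho0 : 0 < c0 * rho by rewrite mulr_gt0.
    have cdl : c0 * rho <= del by apply: le_trans zdel; rewrite ler_wpM2l// ltW.
    have dk (n : nat) : kap / del ^+ n <= kap / (c0 * rho) ^+ n.
      rewrite ler_wpM2l ?(ltW k0)// lef_pV2 ?posrE ?exprn_gt0//.
      by rewrite lerXn2r// nnegrE ltW.
    have g0 : `|f y| <= C * (kap / rho ^+ 2).
      exact: le_trans (H0 e a k y _ e_gt0 rho0 ya krho) (up _ _ _ (kk 2%N _ rho0) Cs0).
    have g1 : `|f1 y| <= C * (kap / rho ^+ 3).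
      exact: le_trans (H1 e a k y _ e_gt0 rho0 ya krho) (up _ _ _ (kk 3%N _ rho0) Cs1).
    have g2 : `|f2 y| <= C * (kap / rho ^+ 3).
      exact: le_trans (H2 e a k y _ e_gt0 rho0 ya krho) (up _ _ _ (kk 3%N _ rho0) Cs2).
    have j0 : `|J y| <= C * (kap / (c0 * rho) ^+ 2).
      apply: le_trans (H0 e a k (p y, q y) _ e_gt0 del0 (lexx _) kdel) _.
      by apply: ler_pM => //; exact: kk.
    have F1' : `|f1 (p y, q y)| <= C * (kap / (c0 * rho) ^+ 3).
      by apply: le_trans F1 _; rewrite ler_wpM2l.
    have F2' : `|f2 (p y, q y)| <= C * (kap / (c0 * rho) ^+ 3).
      by apply: le_trans F2 _; rewrite ler_wpM2l.
    have j1 : `|J1 y| <= 2 * N * (C * (kap / (c0 * rho) ^+ 3)).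
      by apply: le_trans (ler_normD _ _) _; move: (mul_le P1 F1') (mul_le Q1 F2'); clear - area mO bOm; lra.
    have j2 : `|J2 y| <= 2 * N * (C * (kap / (c0 * rho) ^+ 3)).
      by apply: le_trans (ler_normD _ _) _; move: (mul_le P2 F1') (mul_le Q2 F2'); clear - area mO bOm; lra.
    have t1 := mul_le E3 (le_trans (ler_normB _ _) (lerD g0 j0)).
    have t2 := mul_le E1 (le_trans (ler_normB _ _) (lerD g1 j1)).
    have t3 := mul_le E2 (le_trans (ler_normB _ _) (lerD g2 j2)).
    have t4 : `|2 * (eta1 y * (f1 y - J1 y) + eta2 y * (f2 y - J2 y))| <=
        2 * (N * (C * (kap / rho ^+ 3) + 2 * N * (C * (kap / (c0 * rho) ^+ 3))) +
             N * (C * (kap / rho ^+ 3) + 2 * N * (C * (kap / (c0 * rho) ^+ 3)))).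
      by rewrite normrM ger0_norm// ler_wpM2l// (le_trans (ler_normD _ _))// lerD.
    rewrite /T1; apply: le_trans (ler_normD _ _) _; apply: le_trans (lerD t1 t4) _.
    by rewrite /BB le_eqVlt; apply/orP; left; apply/eqP; ring.
  have LJb : `|LJ y| <= (6 * N * C + K4) * (kap / del ^+ 3).
    have D2 : kap / del ^+ 3 = (kap / del ^+ 2) / del by field; rewrite gt_eqF.
    have D3 : kap / del ^+ 4 = (kap / del ^+ 2) / del ^+ 2 by field; rewrite gt_eqF.
    have [I1 I2 I3] := ri y Oy Uy; have [L1 L2] := rl y Oy Uy.
    rewrite D2; apply: reflected_laplacian_bound => //; rewrite -?D2 -?D3 ?kk//.
    - exact: le_trans (H3 e a k (p y, q y) _ e_gt0 del0 (lexx _) kdel) (up _ _ _ (kk 4%N _ del0) Cs3).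
    - exact: le_trans (H4 e a k (p y, q y) _ e_gt0 del0 (lexx _) kdel) (up _ _ _ (kk 4%N _ del0) Cs4).
    - exact: le_trans (H5 e a k (p y, q y) _ e_gt0 del0 (lexx _) kdel) (up _ _ _ (kk 4%N _ del0) Cs5).
    - rewrite lapf; apply: le_trans (HL e a k (p y, q y) _ e_gt0 del0 (lexx _) kdel) _.
      rewrite -mulrA ler_wpM2l// -/del (_ : kap / del ^+ 3 = kap * del ^+ 2 / del ^+ 5); last by field; rewrite gt_eqF.
      rewrite ler_wpM2r ?invr_ge0 ?exprn_ge0 ?(ltW del0)//; apply: le_trans e2 _.
      by rewrite ler_wpM2l ?(ltW k0)// lerXn2r// nnegrE ltW.
  have [e_1 _ _ _] := beta y.
  have X1 : `|psi y * T1 y| <= m * (BB * (12 * r0 ^+ 2 * u y)).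
    apply: mul_le; first exact: psim.
    by apply: le_trans T1b _; rewrite ler_wpM2l// kapu.
  (* The factor [del] in the bound of [psi] turns the order [|k| / del^3] of the image term into
     [|k| / del^2], which is integrable up to a logarithm. *)
  have X2 : `|psi y * (eta y * LJ y)| <= A * (B3 * u y).
    apply: (@le_trans _ _ (A * del * (1 * ((6 * N * C + K4) * (kap / del ^+ 3))))).
      by apply: mul_le; [exact: psiA|exact: mul_le].
    rewrite (_ : A * del * _ = A * ((6 * N * C + K4) * (kap / del ^+ 2))); last by field; rewrite gt_eqF.
    apply: ler_wpM2l => //; rewrite /B3 -(mulrA _ K0); apply: ler_wpM2l => //.
    by apply: addr_ge0 => //; apply: mulr_ge0 => //; apply: mulr_ge0.
  rewrite mulrBr; apply: le_trans (ler_normB _ _) _; apply: le_trans (lerD X1 X2) _.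
  by rewrite /B2 le_eqVlt; apply/orP; left; apply/eqP; ring.
have bX : bcont Om (fun y => psi y * eta y * dker (ker_lap e c) a k y).
  apply: bcontM; last by apply: bcont_continuous => //; apply: kB; exact: continuous_shift (continuous_ker_lap e_gt0).
  by apply: bcontM => //; apply: bcont_continuous => //; exact: C2_c ceta.
set lap1 := (fun y => _) in G_c11 T; set lap2 := (fun y => _) in G_c22 T.
have bY : bcont Om (fun y => psi y * (lap1 y + lap2 y)).
  by apply: bcontM => //; apply: bcontD; exact: bcont_continuous.
pose Z y := psi y * (lap1 y + lap2 y) - psi y * eta y * dker (ker_lap e c) a k y.
have bZ : bcont Om Z by exact: bcontB.
have ZE y : Z y = psi y * (T1 y - eta y * LJ y).
  by rewrite /Z -lapf /lap1 /lap2 /T1 /LJ /J1 /J2 /J; ring.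
have EX : I (fun y => psi y * eta y * dker (ker_lap e c) a k y) =
    I (fun y => psi y * (lap1 y + lap2 y)) - I Z.
  rewrite -[X in _ = _ + X]mulN1r -(I_scale oOm bOm _ bZ) -(I_add oOm bOm bY).
    by apply: eq_Rintegral => y _; rewrite /Z; ring.
  exact: (bcontM (bcont_cst Om _) bZ).
have bu : bcont Om u by exact: bcont_continuous.
have bf : bcont Om (fun y => `|f y|).
  by apply: bcont_norm; apply: bcont_continuous => //; exact: C2_c cf.
have bD (s1 s2 : R) : bcont Om (fun y => s1 * `|f y| + s2 * u y).
  exact: (bcontD (bcontM (bcont_cst Om _) bf) (bcontM (bcont_cst Om _) bu)).
have bcu (s : R) : bcont Om (fun y => s * u y) by exact: (bcontM (bcont_cst Om _) bu).
have bcf (s : R) : bcont Om (fun y => s * `|f y|) by exact: (bcontM (bcont_cst Om _) bf).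
have Lam0 : 0 <= Lam.
  rewrite ln_ge0// ler_pdivlMr ?exprn_gt0// mul1r lerDr mulr_ge0// sqr_ge0 //.
have Iu : I u <= 4 * kap * (1 + Lam).
  rewrite /u I_scale//; last by apply: bcont_continuous => //; exact: continuous_shift (continuous_denV k0).
  rewrite (_ : 4 * kap * (1 + Lam) = kap * (4 * (1 + Lam))); last by ring.
  rewrite ler_wpM2l ?(ltW k0)//.
  have rr0 : 0 < 2 * r0 by rewrite mulr_gt0.
  apply: le_trans (cbox_integral_inv_den a rr0 k0).
  apply: (I_le_cbox oOm bOm) => //; first exact: continuous_shift (continuous_denV k0).
  by move=> x; rewrite invr_ge0 ltW// ker_den_gt0.
have If : I (fun y => `|f y|) <= Ci * kap * (1 + Lam) by exact: HCi.
have Y1 : `|I (fun y => w y * (eta y * (f y - J y)))| <= M * I (fun y => `|f y|) + M * B1 * I u.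
  have bG := bcont_continuous bOm G_c.
  have [NG hNG] := bcont_bmeas oOm bG.
  have hwG := bmeasM hw hNG.
  apply: le_trans (le_normr_Rintegral _ (bmeas_integrable oOm bOm hwG)) _ => //.
  rewrite -(I_scale oOm bOm M bf) -(I_scale oOm bOm (M * B1) bu) -(I_add oOm bOm (bcf _) (bcu _)).
  have [NF hNF] := bcont_bmeas oOm (bD M (M * B1)).
  apply: (bmeas_le oOm bOm (bmeas_norm hwG) hNF) => y Oy.
  by rewrite -mulrA -mulrDr; apply: mul_le; [exact: wM|exact: PW1].
have Y2 : `|I Z| <= (m * B2 + A * B3) * I u.
  apply: le_trans (le_normr_Rintegral _ (bcont_integrable oOm bOm bZ)) _ => //.
  rewrite -(I_scale oOm bOm _ bu); apply: (I_le oOm bOm) => //; first exact: bcont_norm.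
  by move=> y Oy; rewrite ZE; exact: PW2.
rewrite EX T; apply: le_trans (ler_normB _ _) _; apply: le_trans (lerD Y1 Y2) _.
have Z1 := ler_wpM2l M0 If.
have Z2 : (M * B1 + (m * B2 + A * B3)) * I u <= (M * B1 + (m * B2 + A * B3)) * (4 * kap * (1 + Lam)).
  by rewrite ler_wpM2l// !addr_ge0// mulr_ge0.
have pos : 0 <= kap * (1 + Lam) * (Ci * (A + m) + 4 * (B1 * (A + m) + B2 * (M + A) + B3 * (M + m))).
  apply: mulr_ge0; first by apply: mulr_ge0; [exact: ltW|exact: addr_ge0].
  apply: addr_ge0; first by apply: mulr_ge0 => //; exact: addr_ge0.
  apply: mulr_ge0 => //; apply: addr_ge0; last by apply: mulr_ge0 => //; exact: addr_ge0.
  by apply: addr_ge0; apply: mulr_ge0 => //; exact: addr_ge0.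
move: Z1 Z2 pos; move: (I u) (I (fun y => `|f y|)); clear - area mO bOm => i1 i2 h1 h2 h3; lra.
Qed.

End reflected_estimate.

(** * Explicit C^2 cutoff functions *)

Section cutoff_functions.
Context {R : realType}.
Implicit Types (a y z : R * R) (t x : R).

Definition pospart (x : R) : R := Num.max x 0.

Lemma pospart_ge0 x : 0 <= pospart x. Proof. by rewrite le_max lexx orbT. Qed.

Lemma continuous_pospart : continuous pospart.
Proof.
move=> x; rewrite /pospart; apply: (@continuous_max _ _ (fun x => x) (fun=> 0)).
  exact: cvg_id.
exact: cvg_cst.
Qed.

Lemma is_derive_pospart2 x : is_derive x (1 : R) (fun x => pospart x ^+ 2) (2 * pospart x).
Proof.
have h : is_derive x (1 : R) (fun u => pospart u ^+ 2 - 2 * pospart x * u) 0.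
  apply: (@is_derive_quadratic _ _ _ 1) => h; rewrite mul1r ler_norml /pospart.
  have [xh|xh] := leP (x + h) 0; have [xx|xx] := leP x 0; apply/andP; split; nra.
have := dD h (dM (dC (2 * pospart x) x (1 : R)) (is_derive_id x (1 : R))).
rewrite (_ : (fun t => _) = (fun x => pospart x ^+ 2)); last by apply/funext => t; ring.
by move=> h'; apply: d_eq h' _; ring.
Qed.

(** The cube of the positive part, a C^2 function that is zero on a half-line; the cutoffs need no
    more than two derivatives. *)
Definition cube x := pospart x ^+ 2 * x.
Definition cube1 x := 3 * pospart x ^+ 2.
Definition cube2 x := 6 * pospart x.

Lemma pospart_mul x : pospart x * x = pospart x ^+ 2.
Proof. by rewrite /pospart; have [_|_] := leP x 0; rewrite ?mul0r ?expr0n// expr2. Qed.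

Lemma is_derive_cube x : is_derive x (1 : R) cube (cube1 x).
Proof.
apply: d_eq (dM (is_derive_pospart2 x) (is_derive_id x (1 : R))) _.
by rewrite -mulrA pospart_mul /cube1; ring.
Qed.

Lemma is_derive_cube1 x : is_derive x (1 : R) cube1 (cube2 x).
Proof. by apply: d_eq (dM (dC 3 x (1 : R)) (is_derive_pospart2 x)) _; rewrite /cube2; ring. Qed.

(** Nesting two positive parts gives a C^2 step that equals 1 up to [t = 1] and 0 from [t = 2]
    on. *)
Definition plateau t := cube (1 - cube (t - 1)).
Definition plateau1 t := - (cube1 (1 - cube (t - 1)) * cube1 (t - 1)).
Definition plateau2 t := cube2 (1 - cube (t - 1)) * cube1 (t - 1) ^+ 2 -
  cube1 (1 - cube (t - 1)) * cube2 (t - 1).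

Let is_derive_sh t (f : R -> R) (d : R) : is_derive (t - 1) (1 : R) f d ->
  is_derive t (1 : R) (fun t => f (t - 1)) d.
Proof. exact: is_derive_shift. Qed.

Lemma is_derive_plateau t : is_derive t (1 : R) plateau (plateau1 t).
Proof.
have d1 := dB (dC 1 t (1 : R)) (is_derive_sh (is_derive_cube (t - 1))).
apply: d_eq (is_derive_compV d1 (is_derive_cube _)) _; rewrite /plateau1; ring.
Qed.

Lemma is_derive_plateau1 t : is_derive t (1 : R) plateau1 (plateau2 t).
Proof.
have d1 := dB (dC 1 t (1 : R)) (is_derive_sh (is_derive_cube (t - 1))).
have d2 := is_derive_compV d1 (is_derive_cube1 _).
apply: d_eq (dN (dM d2 (is_derive_sh (is_derive_cube1 (t - 1))))) _; rewrite /plateau2; ring.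
Qed.

Lemma continuous_cubes : [/\ continuous cube, continuous cube1 & continuous cube2].
Proof.
have ci : continuous (fun x : R => x) by move=> x; exact: cvg_id.
split; [apply: kM => //; apply: kX|apply: kM; [exact: kC|apply: kX]|apply: kM; [exact: kC|]];
  exact: continuous_pospart.
Qed.

Lemma continuous_plateau : [/\ continuous plateau, continuous plateau1 & continuous plateau2].
Proof.
have [c0 c1 c2] := continuous_cubes.
have cs (f : R -> R) : continuous f -> continuous (fun t => f (t - 1)) by move=> cf; exact: continuous_shift.
have cc (f : R -> R) : continuous f -> continuous (fun t => f (1 - cube (t - 1))).
  move=> cf; apply: (@kcomp _ _ f (fun t => 1 - cube (t - 1))); first by move=> t; exact: cf.
  by apply: kB; [exact: kC|exact: cs].
split; first exact: cc.
  move=> t; apply: (@continuousN _ _ _ (fun t => cube1 (1 - cube (t - 1)) * cube1 (t - 1))).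
  by apply: kM; [exact: cc|exact: cs].
by apply: kB; apply: kM; [exact: cc|apply: kX; exact: cs|exact: cc|exact: cs].
Qed.

Lemma plateau_near t : t <= 1 -> [/\ plateau t = 1, plateau1 t = 0 & plateau2 t = 0].
Proof.
move=> t1; have p : pospart (t - 1) = 0 by apply/max_idPr; olra.
have c0 : cube (t - 1) = 0 by rewrite /cube p expr0n mul0r.
rewrite /plateau /plateau1 /plateau2 c0 subr0 /cube /cube1 /cube2 p.
have -> : pospart 1 = 1 by apply/max_idPl.
by split; ring.
Qed.

Lemma plateau_far t : 2 <= t -> [/\ plateau t = 0, plateau1 t = 0 & plateau2 t = 0].
Proof.
move=> t1; have p : pospart (t - 1) = t - 1 by apply/max_idPl; olra.
have c0 : 1 - cube (t - 1) <= 0.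
  by rewrite /cube p -exprSr subr_le0 exprn_ege1//; olra.
have p0 : pospart (1 - cube (t - 1)) = 0 by apply/max_idPr.
by rewrite /plateau /plateau1 /plateau2 {1}/cube /cube1 /cube2 p0; split; ring.
Qed.

Lemma plateau_bound t : [/\ `|plateau t| <= 1, `|plateau1 t| <= 9 & `|plateau2 t| <= 72].
Proof.
have [t1|t1] := leP t 1.
  by have [-> -> ->] := plateau_near t1; rewrite normr1 normr0.
have [t2|t2] := leP 2 t.
  by have [-> -> ->] := plateau_far t2; rewrite normr0.
have p : pospart (t - 1) = t - 1 by apply/max_idPl; olra.
set s := t - 1 in p *; have s0 : 0 < s by rewrite /s; olra.
have s1 : s < 1 by rewrite /s; olra.
have s31 : 0 <= s ^+ 3 <= 1 by rewrite exprn_ge0 ?exprn_ile1// ltW.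
have q : pospart (1 - s ^+ 3) = 1 - s ^+ 3 by apply/max_idPl; move/andP: s31 => []; olra.
have cs : cube s = s ^+ 3 by rewrite /cube p -exprSr.
rewrite /plateau /plateau1 /plateau2 -/s cs /cube /cube1 /cube2 p q.
set u := 1 - s ^+ 3; have u0 : 0 <= u <= 1 by rewrite /u; olra.
have s01 : 0 <= s <= 1 by olra.
have b1 : 0 <= u ^+ 2 <= 1 by move/andP: u0 => [? ?]; rewrite exprn_ge0 ?exprn_ile1.
have b2 : 0 <= s ^+ 2 <= 1 by move/andP: s01 => [? ?]; rewrite exprn_ge0 ?exprn_ile1.
have b4 : 0 <= (s ^+ 2) ^+ 2 <= 1.
  by move/andP: b2 => [h1 h2]; rewrite sqr_ge0 expr2 mulr_ile1.
have pr (x y : R) : 0 <= x <= 1 -> 0 <= y <= 1 -> 0 <= x * y <= 1.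
  by move=> /andP[? ?] /andP[? ?]; rewrite mulr_ge0//= mulr_ile1.
have h1 := pr _ _ b1 u0; have h2 := pr _ _ b1 b2; have h3 := pr _ _ u0 b4; have h4 := pr _ _ b1 s01.
split; rewrite ler_norml.
- olra.
- have -> : - (3 * u ^+ 2 * (3 * s ^+ 2)) = - 9 * (u ^+ 2 * s ^+ 2) by ring.
  olra.
- have -> : 6 * u * (3 * s ^+ 2) ^+ 2 - 3 * u ^+ 2 * (6 * s) = 54 * (u * (s ^+ 2) ^+ 2) - 18 * (u ^+ 2 * s) by ring.
  olra.
Qed.

Lemma cutoff_exists (rho : R) : 0 < rho -> exists2 N : R, 0 <= N & forall a,
  exists eta eta1 eta2 eta11 eta22, cutoff N rho [set y | `|y - a| < 2 * rho] a eta eta1 eta2 eta11 eta22.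
Proof.
move=> r0; have r2 : 0 < rho ^+ 2 by rewrite exprn_gt0.
have rn : rho != 0 by rewrite gt_eqF.
pose N := 18 / rho + 2 * (72 * (4 / rho ^+ 2) + 9 / rho ^+ 2).
have ir : 0 < rho^-1 by rewrite invr_gt0.
have ir2 : 0 < (rho ^+ 2)^-1 by rewrite invr_gt0.
exists N; first by rewrite /N; olra.
(* The step is composed with a smooth Euclidean square. Comparing it with the max norm gives
   [n <= 1] within distance [rho] and [n >= 2] from distance [2 * rho] on, exactly the two ranges of
   [plateau]. *)
move=> a; pose n y := nsq (y - a) / (2 * rho ^+ 2).
pose x1 y := (y - a).1 / rho ^+ 2; pose x2 y := (y - a).2 / rho ^+ 2.
have dn v y : is_derive y v n (v.1 * x1 y + v.2 * x2 y).
  apply: (@is_derive_shift _ _ (fun z => nsq z / (2 * rho ^+ 2))).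
  have h := dM (dD (dX 2 (is_derive_fst (y - a) v)) (dX 2 (is_derive_snd (y - a) v))) (dC (2 * rho ^+ 2)^-1 (y - a) v).
  by apply: d_eq h _; rewrite /x1 /x2 /= !expr1; field.
have dx1 y : is_derive y (1, 0) x1 (rho ^+ 2)^-1.
  apply: (@is_derive_shift _ _ (fun z : R * R => z.1 / rho ^+ 2)).
  by apply: d_eq (dM (is_derive_fst (y - a) _) (dC (rho ^+ 2)^-1 _ _)) _ => /=; ring.
have dx2 y : is_derive y (0, 1) x2 (rho ^+ 2)^-1.
  apply: (@is_derive_shift _ _ (fun z : R * R => z.2 / rho ^+ 2)).
  by apply: d_eq (dM (is_derive_snd (y - a) _) (dC (rho ^+ 2)^-1 _ _)) _ => /=; ring.
have cx1 : continuous x1.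
  apply: (@continuous_shift _ _ (fun z : R * R => z.1 / rho ^+ 2)).
  by apply: kM; [exact: continuous_fst|exact: kC].
have cx2 : continuous x2.
  apply: (@continuous_shift _ _ (fun z : R * R => z.2 / rho ^+ 2)).
  by apply: kM; [exact: continuous_snd|exact: kC].
have cn : continuous n.
  apply: (@continuous_shift _ _ (fun z : R * R => nsq z / (2 * rho ^+ 2))).
  apply: kM; last exact: kC.
  by apply: kD; apply: kX; [exact: continuous_fst|exact: continuous_snd].
have [cp0 cp1 cp2] := continuous_plateau.
have cc (f : R -> R) : continuous f -> continuous (fun y => f (n y)) by move=> cf; apply: kcomp => // y; exact: cf.
exists (fun y => plateau (n y)), (fun y => plateau1 (n y) * x1 y), (fun y => plateau1 (n y) * x2 y).
exists (fun y => plateau2 (n y) * x1 y ^+ 2 + plateau1 (n y) * (rho ^+ 2)^-1).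
exists (fun y => plateau2 (n y) * x2 y ^+ 2 + plateau1 (n y) * (rho ^+ 2)^-1).
split.
- split.
  + by move=> y; apply: d_eq (is_derive_compV (dn _ y) (is_derive_plateau _)) _ => /=; ring.
  + by move=> y; apply: d_eq (is_derive_compV (dn _ y) (is_derive_plateau _)) _ => /=; ring.
  + by move=> y; apply: d_eq (dM (is_derive_compV (dn _ y) (is_derive_plateau1 _)) (dx1 y)) _ => /=; ring.
  + by move=> y; apply: d_eq (dM (is_derive_compV (dn _ y) (is_derive_plateau1 _)) (dx2 y)) _ => /=; ring.
  + exact: cc.
  + by apply: kM => //; exact: cc.
  + by apply: kM => //; exact: cc.
  + by apply: kD; apply: kM; [exact: cc|exact: kX|exact: cc|exact: kC].
  + by apply: kD; apply: kM; [exact: cc|exact: kX|exact: cc|exact: kC].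
- move=> y; have [b0 b1 b2] := plateau_bound (n y).
  have [n2|n2] := leP 2 (n y).
    have [-> -> ->] := plateau_far n2; rewrite !mul0r !addr0 normr0.
    by have N0 : 0 <= N by [rewrite /N; olra]; split.
  have y2 : `|y - a| <= 2 * rho.
    rewrite -(@ler_pXn2r _ 2) ?nnegrE ?mulr_ge0 ?(ltW r0)//.
    apply: le_trans (norm_le_nsq _) _; move: n2; rewrite /n ltr_pdivrMr ?mulr_gt0//.
    by rewrite exprMn; olra.
  have bx1 : `|x1 y| <= 2 / rho.
    rewrite /x1 normrM normfV [`|rho ^+ 2|]ger0_norm ?(ltW r2)// ler_pdivrMr//.
    rewrite (_ : 2 / rho * rho ^+ 2 = 2 * rho); last by field.
    exact: le_trans (norm_fst_le _) y2.
  have bx2 : `|x2 y| <= 2 / rho.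
    rewrite /x2 normrM normfV [`|rho ^+ 2|]ger0_norm ?(ltW r2)// ler_pdivrMr//.
    rewrite (_ : 2 / rho * rho ^+ 2 = 2 * rho); last by field.
    exact: le_trans (norm_snd_le _) y2.
  have sq (x : R) : `|x| <= 2 / rho -> `|x ^+ 2| <= 4 / rho ^+ 2.
    move=> h; rewrite expr2; apply: le_trans (mul_le h h) _.
    by rewrite le_eqVlt; apply/orP; left; apply/eqP; field.
  have m1 := mul_le b1 bx1; have m2 := mul_le b1 bx2.
  have m3 := mul_le b2 (sq _ bx1); have m4 := mul_le b2 (sq _ bx2).
  have h9 : `|(rho ^+ 2)^-1| <= (rho ^+ 2)^-1 by rewrite ger0_norm// ltW.
  have m5 := mul_le b1 h9.
  split => //.
  + by apply: le_trans m1 _; rewrite /N; olra.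
  + by apply: le_trans m2 _; rewrite /N; olra.
  + apply: le_trans (ler_normD _ _) _.
    apply: le_trans (lerD (le_trans (ler_normD _ _) (lerD m3 m5)) (le_trans (ler_normD _ _) (lerD m4 m5))) _.
    by rewrite /N; olra.
- move=> y yr; have n1 : n y <= 1.
    rewrite /n ler_pdivrMr ?mulr_gt0// mul1r; apply: le_trans (nsq_le_norm _) _.
    by rewrite ler_wpM2l// lerXn2r// ?nnegrE ?(ltW r0)// ltW.
  by have [-> -> ->] := plateau_near n1; split => //; ring.
- move=> y /negP; rewrite -leNgt => yr; have n2 : 2 <= n y.
    rewrite /n ler_pdivlMr ?mulr_gt0//; apply: le_trans (norm_le_nsq _).
    rewrite (_ : 2 * (2 * rho ^+ 2) = (2 * rho) ^+ 2); last by ring.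
    have r20 : 0 <= 2 * rho by rewrite mulr_ge0// ltW.
    by rewrite lerXn2r ?nnegrE.
  by have [-> -> ->] := plateau_far n2; split => //; ring.
Qed.

End cutoff_functions.

(** * Defining functions of the domain near a boundary point *)

Section charts.
Context {R : realType}.
Variable Om : set (R * R).
Hypothesis oOm : open Om.
Implicit Types (a p x y z v h : R * R).

(** The defining function is the signed height over the boundary graph, extended to the whole plane.
    It is affine with slope 1 in the axis direction [v], so heights can be prescribed by moving
    along [v]; being a sum of one-variable functions, it has zero mixed derivatives. *)
Record chart (p : R * R) (eps B : R) (v : R * R) (b b1 b2 b11 b22 : R * R -> R) : Prop := Chart {
  chart_C2 : C2_fun b b1 b2 b11 b22;
  chart_d12 : forall x, is_derive x (0, 1) b1 0;
  chart_d21 : forall x, is_derive x (1, 0) b2 0;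
  chart_eps : 0 < eps;
  chart_B : 1 <= B;
  chart_bound : forall x, `|x - p| < eps -> [/\ `|b1 x| <= B, `|b2 x| <= B, `|b11 x| <= B & `|b22 x| <= B];
  chart_dom : forall x, `|x - p| < eps -> Om x <-> 0 < b x;
  chart_p : b p = 0;
  chart_v : `|v.1| + `|v.2| = 1;
  chart_t : forall y (t : R), b (y + t *: v) = b y + t;
  chart_grad : forall y, 1 <= b1 y ^+ 2 + b2 y ^+ 2;
  chart_norm : `|v| = 1 }.

Lemma continuous_bound_ball (f : R * R -> R) p (r : R) : continuous f ->
  exists2 C : R, 0 <= C & forall x, `|x - p| < r -> `|f x| <= C.
Proof.
move=> cf; have [C HC] : exists C : R, forall x, cbox p r x -> `|f x| <= C.
  by apply: compact_fun_bounded; [exact: compact_cbox|exact: continuous_subspaceT].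
exists `|C| => // x xr; apply: le_trans (HC x _) (ler_norm _).
by apply/cboxE; exact: ltW.
Qed.

Lemma chart_of_function p (eps : R) v b b1 b2 b11 b22 : 0 < eps -> bdry Om p ->
  C2_fun b b1 b2 b11 b22 -> (forall x, is_derive x (0, 1) b1 0) ->
  (forall x, is_derive x (1, 0) b2 0) -> (forall x, `|x - p| < eps -> Om x <-> 0 < b x) ->
  `|v.1| + `|v.2| = 1 -> (forall y (t : R), b (y + t *: v) = b y + t) ->
  (forall y, 1 <= b1 y ^+ 2 + b2 y ^+ 2) -> `|v| = 1 -> exists B, chart p eps B v b b1 b2 b11 b22.
Proof.
move=> e0 [cp ip] C2 d12 d21 dom v1 bt bg vn; have [_ _ _ _ cb cb1 cb2 cb11 cb22] := C2.
have [C1 C10 H1] := continuous_bound_ball p eps cb1.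
have [C2' C20 H2] := continuous_bound_ball p eps cb2.
have [C3 C30 H3] := continuous_bound_ball p eps cb11.
have [C4 C40 H4] := continuous_bound_ball p eps cb22.
exists (1 + C1 + C2' + C3 + C4); split => //; first by olra.
  move=> x xp; have := H1 x xp; have := H2 x xp; have := H3 x xp; have := H4 x xp => h1 h2 h3 h4.
  by split; olra.
(* The height at [p] is not positive since [p] is not an interior point, and not negative since the
   domain has points arbitrarily close to [p]. *)
apply/eqP; rewrite eq_le; apply/andP; split.
  rewrite leNgt; apply/negP => bp; apply: ip.
  by apply: open_nbhs_nbhs; split => //; apply/dom => //; rewrite subrr normr0.
rewrite leNgt; apply/negP => bp.
have bp2 : 0 < - b p by rewrite oppr_gt0.
move/cvgrPdist_lt : (cb p) => /(_ _ bp2) /nbhs_ballP[d /= d0 Hd].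
have m0 : 0 < Num.min d eps by rewrite lt_min d0.
have [x [Ox xm]] := cp _ (nbhsx_ballx p _ m0).
move: xm; rewrite -ball_normE/= distrC lt_min => /andP[xd xe].
have Hx : ball p d x by rewrite -ball_normE/= distrC.
have := Hd x Hx; rewrite ltr_norml => /andP[h1 h2]; have := (dom x xe).1 Ox; olra.
Qed.

Lemma chart_exists p : C2_boundary Om -> bdry Om p ->
  exists eps B v b b1 b2 b11 b22, chart p eps B v b b1 b2 b11 b22.
Proof.
move=> c2 bp; have [e [g [sw [s [e0 ck dom]]]]] := c2 p bp.
have [dg ck1] := ck; have [dg1 ck2] := ck1 1; have c2g := ck2 1.
pose g1 : R -> R := 'D_1 g; pose g2 : R -> R := 'D_1 g1.
rewrite -/g1 -/g2 in dg1 c2g.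
have D1 (x : R) : is_derive x (1 : R) g (g1 x) by apply/derivableP; exact: dg.
have D2 (x : R) : is_derive x (1 : R) g1 (g2 x) by apply/derivableP; exact: dg1.
have cg : continuous g by move=> t; apply/differentiable_continuous/derivable1_diffP; case: (D1 t).
have cg1 : continuous g1 by move=> t; apply/differentiable_continuous/derivable1_diffP; case: (D2 t).
pose sg : R := (-1) ^+ s.
have sg2 : sg * sg = 1 by rewrite -expr2 sqrr_sign.
have sgn : `|sg| = 1 by rewrite normr_sign.
have kf (f : R -> R) : continuous f -> continuous (fun y : R * R => f y.1).
  by move=> cf; apply: kcomp; [move=> y; exact: cf|exact: continuous_fst].
have ks (f : R -> R) : continuous f -> continuous (fun y : R * R => f y.2).
  by move=> cf; apply: kcomp; [move=> y; exact: cf|exact: continuous_snd].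
have cN (f : R * R -> R) : continuous f -> continuous (fun y => - f y).
  by move=> cf y; apply: (@continuousN _ _ _ f); exact: cf.
exists e; case: sw dom => /= dom.
  have [B HB] : exists B, chart p e B (sg, 0) (fun y => sg * (y.1 - g y.2)) (fun=> sg)
      (fun y => - (sg * g1 y.2)) (fun=> 0) (fun y => - (sg * g2 y.2)).
    apply: chart_of_function => //=.
    - split.
      + move=> x; apply: d_eq (dZ sg (dB (is_derive_fst x _) (is_derive_compV (is_derive_snd x _) (D1 x.2)))) _ => /=; ring.
      + move=> x; apply: d_eq (dZ sg (dB (is_derive_fst x _) (is_derive_compV (is_derive_snd x _) (D1 x.2)))) _ => /=; ring.
      + by move=> x; exact: dC.
      + move=> x; apply: d_eq (dN (dZ sg (is_derive_compV (is_derive_snd x _) (D2 x.2)))) _ => /=; ring.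
      + by apply: kM; [exact: kC|apply: kB; [exact: continuous_fst|exact: ks]].
      + exact: kC.
      + by apply: cN; apply: kM; [exact: kC|exact: ks].
      + exact: kC.
      + by apply: cN; apply: kM; [exact: kC|exact: ks].
    - move=> x; apply: d_eq (dN (dZ sg (is_derive_compV (is_derive_snd x _) (D2 x.2)))) _ => /=; ring.
    - by move=> x xp; apply: dom; rewrite -ball_normE/= distrC.
    - by rewrite sgn normr0 addr0.
    - move=> y t; rewrite scaler0 addr0 (_ : sg * (y.1 + t *: sg - g y.2) = sg * (y.1 - g y.2) + t * (sg * sg)); last by rewrite /GRing.scale/=; ring.
      by rewrite sg2 mulr1.
    - by move=> y; rewrite expr2 sg2 lerDl sqr_ge0.
    - by rewrite prod_normE/= sgn normr0; apply/max_idPl.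
  by exists B; do 6 eexists; exact: HB.
have [B HB] : exists B, chart p e B (0, sg) (fun y => sg * (y.2 - g y.1)) (fun y => - (sg * g1 y.1))
    (fun=> sg) (fun y => - (sg * g2 y.1)) (fun=> 0).
  apply: chart_of_function => //=.
  - split.
    + move=> x; apply: d_eq (dZ sg (dB (is_derive_snd x _) (is_derive_compV (is_derive_fst x _) (D1 x.1)))) _ => /=; ring.
    + move=> x; apply: d_eq (dZ sg (dB (is_derive_snd x _) (is_derive_compV (is_derive_fst x _) (D1 x.1)))) _ => /=; ring.
    + move=> x; apply: d_eq (dN (dZ sg (is_derive_compV (is_derive_fst x _) (D2 x.1)))) _ => /=; ring.
    + by move=> x; exact: dC.
    + by apply: kM; [exact: kC|apply: kB; [exact: continuous_snd|exact: kf]].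
    + by apply: cN; apply: kM; [exact: kC|exact: kf].
    + exact: kC.
    + by apply: cN; apply: kM; [exact: kC|exact: kf].
    + exact: kC.
  - move=> x; apply: d_eq (dN (dZ sg (is_derive_compV (is_derive_fst x _) (D2 x.1)))) _ => /=; ring.
  - by move=> x xp; apply: dom; rewrite -ball_normE/= distrC.
  - by rewrite sgn normr0 add0r.
  - move=> y t; rewrite scaler0 addr0 (_ : sg * (y.2 + t *: sg - g y.1) = sg * (y.2 - g y.1) + t * (sg * sg)); last by rewrite /GRing.scale/=; ring.
    by rewrite sg2 mulr1.
  - by move=> y; rewrite [sg ^+ 2]expr2 sg2 lerDr sqr_ge0.
  - by rewrite prod_normE/= sgn normr0; apply/max_idPr.
by exists B; do 6 eexists; exact: HB.
Qed.

Lemma C2_dir f f1 f2 f11 f22 x v : C2_fun f f1 f2 f11 f22 ->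
  is_derive x v f (v.1 * f1 x + v.2 * f2 x).
Proof.
move=> [d1 d2 _ _ _ c1 c2 _ _]; apply: (@partials_directional _ _ _ _ _ _ 1) => //.
exact: c1.
exact: c2.
Qed.

Lemma chart_lipschitz p eps B v b b1 b2 b11 b22 x y : chart p eps B v b b1 b2 b11 b22 ->
  `|x - p| + `|y - x| < eps -> [/\ `|b y - b x| <= 2 * B * `|y - x|,
   `|b1 y - b1 x| <= 2 * B * `|y - x| & `|b2 y - b2 x| <= 2 * B * `|y - x|].
Proof.
move=> [[d1 d2 d11 d22 _ _ _ _ _] d12 d21 _ B1 bb _ _ _ _ _ _] xy.
have B0 : 0 <= B by olra.
have zin z : `|z - x| < eps - `|x - p| -> `|z - p| < eps.
  by move=> zx; have := ler_distD x z p; olra.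
have yx : `|y - x| < eps - `|x - p| by olra.
split.
- by apply: (@partials_lipschitz _ b b1 b2 _ _ _ _ _ yx) => z /zin /bb[h1 h2 h3 h4].
- by apply: (@partials_lipschitz _ b1 b11 (fun=> 0) _ _ _ _ _ yx) => z /zin /bb[h1 h2 h3 h4]; rewrite normr0.
- by apply: (@partials_lipschitz _ b2 (fun=> 0) b22 _ _ _ _ _ yx) => z /zin /bb[h1 h2 h3 h4]; rewrite normr0.
Qed.

End charts.

(** * Boundary decay and the reflection in a chart *)

Section reflected_charts.
Context {R : realType}.
Variable Om : set (R * R).
Hypothesis oOm : open Om.
Implicit Types (a p x y z v h : R * R).

Lemma H10_dir psi psi1 psi2 x h : H10 Om psi psi1 psi2 -> Om x ->
  is_derive x h psi (h.1 * psi1 x + h.2 * psi2 x).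
Proof.
move=> [_ [c1 _] [c2 _] _ dpsi] Ox.
have [r r0 Hr] := (nbhs_ballP x _).1 (open_nbhs_nbhs (conj oOm Ox)).
apply: (@partials_directional _ _ _ _ _ _ r) => //; [|exact: c1|exact: c2].
by move=> z zx; apply: dpsi; apply: Hr; rewrite -ball_normE/= distrC.
Qed.

Lemma norm_dir_le (v : R * R) : `|v.1| + `|v.2| = 1 -> `|v| <= 1.
Proof.
by move=> v1; rewrite prod_normE ge_max -v1 lerDl lerDr !normr_ge0.
Qed.

(** Descending along [-v] one reaches the boundary after the length [b y], inside the domain all the
    way, and [psi] tends to 0 there. The gradient bound along this segment gives the decay. *)
Lemma chart_decay p (eps B : R) v b b1 b2 b11 b22 psi psi1 psi2 (L : R) y :
  chart Om p eps B v b b1 b2 b11 b22 -> H10 Om psi psi1 psi2 ->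
  (forall x, Om x -> `|psi1 x| <= L /\ `|psi2 x| <= L) ->
  Om y -> `|y - p| < eps -> `|y - p| + b y < eps -> `|psi y| <= L * b y.
Proof.
move=> ch hpsi HL Oy yp ye.
have v1 := norm_dir_le (chart_v ch).
have s0 : 0 < b y by exact/(chart_dom ch yp).
have L0 : 0 <= L by apply: le_trans (HL y Oy).1.
have near (t : R) : 0 <= t -> t <= b y -> `|y - t *: v - p| < eps.
  move=> t0 ts; rewrite addrAC; apply: le_lt_trans (ler_normB _ _) _; apply: le_lt_trans ye.
  rewrite lerD2l normrZ ger0_norm//; apply: le_trans ts; rewrite ler_piMr//.
have bt (t : R) : b (y - t *: v) = b y - t by rewrite -scaleNr (chart_t ch).
have inO (t : R) : 0 <= t -> t < b y -> Om (y - t *: v).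
  by move=> t0 ts; apply/(chart_dom ch (near t t0 (ltW ts))); rewrite bt subr_gt0.
have out : ~ Om (y - b y *: v).
  by move/(chart_dom ch (near _ (ltW s0) (lexx _))); rewrite bt subrr ltxx.
apply/ler_addgt0Pr => e e0.
have [K [cK KO HK]] := (let: And5 _ _ _ w _ := hpsi in w) e e0.
have nK : (~` K) (y - b y *: v) by move=> /KO.
have oK : open (~` K) by apply: closed_openC; exact: compact_plane_closed.
have [r r0 Hr] := (nbhs_ballP _ _).1 (open_nbhs_nbhs (conj oK nK)); rewrite /= in r0.
(* Zero boundary values only say that [psi] is small outside a compact set, so the segment stops
   slightly before the exit point: still in the domain, already off the compact set. *)
pose t := b y - Num.min (b y) r / 2.
have m0 : 0 < Num.min (b y) r by rewrite lt_min s0.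
have mb : Num.min (b y) r <= b y by rewrite ge_min lexx.
have mr : Num.min (b y) r <= r by rewrite ge_min lexx orbT.
have t0 : 0 <= t by rewrite /t; olra.
have ts : t < b y by rewrite /t; olra.
have small : `|psi (y - t *: v)| < e.
  apply: HK; first exact: inO.
  apply: Hr; rewrite -ball_normE/= (_ : _ - _ = (t - b y) *: v); last first.
    rewrite opprB [LHS]addrC addrA subrK. exact: esym (scalerBl t (b y) v).
  rewrite normrZ distrC ger0_norm ?subr_ge0 ?(ltW ts)//.
  apply: (@le_lt_trans _ _ (b y - t)); last by rewrite /t; olra.
  by rewrite ler_piMr// subr_ge0 ltW.
have seg (u : R) : 0 <= u <= 1 -> Om (y + u *: (- t *: v)).
  move=> /andP[u0 u1]; rewrite scalerA mulrN scaleNr; apply: inO; first exact: mulr_ge0.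
  by apply: le_lt_trans ts; rewrite ler_piMl.
have [u /andP[u0 u1]] := @segment_mvt _ psi (fun z => (- t *: v).1 * psi1 z + (- t *: v).2 * psi2 z) y (- t *: v)
  (fun u hu => H10_dir _ hpsi (seg u hu)).
have uI : 0 <= u <= 1 by rewrite !ltW.
have [h1 h2] := HL _ (seg u uI).
set z := y + u *: _ in h1 h2 * => Ez.
have B1 : `|psi (y - t *: v) - psi y| <= L * t.
  rewrite -scaleNr Ez (_ : _ + _ = - t * (v.1 * psi1 z + v.2 * psi2 z)); last first.
    by rewrite /=/GRing.scale/=; ring.
  rewrite normrM normrN (ger0_norm t0) [leLHS]mulrC ler_wpM2r//.
  apply: le_trans (ler_normD _ _) _; rewrite !normrM -[leRHS]mul1r -(chart_v ch) mulrDl.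
  by apply: lerD; apply: ler_wpM2l.
have := ler_distD (psi (y - t *: v)) (psi y) 0; rewrite !subr0 distrC.
have : L * t <= L * b y by rewrite ler_wpM2l// ltW.
by clear - B1 small oOm; move: (psi y) (psi (y - t *: v)) B1 small => *; olra.
Qed.

Section reflection_algebra.
Variables (B t n1 n2 g1 g2 : R).
Let n := n1 ^+ 2 + n2 ^+ 2.
Hypothesis B1 : 1 <= B.
Hypothesis n_ge1 : 1 <= n.
Hypothesis n1B : `|n1| <= B.
Hypothesis n2B : `|n2| <= B.
Hypothesis g1t : `|g1 - n1| <= t.
Hypothesis g2t : `|g2 - n2| <= t.
Hypothesis g1B : `|g1 - n1| <= 2 * B.
Hypothesis g2B : `|g2 - n2| <= 2 * B.
Let c1 := n1 / n.
Let c2 := n2 / n.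

Let div_le (x : R) : `|x| <= B -> `|x / n| <= B.
Proof.
move=> xB; have n1' := n_ge1; have np : 0 < n by olra.
rewrite normrM normfV [`|n|]ger0_norm ?(ltW np)// ler_pdivrMr//.
have B0 : 0 <= B by apply: le_trans B1.
by apply: le_trans xB _; rewrite ler_peMr.
Qed.

(** The common shape of the three isometry defects: a polynomial in [g - n] without constant
    term. *)
Lemma quad_bound (k1 k2 d1 d2 : R) : `|k1| <= 2 * B -> `|k2| <= 2 * B -> `|d1| <= B -> `|d2| <= B ->
  `|- 2 * (k1 * (g1 - n1) + k2 * (g2 - n2)) +
    4 * (d1 * d2) * (2 * (n1 * (g1 - n1) + n2 * (g2 - n2)) + ((g1 - n1) * (g1 - n1) + (g2 - n2) * (g2 - n2)))| <=
  40 * B ^+ 3 * t.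
Proof.
move=> k1B k2B d1B d2B; have t0 : 0 <= t by apply: le_trans g1t.
have B0 : 0 <= B by apply: le_trans B1.
have a1 := mul_le k1B g1t; have a2 := mul_le k2B g2t.
have a3 := mul_le n1B g1t; have a4 := mul_le n2B g2t.
have a5 := mul_le g1B g1t; have a6 := mul_le g2B g2t.
have a7 := mul_le d1B d2B.
have q : `|2 * (n1 * (g1 - n1) + n2 * (g2 - n2)) + ((g1 - n1) * (g1 - n1) + (g2 - n2) * (g2 - n2))| <=
    8 * (B * t).
  apply: le_trans (ler_normD _ _) _.
  have h1 : `|2 * (n1 * (g1 - n1) + n2 * (g2 - n2))| <= 2 * (B * t + B * t).
    by rewrite normrM [`|2|]ger0_norm// ler_wpM2l// (le_trans (ler_normD _ _))// lerD.
  have h2 := le_trans (ler_normD _ _) (lerD a5 a6).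
  by apply: le_trans (lerD h1 h2) _; olra.
have a8 := mul_le a7 q.
have b1 : `|- 2 * (k1 * (g1 - n1) + k2 * (g2 - n2))| <= 2 * (2 * B * t + 2 * B * t).
  by rewrite mulNr normrN normrM [`|2|]ger0_norm// ler_wpM2l// (le_trans (ler_normD _ _))// lerD.
apply: le_trans (ler_normD _ _) _; rewrite -mulrA [X in _ + X]normrM [`|4|]ger0_norm//.
have B3 : B * t <= B ^+ 3 * t.
  by apply: ler_wpM2r => //; rewrite exprS ler_peMr// exprn_ege1.
have := ler_wpM2l (ler0n R 4) a8; olra.
Qed.

(** The differential of the map is the identity minus [2 * c] tensor [g], where [c] is [n] divided
    by its squared length and [g] is the gradient at the current point. For [g = n] this is an
    orthogonal reflection, so the defects vanish to first order in [g - n]. *)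
Lemma reflection_iso : [/\ `|(1 - 2 * c1 * g1) ^+ 2 + (- 2 * c1 * g2) ^+ 2 - 1| <= 40 * B ^+ 3 * t,
  `|(- 2 * c2 * g1) ^+ 2 + (1 - 2 * c2 * g2) ^+ 2 - 1| <= 40 * B ^+ 3 * t &
  `|(1 - 2 * c1 * g1) * (- 2 * c2 * g1) + (- 2 * c1 * g2) * (1 - 2 * c2 * g2)| <= 40 * B ^+ 3 * t].
Proof.
have nn : n != 0 by apply/eqP => h; move: n_ge1; rewrite h; olra.
have c1B : `|c1| <= B by exact: div_le. have c2B : `|c2| <= B by exact: div_le.
have B0 : 0 <= B by apply: le_trans B1.
have z0 : `|0 : R| <= B by rewrite normr0.
have h1 : n1 = n * c1 by rewrite /c1; field.
have h2 : n2 = n * c2 by rewrite /c2; field.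
have c1n : 4 * (c1 * c1) * n = 4 * c1 * n1 by rewrite [in RHS]h1; ring.
have c2n : 4 * (c2 * c2) * n = 4 * c2 * n2 by rewrite [in RHS]h2; ring.
have c12n : 4 * (c1 * c2) * n = 2 * (c2 * n1 + c1 * n2) by rewrite [in RHS]h1 [in RHS]h2; ring.
have c12B : `|2 * c1| <= 2 * B by rewrite normrM ger0_norm// ler_wpM2l.
have c22B : `|2 * c2| <= 2 * B by rewrite normrM ger0_norm// ler_wpM2l.
have z2 : `|0 : R| <= 2 * B by rewrite normr0 mulr_ge0.
have c1B' : `|c1| <= 2 * B by apply: le_trans c1B _; olra.
have c2B' : `|c2| <= 2 * B by apply: le_trans c2B _; olra.
split.
- have := quad_bound c12B z2 c1B c1B; apply: le_trans; rewrite le_eqVlt; apply/orP; left; apply/eqP.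
  congr `|_|; apply/eqP; rewrite -subr_eq0; apply/eqP.
  by transitivity (4 * (c1 * c1) * n - 4 * c1 * n1); [rewrite /n; ring|rewrite c1n subrr].
- have := quad_bound z2 c22B c2B c2B; apply: le_trans; rewrite le_eqVlt; apply/orP; left; apply/eqP.
  congr `|_|; apply/eqP; rewrite -subr_eq0; apply/eqP.
  by transitivity (4 * (c2 * c2) * n - 4 * c2 * n2); [rewrite /n; ring|rewrite c2n subrr].
- have := quad_bound c2B' c1B' c1B c2B; apply: le_trans; rewrite le_eqVlt; apply/orP; left; apply/eqP.
  congr `|_|; apply/eqP; rewrite -subr_eq0; apply/eqP.
  by transitivity (4 * (c1 * c2) * n - 2 * (c2 * n1 + c1 * n2)); [rewrite /n; ring|rewrite c12n subrr].
Qed.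

End reflection_algebra.

(* The reflection across the level set of the defining function, along its gradient at [a]. *)
Lemma chart_reflection p (eps B : R) v b b1 b2 b11 b22 (rho : R) a :
  chart Om p eps B v b b1 b2 b11 b22 -> 0 < rho -> 32 * B ^+ 2 * rho <= eps -> 15 * 16 * B ^+ 4 * rho <= 1 ->
  Om a -> `|a - p| < rho ->
  exists P P1 P2 P11 P22 Q Q1 Q2 Q11 Q22,
  [/\ reflection Om (10 * (40 * (2 * (9 * B ^+ 6)))) (11 * B ^+ 2)^-1 (b a) [set y | `|y - a| < 2 * rho] a
         P P1 P2 P11 P22 Q Q1 Q2 Q11 Q22,
      0 < b a,
      forall y, Om y -> `|y - a| < 2 * rho -> [/\ 0 < b y, b y <= 4 * B * `|(P y, Q y) - a| &
         `|y - (P y, Q y)| <= 2 * B * b y] &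
      forall y, Om y -> `|y - a| < 2 * rho -> `|y - p| + b y < eps ].
Proof.
move=> ch r0 re rB Oa ap; have [C2b d12 d21 e0 B1 bb dom bp v1 bt bg _] := ch.
have [db1 db2 db11 db22 cb cb1 cb2 cb11 cb22] := C2b.
have B0 : 0 <= B by olra.
have BB : B <= B ^+ 2 by rewrite expr2 ler_peMr.
have rBr : rho <= B ^+ 2 * rho by rewrite ler_peMl ?(ltW r0)// exprn_ege1.
have Br : B * rho <= B ^+ 2 * rho by rewrite ler_wpM2r// ltW.
have ape : `|a - p| < eps by olra.
have ba0 : 0 < b a by exact/(dom a ape).
set n1 := b1 a; set n2 := b2 a; pose n := n1 ^+ 2 + n2 ^+ 2.
have n_ge1 : 1 <= n by exact: bg.
have n0 : 0 < n by olra.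
have nn : n != 0 by rewrite gt_eqF.
have [n1B n2B _ _] := bb a ape; rewrite -/n1 -/n2 in n1B n2B.
have divn (x : R) : `|x| <= B -> `|x / n| <= B.
  move=> xB; rewrite normrM normfV [`|n|]ger0_norm ?(ltW n0)// ler_pdivrMr//.
  by apply: le_trans xB _; rewrite ler_peMr.
have c1B := divn _ n1B; have c2B := divn _ n2B.
pose c1 := n1 / n; pose c2 := n2 / n; rewrite -/c1 -/c2 in c1B c2B.
(* The direction is frozen at [a]. The map is then as smooth as [b]; following the normal at each
   point would cost one derivative, and [b] has only two. *)
pose P y := y.1 - 2 * c1 * b y; pose Q y := y.2 - 2 * c2 * b y.
exists P, (fun y => 1 - 2 * c1 * b1 y), (fun y => - 2 * c1 * b2 y), (fun y => - 2 * c1 * b11 y),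
  (fun y => - 2 * c1 * b22 y).
exists Q, (fun y => - 2 * c2 * b1 y), (fun y => 1 - 2 * c2 * b2 y), (fun y => - 2 * c2 * b11 y),
  (fun y => - 2 * c2 * b22 y).
have geo y : Om y -> `|y - a| < 2 * rho -> [/\ `|y - p| < 3 * rho, 0 < b y, b y <= 6 * (B * rho) &
    `|(P y, Q y) - y| <= 2 * B * b y].
  move=> Oy ya; have yp : `|y - p| < 3 * rho by move: (ler_distD a y p) ya ap; clear - Om; lra.
  have ype : `|y - p| < eps by olra.
  have by0 : 0 < b y by exact/(dom y ype).
  have [h _ _] : [/\ `|b y - b p| <= 2 * B * `|y - p|, `|b1 y - b1 p| <= 2 * B * `|y - p| &
     `|b2 y - b2 p| <= 2 * B * `|y - p|] by apply: (chart_lipschitz ch); rewrite subrr normr0 add0r.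
  split => //.
    move: h; rewrite bp subr0 ger0_norm ?(ltW by0)// => h; apply: le_trans h _.
    rewrite (_ : 6 * (B * rho) = 2 * B * (3 * rho)); last by ring.
    by rewrite ler_wpM2l ?mulr_ge0// ltW.
  rewrite prod_normE ge_max /P /Q /=; apply/andP; split.
    rewrite addrAC subrr add0r normrN normrM [`|b y|]ger0_norm ?(ltW by0)// normrM ger0_norm//.
    by rewrite ler_wpM2r ?(ltW by0)// ler_wpM2l.
  rewrite addrAC subrr add0r normrN normrM [`|b y|]ger0_norm ?(ltW by0)// normrM ger0_norm//.
  by rewrite ler_wpM2r ?(ltW by0)// ler_wpM2l.
(* Moving from [y] to its image lowers [b] by at least [3/2] of [b y], so the image lies at height
   at most [- b y / 2], beyond the boundary. Since [b] is Lipschitz, this height difference from [a]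
   bounds the distance to [a] from below. *)
have main y : Om y -> `|y - a| < 2 * rho -> b a + b y / 2 <= 2 * B * `|(P y, Q y) - a|.
  move=> Oy ya; have [yp by0 byr Py] := geo y Oy ya.
  set h := (P y, Q y) - y in Py.
  have hE : h = (- (2 * c1 * b y), - (2 * c2 * b y)).
    by rewrite /h /P /Q; congr pair => /=; rewrite addrAC subrr add0r.
  have hr : `|h| <= 12 * (B ^+ 2 * rho).
    apply: le_trans Py _; have := ler_wpM2l (mulr_ge0 (ler0n R 2) B0) byr.
    by rewrite (_ : 2 * B * (6 * (B * rho)) = 12 * (B ^+ 2 * rho)); last by ring.
  have seg (t : R) : 0 <= t <= 1 -> `|y + t *: h - a| < 14 * (B ^+ 2 * rho).
    move=> /andP[t0 t1]; rewrite addrAC; apply: le_lt_trans (ler_normD _ _) _.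
    rewrite normrZ (ger0_norm t0).
    have th : t * `|h| <= `|h| by rewrite ler_piMl.
    by move: th hr ya rBr; clear - Om; lra.
  have [t /andP[t0 t1]] := @segment_mvt _ b (fun z => h.1 * b1 z + h.2 * b2 z) y h
    (fun t _ => C2_dir (y + t *: h) h C2b).
  have tI : 0 <= t <= 1 by rewrite !ltW.
  have za := seg t tI; set z := y + t *: h in za * => Ez.
  have [_ g1 g2] : [/\ `|b z - b a| <= 2 * B * `|z - a|, `|b1 z - b1 a| <= 2 * B * `|z - a| &
     `|b2 z - b2 a| <= 2 * B * `|z - a|] by apply: (chart_lipschitz ch); move: za ap re rBr r0; clear - Om; lra.
  have yh : y + h = (P y, Q y) by rewrite /h addrC subrK.
  rewrite yh in Ez.
  have bound : 28 * (B ^+ 3 * rho) = 2 * B * (14 * (B ^+ 2 * rho)) by ring.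
  have zB : 2 * B * `|z - a| <= 28 * (B ^+ 3 * rho).
    by rewrite bound ler_wpM2l ?mulr_ge0// ltW.
  have s1 := mul_le n1B (le_trans g1 zB); have s2 := mul_le n2B (le_trans g2 zB).
  have E4 : B * (28 * (B ^+ 3 * rho)) = 28 * (B ^+ 4 * rho) by ring.
  rewrite E4 in s1 s2; move: s1 s2; rewrite !ler_norml => /andP[s1 _] /andP[s2 _].
  have dot : 3 / 4 * n <= n1 * b1 z + n2 * b2 z.
    have -> : n1 * b1 z + n2 * b2 z = n + n1 * (b1 z - n1) + n2 * (b2 z - n2) by rewrite /n; ring.
    by move: s1 s2 n_ge1 rB; rewrite /n1 /n2; clear - Om; lra.
  have Ez' : b (P y, Q y) - b y = - (2 * b y / n) * (n1 * b1 z + n2 * b2 z).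
    by rewrite Ez hE /c1 /c2 /=; field.
  have neg : b (P y, Q y) <= - (b y / 2).
    have : 2 * b y / n * (3 / 4 * n) <= 2 * b y / n * (n1 * b1 z + n2 * b2 z).
      by rewrite ler_wpM2l// divr_ge0 ?mulr_ge0 ?(ltW n0) ?(ltW by0).
    rewrite (_ : 2 * b y / n * (3 / 4 * n) = 3 / 2 * b y); last by field.
    by move: Ez'; clear - Om; lra.
  have ea : 0 <= (1 : R) <= 1 by rewrite ler01 lexx.
  have := seg 1 ea; rewrite scale1r yh => Pa.
  have [q _ _] : [/\ `|b (P y, Q y) - b a| <= 2 * B * `|(P y, Q y) - a|,
     `|b1 (P y, Q y) - b1 a| <= 2 * B * `|(P y, Q y) - a| &
     `|b2 (P y, Q y) - b2 a| <= 2 * B * `|(P y, Q y) - a|] by apply: (chart_lipschitz ch); move: Pa ap re rBr r0; clear - Om; lra.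
  by apply: le_trans q; rewrite distrC; apply: le_trans (ler_norm _); move: neg; clear - Om; lra.
have far y : Om y -> `|y - a| < 2 * rho -> [/\ b y <= 4 * B * `|(P y, Q y) - a|,
    b a <= 2 * B * `|(P y, Q y) - a| & `|y - a| <= 9 * B ^+ 2 * `|(P y, Q y) - a|].
  move=> Oy ya; have [yp by0 byr Py] := geo y Oy ya; have m := main y Oy ya.
  have h1 : b y <= 4 * B * `|(P y, Q y) - a| by olra.
  split; [exact: h1|olra|].
  have : `|y - a| <= `|(P y, Q y) - y| + `|(P y, Q y) - a| by rewrite -(distrC y); exact: ler_distD.
  have h2 := ler_wpM2l (mulr_ge0 (ler0n R 2) B0) h1.
  have h3 : `|(P y, Q y) - a| <= B ^+ 2 * `|(P y, Q y) - a| by rewrite ler_peMl// exprn_ege1.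
  have h4 : 2 * B * (4 * B * `|(P y, Q y) - a|) = 8 * B ^+ 2 * `|(P y, Q y) - a| by ring.
  by olra.
have B6 (k : nat) : (k <= 6)%N -> B ^+ k <= B ^+ 6 by move=> k6; exact: ler_weXn2l.
have B60 : 0 <= B ^+ 6 by exact: exprn_ge0.
have N2 : 1 + 2 * B * B <= 10 * (40 * (2 * (9 * B ^+ 6))).
  by move: (B6 0%N isT) (B6 2%N isT); rewrite expr0 expr2 -mulrA; clear - Om; lra.
have N4 : 4 * (B * B) <= 10 * (40 * (2 * (9 * B ^+ 6))).
  by move: (B6 2%N isT) B60; rewrite expr2; clear - Om; lra.
have bin y : Om y -> `|y - a| < 2 * rho -> [/\ `|b1 y| <= B, `|b2 y| <= B, `|b11 y| <= B & `|b22 y| <= B].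
  by move=> Oy ya; have [yp _ _ _] := geo y Oy ya; apply: bb; move: yp re rBr r0; clear - Om; lra.
have dlin (k1 k2 : R) (f : R * R -> R) (x w : R * R) (d : R) : is_derive x w f d ->
    is_derive x w (fun y => k1 - 2 * k2 * f y) (- 2 * k2 * d).
  by move=> df; apply: d_eq (dB (dC k1 x w) (dZ (2 * k2) df)) _; ring.
split; [|exact: ba0| |].
- split.
  + split.
    * by move=> x; apply: d_eq (dB (is_derive_fst x _) (dZ (2 * c1) (db1 x))) _.
    * by move=> x; apply: d_eq (dB (is_derive_fst x _) (dZ (2 * c1) (db2 x))) _ => /=; ring.
    * by move=> x; exact: dlin.
    * by move=> x; exact: dZ.
    * by apply: kB; [exact: continuous_fst|apply: kM => //; exact: kC].
    * by apply: kB; [exact: kC|apply: kM => //; exact: kC].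
    * by apply: kM => //; exact: kC.
    * by apply: kM => //; exact: kC.
    * by apply: kM => //; exact: kC.
  + split.
    * by move=> x; apply: d_eq (dB (is_derive_snd x _) (dZ (2 * c2) (db1 x))) _ => /=; ring.
    * by move=> x; apply: d_eq (dB (is_derive_snd x _) (dZ (2 * c2) (db2 x))) _.
    * by move=> x; exact: dZ.
    * by move=> x; exact: dlin.
    * by apply: kB; [exact: continuous_snd|apply: kM => //; exact: kC].
    * by apply: kM => //; exact: kC.
    * by apply: kB; [exact: kC|apply: kM => //; exact: kC].
    * by apply: kM => //; exact: kC.
    * by apply: kM => //; exact: kC.
  + move=> y Oy ya; have [g1 g2 _ _] := bin y Oy ya.
    have P1 (c g : R) : `|c| <= B -> `|g| <= B -> `|2 * c * g| <= 2 * (B * B).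
      by move=> cB gB; rewrite -mulrA normrM ger0_norm// ler_wpM2l// mul_le.
    have P2 (c g : R) : `|c| <= B -> `|g| <= B -> `|- 2 * c * g| <= 10 * (40 * (2 * (9 * B ^+ 6))).
      move=> cB gB; rewrite !mulNr normrN; by apply: le_trans (P1 _ _ cB gB) _; move: N4 B60 (mulr_ge0 B0 B0); clear - Om; lra.
    have P3 (c g : R) : `|c| <= B -> `|g| <= B -> `|1 - 2 * c * g| <= 10 * (40 * (2 * (9 * B ^+ 6))).
      move=> cB gB; apply: le_trans (ler_normB _ _) _; rewrite normr1.
      by move: (P1 _ _ cB gB) N2; clear - Om; lra.
    by split; [exact: P3|exact: P2|exact: P2|exact: P3].
  + move=> y Oy ya; have [_ _ g1 g2] := bin y Oy ya.
    have P1 (c g g' : R) : `|c| <= B -> `|g| <= B -> `|g'| <= B ->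
        `|- 2 * c * g + - 2 * c * g'| <= 10 * (40 * (2 * (9 * B ^+ 6))).
      move=> cB gB gB'; rewrite (_ : _ + _ = - (2 * (c * (g + g')))); last by ring.
      rewrite normrN normrM ger0_norm//.
      by move: (mul_le cB (le_trans (ler_normD _ _) (lerD gB gB'))) N4; clear - Om; lra.
    by split; exact: P1.
  (* The constant 11 adds the 9 in the bound of [|y - a|] to the 2 in the bound of [b a]. *)
  + move=> y Oy ya; have [f1 f2 f3] := far y Oy ya.
    rewrite mulrC ler_pdivrMr; last by rewrite mulr_gt0// exprn_gt0// (lt_le_trans ltr01).
    rewrite mulrC.
    have : 2 * B * `|(P y, Q y) - a| <= 2 * B ^+ 2 * `|(P y, Q y) - a|.
      by rewrite ler_wpM2r// ler_wpM2l.
    olra.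
  + move=> y Oy ya; have [f1 f2 f3] := far y Oy ya; have [g1 g2 _ _] := bin y Oy ya.
    have [yp _ _ _] := geo y Oy ya; rewrite /= in ya.
    have [_ l1 l2] : [/\ `|b y - b a| <= 2 * B * `|y - a|, `|b1 y - b1 a| <= 2 * B * `|y - a| &
     `|b2 y - b2 a| <= 2 * B * `|y - a|] by apply: (chart_lipschitz ch); move: ya ap re rBr r0; clear - Om; lra.
    have m1 : `|b1 y - n1| <= 2 * B by apply: le_trans (ler_normB _ _) _; move: g1 n1B; clear - Om; lra.
    have m2 : `|b2 y - n2| <= 2 * B by apply: le_trans (ler_normB _ _) _; move: g2 n2B; clear - Om; lra.
    have [i1 i2 i3] := reflection_iso B1 n_ge1 n1B n2B l1 l2 m1 m2.
    have fin : 40 * B ^+ 3 * (2 * B * `|y - a|) <= 10 * (40 * (2 * (9 * B ^+ 6))) * `|(P y, Q y) - a|.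
      apply: (@le_trans _ _ (40 * B ^+ 3 * (2 * B * (9 * B ^+ 2 * `|(P y, Q y) - a|)))).
        by rewrite ler_wpM2l ?mulr_ge0 ?exprn_ge0// ler_wpM2l ?mulr_ge0.
      rewrite (_ : 40 * B ^+ 3 * _ = 40 * (2 * (9 * B ^+ 6)) * `|(P y, Q y) - a|); last by ring.
      by rewrite ler_wpM2r//; move: B60; clear - Om; lra.
    by split; [apply: le_trans i1 fin|apply: le_trans i2 fin|apply: le_trans i3 fin].
- move=> y Oy ya; have [yp by0 byr Py] := geo y Oy ya; have [f1 _ _] := far y Oy ya.
  by split => //; rewrite distrC.
- by move=> y Oy ya; have [yp by0 byr Py] := geo y Oy ya; olra.
Qed.

End reflected_charts.

(** * Calculus of the log-Lipschitz modulus *)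

Section modulus.
Context {R : realType}.
Implicit Types (A r t q K T : R).

Definition th A r := r * (A + ln r^-1).

(** Tailored to telescoping: the modulus at the length of a step is at most the decrease of [th]
    over that step, provided the additive constant is enlarged. It rests on
    [q * ln (1/q) <= 1 - q]. *)
Lemma th_step A q t : 0 < q -> q < 1 -> 0 < t ->
  th A ((1 - q) * t) <= th (A + 1 + ln (1 - q)^-1) t - th (A + 1 + ln (1 - q)^-1) (q * t).
Proof.
move=> q0 q1 t0; have q1' : 0 < 1 - q by rewrite subr_gt0.
have lq : q * ln q^-1 <= 1 - q.
  have := @le_ln1Dx R (q^-1 - 1); rewrite addrCA subrr addr0.
  have qi : 0 < q^-1 by rewrite invr_gt0.
  have h : -1 < q^-1 - 1 by olra.
  move=> /(_ h) h'; have := ler_wpM2l (ltW q0) h'.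
  by rewrite mulrBr mulfV ?gt_eqF// mulr1.
rewrite /th !invfM !lnM ?posrE ?invr_gt0//.
set l1 := ln (1 - q)^-1; set l := ln t^-1; set lq1 := ln q^-1 in lq *.
rewrite -subr_ge0 (_ : _ - _ = t * ((1 - q) - q * lq1)); last by ring.
by rewrite mulr_ge0 ?(ltW t0)// subr_ge0.
Qed.

(** The path from [T] to 0 is cut at the points [q^n * T]. The bounds telescope by [th_step], and
    continuity at 0 supplies the end point. *)
Lemma chain_bound (f : R -> R) A q K T : 0 <= K -> 0 < q -> q < 1 -> 0 < T -> T <= 1 -> 0 <= A ->
  f t @[t --> 0] --> f 0 ->
  (forall t, 0 < t -> t <= T -> `|f t - f (q * t)| <= K * th A ((1 - q) * t)) ->
  `|f T - f 0| <= K * th (A + 1 + ln (1 - q)^-1) T.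
Proof.
move=> K0 q0 q1 T0 T1 A0 cf H; set A' := A + 1 + _.
have q1' : 0 < 1 - q by rewrite subr_gt0.
have A'0 : 0 <= A'.
  rewrite /A' !addr_ge0// ln_ge0// -[leLHS]invr1 lef_pV2 ?posrE//; olra.
have step n : `|f T - f (q ^+ n * T)| <= K * (th A' T - th A' (q ^+ n * T)).
  elim: n => [|n ih]; first by rewrite expr0 mul1r !subrr normr0 mulr0.
  have qn0 : 0 < q ^+ n * T by rewrite mulr_gt0// exprn_gt0.
  have qnT : q ^+ n * T <= T by rewrite ler_piMl ?(ltW T0)// exprn_ile1// ltW.
  have h := H _ qn0 qnT; rewrite exprS -mulrA.
  have s := ler_wpM2l K0 (th_step A q0 q1 qn0); rewrite -/A' in s.
  have := ler_distD (f (q ^+ n * T)) (f T) (f (q * (q ^+ n * T))).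
  by olra.
apply/ler_addgt0Pr => e e0.
move/cvgrPdist_lt : cf => /(_ _ e0) /nbhs_ballP[d /= d0 Hd].
have [n Hn] : exists n, q ^+ n * T < d.
  have : q ^+ n @[n --> \oo] --> (0 : R) by apply: cvg_expr; rewrite ger0_norm// ltW.
  move/cvgrPdist_lt => /(_ d d0) [n _ Hn]; exists n.
  have := Hn n (leqnn n); rewrite sub0r normrN ger0_norm ?exprn_ge0 ?(ltW q0)// => h.
  by apply: le_lt_trans h; rewrite ler_piMr// exprn_ge0// ltW.
have qn0 : 0 < q ^+ n * T by rewrite mulr_gt0// exprn_gt0.
have h1 : `|f 0 - f (q ^+ n * T)| < e by apply: Hd; rewrite /ball/= sub0r normrN ger0_norm// ltW.
have th0 : 0 <= th A' (q ^+ n * T).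
  rewrite mulr_ge0 ?(ltW qn0)// addr_ge0// ln_ge0// -[leLHS]invr1 lef_pV2 ?posrE//.
  by apply: le_trans T1; rewrite ler_piMl ?(ltW T0)// exprn_ile1// ltW.
have h2 := step n; rewrite mulrBr in h2.
have h3 := mulr_ge0 K0 th0.
have := ler_distD (f (q ^+ n * T)) (f T) (f 0); rewrite [X in _ <= _ + X]distrC; olra.
Qed.

Lemma th_scale A (l r : R) : 1 <= l -> 0 < r -> th A (l * r) <= l * th A r.
Proof.
move=> l1 r0; have l0 : 0 < l by olra.
rewrite /th invfM lnM ?posrE ?invr_gt0// -mulrA ler_wpM2l ?(ltW l0)// ler_wpM2l ?(ltW r0)//.
by rewrite lerD2l gerDr ln_le0// invf_le1.
Qed.

Lemma th_mono A A' r : A <= A' -> 0 <= r -> th A r <= th A' r.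
Proof. by move=> AA r0; rewrite /th ler_wpM2l// lerD2r. Qed.

Lemma th_ge0 A r : 0 <= A -> 0 <= r -> r <= 1 -> 0 <= th A r.
Proof.
move=> A0; rewrite le_eqVlt => /orP[/eqP<- _|r0 r1]; first by rewrite /th mul0r.
by rewrite mulr_ge0 ?(ltW r0)// addr_ge0// ln_ge0// -[leLHS]invr1 lef_pV2 ?posrE.
Qed.

Lemma log_term_th (r0 k : R) : 0 < r0 -> 0 < k -> k <= 2 * r0 ->
  k * (1 + ln ((2 * (2 * r0) ^+ 2 + k ^+ 2) / k ^+ 2)) <= 2 * th (1 + `|ln (12 * r0 ^+ 2)|) k.
Proof.
move=> r00 k0 kr; have k2 : 0 < k ^+ 2 by rewrite exprn_gt0.
have n0 : 0 < 2 * (2 * r0) ^+ 2 + k ^+ 2 by rewrite ltr_wpDl// mulr_ge0// sqr_ge0.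
have m0 : 0 < 12 * r0 ^+ 2 by rewrite mulr_gt0// exprn_gt0.
rewrite /th [leRHS]mulrCA ler_wpM2l ?(ltW k0)// lnM ?posrE ?invr_gt0//.
have -> : ln (k ^+ 2)^-1 = 2 * ln k^-1 by rewrite -exprVn lnXn ?invr_gt0// mulr_natl.
have : ln (2 * (2 * r0) ^+ 2 + k ^+ 2) <= ln (12 * r0 ^+ 2).
  by rewrite ler_ln ?posrE//; nra.
have := ler_norm (ln (12 * r0 ^+ 2)); have := normr_ge0 (ln (12 * r0 ^+ 2)); olra.
Qed.

End modulus.

(** * Oscillation of gradients between nearby points, in the interior and near the boundary *)

Section local_modulus.
Context {R : realType}.
Variable Om : set (R * R).
Hypothesis oOm : open Om.
Hypothesis bOm : bounded_set Om.
Implicit Types (a p x y z v h c k : R * R).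

Record potential psi psi1 psi2 w (M L m : R) : Prop := Potential {
  pot_H10 : H10 Om psi psi1 psi2;
  pot_w : bmeas Om w M;
  pot_eq : distr_laplacian Om psi w;
  pot_M : 0 <= M; pot_L : 0 <= L; pot_m : 0 <= m;
  pot_bound : forall x, Om x -> `|psi x| <= m;
  pot_bound1 : forall x, Om x -> `|psi1 x| <= L /\ `|psi2 x| <= L }.

(** Quantified over all potentials, it is a property of two points of the domain alone; estimates
    along a chain of points can then be added without carrying the data. *)
Definition grad_osc (K : R) x y := forall psi psi1 psi2 w (M L m : R) c,
  potential psi psi1 psi2 w M L m -> c = (1, 0) \/ c = (0, 1) ->
  `|(c.1 * psi1 x + c.2 * psi2 x) - (c.1 * psi1 y + c.2 * psi2 y)| <= K * (M + L + m).

Lemma grad_osc_sym K x y : grad_osc K x y -> grad_osc K y x.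
Proof. by move=> H psi psi1 psi2 w M L m c hp hc; rewrite distrC; exact: H hp hc. Qed.

Lemma grad_osc_le K K' x y : K <= K' -> grad_osc K x y -> grad_osc K' x y.
Proof.
move=> KK H psi psi1 psi2 w M L m c hp hc; apply: le_trans (H _ _ _ _ _ _ _ _ hp hc) _.
by have [_ _ _ M0 L0 m0 _ _] := hp; rewrite ler_wpM2r// !addr_ge0.
Qed.

Lemma grad_osc_trans K K' x y z : grad_osc K x y -> grad_osc K' y z -> grad_osc (K + K') x z.
Proof.
move=> H H' psi psi1 psi2 w M L m c hp hc; rewrite mulrDl.
exact: le_trans (ler_distD _ _ _) (lerD (H _ _ _ _ _ _ _ _ hp hc) (H' _ _ _ _ _ _ _ _ hp hc)).
Qed.

(** Away from the boundary nothing has to be reflected: the role of the image is played by a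
    constant map with value at a fixed distance from [a], that is, a constant is subtracted from the
    kernel difference. This makes one estimate serve both cases, with no gradient bound required
    here. *)
Lemma interior_step p : Om p -> exists2 r : R, 0 < r & exists2 K : R, 0 <= K & exists2 A : R, 0 <= A &
  forall a k, Om a -> Om (a + k) -> `|a - p| < r -> 0 < `|k| -> `|k| <= r / 2 ->
  grad_osc (K * th A `|k|) (a + k) a.
Proof.
move=> Op; have [r0 r00 Or] := dom_norm bOm.
have {}Or x : Om x -> `|x| <= r0 by move=> /Or /ltW.
have [r /= rr Hr] := (nbhs_ballP p _).1 (open_nbhs_nbhs (conj oOm Op)).
have [rho rho0 r8] : exists2 rho : R, 0 < rho & r = 8 * rho.
  by exists (r / 8); [rewrite divr_gt0|field].
have inr y : `|y - p| < r -> Om y by move=> yp; apply: Hr; rewrite -ball_normE/= distrC.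
have [N N0 HN] := cutoff_exists rho0.
(* A constant map has isometry defect 1. Its value stays at distance at least [3 * rho] from [a], so
   [N' * rho >= 1] makes this defect admissible. *)
pose N' := N + rho^-1; have N'0 : 0 <= N' by rewrite addr_ge0// invr_ge0 ltW.
have NN' : N <= N' by rewrite lerDl invr_ge0 ltW.
have N'r : 1 <= N' * rho.
  by rewrite mulrDl mulVf ?gt_eqF// lerDr mulr_ge0// ltW.
have one0 : (0 : R) < 1 := ltr01.
have B c : c = (1, 0) \/ c = (0, 1) -> _ :=
  fun hc => reflection_gradient_bound oOm bOm hc one0 (lexx 1) rho0 N'0 r00 Or.
have [C C0 HC] : exists2 C : R, 0 <= C & forall a k, Om a -> Om (a + k) -> `|a - p| < rho ->
    0 < `|k| -> `|k| <= rho / 2 -> grad_osc (C * (`|k| * (1 + ln ((2 * (2 * r0) ^+ 2 + `|k| ^+ 2) / `|k| ^+ 2)))) (a + k) a.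
  have [C1 C10 H1] := B (1, 0) (or_introl erefl); have [C2 C20 H2] := B (0, 1) (or_intror erefl).
  exists ((C1 + C2) * (1 + rho^-1)); first by rewrite mulr_ge0 ?addr_ge0// invr_ge0 ltW.
  move=> a k Oa Ob ap k0 kr psi psi1 psi2 w M L m c [h1 h2 h3 M0 L0 m0 b0 b1] hc.
  have [eta [eta1 [eta2 [eta11 [eta22 hcut]]]]] := HN a.
  have hcut' : cutoff N' rho [set y | `|y - a| < 2 * rho] a eta eta1 eta2 eta11 eta22.
    by case: hcut => d1 d2 d3 d4; split => // y; have [? ? ? ?] := d2 y; split => //; exact: le_trans NN'.
  pose z0 : R * R := (p.1 + 4 * rho, p.2).
  have za : 3 * rho <= `|z0 - a|.
    have h : `|z0 - p| = 4 * rho.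
      have r40 : 0 <= 4 * rho by olra.
      by rewrite prod_normE /z0 /= subrr normr0 addrAC subrr add0r ger0_norm//; apply/max_idPl.
    by have := ler_distD a z0 p; rewrite h; olra.
  have cst2 (x : R) : C2_fun (fun=> x) (fun=> 0) (fun=> 0) (fun=> 0) (fun=> 0 : R).
    by split; try (by move=> y; exact: dC); exact: kC.
  have href : reflection Om N' 1 rho [set y | `|y - a| < 2 * rho] a (fun=> z0.1) (fun=> 0) (fun=> 0)
      (fun=> 0) (fun=> 0) (fun=> z0.2) (fun=> 0) (fun=> 0) (fun=> 0) (fun=> 0).
    have z0E : (z0.1, z0.2) = z0 by [].
    split => //.
    - by move=> y _ _; rewrite normr0.
    - by move=> y _ _; rewrite addr0 normr0.
    - by move=> y _ /= ya; rewrite z0E mul1r; olra.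
    - move=> y _ _; rewrite z0E expr0n/= mul0r !addr0 sub0r normrN normr1 normr0.
      have h : 1 <= N' * `|z0 - a| by apply: le_trans N'r _; rewrite ler_wpM2l//; olra.
      by split => //; rewrite mulr_ge0.
  have hvan : vanishing Om (fun y => eta y * `|y - (z0.1, z0.2)|).
    move=> e e0; exists (cbox a (2 * rho)); split; first exact: compact_cbox.
      by move=> y /cboxE ya; apply: inr; have := ler_distD a y p; olra.
    move=> y _ ny; have [|-> _ _ _] := (let: Cutoff _ _ _ far := hcut in far) y.
      by move=> /= ya; apply: ny; apply/cboxE; exact: ltW.
    by rewrite mul0r normr0.
  have kd : `|k| <= 1 * rho / 2 by rewrite mul1r.
  have A0 : 0 <= m / rho by rewrite divr_ge0// ltW.
  have psiA y : Om y -> [set y | `|y - a| < 2 * rho] y -> `|psi y| <= m / rho * `|(z0.1, z0.2) - a|.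
    move=> Oy _; apply: le_trans (b0 y Oy) _; rewrite mulrAC ler_pdivlMr// ler_wpM2l//.
    by rewrite (_ : (z0.1, z0.2) = z0)//; olra.
  have fin (C' : R) : 0 <= C' -> C' <= C1 + C2 ->
      C' * (M + m / rho + m) <= (C1 + C2) * (1 + rho^-1) * (M + L + m).
    move=> C'0 CC; rewrite -mulrA; apply: ler_pM => //; first by rewrite !addr_ge0.
    have ri : 0 <= rho^-1 by rewrite invr_ge0 ltW.
    have := mulr_ge0 ri M0; have := mulr_ge0 ri L0; olra.
  set LL := 1 + ln _; have LL0 : 0 <= `|k| * LL.
    rewrite mulr_ge0// addr_ge0// ln_ge0// ler_pdivlMr ?exprn_gt0// mul1r lerDr mulr_ge0// sqr_ge0 //.
  rewrite mulrAC; case: hc => ->.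
    apply: le_trans (H1 a k rho _ _ _ _ _ _ _ _ _ _ _ _ _ _ _ _ _ _ _ _ M (m / rho) m
      Oa Ob k0 kd kr rho0 hcut' href hvan h1 h2 h3 M0 A0 m0 b0 psiA) _.
    by rewrite -mulrA -/LL; apply: ler_wpM2r => //; apply: fin => //; rewrite lerDl.
  apply: le_trans (H2 a k rho _ _ _ _ _ _ _ _ _ _ _ _ _ _ _ _ _ _ _ _ M (m / rho) m
      Oa Ob k0 kd kr rho0 hcut' href hvan h1 h2 h3 M0 A0 m0 b0 psiA) _.
  by rewrite -mulrA -/LL; apply: ler_wpM2r => //; apply: fin => //; rewrite lerDr.
exists rho => //; exists (2 * C); first by rewrite mulr_ge0.
exists (1 + `|ln (12 * r0 ^+ 2)|); first by rewrite addr_ge0.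
move=> a k Oa Ob ap k0 kr; apply: grad_osc_le (HC a k Oa Ob ap k0 kr).
rewrite [2 * C]mulrC -mulrA ler_wpM2l//; apply: log_term_th => //.
rewrite (_ : k = (a + k) - a); last by rewrite addrAC subrr add0r.
by apply: le_trans (ler_normB _ _) _; have := Or _ Oa; have := Or _ Ob; olra.
Qed.

Lemma reflection_le (N N' c0 d : R) U a (p p1 p2 p11 p22 q q1 q2 q11 q22 : R * R -> R) : N <= N' ->
  reflection Om N c0 d U a p p1 p2 p11 p22 q q1 q2 q11 q22 ->
  reflection Om N' c0 d U a p p1 p2 p11 p22 q q1 q2 q11 q22.
Proof.
move=> NN [cp cq rb rl rf ri]; split => // y Oy Uy.
- by have [? ? ? ?] := rb y Oy Uy; split; exact: le_trans NN.
- by have [? ?] := rl y Oy Uy; split; exact: le_trans NN.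
- by have [h1 h2 h3] := ri y Oy Uy; split; [apply: le_trans h1 _|apply: le_trans h2 _|apply: le_trans h3 _];
    rewrite ler_wpM2r.
Qed.

(** The step must be short compared with the height of [a], so that the singularities are closer to
    each other than to any reflected point. Longer steps are obtained by chaining. *)
Lemma boundary_step p (eps B : R) v b b1 b2 b11 b22 : chart Om p eps B v b b1 b2 b11 b22 ->
  exists2 r : R, 0 < r /\ r <= eps & exists2 K : R, 0 <= K & exists2 A : R, 0 <= A & exists2 c0 : R, 0 < c0 <= 1 &
  forall a k, Om a -> Om (a + k) -> `|a - p| < r -> 0 < `|k| -> `|k| <= r / 2 ->
  `|k| <= c0 * b a / 2 -> grad_osc (K * th A `|k|) (a + k) a.
Proof.
move=> ch; have e0 := chart_eps ch; have B1 := chart_B ch.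
have [r0 r00 Or] := dom_norm bOm.
have {}Or x : Om x -> `|x| <= r0 by move=> /Or /ltW.
have B0 : 0 < B by olra.
have B2 : 0 < 32 * B ^+ 2 by rewrite mulr_gt0// exprn_gt0.
have B4 : 0 < 15 * 16 * B ^+ 4 by rewrite mulr_gt0// exprn_gt0.
pose rho := Num.min (eps / (32 * B ^+ 2)) (15 * 16 * B ^+ 4)^-1.
have rho0 : 0 < rho by rewrite lt_min divr_gt0//= invr_gt0.
have re : 32 * B ^+ 2 * rho <= eps by rewrite mulrC -ler_pdivlMr// ge_min lexx.
have rB : 15 * 16 * B ^+ 4 * rho <= 1 by rewrite mulrC -ler_pdivlMr// mul1r ge_min lexx orbT.
clearbody rho.
have B21 : 1 <= B ^+ 2 by exact: exprn_ege1.
have re' : 32 * rho <= eps.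
  by apply: le_trans re; rewrite ler_wpM2r ?(ltW rho0)// ler_peMr.
have [Nc Nc0 HN] := cutoff_exists rho0.
pose Nr := 10 * (40 * (2 * (9 * B ^+ 6))).
have Nr0 : 0 <= Nr by have := exprn_ge0 6 (ltW B0); rewrite /Nr; olra.
have N0 : 0 <= Nc + Nr by exact: addr_ge0.
pose c0 := (11 * B ^+ 2)^-1.
have c00 : 0 < c0 by rewrite invr_gt0; olra.
have c01 : c0 <= 1 by rewrite invf_le1; olra.
have RB c (hc : c = (1, 0) \/ c = (0, 1)) :=
  reflection_gradient_bound oOm bOm hc c00 c01 rho0 N0 r00 Or.
have [C1 C10 H1] := RB (1, 0) (or_introl erefl); have [C2 C20 H2] := RB (0, 1) (or_intror erefl).
exists rho; first by split=> //; olra.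
exists ((C1 + C2) * (1 + 4 * B) * 2); first by rewrite !mulr_ge0// addr_ge0// ?mulr_ge0// ltW.
exists (1 + `|ln (12 * r0 ^+ 2)|); first by rewrite addr_ge0.
exists c0; first by rewrite c00.
move=> a k Oa Ob ap k0 kr kd psi psi1 psi2 w M L m c [h1 h2 h3 M0 L0 m0 b0 bl] hc.
have [P [P1 [P2 [P11 [P22 [Q [Q1 [Q2 [Q11 [Q22 [href ba0 geo near]]]]]]]]]]] :=
  chart_reflection ch rho0 re rB Oa ap.
have [eta [eta1 [eta2 [eta11 [eta22 hcut]]]]] := HN a.
have hcut' : cutoff (Nc + Nr) rho [set y | `|y - a| < 2 * rho] a eta eta1 eta2 eta11 eta22.
  have NN : Nc <= Nc + Nr by rewrite lerDl.
  by case: hcut => d1 d2 d3 d4; split => // y; have [? ? ? ?] := d2 y; split => //; exact: le_trans NN.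
have href' := reflection_le (_ : Nr <= Nc + Nr) href.
have NrN : Nr <= Nc + Nr by rewrite lerDr.
have {}href' := href' NrN.
have cb := C2_c (chart_C2 ch).
have hvan : vanishing Om (fun y => eta y * `|y - (P y, Q y)|).
  move=> e e_0; pose e' := e / (2 * B).
  have e'0 : 0 < e' by rewrite divr_gt0// mulr_gt0.
  exists (cbox a (2 * rho) `&` [set y | e' <= b y]); split.
  - apply: compact_closedI; first exact: compact_cbox.
    by apply: (@closed_comp _ _ b [set x | e' <= x]) => //; exact: closed_ge.
  - move=> y [/cboxE ya /= by0].
    have yp : `|y - p| < eps by have := ler_distD a y p; olra.
    by apply/(chart_dom ch yp); exact: lt_le_trans by0.
  - move=> y Oy ny; have [ya|ya] := ltP `|y - a| (2 * rho); last first.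
      have [|-> _ _ _] := (let: Cutoff _ _ _ far := hcut in far) y; first by move=> /=; rewrite ltNge ya.
      by rewrite mul0r normr0.
    have [by0 _ yP] := geo y Oy ya; have [e1 _ _ _] := (let: Cutoff _ bound _ _ := hcut in bound) y.
    have be : b y < e'.
      by rewrite ltNge; apply/negP => eb; apply: ny; split => //; apply/cboxE; exact: ltW.
    rewrite normrM normr_id; apply: le_lt_trans (ler_pM _ _ e1 yP) _ => //.
    by rewrite mul1r mulrC -ltr_pdivlMr// mulr_gt0.
have A0 : 0 <= 4 * B * L by rewrite !mulr_ge0// ltW.
(* The decay [|psi| <= L * b] is combined with the bound of the height of [y] by the distance of its
   reflected point to [a]. *)
have psiA y : Om y -> [set y | `|y - a| < 2 * rho] y -> `|psi y| <= 4 * B * L * `|(P y, Q y) - a|.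
  move=> Oy /= ya; have [by0 byP _] := geo y Oy ya.
  have yp : `|y - p| < eps by have := ler_distD a y p; olra.
  apply: le_trans (chart_decay oOm ch h1 bl Oy yp (near y Oy ya)) _.
  by rewrite [4 * B * L]mulrC -mulrA ler_wpM2l.
have fin (C' : R) : 0 <= C' -> C' <= C1 + C2 ->
    C' * (M + 4 * B * L + m) <= (C1 + C2) * (1 + 4 * B) * (M + L + m).
  move=> C'0 CC; rewrite -(mulrA (C1 + C2)); apply: ler_pM => //; first by apply: addr_ge0 => //; exact: addr_ge0.
  have Bge : 0 <= B := ltW B0.
  by have := mulr_ge0 Bge M0; have := mulr_ge0 Bge m0; olra.
have kk : `|k| <= 2 * r0.
  rewrite (_ : k = (a + k) - a); last by rewrite addrAC subrr add0r.
  by apply: le_trans (ler_normB _ _) _; have := Or _ Oa; have := Or _ Ob; olra.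
have T := log_term_th r00 k0 kk.
have TT (C' : R) : 0 <= C' -> C' <= C1 + C2 ->
    C' * (M + 4 * B * L + m) * `|k| * (1 + ln ((2 * (2 * r0) ^+ 2 + `|k| ^+ 2) / `|k| ^+ 2)) <=
    (C1 + C2) * (1 + 4 * B) * 2 * th (1 + `|ln (12 * r0 ^+ 2)|) `|k| * (M + L + m).
  move=> C'0 CC; have pos : 0 <= C' * (M + 4 * B * L + m).
    by apply: mulr_ge0 => //; apply: addr_ge0 => //; exact: addr_ge0.
  rewrite -(mulrA (C' * _)); apply: le_trans (ler_wpM2l pos T) _.
  have th0 : 0 <= 2 * th (1 + `|ln (12 * r0 ^+ 2)|) `|k|.
    apply: le_trans T; rewrite mulr_ge0// addr_ge0// ln_ge0// ler_pdivlMr ?exprn_gt0// mul1r.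
    by rewrite lerDr mulr_ge0// sqr_ge0.
  apply: le_trans (ler_wpM2r th0 (fin C' C'0 CC)) _.
  by rewrite le_eqVlt; apply/orP; left; apply/eqP; ring.
case: hc => ->.
  apply: le_trans (H1 a k (b a) _ _ _ _ _ _ _ _ _ _ _ _ _ _ _ _ _ _ _ _ M (4 * B * L) m
      Oa Ob k0 kd kr ba0 hcut' href' hvan h1 h2 h3 M0 A0 m0 b0 psiA) _.
  by apply: TT => //; rewrite lerDl.
apply: le_trans (H2 a k (b a) _ _ _ _ _ _ _ _ _ _ _ _ _ _ _ _ _ _ _ _ M (4 * B * L) m
      Oa Ob k0 kd kr ba0 hcut' href' hvan h1 h2 h3 M0 A0 m0 b0 psiA) _.
by apply: TT => //; rewrite lerDr.
Qed.

End local_modulus.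

(** * The modulus of the gradient on the whole domain, by compactness *)

Section global_modulus.
Context {R : realType}.
Variable Om : set (R * R).
Hypothesis oOm : open Om.
Hypothesis bOm : bounded_set Om.
Implicit Types (a p x y z v h c k : R * R).

Lemma pot_dir_continuous psi psi1 psi2 w M L m c x : potential Om psi psi1 psi2 w M L m -> Om x ->
  {for x, continuous (fun y => c.1 * psi1 y + c.2 * psi2 y)}.
Proof.
move=> [[_ [c1 _] [c2 _] _ _] _ _ _ _ _ _ _] Ox.
apply: (@continuousD _ _ _ (fun y => c.1 * psi1 y) (fun y => c.2 * psi2 y)).
  by apply: (@continuousM _ _ (fun=> c.1)); [exact: cvg_cst|exact: c1].
by apply: (@continuousM _ _ (fun=> c.2)); [exact: cvg_cst|exact: c2].
Qed.

(* Two points near the boundary are first lifted along [v] to a distance comparable to their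
   separation; the vertical displacements are cut into geometrically decreasing steps. *)
Lemma boundary_modulus p (eps B : R) v b b1 b2 b11 b22 : chart Om p eps B v b b1 b2 b11 b22 ->
  exists2 r : R, 0 < r & exists2 K : R, 0 <= K & exists2 A : R, 0 <= A &
  forall x y, Om x -> Om y -> `|x - p| < r -> `|y - p| < r -> x != y ->
  grad_osc Om (K * th A `|x - y|) x y.
Proof.
move=> ch; have [rho [rho0 rhoe] [K K0 [A A0 [c0 /andP[c00 c01] H]]]] := boundary_step oOm bOm ch.
have v1 := chart_norm ch; have bt := chart_t ch.
(* After a lift by [lam * |x - y|] the height exceeds that lift, so the step of length [|x - y|]
   between the lifted points meets the restriction of [boundary_step]. *)
pose lam := 2 / c0; have lam2 : 2 <= lam by rewrite ler_pdivlMr//; olra.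
have lc : c0 * lam = 2 by rewrite /lam mulrCA mulfV ?mulr1// gt_eqF.
(* Descending from offset [t] to offset [q * t] is a step of length [c0 * t / 2], admissible because
   the height at offset [t] exceeds [t]. *)
pose q := 1 - c0 / 2; have q0 : 0 < q by rewrite /q; olra.
have q1 : q < 1 by rewrite /q; olra.
have qc : 1 - q = c0 / 2 by rewrite /q; ring.
pose A' := A + 1 + ln (1 - q)^-1.
have AA' : A <= A'.
  rewrite /A' -addrA lerDl addr_ge0// ln_ge0// -[leLHS]invr1 lef_pV2 ?posrE//; olra.
have D0 : 0 < 1 + 2 * lam by olra.
pose r := Num.min (rho / (2 * (1 + 2 * lam))) (2 * lam)^-1.
have r0 : 0 < r by rewrite lt_min divr_gt0 ?mulr_gt0//= invr_gt0; olra.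
have rr : r * (2 * (1 + 2 * lam)) <= rho by rewrite -ler_pdivlMr ?mulr_gt0// ge_min lexx.
have rl : 2 * lam * r <= 1 by rewrite mulrC -ler_pdivlMr ?mul1r ?ge_min ?lexx ?orbT//; olra.
clearbody r q lam.
have rlam : r * lam = lam * r by rewrite mulrC.
exists r => //; exists (K * (2 * lam + 1)); first by rewrite mulr_ge0//; olra.
exists A'; first exact: le_trans AA'.
have lift x (T : R) : Om x -> `|x - p| < r -> 0 < T -> T <= lam * (2 * r) ->
    [/\ forall t : R, 0 <= t -> t <= T -> Om (x + t *: v) /\ `|x + t *: v - p| < rho &
     grad_osc Om (K * th A' T) (x + T *: v) x].
  move=> Ox xp T0 TT.
  have xpe : `|x - p| < eps by olra.
  have bx0 : 0 < b x by exact/(chart_dom ch xpe).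
  have near (t : R) : 0 <= t -> t <= T -> `|x + t *: v - p| < rho.
    move=> t0 tT; rewrite addrAC; apply: le_lt_trans (ler_normD _ _) _.
    by rewrite normrZ v1 mulr1 ger0_norm//; olra.
  have inO (t : R) : 0 <= t -> t <= T -> Om (x + t *: v).
    move=> t0 tT; have h : `|x + t *: v - p| < eps by apply: lt_le_trans (near t t0 tT) rhoe.
    by apply/(chart_dom ch h); rewrite bt; olra.
  split; first by move=> t t0 tT; split; [exact: inO|exact: near].
  move=> psi psi1 psi2 w M L m c hp hc.
  pose g y := c.1 * psi1 y + c.2 * psi2 y; pose f (t : R) := g (x + t *: v).
  have MLm : 0 <= M + L + m by case: hp => _ _ _ M0 L0 m0 _ _; rewrite !addr_ge0.
  have f0 : f 0 = g x by rewrite /f scale0r addr0.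
  have KM : 0 <= K * (M + L + m) by rewrite mulr_ge0.
  have T1 : T <= 1 by olra.
  have cf : f t @[t --> 0] --> f 0.
    have cg : {for x + (0 : R) *: v, continuous g}.
      by rewrite scale0r addr0; exact: pot_dir_continuous hp Ox.
    apply: (@continuous_comp _ _ _ (fun t : R => x + t *: v) g) => //.
    apply: cvgD; first exact: cvg_cst.
    by apply: cvgZr_tmp; exact: cvg_id.
  have := @chain_bound _ f A q (K * (M + L + m)) T KM q0 q1 T0 T1 A0 cf.
  rewrite f0 -/A' (_ : K * (M + L + m) * th A' T = K * th A' T * (M + L + m)); last by ring.
  apply=> t t0 tT; rewrite -[leRHS]mulrAC.
  have qt0 : 0 < q * t by rewrite mulr_gt0.
  have qt : q * t <= t by rewrite ler_piMl ?ltW.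
  have qtT : q * t <= T by exact: le_trans qt tT.
  have kE : x + q * t *: v + ((1 - q) * t) *: v = x + t *: v.
    by rewrite -addrA -scalerDl; congr (_ + _ *: _); ring.
  have kn : `|((1 - q) * t) *: v| = (1 - q) * t.
    by rewrite normrZ v1 mulr1 ger0_norm// mulr_ge0 ?ltW// subr_gt0.
  have kE' : x + t *: v + (- ((1 - q) * t)) *: v = x + (q * t) *: v.
    by rewrite -addrA -scalerDl; congr (_ + _ *: _); ring.
  have kn' : `|(- ((1 - q) * t)) *: v| = (1 - q) * t by rewrite scaleNr normrN.
  have q1t : 0 < (1 - q) * t by rewrite mulr_gt0// subr_gt0.
  have := H (x + t *: v) (- ((1 - q) * t) *: v).
  rewrite kE' kn' => /(_ (inO t (ltW t0) tT) (inO _ (ltW qt0) qtT) (near t (ltW t0) tT) q1t).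
  have s1 : (1 - q) * t <= rho / 2.
    rewrite qc; have : c0 / 2 * t <= 1 / 2 * t by rewrite ler_wpM2r ?(ltW t0)//; olra.
    by olra.
  have s2 : (1 - q) * t <= c0 * b (x + t *: v) / 2.
    by rewrite qc bt; move: (mulr_ge0 (ltW c00) (ltW bx0)); clear - oOm bOm; lra.
  move=> /(_ s1 s2 _ _ _ _ _ _ _ _ hp hc).
  by rewrite -/(g (x + (q * t) *: v)) -/(g (x + t *: v)) distrC -mulrA [th _ _ * _]mulrC mulrA.
move=> x y Ox Oy xp yp xy.
have rxy : 0 < `|x - y| by rewrite normr_gt0 subr_eq0.
have xy2 : `|x - y| <= 2 * r by move: (ler_distD p x y) xp yp; rewrite (distrC p y); clear - oOm bOm; lra.
pose T := lam * `|x - y|.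
have T0 : 0 < T by rewrite mulr_gt0//; olra.
have TT : T <= lam * (2 * r) by rewrite ler_wpM2l//; olra.
have [inx Hx] := lift x T Ox xp T0 TT; have [iny Hy] := lift y T Oy yp T0 TT.
have [OxT xT] := inx T (ltW T0) (lexx T); have [OyT yT] := iny T (ltW T0) (lexx T).
have kE : x + T *: v + (y - x) = y + T *: v by rewrite addrAC addrCA subrr addr0.
have Hm : grad_osc Om (K * th A `|x - y|) (y + T *: v) (x + T *: v).
  have := H (x + T *: v) (y - x); rewrite kE [`|y - x|]distrC; apply => //.
    have : r * (2 * (1 + 2 * 2)) <= r * (2 * (1 + 2 * lam)) by rewrite ler_wpM2l ?(ltW r0)//; olra.
    by olra.
  have bx0 : 0 < b x by apply/(chart_dom ch) => //; olra.
  rewrite bt; have : c0 * (b x + T) = c0 * b x + 2 * `|x - y| by rewrite /T mulrDr mulrA lc.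
  move: (mulr_gt0 c00 bx0); clear - oOm bOm; lra.
have := grad_osc_trans (grad_osc_sym Hx) (grad_osc_trans (grad_osc_sym Hm) Hy).
apply: grad_osc_le.
have thx := th_scale A' (le_trans (ler1n R 2) lam2) rxy.
have thm := th_mono AA' (ltW rxy).
by move: (ler_wpM2l K0 thx) (ler_wpM2l K0 thm); rewrite -/T; clear - oOm bOm; lra.
Qed.

Lemma closure_compact : compact (closure Om).
Proof.
have [r r0 Or] := dom_norm bOm.
apply: (subclosed_compact _ (@compact_cbox _ (0 : R * R) r)); first exact: closed_closure.
move=> p cp; apply/cboxE; rewrite leNgt subr0; apply/negP => rp.
have e0 : 0 < `|p| - r by rewrite subr_gt0.
have [x [Ox]] := cp _ (nbhsx_ballx p _ e0); rewrite -ball_normE/= => xe.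
have := Or x Ox; have := ler_distD x p 0; rewrite !subr0; olra.
Qed.

Lemma near_pinfty_pair (p : R * R) (r N0 : R) (P : R -> R * R -> Prop) : 0 < r ->
  (forall N x, N0 < N -> `|x - p| < r -> P N x) ->
  \forall x' \near p & N \near +oo%R, P N x'.
Proof.
move=> r0 H; exists (ball p r, [set N : R | N0 < N]) => /=.
  split; first exact: nbhsx_ballx.
  by exists N0; split; [exact: num_real|].
by move=> [x N] [/= xp NN]; apply: H => //; move: xp; rewrite -ball_normE/= distrC.
Qed.

Hypothesis C2b : C2_boundary Om.

Lemma closure_cases p : closure Om p -> Om p \/ bdry Om p.
Proof.
move=> cp; have [Op|nOp] := pselect (Om p); first by left.
by right; split => // ip; apply: nOp; exact: interior_subset ip.
Qed.

(** A single constant serves as the factor, as the parameter of [th] and as the inverse of the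
    admissible distance. The local estimates then become one property that holds for all large [N]
    near each point, and compactness of the closure makes it uniform. *)
Lemma gradient_modulus : exists2 N : R, 1 <= N & forall x y, Om x -> Om y -> x != y ->
  `|x - y| < N^-1 -> grad_osc Om (N * th N `|x - y|) x y.
Proof.
pose P N x := Om x -> forall y, Om y -> x != y -> `|x - y| < N^-1 ->
  grad_osc Om (N * th N `|x - y|) x y.
have loc p : closure Om p -> exists2 r : R, 0 < r & exists2 K : R, 0 <= K & exists2 A : R, 0 <= A &
    forall x y, Om x -> Om y -> `|x - p| < r -> `|y - p| < r -> x != y ->
    grad_osc Om (K * th A `|x - y|) x y.
  move=> /closure_cases[Op|bp]; last first.
    have [eps [B [v [b [b1 [b2 [b11 [b22 ch]]]]]]]] := chart_exists oOm C2b bp.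
    exact: boundary_modulus ch.
  have [r r0 [K K0 [A A0 H]]] := interior_step oOm bOm Op.
  exists (r / 4); first by rewrite divr_gt0.
  exists K => //; exists A => // x y Ox Oy xp yp xy.
  have kE : x + (y - x) = y by rewrite addrCA subrr addr0.
  have xr : `|x - p| < r by olra.
  have := H x (y - x) Ox; rewrite kE [`|y - x|]distrC => /(_ Oy xr).
  have d0 : 0 < `|x - y| by rewrite normr_gt0 subr_eq0.
  have d1 : `|x - y| <= r / 2 by have := ler_distD p x y; rewrite (distrC p y); olra.
  by move=> /(_ d0 d1) h; exact: grad_osc_sym.
have cov : \forall N \near +oo%R, closure Om `<=` P N.
  have := (compact_near_coveringP _).1 closure_compact R (+oo%R) P _.
  apply => p cp; have [r r0 [K K0 [A A0 H]]] := loc p cp.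
  have r2 : 0 < r / 2 by rewrite divr_gt0.
  apply: (@near_pinfty_pair _ (r / 2) (1 + K + A + 2 / r)) => // N x NN xp Ox y Oy xy xyN.
  have r2' : 0 < 2 / r by rewrite divr_gt0.
  have N0 : 0 < N by olra.
  have xyr : `|x - y| < r / 2.
    apply: lt_le_trans xyN _; rewrite -[r / 2]invrK invf_div lef_pV2 ?posrE//; olra.
  have xy1 : `|x - y| <= 1.
    by apply: (le_trans (ltW xyN)); rewrite invf_le1//; olra.
  apply: grad_osc_le (H x y Ox Oy _ _ xy); last 2 first.
  - olra.
  - by have := ler_distD x y p; rewrite (distrC y x); olra.
  apply: ler_pM => //; [exact: th_ge0|olra|apply: th_mono => //; olra].
have [N [HN N1]] := filter_ex (filterI cov (nbhs_pinfty_gt (num_real 1))).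
exists N; first exact: ltW.
by move=> x y Ox; apply: (HN x) => //; exact: subset_closure.
Qed.

(** A weak interior cone condition. It provides, near any point, a square of prescribed size on
    which difference quotients of the potential can be taken. *)
Lemma interior_boxes : exists2 N : R, 1 <= N & forall x (h : R), Om x -> 0 < h -> h < N^-1 ->
  exists2 z, `|z - x| <= N * h & cbox z h `<=` Om.
Proof.
pose P N x := Om x -> forall h : R, 0 < h -> h < N^-1 -> exists2 z, `|z - x| <= N * h & cbox z h `<=` Om.
have cov : \forall N \near +oo%R, closure Om `<=` P N.
  have := (compact_near_coveringP _).1 closure_compact R (+oo%R) P _.
  apply => p /closure_cases[Op|bp].
    have [r /= r0 Hr] := (nbhs_ballP p _).1 (open_nbhs_nbhs (conj oOm Op)).
    have r2 : 0 < r / 2 by rewrite divr_gt0.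
    have r2' : 0 < 2 / r by rewrite divr_gt0.
    apply: (@near_pinfty_pair _ (r / 2) (2 / r)) => // N x NN xp Ox h h0 hN.
    exists x; first by rewrite subrr normr0 mulr_ge0// ltW//; exact: lt_trans NN.
    move=> y /cboxE yx; apply: Hr; rewrite -ball_normE/= distrC.
    have hr : h < r / 2.
      apply: lt_trans hN _; rewrite -[r / 2]invrK invf_div ltf_pV2 ?posrE//; exact: lt_trans NN.
    by have := ler_distD x y p; olra.
  have [eps [B [v [b [b1 [b2 [b11 [b22 ch]]]]]]]] := chart_exists oOm C2b bp.
  have e0 := chart_eps ch; have B1 := chart_B ch; have bt := chart_t ch.
  have e2 : 0 < eps / 4 by rewrite divr_gt0.
  have e3 : 0 < 20 * B / eps by rewrite divr_gt0// mulr_gt0//; olra.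
  apply: (@near_pinfty_pair _ (eps / 4) (3 * B + 20 * B / eps)) => // N x NN xp Ox h h0 hN.
  have N0 : 0 < N by olra.
  have hB : 20 * B * h < eps.
    have Nh : N * h < 1 by rewrite mulrC -ltr_pdivlMr// mul1r.
    have : (20 * B / eps) * h < N * h by rewrite ltr_pM2r//; olra.
    move=> h1; have h2 : 20 * B / eps * h < 1 by olra.
    rewrite (_ : 20 * B * h = (20 * B / eps * h) * eps); first by rewrite gtr_pMl.
    by field; rewrite gt_eqF.
  have Bh : h <= B * h by rewrite ler_peMl// ltW.
  have zx : `|x + (3 * B * h) *: v - x| = 3 * B * h.
    by rewrite addrAC subrr add0r normrZ (chart_norm ch) mulr1 ger0_norm//; olra.
  (* The shift raises the height by [3 * B * h], while the height varies by at most [2 * B * h] over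
     the square. *)
  exists (x + (3 * B * h) *: v).
    by rewrite zx ler_wpM2r ?(ltW h0)//; olra.
  set z := x + _ in zx *; move=> y /cboxE yz.
  have zp : `|z - p| < eps / 2 by have := ler_distD x z p; olra.
  have yp : `|y - p| < eps by have := ler_distD z y p; olra.
  have [l _ _] : [/\ `|b y - b z| <= 2 * B * `|y - z|, `|b1 y - b1 z| <= 2 * B * `|y - z| &
     `|b2 y - b2 z| <= 2 * B * `|y - z|] by apply: (chart_lipschitz ch); olra.
  apply/(chart_dom ch yp).
  have xpe : `|x - p| < eps by olra.
  have bx0 := (chart_dom ch xpe).1 Ox.
  have bz : b z = b x + 3 * B * h by rewrite /z bt.
  have : 2 * B * `|y - z| <= 2 * B * h by rewrite ler_wpM2l//; olra.
  by move: l; rewrite distrC ler_norml => /andP[_ l]; rewrite bz in l; olra.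
have [N [HN N1]] := filter_ex (filterI cov (nbhs_pinfty_gt (num_real 1))).
exists N; first exact: ltW.
by move=> x h Ox; apply: (HN x) => //; exact: subset_closure.
Qed.

End global_modulus.

(** * Maximum principle, gradient bound and velocity modulus *)

Section uniform_bounds.
Context {R : realType}.
Variable Om : set (R * R).
Hypothesis oOm : open Om.
Hypothesis bOm : bounded_set Om.
Implicit Types (a p x y z v h c k : R * R) (f : R * R -> R).
Local Notation I h := (\int[leb2 R]_(x in Om) (h x)).
Let mO : measurable (Om : set (mplane R)) := measurable_dom oOm.

Lemma leb2_cbox a (r : R) : 0 < r -> \int[leb2 R]_(x in cbox a r) (1 : R) = 4 * r ^+ 2.
Proof.
move=> r0; have d1 x : is_derive x (1, 0) (fun z : R * R => z.1) ((fun=> 1) x) := is_derive_fst x (1, 0).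
rewrite (cbox_d1 a r0 (@kC _ _ (1 : R)) d1) /=.
rewrite (_ : Rintegral _ _ _ = \int[lebesgue_measure]_(t in `[a.2 - r, a.2 + r]) (2 * r)); last by apply: eq_Rintegral => t _; ring.
rewrite Rintegral_cst//; have := @lebesgue_measure_itv R `[a.2 - r, a.2 + r].
rewrite /= lte_fin => ->; rewrite ifT; last by olra.
by rewrite -EFinD /=; ring.
Qed.

Lemma nonneg_integral_eq0 f : bcont Om f -> (forall x, Om x -> 0 <= f x) -> I f <= 0 ->
  forall x, Om x -> f x = 0.
Proof.
move=> bf f0 If x Ox; apply/eqP; rewrite eq_le f0// andbT leNgt; apply/negP => fx.
have f2 : 0 < f x / 2 by rewrite divr_gt0.
move/cvgrPdist_lt : (bf.1 x Ox) => /(_ _ f2) Hn.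
have [d /= d0 Hd] := (nbhs_ballP x _).1 (filterI Hn (open_nbhs_nbhs (conj oOm Ox))).
pose r := d / 2; have r0 : 0 < r by rewrite divr_gt0.
have sub y : cbox x r y -> f x / 2 <= f y /\ Om y.
  move=> /cboxE yx; have [] := Hd y; first by rewrite -ball_normE/= distrC /r in yx *; olra.
  by rewrite ltr_norml => /andP[_ h] Oy; split => //; olra.
have mc := @measurable_cbox _ x r.
have ic := bcont_integrable oOm bOm bf.
have iC : (leb2 R).-integrable (cbox x r) (EFin \o f).
  by apply: integrableS ic => // y /sub[].
have h1 : \int[leb2 R]_(y in cbox x r) f y <= I f.
  apply: fine_le; try by apply: integrable_fin_num.
  apply: ge0_subset_integral => //; first by case/integrableP: ic.
  by move=> y /sub[].
have h2 : \int[leb2 R]_(y in cbox x r) (f x / 2 * 1) <= \int[leb2 R]_(y in cbox x r) f y.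
  apply: le_Rintegral => //; first by apply: cbox_integrable; exact: kC.
  by move=> y /sub[]; rewrite mulr1.
rewrite RintegralZl// ?leb2_cbox// in h2; last by apply: (@cbox_integrable _ (fun=> 1)); exact: kC.
have : 0 < f x / 2 * (4 * r ^+ 2) by rewrite !mulr_gt0// exprn_gt0.
olra.
Qed.

(* Comparison with the quadratic barrier (M + 1) (r^2 - x1^2) / 2. *)
Lemma maximum_principle (r : R) psi psi1 psi2 w (M : R) : 0 < r -> (forall x, Om x -> `|x| <= r) ->
  H10 Om psi psi1 psi2 -> bmeas Om w M -> distr_laplacian Om psi w -> 0 <= M ->
  forall x, Om x -> `|psi x| <= (M + 1) * r ^+ 2.
Proof.
move=> r0 Or hpsi hw heq M0.
suff H (s : R) : s = 1 \/ s = -1 -> forall x, Om x -> s * psi x <= (M + 1) * r ^+ 2.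
  move=> x Ox; rewrite ler_norml; apply/andP; split.
    by have := H (-1) (or_intror erefl) x Ox; olra.
  by have := H 1 (or_introl erefl) x Ox; olra.
move=> hs x Ox; have ss : s * s = 1 by case: hs => ->; ring.
have s1 : `|s| = 1 by case: hs => ->; rewrite ?normrN normr1.
pose phi (y : R * R) := (M + 1) / 2 * (r ^+ 2 - y.1 ^+ 2).
pose phi1 (y : R * R) := - (M + 1) * y.1.
have phi0 y : Om y -> 0 <= phi y <= (M + 1) * r ^+ 2.
  move=> Oy; have h : y.1 ^+ 2 <= r ^+ 2.
    rewrite -(real_normK (num_real y.1)) lerXn2r ?nnegrE ?(ltW r0)//.
    by apply: le_trans (norm_fst_le y) (Or y Oy).
  have y0 := sqr_ge0 y.1; have M2 : 0 <= (M + 1) / 2 by olra.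
  rewrite /phi mulr_ge0 ?subr_ge0//=.
  have h2 : (M + 1) / 2 * (r ^+ 2 - y.1 ^+ 2) <= (M + 1) / 2 * r ^+ 2 by rewrite ler_wpM2l//; olra.
  by have := mulr_ge0 M2 (sqr_ge0 r); olra.
have dphi1 y : is_derive y (1, 0) phi (phi1 y).
  apply: d_eq (dZ ((M + 1) / 2) (dB (dC (r ^+ 2) y (1, 0)) (dX 2 (is_derive_fst y (1, 0))))) _.
  by rewrite /phi1/= expr1; field.
have dphi2 y : is_derive y (0, 1) phi 0.
  apply: d_eq (dZ ((M + 1) / 2) (dB (dC (r ^+ 2) y (0, 1)) (dX 2 (is_derive_fst y (0, 1))))) _.
  by rewrite /=; ring.
have dphi11 y : is_derive y (1, 0) phi1 (- (M + 1)).
  by apply: d_eq (dZ (- (M + 1)) (is_derive_fst y (1, 0))) _; rewrite /= mulr1.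
have cphi : continuous phi.
  by apply: kM; [exact: kC|apply: kB; [exact: kC|apply: kX; exact: continuous_fst]].
have cphi1 : continuous phi1 by apply: kM; [exact: kC|exact: continuous_fst].
have bphi := bcont_continuous bOm cphi; have bphi1 := bcont_continuous bOm cphi1.
have [b0 b1 b2 van dpsi] := hpsi.
have bs := bcont_cst Om s.
apply/ler_addgt0Pr => e e0.
pose v y := s * psi y - phi y; pose v1 y := s * psi1 y - phi1 y; pose v2 y := s * psi2 y.
have bv : bcont Om v by apply: bcontB => //; exact: bcontM.
have bv1 : bcont Om v1 by apply: bcontB => //; exact: bcontM.
have bv2 : bcont Om v2 by exact: bcontM.
(* The excess over the barrier, squared to be C^1. Subtracting [e] makes it vanish near the
   boundary, where [|psi| < e], so it is an admissible test function. *)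
pose f y := pospart (v y - e) ^+ 2; pose t y := 2 * pospart (v y - e).
have bve : bcont Om (fun y => v y - e) by apply: bcontB => //; exact: bcont_cst.
have bp : bcont Om (fun y => pospart (v y - e)) by apply: bcont_comp => //; exact: continuous_pospart.
have bf : bcont Om f by exact: bcontM.
have bt : bcont Om t by apply: bcontM => //; exact: bcont_cst.
have f0 y : 0 <= f y by exact: sqr_ge0.
have dv y w' (d : R) : is_derive y w' v d -> is_derive y w' f (t y * d).
  move=> dvy; have d1 : is_derive y w' (fun y => v y - e) d.
    by apply: d_eq (dB dvy (dC e y w')) _; rewrite subr0.
  exact: is_derive_compV d1 (is_derive_pospart2 _).
have hf : H10 Om f (fun y => t y * v1 y) (fun y => t y * v2 y).
  split => //; try exact: bcontM.
    move=> e' e'0; have [K [cK KO HK]] := van e e0; exists K; split => // y Oy nK.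
    have := HK y Oy nK => psie; have /andP[ph _] := phi0 y Oy.
    have : s * psi y < e by apply: le_lt_trans (ler_norm _) _; rewrite normrM s1 mul1r.
    move=> h; rewrite /f (_ : pospart _ = 0) ?expr0n ?normr0//.
    by apply/max_idPr; rewrite /v; olra.
  move=> y Oy; have [p1 p2] := dpsi y Oy; split.
    by apply: dv; exact: dB (dZ s p1) (dphi1 y).
  by apply: dv; apply: d_eq (dB (dZ s p2) (dphi2 y)) _; rewrite subr0.
have W := weak_form oOm bOm hpsi hf hw.1 (bmeas_integrable oOm bOm hw) heq.
have bff1 : bcont Om (fun y => t y * v1 y) by exact: bcontM.
have bff2 : bcont Om (fun y => t y * v2 y) by exact: bcontM.
have vf : vanishing Om f by case: hf.
have df1 y : Om y -> is_derive y (1, 0) f (t y * v1 y) by move=> Oy; case: hf => _ _ _ _ /(_ y Oy)[].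
have V := vanishing_ibpM oOm bOm axis_e1 vf bf bff1 bphi1 (bcont_cst Om (- (M + 1))) df1 (fun y _ => dphi11 y).
have V' : (M + 1) * I f = I (fun y => t y * v1 y * phi1 y).
  apply: (@oppr_inj R); rewrite -V -mulNr -(I_scale oOm bOm _ bf).
  by apply: eq_Rintegral => y _; rewrite mulrC.
have bmf : exists F, bmeas Om f F by exact: bcont_bmeas.
have [F hF] := bmf; have hwf := bmeasM hw hF.
have sq0 : 0 <= I (fun y => t y * (v1 y ^+ 2 + v2 y ^+ 2)).
  apply: Rintegral_ge0 => y _; rewrite mulr_ge0 ?addr_ge0 ?sqr_ge0//.
  by rewrite mulr_ge0// pospart_ge0.
have E1 : I (fun y => t y * (v1 y ^+ 2 + v2 y ^+ 2)) =
    s * (I (fun y => psi1 y * (t y * v1 y)) + I (fun y => psi2 y * (t y * v2 y))) - I (fun y => t y * v1 y * phi1 y).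
  rewrite -(I_add oOm bOm); [|exact: bcontM|exact: bcontM].
  rewrite -(I_scale oOm bOm); last by apply: bcontD; exact: bcontM.
  rewrite -[X in _ = _ + X]mulN1r -(I_scale oOm bOm); last exact: bcontM.
  rewrite -(I_add oOm bOm).
  - by apply: eq_Rintegral => y _; rewrite /v1 /v2; ring.
  - by apply: bcontM => //; apply: bcontD; exact: bcontM.
  - by apply: bcontM; [exact: bcont_cst|exact: bcontM].
rewrite W -V' in E1.
have L1 : - (M * I f) <= s * I (fun y => w y * f y).
  have iwf := bmeas_integrable oOm bOm hwf.
  have h1 : `|I (fun y => w y * f y)| <= M * I f.
    apply: le_trans (le_normr_Rintegral _ iwf) _ => //.
    rewrite -(I_scale oOm bOm _ bf).
    have [F' hF'] := bcont_bmeas oOm (bcontM (bcont_cst Om M) bf).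
    apply: (bmeas_le oOm bOm (bmeas_norm hwf) hF') => y Oy.
    by rewrite normrM (ger0_norm (f0 y)) ler_wpM2r// hw.2.
  have : `|s * I (fun y => w y * f y)| <= M * I f by rewrite normrM s1 mul1r.
  by rewrite ler_norml => /andP[].
(* The barrier gains [M + 1] times the integral of [f] while the vorticity costs at most [M] times
   it; the difference is what forces the integral to vanish. *)
have If : I f <= 0 by olra.
have := nonneg_integral_eq0 bf (fun y _ => f0 y) If Ox => /eqP.
rewrite /f sqrf_eq0 => /eqP px.
have : v x - e <= 0 by rewrite leNgt; apply/negP => vx; move: px; rewrite /pospart (max_idPl (ltW vx)); olra.
by have /andP[_ ph] := phi0 x Ox; rewrite /v; olra.
Qed.

Lemma th_sqrt_bound (A r s : R) : 0 <= A -> 0 < r -> r <= s -> s <= 1 ->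
  th A r <= (A + 2) * Num.sqrt s.
Proof.
move=> A0 r0 rs s1; have q0 : 0 < Num.sqrt r by rewrite sqrtr_gt0.
have qq : r = Num.sqrt r ^+ 2 by rewrite sqr_sqrtr// ltW.
have q1 : Num.sqrt r <= 1 by rewrite -sqrtr1 ler_sqrt//; olra.
have qs : Num.sqrt r <= Num.sqrt s by rewrite ler_sqrt//; olra.
have lnq : ln r^-1 <= 2 * (Num.sqrt r)^-1.
  rewrite {1}qq -exprVn lnXn ?invr_gt0// mulr2n.
  have qi : 0 < (Num.sqrt r)^-1 by rewrite invr_gt0.
  have h : -1 < (Num.sqrt r)^-1 - 1 by olra.
  have := le_ln1Dx h; rewrite addrCA subrr addr0; olra.
rewrite /th; apply: (@le_trans _ _ (r * (A + 2 * (Num.sqrt r)^-1))).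
  by rewrite ler_wpM2l ?(ltW r0)// lerD2l.
rewrite (_ : r * _ = Num.sqrt r * (A * Num.sqrt r + 2)); last first.
  by rewrite {1}qq; field; rewrite gt_eqF.
rewrite [leRHS]mulrC; apply: ler_pM; rewrite ?sqrtr_ge0//.
  by rewrite addr_ge0// mulr_ge0// sqrtr_ge0.
by rewrite lerD2r ler_piMr.
Qed.


Lemma th_incr (A s r : R) : 0 < s -> s <= r -> 1 + ln r <= A -> th A s <= th A r.
Proof.
move=> s0 sr hA; have r0 : 0 < r by exact: lt_le_trans sr.
have h : -1 < r / s - 1 by have := divr_gt0 r0 s0; olra.
have := le_ln1Dx h; rewrite addrCA subrr addr0 ln_div ?posrE// => h1.
have := ler_wpM2l (ltW s0) h1; rewrite [leRHS]mulrBr mulrCA mulfV ?gt_eqF// !mulr1 => h2.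
have h3 : (r - s) * 1 <= (r - s) * (A - ln r) by rewrite ler_wpM2l; olra.
by rewrite /th !lnV ?posrE//; move: h2 h3; set l1 := ln r; set l2 := ln s; move=> h2 h3; olra.
Qed.

Hypothesis C2b : C2_boundary Om.

(** The modulus of the gradient involves the supremum [L] of the gradient. On a small scale [s] it
    contributes at most [(M + L + m) / 4], while at some point within distance [s] the derivative is
    a difference quotient of [psi], bounded by [2 * m / h]. Hence [L <= B + L / 4]; this is
    legitimate because [L] is known to be finite. *)
Lemma gradient_bound (r M : R) : 0 < r -> (forall x, Om x -> `|x| <= r) -> 0 <= M ->
  exists2 L : R, 0 <= L & forall psi psi1 psi2 w, H10 Om psi psi1 psi2 -> bmeas Om w M ->
    distr_laplacian Om psi w -> potential Om psi psi1 psi2 w M L ((M + 1) * r ^+ 2).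
Proof.
move=> r0 Or M0; set m := (M + 1) * r ^+ 2.
have m0 : 0 <= m by rewrite mulr_ge0 ?sqr_ge0//; olra.
have [N N1 HN] := gradient_modulus oOm bOm C2b.
have [N' N1' HN'] := interior_boxes oOm bOm C2b.
(* At distances up to [s = k^-2] the modulus [th N] is at most [(N + 2) / k], so [N * th N] is at
   most [1 / 4]. *)
pose k := 4 * (N * (N + 2)).
have NN : N <= N * (N + 2) by rewrite ler_peMr; olra.
have k4 : 4 * N <= k by rewrite /k; olra.
have k0 : 0 < k by olra.
have NN0 : 0 < N * (N + 2) by olra.
pose s := k^-1 ^+ 2.
have ki : 0 < k^-1 by rewrite invr_gt0.
have s0 : 0 < s by rewrite exprn_gt0.
have sq : Num.sqrt s = k^-1 by rewrite sqrtr_sqr ger0_norm ?ltW.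
have kle : k^-1 <= (4 * N)^-1 by rewrite lef_pV2 ?posrE//; olra.
have Ni : 0 < N^-1 by rewrite invr_gt0; olra.
have Ni1 : N^-1 <= 1 by rewrite invf_le1; olra.
have kle' : k^-1 <= N^-1 / 4 by move: kle; rewrite invfM; olra.
have sk : s <= k^-1 by rewrite /s expr2 ler_piMr ?ltW//; olra.
have s1 : s < 1 by olra.
pose h := s / (N' + 1).
have h0 : 0 < h by rewrite divr_gt0//; olra.
have hs : (N' + 1) * h = s by rewrite /h mulrCA mulfV ?mulr1// gt_eqF//; olra.
have hN' : h < N'^-1.
  by rewrite -[ltRHS]mul1r ltr_pdivlMr; [rewrite mulrC; olra|olra].
pose B := m / h * 2 + (M + m) / 4.
have mh : 0 <= m / h by rewrite divr_ge0// ltW.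
have B0 : 0 <= B by rewrite /B; olra.
exists (2 * B); first olra.
move=> psi psi1 psi2 w hpsi hw heq.
have bm x : Om x -> `|psi x| <= m by exact: (maximum_principle r0 Or hpsi hw heq M0).
have [_ [_ [C1 bC1]] [_ [C2 bC2]] _ dpsi] := hpsi.
suff key : forall x, Om x -> `|psi1 x| <= 2 * B /\ `|psi2 x| <= 2 * B.
  by split => //; olra.
pose V := [set l | exists2 x, Om x & l = `|psi1 x| \/ l = `|psi2 x|].
have hub : has_ubound V.
  exists (`|C1| + `|C2|) => l [x Ox [->|->]].
    by apply: le_trans (bC1 x Ox) _; have := ler_norm C1; have := normr_ge0 C2; olra.
  by apply: le_trans (bC2 x Ox) _; have := ler_norm C2; have := normr_ge0 C1; olra.
move=> x Ox; set L := sup V.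
have bL y : Om y -> `|psi1 y| <= L /\ `|psi2 y| <= L.
  by move=> Oy; split; apply: ub_le_sup => //; exists y => //; [left|right].
have L0 : 0 <= L by have [h1 _] := bL x Ox; exact: le_trans (normr_ge0 _) h1.
have pot : potential Om psi psi1 psi2 w M L m by [].
suff LB : L <= B + L / 4 by have [h1 h2] := bL x Ox; olra.
have P y (c : R * R) (g : R * R -> R) : Om y -> c = (1, 0) \/ c = (0, 1) ->
    (forall z, Om z -> is_derive z c psi (g z)) ->
    (forall z, g z = c.1 * psi1 z + c.2 * psi2 z) -> `|g y| <= B + L / 4.
  move=> Oy hc dg gE; have [z zy zO] := HN' y h Oy h0 hN'.
  have c1 : `|c| = 1.
    by case: hc => ->; rewrite prod_normE/= normr0 normr1; [apply/max_idPl|apply/max_idPr]; exact: ler01.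
  have box (t : R) : 0 <= t <= 1 -> cbox z h (z + t *: (h *: c)).
    move=> /andP[t0 t1]; apply/cboxE; rewrite addrC addKr 2!normrZ c1 mulr1.
    by rewrite (ger0_norm t0) (gtr0_norm h0) ler_piMl ?(ltW h0).
  have [t /andP[t0 t1] E] := @segment_mvt _ psi (fun z => h * g z) z (h *: c) (fun t ht =>
    @is_derive_scaledir _ _ _ _ h _ (dg _ (zO _ (box t ht)))).
  have ht : 0 <= t <= 1 by rewrite (ltW t0) (ltW t1).
  move: E; set xi := z + t *: _ => E; have Ox' : Om xi by apply: zO; exact: box.
  have Oz : Om z by have := zO _ (box 0 _); rewrite scale0r addr0; apply; rewrite lexx ler01.
  have Oz1 : Om (z + h *: c) by have := zO _ (box 1 _); rewrite scale1r; apply; rewrite lexx ler01.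
  have gxi : `|g xi| <= m / h * 2.
    rewrite mulrAC ler_pdivlMr// -(gtr0_norm h0) -normrM mulrC -E.
    by apply: le_trans (ler_normB _ _) _; move: (bm _ Oz) (bm _ Oz1); clear - mO bOm C2b; lra.
  have yxi : `|y - xi| <= s.
    have /cboxE h1 := box t ht; rewrite (_ : y - xi = - (z - y) - (xi - z)); last first.
      by rewrite !opprB addrA subrK.
    by apply: le_trans (ler_normB _ _) _; rewrite normrN -hs; move: h1 zy; clear - mO bOm C2b; lra.
  have [->|ne] := eqVneq y xi; first by move: gxi L0 m0 M0; rewrite /B; clear - mO bOm C2b; lra.
  have yx0 : 0 < `|y - xi| by rewrite normr_gt0 subr_eq0.
  have lt : `|y - xi| < N^-1 by move: yxi sk kle' Ni; clear - mO bOm C2b; lra.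
  have := HN y xi Oy Ox' ne lt _ _ _ _ _ _ _ _ pot hc; rewrite -!gE => H.
  have T := @th_sqrt_bound N `|y - xi| s (le_trans ler01 N1) yx0 yxi (ltW s1).
  have T2 : N * th N `|y - xi| <= 1 / 4.
    apply: (@le_trans _ _ (N * ((N + 2) * Num.sqrt s))); first by rewrite ler_wpM2l ?(le_trans ler01 N1).
    by rewrite sq mulrA /k invfM mulrCA mulfV ?gt_eqF// mulr1 div1r.
  have T3 : N * th N `|y - xi| * (M + L + m) <= 1 / 4 * (M + L + m) by rewrite ler_wpM2r// !addr_ge0.
  have -> : g y = (g y - g xi) + g xi by rewrite subrK.
  by apply: le_trans (ler_normD _ _) _; move: H gxi T3; rewrite /B; clear - mO bOm C2b; lra.
apply: ge_sup; first by exists `|psi1 x|; exists x => //; left.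
move=> l [y Oy [->|->]].
  by apply: (P y (1, 0)) => //; [left|move=> z /dpsi[]|move=> z /=; ring].
by apply: (P y (0, 1)) => //; [right|move=> z /dpsi[]|move=> z /=; ring].
Qed.

Record velocity_bound (psi psi1 psi2 : R * R -> R) (C : R) : Prop := VelocityBound {
  vel_bound : forall x, Om x -> [/\ `|psi x| <= C, `|psi1 x| <= C & `|psi2 x| <= C];
  vel_modulus : forall x y, Om x -> Om y -> x != y ->
    `|psi1 x - psi1 y| <= C * th C `|x - y| /\ `|psi2 x - psi2 y| <= C * th C `|x - y| }.

(** The lower bound on [C] makes [th C] increasing, and at least the identity, up to the diameter of
    the domain, so that later arguments need not distinguish small distances from large ones. *)
Lemma velocity_modulus (r M : R) : 0 < r -> (forall x, Om x -> `|x| <= r) -> 0 <= M ->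
  exists2 C : R, 1 + `|ln (2 * r)| <= C & forall psi psi1 psi2 w, H10 Om psi psi1 psi2 ->
    bmeas Om w M -> distr_laplacian Om psi w -> velocity_bound psi psi1 psi2 C.
Proof.
move=> r0 Or M0; have [L L0 HL] := gradient_bound r0 Or M0.
set m := (M + 1) * r ^+ 2 in HL.
have m0 : 0 <= m by rewrite mulr_ge0 ?sqr_ge0//; olra.
have [N N1 HN] := gradient_modulus oOm bOm C2b.
pose C := 1 + `|ln (2 * r)| + N + N * (M + L + m) + 2 * L * N + m + L.
have l0 := normr_ge0 (ln (2 * r)).
have n1 : 0 <= N * (M + L + m) by rewrite mulr_ge0//; olra.
have n2 : 0 <= 2 * L * N by rewrite mulr_ge0//; olra.
have hC : 1 + `|ln (2 * r)| <= C by rewrite /C; olra.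
have C0 : 0 <= C by olra.
exists C => // psi psi1 psi2 w hpsi hw heq; have pot := HL _ _ _ _ hpsi hw heq.
have [_ _ _ _ _ _ bm bL] := pot; split => [x Ox|x y Ox Oy xy].
  by have [h1 h2] := bL x Ox; have h3 := bm x Ox; split; rewrite /C; olra.
have d0 : 0 < `|x - y| by rewrite normr_gt0 subr_eq0.
have d2 : `|x - y| <= 2 * r.
  by apply: le_trans (ler_normB _ _) _; have := Or x Ox; have := Or y Oy; olra.
have dth : `|x - y| <= th C `|x - y|.
  rewrite /th ler_peMr ?(ltW d0)//; have h : ln `|x - y| <= ln (2 * r) by rewrite ler_ln ?posrE//; olra.
  by rewrite lnV ?posrE//; have := ler_norm (ln (2 * r)); move: hC h; olra.
have P (c : R * R) (g : R * R -> R) : c = (1, 0) \/ c = (0, 1) ->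
    (forall z, g z = c.1 * psi1 z + c.2 * psi2 z) -> (forall z, Om z -> `|g z| <= L) ->
    `|g x - g y| <= C * th C `|x - y|.
  move=> hc gE gL; have [lt|ge] := ltP `|x - y| N^-1.
    have := HN x y Ox Oy xy lt _ _ _ _ _ _ _ _ pot hc; rewrite -!gE => H; apply: (le_trans H).
    have Ni1 : N^-1 <= 1 by rewrite invf_le1; olra.
    have t0 : 0 <= th N `|x - y| by apply: th_ge0; olra.
    rewrite mulrAC; apply: ler_pM => //; first by rewrite /C; olra.
    by apply: th_mono; rewrite ?(ltW d0)// /C; olra.
  (* At distances of at least [1 / N] the bound [2 * L] on the oscillation is itself at most
     [2 * L * N] times the distance. *)
  apply: le_trans (ler_normB _ _) _.
  have h1 : 2 * L * N * N^-1 <= C * th C `|x - y|.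
    apply: ler_pM => //; first by rewrite invr_ge0; olra.
      by rewrite /C; olra.
    by olra.
  by move: h1; rewrite mulfK ?gt_eqF//; [|olra]; have := gL x Ox; have := gL y Oy; olra.
split; [apply: (P (1, 0))|apply: (P (0, 1))] => //; try by move=> z /bL[].
- by left.
- by move=> z /=; ring.
- by right.
- by move=> z /=; ring.
Qed.

End uniform_bounds.

(** * From the definition of solutions to bounded representatives *)

Section solutions.
Context {R : realType}.
Variable Om : set (R * R).
Hypothesis oOm : open Om.
Hypothesis bOm : bounded_set Om.
Implicit Types (x y z v : R * R) (f g w psi : R * R -> R) (X : R * R -> R * R).
Local Notation I h := (\int[leb2 R]_(x in Om) (h x)).
Let mO : measurable (Om : set (mplane R)) := measurable_dom oOm.

Lemma within_bcont f : {within closure Om, continuous f} -> bcont Om f.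
Proof.
move=> cf; split => [x Ox|].
  have := continuous_subspaceW (@subset_closure _ Om) cf.
  by rewrite continuous_open_subspace// => /(_ x); rewrite inE; exact.
have /compact_bounded[M [_ HM]] := continuous_compact cf (closure_compact bOm).
exists (M + 1) => x Ox; apply: (HM (M + 1)); first by rewrite ltrDl.
by exists x => //; exact: subset_closure.
Qed.

(** The points of the closure where [|psi| >= e] form a compact set, which the boundary condition
    keeps inside the domain. *)
Lemma within_vanishing psi : {within closure Om, continuous psi} ->
  (forall x, bdry Om x -> psi x = 0) -> vanishing Om psi.
Proof.
move=> cpsi p0 e e0.
pose A := psi @^-1` [set t : R | e <= `|t|].
have cl : closed [set t : R | e <= `|t|].
  exact: (closed_comp (fun t _ => @norm_continuous _ _ t) (@closed_ge _ e)).
have /closed_subspaceP[V cV VA] : closed (A : set (subspace (closure Om))).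
  by apply: (@preimage_closed (subspace (closure Om)) R psi _ _ cl) => x _; exact: cpsi.
exists (closure Om `&` A); split.
- rewrite setIC -VA setIC; exact: compact_closedI (closure_compact bOm) cV.
- move=> x [cx Ax]; case: (closure_cases cx) => // /p0 px.
  by move: Ax; rewrite /A/= px normr0; lra.
- by move=> x Ox nK; rewrite ltNge; apply/negP => h; apply: nK; split => //; exact: subset_closure.
Qed.

Lemma biot_savart_H10 w (u : R * R -> R * R) : biot_savart Om w u ->
  exists2 psi, H10 Om psi (fun x => (u x).2) (fun x => - (u x).1) & distr_laplacian Om psi w.
Proof.
move=> [psi [[cpsi p0 heq] dpsi uE cu]]; exists psi; last exact: heq.
have cu2 : {within closure Om, continuous (fun x => (u x).2)}.
  by move=> x; apply: (continuous_comp (cu x)); exact: continuous_snd.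
have cu1 : {within closure Om, continuous (fun x => (u x).1)}.
  by move=> x; apply: (continuous_comp (cu x)); exact: continuous_fst.
split.
- exact: within_bcont.
- exact: within_bcont.
- by apply: bcontN; exact: within_bcont.
- exact: within_vanishing.
- move=> x Ox; rewrite uE//= opprK; split; [exact: (DeriveDef (dpsi x (1, 0) Ox) erefl)|exact: (DeriveDef (dpsi x (0, 1) Ox) erefl)].
Qed.

Lemma ae_imply (P Q : R * R -> Prop) : (forall x, P x -> Q x) ->
  {ae leb2 R, forall x, P x} -> {ae leb2 R, forall x, Q x}.
Proof.
by move=> PQ [A [mA A0 sA]]; exists A; split => // x /= nQ; apply: sA => /= Px; apply: nQ; exact: PQ.
Qed.

Lemma ae_imply2 (P Q S : R * R -> Prop) : (forall x, P x -> Q x -> S x) ->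
  {ae leb2 R, forall x, P x} -> {ae leb2 R, forall x, Q x} -> {ae leb2 R, forall x, S x}.
Proof.
move=> PQS [A [mA A0 sA]] [B [mB B0 sB]]; exists (A `|` B); split; first exact: measurableU.
  by rewrite measureU0.
move=> x /= nS; have [Px|nP] := pselect (P x); last by left; exact: sA.
by right; apply: sB => /= Qx; apply: nS; exact: PQS.
Qed.

Lemma ae_I_eq f g : measurable_fun (Om : set (mplane R)) f -> measurable_fun (Om : set (mplane R)) g ->
  {ae leb2 R, forall x, Om x -> f x = g x} -> I f = I g.
Proof.
move=> mf mg fg; congr fine; apply: ae_eq_integral => //; try exact/measurable_EFinP.
by apply: ae_imply fg => x h /h ->.
Qed.

Lemma smooth_continuous f : smooth f -> continuous f.
Proof. by move=> /(_ 0). Qed.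

Lemma distr_laplacian_ae psi w w' : measurable_fun (Om : set (mplane R)) w ->
  measurable_fun (Om : set (mplane R)) w' -> {ae leb2 R, forall x, Om x -> w x = w' x} ->
  distr_laplacian Om psi w -> distr_laplacian Om psi w'.
Proof.
move=> mw mw' ww' heq phi tphi; rewrite (heq _ tphi); have [sphi _] := tphi.
have mphi : measurable_fun (Om : set (mplane R)) phi.
  by apply: continuous_mplane_measurable => // x _; exact: smooth_continuous.
apply: ae_I_eq; try exact: measurable_funM.
by apply: ae_imply ww' => x h /h ->.
Qed.

Lemma mfun_restrict f : measurable_fun (Om : set (mplane R)) f <->
  measurable_fun [set: mplane R] (f \_ Om).
Proof. by split => h; [apply/(measurable_restrictT _ mO)|apply/(measurable_restrictT _ mO)]. Qed.

Lemma in_Loo_ae_bounded f : in_Lp Om +oo%E f -> measurable_fun (Om : set (mplane R)) f /\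
  exists2 M : R, 0 <= M & {ae leb2 R, forall x, Om x -> `|f x| <= M}.
Proof.
rewrite /in_Lp inE/= => /andP[]; rewrite !inE/= => mf ff; split; first exact/mfun_restrict.
move: ff; rewrite /finite_norm unlock.
have [pos|] := ltP 0%E (leb2 R [set: mplane R]); last first.
  rewrite measure_le0 => /eqP T0 _; exists 0 => //.
  exists setT; split => //.
have h := ess_sup_inf.ess_sup_ge (leb2 R) (abse \o (EFin \o f \_ Om)).
set s := ess_sup_inf.ess_sup _ _ in h *; case: s h => [M|//|] h _.
  exists `|M| => //; apply: ae_imply h => x /= + Ox; rewrite patchE mem_set//.
  by rewrite lee_fin => h; apply: le_trans h (ler_norm _).
by exists 0 => //; apply: ae_imply h => x /=; rewrite leeNy_eq => /eqP.
Qed.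

Lemma bmeas_in_Loo w M : bmeas Om w M -> in_Lp Om +oo%E w.
Proof.
move=> [mw wM]; rewrite /in_Lp inE/=; apply/andP; split; rewrite inE/=; first exact/mfun_restrict.
rewrite /finite_norm unlock; case: ifP => // _.
apply: (@le_lt_trans _ _ (`|M|%:E)); last exact: ltry.
apply/ess_sup_inf.ess_supP; apply: aeW => x /=; rewrite lee_fin patchE; case: ifPn => [|_]; rewrite ?normr0//.
by rewrite inE => Ox; apply: le_trans (wM x Ox) (ler_norm _).
Qed.

Section measure_preserving_maps.
Variable X : R * R -> R * R.
Hypothesis mpX : measure_preserving Om X.
Hypothesis XO : forall x, Om x -> Om (X x).

(** Outside the domain nothing is known about [X]. Extending it by the identity gives a measurable
    map of the plane, to which the image measure formula applies. *)
Let X' x := if x \in Om then X x else x.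

Let mX' : measurable_fun [set: mplane R] (X' : mplane R -> mplane R).
Proof.
move=> _ A mA; rewrite setTI.
rewrite (_ : _ @^-1` _ = (Om `&` X @^-1` A) `|` (~` Om `&` A)); last first.
  apply/seteqP; split => x /=; rewrite /X'.
    by case: ifPn; rewrite ?inE ?notin_setE => Ox Ax; [left|right].
  by case=> -[Ox Ax]; case: ifPn => //; rewrite ?inE ?notin_setE.
apply: measurableU; first exact: mpX.1.
by apply: measurableI => //; exact: measurableC.
Qed.

Let pushE (A : set (mplane R)) : measurable A -> A `<=` Om -> pushforward (leb2 R) X' A = leb2 R A.
Proof.
move=> mA AO; rewrite /pushforward -(mpX.2 A mA AO); congr (leb2 R _).
apply/seteqP; split => x /=; rewrite /X'.
  case: ifPn; rewrite ?inE ?notin_setE; first by move=> Ox Ax.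
  by move=> nO /AO.
by move=> [Ox Ax]; rewrite mem_set.
Qed.

Lemma mp_measurable d (T : measurableType d) (f : R * R -> T) :
  measurable_fun (Om : set (mplane R)) f -> measurable_fun (Om : set (mplane R)) (f \o X).
Proof.
move=> mf; apply: (@measurable_comp _ _ _ _ _ _ (Om : set (mplane R))) => //.
  by move=> _ [x Ox <-]; exact: XO.
exact: mpX.1.
Qed.

Lemma mp_integral (f : R * R -> \bar R) : measurable_fun (Om : set (mplane R)) f ->
  (forall x, Om x -> 0 <= f x)%E ->
  (\int[leb2 R]_(x in Om) f (X x) = \int[leb2 R]_(x in Om) f x)%E.
Proof.
move=> mf f0.
have E : X' @^-1` Om = Om.
  apply/seteqP; split => x; rewrite /preimage/= /X'; last by move=> Ox; rewrite mem_set//; exact: XO.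
  by have [|_] := boolP (x \in Om); first by rewrite inE.
have f0' : {in Om, forall y, 0 <= f y}%E by move=> x; rewrite inE => /f0.
have H := @ge0_integral_pushforward _ _ (mplane R) (mplane R) R X' mX' (leb2 R) Om f mO mf f0'.
apply: (etrans _ (etrans (esym H) _)); last by apply: eq_measure_integral => A mA AO; exact: pushE.
rewrite E.
by apply: eq_integral => x Ox /=; rewrite /X' Ox.
Qed.

Lemma mp_ae (P : R * R -> Prop) : {ae leb2 R, forall x, Om x -> P x} ->
  {ae leb2 R, forall x, Om x -> P (X x)}.
Proof.
move=> [A [mA A0 sA]]; have mAO : measurable (A `&` Om : set (mplane R)) by exact: measurableI.
exists (Om `&` X @^-1` (A `&` Om)); split.
- exact: mpX.1.
- apply: etrans (mpX.2 _ mAO (@subIsetr _ _ _)) _.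
  by apply: subset_measure0 A0 => //; exact: subIsetl.
- move=> x /= nP; have [Ox nPX] : Om x /\ ~ P (X x) by apply/not_implyP.
  split => //; split; last exact: XO.
  by apply: sA => /= h; apply: nPX; apply: h; exact: XO.
Qed.

Lemma mp_I f (M : R) : bmeas Om f M -> I (f \o X) = I f.
Proof.
move=> hf; have [mf fM] := hf.
have hfX : bmeas Om (f \o X) M by split => [|x Ox]; [exact: mp_measurable|exact/fM/XO].
have ic := bcont_integrable oOm bOm (bcont_cst Om M).
(* Adding [M] reduces the formula to nonnegative functions. *)
have E : I (fun x => f (X x) + M) = I (fun x => f x + M).
  congr fine; apply: (@mp_integral (fun x => (f x + M)%:E)).
    by apply/measurable_EFinP; apply: measurable_funD.
  by move=> x /fM; rewrite lee_fin ler_norml => /andP[]; lra.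
have hfi := bmeas_integrable oOm bOm hf; have hfXi := bmeas_integrable oOm bOm hfX.
have h1 := RintegralD mO hfi ic; have h2 := RintegralD mO hfXi ic.
by move: E; rewrite /= in h1 h2 *; rewrite h1 h2; exact: addIr.
Qed.

End measure_preserving_maps.

Definition clamp (M t : R) := Num.max (- M) (Num.min M t).

Lemma norm_clamp M t : 0 <= M -> `|clamp M t| <= M.
Proof.
move=> M0; rewrite /clamp; case: (leP M t) => h; [case: (leP (- M) M) => h2|case: (leP (- M) t) => h2];
  rewrite ler_norml; apply/andP; split; lra.
Qed.

Lemma clamp_id M t : `|t| <= M -> clamp M t = t.
Proof.
rewrite ler_norml /clamp => /andP[h1 h2].
by case: (leP M t) => h; [case: (leP (- M) M) => h3|case: (leP (- M) t) => h3]; lra.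
Qed.

(** Projection onto an interval does not increase the distance to its points. This is how clamped
    data remain close to a limit bounded by [M], although the data themselves have no common
    bound. *)
Lemma clamp_lip M t s : `|s| <= M -> `|clamp M t - s| <= `|t - s|.
Proof.
rewrite {1}ler_norml /clamp => /andP[h1 h2].
by case: (leP M t) => h; [case: (leP (- M) M) => h3|case: (leP (- M) t) => h3];
  rewrite ler_norml; apply/andP; split; case: ger0P; lra.
Qed.

Lemma bmeas_clamp M w : 0 <= M -> measurable_fun (Om : set (mplane R)) w -> bmeas Om (fun x => clamp M (w x)) M.
Proof.
move=> M0 mw; split => [|x _]; last exact: norm_clamp.
by apply: measurable_maxr => //; apply: measurable_minr.
Qed.

End solutions.

(** * Increments of a potential in a domain that need not be convex *)

Section segments.
Context {R : realType}.
Variable Om : set (R * R).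
Hypothesis oOm : open Om.
Variables (r C : R) (chi chi1 chi2 : R * R -> R).
Implicit Types (x y z v a b : R * R).
Hypothesis r0 : 0 < r.
Hypothesis Or : forall x, Om x -> `|x| <= r.
Hypothesis hC : 1 + `|ln (2 * r)| <= C.
Hypothesis hchi : H10 Om chi chi1 chi2.
Hypothesis vel : velocity_bound Om chi chi1 chi2 C.
Local Notation g x := (`|chi1 x| + `|chi2 x|).

Lemma ln_le_diam (d : R) : 0 < d -> d <= 2 * r -> 1 + ln d <= C.
Proof.
move=> d0 dr; have h := hC; have := ler_norm (ln (2 * r)).
have : ln d <= ln (2 * r) by rewrite ler_ln ?posrE//; apply: lt_le_trans dr.
olra.
Qed.

Lemma th_ge (d : R) : 0 < d -> d <= 2 * r -> d <= th C d.
Proof. by move=> d0 dr; rewrite /th ler_peMr ?(ltW d0)// lnV ?posrE//; have := ln_le_diam d0 dr; olra. Qed.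

Lemma segment_bound a v : 0 < `|v| -> `|v| <= 2 * r -> (forall t : R, 0 <= t <= 1 -> Om (a + t *: v)) ->
  `|chi (a + v) - chi a| <= `|v| * (g a + 2 * C * th C `|v|).
Proof.
move=> v0 vr aO; have [_ [c1 _] [c2 _] _ dchi] := hchi.
have Oa : Om a by have := aO 0; rewrite scale0r addr0; apply; rewrite lexx ler01.
have C0 : 0 <= C by have := hC; have := normr_ge0 (ln (2 * r)); olra.
have th0 : 0 <= th C `|v| by apply: le_trans (th_ge v0 vr); exact: ltW.
have cth : 0 <= C * th C `|v| by exact: mulr_ge0.
have [t tr|t /andP[t0 t1] ->] := @segment_mvt _ chi (fun z => v.1 * chi1 z + v.2 * chi2 z) a v.
  have [d /= d0 Hd] := (nbhs_ballP (a + t *: v) _).1 (open_nbhs_nbhs (conj oOm (aO t tr))).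
  apply: (@partials_directional _ chi chi1 chi2 (a + t *: v) v d d0).
  - move=> z zx; apply: dchi; apply: Hd; first by rewrite -ball_normE/= distrC.
  - exact: c1 (aO _ tr).
  - exact: c2 (aO _ tr).
have tr : 0 <= t <= 1 by rewrite (ltW t0) (ltW t1).
set z := a + t *: v; have Oz : Om z := aO t tr.
have za : z - a = t *: v by rewrite /z addrC addKr.
have tv : `|z - a| = t * `|v| by rewrite za normrZ gtr0_norm.
have ne : z != a by rewrite -subr_eq0 -normr_gt0 tv mulr_gt0.
have tv0 : 0 < `|z - a| by rewrite normr_gt0 subr_eq0.
have tv1 : `|z - a| <= `|v| by rewrite tv ler_piMl ?(ltW t1)// ltW.
have [m1 m2] := vel_modulus vel Oz Oa ne.
have Th : C * th C `|z - a| <= C * th C `|v|.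
  by rewrite ler_wpM2l//; apply: th_incr => //; exact: ln_le_diam.
have b1 : `|chi1 z| <= `|chi1 a| + C * th C `|v|.
  by have := ler_dist_dist (chi1 z) (chi1 a); rewrite ler_norml => /andP[]; olra.
have b2 : `|chi2 z| <= `|chi2 a| + C * th C `|v|.
  by have := ler_dist_dist (chi2 z) (chi2 a); rewrite ler_norml => /andP[]; olra.
apply: le_trans (ler_normD _ _) _; rewrite !normrM.
have h1 : `|v.1| * `|chi1 z| <= `|v| * (`|chi1 a| + C * th C `|v|).
  by apply: ler_pM => //; exact: norm_fst_le.
have h2 : `|v.2| * `|chi2 z| <= `|v| * (`|chi2 a| + C * th C `|v|).
  by apply: ler_pM => //; exact: norm_snd_le.
by move: h1 h2; rewrite !mulrDr; olra.
Qed.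

(* If the segment leaves Om, then chi vanishes at the first exit point. *)
Lemma exit_bound a v (t : R) : Om a -> 0 < `|v| -> `|v| <= 2 * r -> 0 <= t <= 1 -> ~ Om (a + t *: v) ->
  `|chi a| <= `|v| * (g a + 2 * C * th C `|v|).
Proof.
move=> Oa v0 vr tr nt; have [_ _ _ van _] := hchi.
pose S := [set s : R | 0 <= s <= 1 /\ ~ Om (a + s *: v)].
have hS : has_inf S.
  by split; [exists t|exists 0 => s [/andP[]]].
pose s := inf S.
have s0 : 0 <= s by apply: lb_le_inf => [|l [/andP[]//]]; exists t.
have s1 : s <= 1 by have /andP[_ h] := tr; apply: le_trans h; apply: inf_lbound => //; exact: hS.2.
have below l : 0 <= l -> l < s -> Om (a + l *: v).
  move=> l0 ls; apply: contrapT => nO; have : s <= l; last by olra.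
  by apply: inf_lbound; [exact: hS.2|split => //; olra].
have step (l : R) d : 0 < d -> exists2 e : R, 0 < e & forall l', `|l' - l| < e -> `|(a + l' *: v) - (a + l *: v)| < d.
  move=> d0; exists (d / `|v|); first exact: divr_gt0.
  move=> l' h; rewrite opprD addrACA subrr add0r -scalerBl normrZ.
  by rewrite -ltr_pdivlMr.
have sS : ~ Om (a + s *: v).
  move=> Os; have [d /= d0 Hd] := (nbhs_ballP (a + s *: v) _).1 (open_nbhs_nbhs (conj oOm Os)).
  have [e e0 He] := step s d d0.
  have [l [lr nO] ls] := inf_adherent e0 hS.
  have sl : s <= l by apply: inf_lbound; [exact: hS.2|].
  apply: nO; apply: Hd; rewrite -ball_normE/= distrC; apply: He.
  by rewrite -/s in ls; rewrite ger0_norm; olra.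
have s00 : 0 < s by rewrite lt_neqAle s0 andbT; apply/eqP => s0'; apply: sS; rewrite -s0' scale0r addr0.
apply/ler_addgt0Pr => e e0; have [K [cK KO HK]] := van e e0.
have nK : ~ K (a + s *: v) by move=> /KO.
have oK : open (~` K) by apply: closed_openC; exact: compact_plane_closed.
have [d /= d0 Hd] := (nbhs_ballP (a + s *: v) _).1 (open_nbhs_nbhs (conj oK nK)).
have [f f0 Hf] := step s d d0.
pose l := s - Num.min (s / 2) (f / 2).
have m0 : 0 < Num.min (s / 2) (f / 2) by rewrite lt_min !divr_gt0.
have ms : Num.min (s / 2) (f / 2) <= s / 2 by rewrite ge_min lexx.
have mf : Num.min (s / 2) (f / 2) <= f / 2 by rewrite ge_min lexx orbT.
have l0 : 0 < l by rewrite /l; olra.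
have ls : l < s by rewrite /l; olra.
have Kl : ~ K (a + l *: v).
  apply: Hd; rewrite -ball_normE/= distrC; apply: Hf.
  by rewrite ltr0_norm; rewrite /l; olra.
have small := HK _ (below l (ltW l0) ls) Kl.
have lv : `|l *: v| = l * `|v| by rewrite normrZ gtr0_norm.
have lv0 : 0 < `|l *: v| by rewrite lv mulr_gt0.
have lv1 : `|l *: v| <= `|v| by rewrite lv ler_piMl ?(ltW v0)//; olra.
have h : `|chi (a + l *: v) - chi a| <= `|l *: v| * (g a + 2 * C * th C `|l *: v|).
  apply: segment_bound => //; first exact: le_trans vr.
  move=> k /andP[k0 k1]; rewrite scalerA; apply: below; first by rewrite mulr_ge0// ltW.
  by apply: le_lt_trans ls; rewrite ler_piMl// ltW.
have h2 : `|l *: v| * (g a + 2 * C * th C `|l *: v|) <= `|v| * (g a + 2 * C * th C `|v|).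
  have C0 : 0 <= C by have := hC; have := normr_ge0 (ln (2 * r)); olra.
  have th0 : 0 <= th C `|l *: v|.
    by apply: le_trans (th_ge lv0 (le_trans lv1 vr)); exact: ltW.
  have c2 : 0 <= 2 * C by olra.
  apply: ler_pM => //.
    by have := mulr_ge0 c2 th0; have := normr_ge0 (chi1 a); have := normr_ge0 (chi2 a); olra.
  by rewrite lerD2l ler_wpM2l//; apply: th_incr => //; exact: ln_le_diam.
have := ler_dist_dist (chi (a + l *: v)) (chi a); rewrite ler_norml => /andP[]; olra.
Qed.

(** If the segment stays in the domain, the gradient at one end suffices; if it leaves, both values
    are bounded by their distances to exit points. Only gradients at the two ends appear, so that
    composing with measure-preserving maps turns them into integrals of the gradient. *)
Lemma chi_increment a b : Om a -> Om b ->
  `|chi a - chi b| <= `|a - b| * (g a + g b + 4 * C * th C `|a - b|).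
Proof.
move=> Oa Ob; have [->|ne] := eqVneq a b; first by rewrite !subrr !normr0 mul0r.
have v0 : 0 < `|b - a| by rewrite normr_gt0 subr_eq0 eq_sym.
have v0' : 0 < `|a - b| by rewrite distrC.
have vr : `|a - b| <= 2 * r.
  by apply: le_trans (ler_normB _ _) _; have := Or Oa; have := Or Ob; olra.
have vr' : `|b - a| <= 2 * r by rewrite distrC.
have C0 : 0 <= C by have := hC; have := normr_ge0 (ln (2 * r)); olra.
have th0 : 0 <= C * th C `|a - b|.
  by apply: mulr_ge0 => //; apply: le_trans (th_ge v0' vr); exact: ltW.
have fin (x y : R) : x <= `|a - b| * (g a + 2 * C * th C `|a - b|) ->
    y <= `|a - b| * (g b + 2 * C * th C `|a - b|) ->
    x + y <= `|a - b| * (g a + g b + 4 * C * th C `|a - b|).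
  by rewrite !mulrDr; olra.
have [all|] := pselect (forall t : R, 0 <= t <= 1 -> Om (a + t *: (b - a))).
  have := segment_bound v0 vr' all; rewrite (_ : a + (b - a) = b); last by rewrite addrC subrK.
  rewrite !(distrC b a) (distrC (chi b)) => h.
  rewrite -[leLHS]addr0; apply: fin => //.
  apply: mulr_ge0; first exact: ltW.
  by rewrite !addr_ge0//; olra.
move/existsNP => [t /not_implyP[tr nt]]; apply: le_trans (ler_normB _ _) _; apply: fin.
  by have := exit_bound Oa v0 vr' tr nt; rewrite (distrC b a).
have tr' : 0 <= 1 - t <= 1 by olra.
apply: (exit_bound Ob v0' vr tr'); rewrite scalerBl scale1r (_ : _ + _ = a + t *: (b - a))//.
by rewrite addrA (addrC b) subrK -scalerN opprB.
Qed.

End segments.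

(** * Osgood's lemma and squared distances along trajectories *)

Section log_gronwall.
Context {R : realType}.
Implicit Types (a b p q x y : R * R).

Lemma mul_ln_le (s l : R) : 0 < s -> 0 < l -> s * (ln l - ln s) <= l - s.
Proof.
move=> s0 l0; have h : -1 < l / s - 1 by have := divr_gt0 l0 s0; olra.
have := le_ln1Dx h; rewrite addrCA subrr addr0 ln_div ?posrE// => h1.
by have := ler_wpM2l (ltW s0) h1; rewrite [leRHS]mulrBr mulrCA mulfV ?gt_eqF// !mulr1.
Qed.

(** The function [ln (A - ln F)] is defined because [A - ln F >= 1], and its derivative is bounded
    by [K]. The two times play symmetric roles, so the estimate runs both forwards and backwards. *)
Lemma osgood (F dF : R -> R) (A K : R) : (forall t, 0 < F t) -> (forall t, 1 + ln (F t) <= A) ->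
  (forall t : R, is_derive t 1 F (dF t)) -> (forall t, `|dF t| <= K * (F t * (A - ln (F t)))) ->
  forall s t, A - ln (F s) <= (A - ln (F t)) * expR (K * `|s - t|).
Proof.
move=> F0 FA dFd bd.
have P t : 0 < A - ln (F t) by have := FA t; olra.
pose G t := ln (A - ln (F t)); pose dG t := (A - ln (F t))^-1 * (0 - (F t)^-1 * dF t).
have dGd (t : R) : is_derive t 1 G (dG t).
  have d1 : is_derive t 1 (fun s => A - ln (F s)) (0 - (F t)^-1 * dF t).
    by apply: dB (dC A t 1) _; exact: is_derive_compV (dFd t) (is_derive1_ln (F0 t)).
  exact: is_derive_compV d1 (is_derive1_ln (P t)).
have bG t : `|dG t| <= K.
  have Pi : 0 < (A - ln (F t))^-1 by rewrite invr_gt0.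
  have Fi : 0 < (F t)^-1 by rewrite invr_gt0.
  rewrite /dG sub0r normrM normrN normrM (gtr0_norm Pi) (gtr0_norm Fi).
  rewrite mulrC ler_pdivrMr// mulrC ler_pdivrMr//.
  by have := bd t; rewrite (mulrC (F t)) mulrA.
have lip s t : s <= t -> `|G t - G s| <= K * `|s - t|.
  move=> st; have [|c _ ->] := MVT_segment st (fun z _ => dGd z).
    by apply: derivable_within_continuous => z _; have [] := dGd z.
  by rewrite normrM distrC ler_wpM2r.
move=> s t; have {}lip : `|G s - G t| <= K * `|s - t|.
  by have [/lip|/ltW/lip] := leP s t; rewrite 1?distrC// (distrC s).
rewrite -[leLHS]lnK ?posrE// -[X in _ <= X * _]lnK ?posrE// -expRD ler_expR.
by have := ler_norm (G s - G t); rewrite /G in lip *; olra.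
Qed.

(** The squared Euclidean distance, which is differentiable along trajectories, unlike the max
    norm. *)
Definition sqd a b := (a.1 - b.1) ^+ 2 + (a.2 - b.2) ^+ 2.

Lemma norm_le_sqd a b : `|a - b| ^+ 2 <= sqd a b.
Proof.
rewrite prod_normE /sqd /=; have h1 := sqr_ge0 (a.1 - b.1); have h2 := sqr_ge0 (a.2 - b.2).
by case: (leP `|a.1 - b.1| `|a.2 - b.2|) => _; rewrite real_normK ?num_real//; olra.
Qed.

Lemma sqd_le_norm a b : sqd a b <= 2 * `|a - b| ^+ 2.
Proof.
have h1 : (a.1 - b.1) ^+ 2 <= `|a - b| ^+ 2.
  by rewrite -(real_normK (num_real (a.1 - b.1))) lerXn2r ?nnegrE//; exact: (norm_fst_le (a - b)).
have h2 : (a.2 - b.2) ^+ 2 <= `|a - b| ^+ 2.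
  by rewrite -(real_normK (num_real (a.2 - b.2))) lerXn2r ?nnegrE//; exact: (norm_snd_le (a - b)).
by rewrite /sqd; olra.
Qed.

Lemma sqd_ge0 a b : 0 <= sqd a b. Proof. by rewrite addr_ge0 ?sqr_ge0. Qed.

Lemma is_derive_path_fst (f : R -> R * R) (t : R) d : is_derive t 1 f d -> is_derive t 1 (fun s => (f s).1) d.1.
Proof.
move=> [df dE]; have c : (fun h : R => h^-1 *: ((f \o shift t) (h *: 1) - f t)) @ 0^' --> d by rewrite -dE; exact: df.
have c1 := cvg_comp _ _ c (continuous_fst (x := d)).
by apply: DeriveDef; [exact: cvgP c1|exact: cvg_lim c1].
Qed.

Lemma is_derive_path_snd (f : R -> R * R) (t : R) d : is_derive t 1 f d -> is_derive t 1 (fun s => (f s).2) d.2.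
Proof.
move=> [df dE]; have c : (fun h : R => h^-1 *: ((f \o shift t) (h *: 1) - f t)) @ 0^' --> d by rewrite -dE; exact: df.
have c1 := cvg_comp _ _ c (continuous_snd (x := d)).
by apply: DeriveDef; [exact: cvgP c1|exact: cvg_lim c1].
Qed.

Lemma sqd_derive (p q : R -> R * R) (t : R) a b : is_derive t 1 p a -> is_derive t 1 q b ->
  is_derive t 1 (fun s => sqd (p s) (q s))
    (2 * ((p t).1 - (q t).1) * (a.1 - b.1) + 2 * ((p t).2 - (q t).2) * (a.2 - b.2)).
Proof.
move=> da db; apply: d_eq (dD (dX 2 (dB (is_derive_path_fst da) (is_derive_path_fst db)))
  (dX 2 (dB (is_derive_path_snd da) (is_derive_path_snd db)))) _.
by rewrite /= !expr1.
Qed.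

Lemma sqd_derive_le (a b : R * R) (e1 e2 : R) :
  `|2 * (a.1 - b.1) * e1 + 2 * (a.2 - b.2) * e2| <= 2 * `|a - b| * (`|e1| + `|e2|).
Proof.
apply: le_trans (ler_normD _ _) _; rewrite !normrM normr_nat mulrDr.
by apply: lerD; rewrite ler_wpM2r// ler_wpM2l//; [exact: (norm_fst_le (a - b))|exact: (norm_snd_le (a - b))].
Qed.

(* Concavity of - s ln s, used with s = d^2. *)
Lemma th_sq_le (C A d l : R) : 0 < d -> 0 < l -> 2 * C <= A -> ln l <= A ->
  2 * (d * th C d) <= d ^+ 2 * (A - ln l) + l.
Proof.
move=> d0 l0 CA lA; have s0 : 0 < d ^+ 2 by exact: exprn_gt0.
have := mul_ln_le s0 l0; rewrite lnXn// mulr2n => h.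
have h2 : d ^+ 2 * (2 * C) <= d ^+ 2 * A by rewrite ler_wpM2l// ltW.
have h3 : 2 * (d * th C d) = d ^+ 2 * (2 * C) - d ^+ 2 * (ln d + ln d).
  by rewrite /th lnV ?posrE//; ring.
by rewrite h3 mulrBr; rewrite mulrBr in h; olra.
Qed.

End log_gronwall.

(** * Flows of bounded vorticities *)

Section flows.
Context {R : realType}.
Variable Om : set (R * R).
Hypothesis oOm : open Om.
Hypothesis bOm : bounded_set Om.
Implicit Types (x y z : R * R) (w : R * R -> R).

(** A solution with everywhere bounded representatives and a stream function with its partial
    derivatives; the velocity is [(- psi2, psi1)]. Transport is stated along [X], which avoids the
    inverse map. *)
Record euler_flow (w0 : R * R -> R) (M : R) (W psi psi1 psi2 : R -> R * R -> R)
    (X : R -> R * R -> R * R) : Prop := EulerFlow {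
  ef_w0 : bmeas Om w0 M;
  ef_W : forall t, bmeas Om (W t) M;
  ef_H10 : forall t, H10 Om (psi t) (psi1 t) (psi2 t);
  ef_eq : forall t, distr_laplacian Om (psi t) (W t);
  ef_mp : forall t, measure_preserving Om (X t);
  ef_bij : forall t, set_bij Om Om (X t);
  ef_id : forall x, Om x -> X 0 x = x;
  ef_ode : forall (t : R) x, Om x -> is_derive t 1 (fun s => X s x) (- psi2 t (X t x), psi1 t (X t x));
  ef_transport : forall t, {ae leb2 R, forall x, Om x -> W t (X t x) = w0 x} }.

Lemma ef_dom w0 M W psi psi1 psi2 X : euler_flow w0 M W psi psi1 psi2 X -> forall t x, Om x -> Om (X t x).
Proof. by move=> ef t x; have [+ _ _] := ef_bij ef t; exact. Qed.

(** Clamping at the essential bound of the data changes the functions on null sets only, so the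
    equation and the transport persist while the bounds become valid at every point. *)
Lemma yudovich_flow v0 v u X : in_Lp Om +oo%E v0 -> yudovich_solution Om v0 v u X ->
  exists (M : R) W w0 psi psi1 psi2, [/\ 0 <= M, euler_flow w0 M W psi psi1 psi2 X,
    {ae leb2 R, forall x, Om x -> w0 x = v0 x} &
    forall t, measurable_fun (Om : set (mplane R)) (v t) /\ {ae leb2 R, forall x, Om x -> W t x = v t x}].
Proof.
move=> hv0 [[hv _ _] bs hX ode tr]; have [mv0 [M M0 v0M]] := in_Loo_ae_bounded oOm hv0.
have mv t : measurable_fun (Om : set (mplane R)) (v t) by have [] := in_Loo_ae_bounded oOm (hv t).
have trX t : {ae leb2 R, forall x, Om x -> v t (X t x) = v0 x}.
  have [hb mp] := hX t; have [XO inj _] := hb.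
  apply: ae_imply (mp_ae oOm mp XO (tr t)) => x h Ox; rewrite h//.
  by rewrite pinvKV ?inE.
(* The set where the bound fails at time [t] has a null preimage under [X t], hence is null because
   [X t] preserves measure. *)
have bd t : {ae leb2 R, forall x, Om x -> `|v t x| <= M}.
  have [hb mp] := hX t; have [XO inj surj] := hb.
  have [B [mB B0 sB]] : {ae leb2 R, forall x, Om x -> `|v t (X t x)| <= M}.
    by apply: ae_imply2 (trX t) v0M => x h1 h2 Ox; rewrite h1// h2.
  have mabs : measurable_fun (Om : set (mplane R)) (fun x => `|v t x|) by exact: measurableT_comp.
  pose N := (Om : set (mplane R)) `&` (fun x => `|v t x|) @^-1` `]M, +oo[.
  have mN : measurable N by apply: mabs => //; exact: measurable_dom.
  exists N; split => //.
    rewrite -(mp.2 N mN (@subIsetl _ _ _)); apply: subset_measure0 B0 => //.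
      by apply: mp.1 => //; exact: measurable_dom.
    move=> x [Ox [_ /=]]; rewrite in_itv/= andbT => h; apply: sB => /= /(_ Ox); olra.
  move=> x /= /not_implyP[Ox h]; split => //=; rewrite in_itv/= andbT ltNge; exact/negP.
have : forall t, exists psi, H10 Om psi (fun x => (u t x).2) (fun x => - (u t x).1) /\ distr_laplacian Om psi (v t).
  by move=> t; have [psi h1 h2] := biot_savart_H10 oOm bOm (bs t); exists psi.
move=> /choice[psi hpsi].
have cl t : {ae leb2 R, forall x, Om x -> v t x = clamp M (v t x)}.
  by apply: ae_imply (bd t) => x h Ox; rewrite clamp_id// h.
have bW t := bmeas_clamp M0 (mv t).
exists M, (fun t x => clamp M (v t x)), (fun x => clamp M (v0 x)), psi,
  (fun t x => (u t x).2), (fun t x => - (u t x).1); split; [exact: M0| | |].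
- split.
  + exact: bmeas_clamp.
  + exact: bW.
  + by move=> t; have [] := hpsi t.
  + by move=> t; have [_ h] := hpsi t; apply: (distr_laplacian_ae oOm _ _ (cl t) h) => //; exact: (bW t).1.
  + by move=> t; have [] := hX t.
  + by move=> t; have [] := hX t.
  + by move=> x Ox; have [] := ode x (subset_closure Ox).
  + move=> t x Ox; have [_ /(_ t)[_]] := ode x (subset_closure Ox).
    by rewrite opprK -surjective_pairing.
  + by move=> t; apply: ae_imply (trX t) => x h Ox; rewrite h.
- by apply: ae_imply v0M => x h Ox; rewrite clamp_id// h.
- by move=> t; split => //; apply: ae_imply (cl t) => x h Ox; rewrite -h.
Qed.

Variables (r C : R).
Hypothesis r0 : 0 < r.
Hypothesis Or : forall x, Om x -> `|x| <= r.
Hypothesis hC : 1 + `|ln (2 * r)| <= C.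

Lemma dist_dom x y : Om x -> Om y -> `|x - y| <= 2 * r.
Proof. by move=> Ox Oy; apply: le_trans (ler_normB _ _) _; have := Or Ox; have := Or Oy; olra. Qed.

(** It bounds the distance of the images from below by a power of the initial distance, and is
    therefore a Hölder modulus of the inverse flow. *)
Lemma flow_modulus w0 M W psi psi1 psi2 X : euler_flow w0 M W psi psi1 psi2 X ->
  (forall t, velocity_bound Om (psi t) (psi1 t) (psi2 t) C) ->
  forall t x y, Om x -> Om y -> x != y ->
  2 * C + 2 - ln (sqd (X t x) (X t y)) <= (2 * C + 2 - ln (sqd x y)) * expR (4 * C * `|t|).
Proof.
move=> ef vel t x y Ox Oy xy; have dom := ef_dom ef.
have C1 : 1 <= C by have := hC; have := normr_ge0 (ln (2 * r)); olra.
have ne s : X s x != X s y.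
  by apply/eqP => h; move/eqP: xy; apply; have [_ inj _] := ef_bij ef s; apply: inj h; rewrite inE.
pose d s := `|X s x - X s y|.
have d0 s : 0 < d s by rewrite normr_gt0 subr_eq0.
have dr s : d s <= 2 * r by apply: dist_dom; exact: dom.
pose F s := sqd (X s x) (X s y).
have Fd s : d s ^+ 2 <= F s := norm_le_sqd _ _.
have F0 s : 0 < F s by apply: lt_le_trans (Fd s); exact: exprn_gt0.
have FC s : 1 + ln (F s) <= 2 * C + 2.
  have h1 : ln (F s) <= ln (2 * d s ^+ 2).
    by rewrite ler_ln ?posrE ?mulr_gt0 ?exprn_gt0//; exact: sqd_le_norm.
  have h2 := ln_le_diam hC (d0 s) (dr s).
  have h3 : ln (2 : R) <= 1 by have := @le_ln1Dx R 1; rewrite (_ : 1 + 1 = 2)//; apply; olra.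
  move: h1; rewrite lnM ?posrE ?exprn_gt0// lnXn// mulr2n; olra.
have dF (s : R) := sqd_derive (ef_ode ef s Ox) (ef_ode ef s Oy).
have bd s : `|2 * ((X s x).1 - (X s y).1) * (- psi2 s (X s x) - - psi2 s (X s y)) +
    2 * ((X s x).2 - (X s y).2) * (psi1 s (X s x) - psi1 s (X s y))| <= 4 * C * (F s * (2 * C + 2 - ln (F s))).
  apply: le_trans (sqd_derive_le _ _ _ _) _.
  have [m1 m2] := vel_modulus (vel s) (dom s _ Ox) (dom s _ Oy) (ne s).
  rewrite -/(d s) in m1 m2 *; rewrite -opprD normrN.
  have h1 : 2 * d s * (`|psi2 s (X s x) - psi2 s (X s y)| + `|psi1 s (X s x) - psi1 s (X s y)|) <=
      2 * d s * (2 * (C * th C (d s))).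
    by rewrite ler_wpM2l//; [have := d0 s; olra|olra].
  apply: (le_trans h1); have lF : ln (F s) <= 2 * C + 1 by have := FC s; olra.
  (* Applied with the constant [2 * C + 1]: the additive term [F s] is then absorbed by passing to
     [2 * C + 2]. *)
  have h2 := th_sq_le (d0 s) (F0 s) (_ : 2 * C <= 2 * C + 1) lF.
  have h3 : d s ^+ 2 * (2 * C + 1 - ln (F s)) <= F s * (2 * C + 1 - ln (F s)) by rewrite ler_wpM2r//; olra.
  have h4 : 2 * (d s * th C (d s)) <= F s * (2 * C + 2 - ln (F s)).
    by have := h2 _; move: h3; rewrite !mulrBr !mulrDr; olra.
  have h5 : 2 * C * (2 * (d s * th C (d s))) <= 2 * C * (F s * (2 * C + 2 - ln (F s))) by rewrite ler_wpM2l//; olra.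
  have h6 : 0 <= F s * (2 * C + 2 - ln (F s)) by apply: mulr_ge0; [exact: ltW|have := FC s; olra].
  have h7 : 0 <= 2 * C * (F s * (2 * C + 2 - ln (F s))) by apply: mulr_ge0 => //; olra.
  move: h5 h7; set u := F s * _; set v := d s * th C _.
  rewrite (_ : 2 * d s * (2 * (C * th C (d s))) = 2 * C * (2 * v)); last by rewrite /v; ring.
  olra.
have := osgood F0 FC dF bd t 0; rewrite subr0 /F.
by rewrite (ef_id ef Ox) (ef_id ef Oy).
Qed.

End flows.

(** * The rate of separation of two flows at a fixed time *)

Section energy.
Context {R : realType}.
Variable Om : set (R * R).
Hypothesis oOm : open Om.
Hypothesis bOm : bounded_set Om.
Implicit Types (x y z : R * R) (f g w : R * R -> R).
Local Notation I h := (\int[leb2 R]_(x in Om) (h x)).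
Local Notation area := (fine (leb2 R Om)).
Let mO : measurable (Om : set (mplane R)) := measurable_dom oOm.

Definition bmf f := exists M : R, bmeas Om f M.

Lemma bmf_integrable f : bmf f -> (leb2 R).-integrable Om (EFin \o f).
Proof. by move=> [M hf]; exact: (bmeas_integrable oOm bOm hf). Qed.

Lemma bmf_cst (c : R) : bmf (fun=> c).
Proof. by exists `|c|; split. Qed.

Lemma bmfM f g : bmf f -> bmf g -> bmf (fun x => f x * g x).
Proof. by move=> [M hf] [N hg]; exists (M * N); exact: bmeasM. Qed.

Lemma bmfD f g : bmf f -> bmf g -> bmf (fun x => f x + g x).
Proof.
move=> [M [mf hf]] [N [mg hg]]; exists (M + N); split => [|x Ox]; first exact: measurable_funD.
by apply: le_trans (ler_normD _ _) _; rewrite lerD ?hf ?hg.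
Qed.

Lemma bmfN f : bmf f -> bmf (fun x => - f x).
Proof.
move=> [M [mf hf]]; exists M; split => [|x Ox]; first exact: measurableT_comp.
by rewrite normrN hf.
Qed.

Lemma bmfX f n : bmf f -> bmf (fun x => f x ^+ n).
Proof.
move=> hf; elim: n => [|n IH]; first exact: (bmf_cst 1).
by rewrite (_ : (fun x => _) = (fun x => f x * f x ^+ n)); [exact: bmfM|apply/funext => x; rewrite exprS].
Qed.

Lemma bmf_norm f : bmf f -> bmf (fun x => `|f x|).
Proof. by move=> [M hf]; exists M; exact: bmeas_norm. Qed.

Lemma bcont_bmf f : bcont Om f -> bmf f.
Proof. by move=> bf; have [M hM] := bcont_bmeas oOm bf; exists M. Qed.

Lemma bI_le f g : bmf f -> bmf g -> (forall x, Om x -> f x <= g x) -> I f <= I g.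
Proof. by move=> [M hf] [N hg]; exact: (bmeas_le oOm bOm hf hg). Qed.

Lemma bI_add f g : bmf f -> bmf g -> I (fun x => f x + g x) = I f + I g.
Proof. by move=> hf hg; rewrite RintegralD//; exact: bmf_integrable. Qed.

Lemma bI_scale (c : R) f : bmf f -> I (fun x => c * f x) = c * I f.
Proof. by move=> hf; rewrite RintegralZl//; exact: bmf_integrable. Qed.

Lemma bI_sub f g : bmf f -> bmf g -> I (fun x => f x - g x) = I f - I g.
Proof.
move=> hf hg; rewrite (bI_add hf (bmfN hg)); congr (_ + _).
by rewrite -[RHS]mulN1r -bI_scale//; apply: eq_Rintegral => x _; rewrite mulN1r.
Qed.

Lemma distr_laplacianB f g v w : bcont Om f -> bcont Om g -> bmf v -> bmf w ->
  distr_laplacian Om f v -> distr_laplacian Om g w ->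
  distr_laplacian Om (fun x => f x - g x) (fun x => v x - w x).
Proof.
move=> bf bg hv hw hf hg phi tphi; have [sphi _] := tphi.
have bphi : bmf phi by apply/bcont_bmf/bcont_continuous => //; exact: smooth_continuous.
have bL : bmf (laplacian phi).
  have [_ H] := sphi 2; apply: bmfD; apply/bcont_bmf/bcont_continuous => //.
    by have [_ h] := H (1, 0); exact: h.
  by have [_ h] := H (0, 1); exact: h.
have h1 := bcont_bmf bf; have h2 := bcont_bmf bg.
transitivity (I (fun x => f x * laplacian phi x) - I (fun x => g x * laplacian phi x)).
  by rewrite -bI_sub; [apply: eq_Rintegral => x _; rewrite mulrBl|exact: bmfM|exact: bmfM].
rewrite hf// hg// -bI_sub; [|exact: bmfM|exact: bmfM].
by apply: eq_Rintegral => x _; rewrite mulrBl.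
Qed.

Lemma H10B f f1 f2 g g1 g2 : H10 Om f f1 f2 -> H10 Om g g1 g2 ->
  H10 Om (fun x => f x - g x) (fun x => f1 x - g1 x) (fun x => f2 x - g2 x).
Proof.
move=> [a1 a2 a3 va da] [b1 b2 b3 vb db]; split; try exact: bcontB.
  move=> e e0; have e2 : 0 < e / 2 by rewrite divr_gt0.
  have [K [cK KO HK]] := va _ e2; have [L [cL LO HL]] := vb _ e2.
  exists (K `|` L); split; first exact: compactU.
    by move=> x [/KO|/LO].
  move=> x Ox nKL; have h1 := HK x Ox (fun h => nKL (or_introl h)).
  have h2 := HL x Ox (fun h => nKL (or_intror h)).
  by apply: le_lt_trans (ler_normB _ _) _; lra.
by move=> x Ox; have [p1 p2] := da x Ox; have [q1 q2] := db x Ox; split; exact: dB.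
Qed.

Lemma energy_absorb (a b i : R) : i <= a + b + (1 / 8 * i + 1 / 8 * i) -> 0 <= i -> i <= 2 * (a + b).
Proof. by lra. Qed.

Lemma rate_sum (r a C k s e iE iP iv i1 : R) :
  iE <= 2 * (C * iv + k * iP) -> 4 * r * i1 <= 4 * r * ((4 * a + 1) * s) ->
  C * iv <= C * (e / 2) -> C * e <= C * s -> 0 <= 4 * r * (4 * a + 1) * iP -> 0 <= C * iP ->
  0 <= (2 + 4 * C) * s -> 0 <= k * s ->
  4 * r * i1 + (iE + (2 + 4 * C) * iP) <= (4 * r * (4 * a + 1) + C + (2 + 4 * C) + 2 * k) * (s + iP).
Proof. by lra. Qed.

Lemma rate_split (r C a t T1 T2 q1 q2 s1 s2 p : R) :
  2 * a * q1 <= a ^+ 2 + s1 -> 2 * a * q2 <= a ^+ 2 + s2 -> 2 * a * (T1 + T2) <= 4 * r * (T1 + T2) ->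
  a ^+ 2 <= p -> 4 * C * (a * t) <= 4 * C * p ->
  2 * a * (T1 + (q1 + C * t) + (T2 + (q2 + C * t))) <= 4 * r * (T1 + T2) + (s1 + s2 + (2 + 4 * C) * p).
Proof. by lra. Qed.

Lemma mul_norm_le_sqr (b c : R) : 2 * b * `|c| <= b ^+ 2 + c ^+ 2.
Proof. by rewrite -(real_normK (num_real c)); have := sqr_ge0 (b - `|c|); rewrite sqrrB; lra. Qed.

Section fixed_time.
Variables (r C M : R) (X Y : R * R -> R * R) (w0 W : R * R -> R) (P : R * R -> R).
Hypothesis M0 : 0 <= M.
Hypothesis Or : forall x, Om x -> `|x| <= r.
Hypothesis hC : 1 + `|ln (2 * r)| <= C.
Hypothesis mpX : measure_preserving Om X.
Hypothesis XO : forall x, Om x -> Om (X x).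
Hypothesis mpY : measure_preserving Om Y.
Hypothesis YO : forall x, Om x -> Om (Y x).
Hypothesis hw0 : bmeas Om w0 M.
Hypothesis hW : bmeas Om W M.
Hypothesis WX : {ae leb2 R, forall x, Om x -> W (X x) = w0 x}.
Local Notation d x := (`|Y x - X x|).
(** An abstract majorant for the two functions of the distance that occur. It is later taken affine
    in the squared distance, so that its integral is controlled by the integral of the squared
    distance. *)
Hypothesis hP : bmf P.
Hypothesis P1 : forall x, Om x -> d x ^+ 2 <= P x.
Hypothesis P2 : forall x, Om x -> d x * th C (d x) <= P x.

Let bmX f : bmf f -> bmf (f \o X).
Proof. by move=> [N [mf hf]]; exists N; split => [|x Ox]; [exact: mp_measurable|exact/hf/XO]. Qed.

Let bmY f : bmf f -> bmf (f \o Y).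
Proof. by move=> [N [mf hf]]; exists N; split => [|x Ox]; [exact: mp_measurable|exact/hf/YO]. Qed.

Let IX f : bmf f -> I (fun x => f (X x)) = I f.
Proof. by move=> [N hf]; exact: (mp_I oOm bOm mpX XO hf). Qed.

Let IY f : bmf f -> I (fun x => f (Y x)) = I f.
Proof. by move=> [N hf]; exact: (mp_I oOm bOm mpY YO hf). Qed.

(** The increments of [chi] are bounded by the distance of the two trajectories times gradients at
    their positions. Young's inequality turns the gradients into small multiples of the energy
    density at [Y x] and [X x], whose integrals are both the energy itself; a quarter of it appears
    on the right and is absorbed. *)
Lemma dirichlet_energy v0 V chi chi1 chi2 : bmeas Om v0 M -> bmeas Om V M ->
  {ae leb2 R, forall x, Om x -> V (Y x) = v0 x} ->
  H10 Om chi chi1 chi2 -> velocity_bound Om chi chi1 chi2 C ->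
  distr_laplacian Om chi (fun x => V x - W x) ->
  I (fun x => chi1 x ^+ 2 + chi2 x ^+ 2) <=
    2 * (C * I (fun x => `|v0 x - w0 x|) + (8 * M ^+ 2 + 4 * C * M) * I P).
Proof.
move=> hv0 hV VY hchi vel heq; have [bchi b1 b2 _ _] := hchi.
have [mv0 _] := hv0; have [mw0 _] := hw0; have [mV _] := hV; have [mW _] := hW.
have bv0 : bmf v0 by exists M.
have bw0 : bmf w0 by exists M.
have bV : bmf V by exists M.
have bW : bmf W by exists M.
have hc := bcont_bmf bchi; have h1 := bcont_bmf b1; have h2 := bcont_bmf b2.
have hVW : bmf (fun x => V x - W x) by apply: bmfD => //; exact: bmfN.
pose e x := chi1 x ^+ 2 + chi2 x ^+ 2.
have be : bmf e by apply: bmfD; exact: bmfX.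
have hcY : bmf (fun x => chi (Y x)) := bmY hc.
have hcX : bmf (fun x => chi (X x)) := bmX hc.
have mbm f : bmf f -> measurable_fun (Om : set (mplane R)) f by move=> [N []].
have EV : I (fun x => V x * chi x) = I (fun x => v0 x * chi (Y x)).
  rewrite -(IY (bmfM bV hc)); apply: (ae_I_eq oOm).
  - by apply: mbm; exact: (bmY (bmfM bV hc)).
  - by apply: mbm; exact: bmfM.
  - by apply: ae_imply VY => x h Ox; rewrite h.
have EW : I (fun x => W x * chi x) = I (fun x => w0 x * chi (X x)).
  rewrite -(IX (bmfM bW hc)); apply: (ae_I_eq oOm).
  - by apply: mbm; exact: (bmX (bmfM bW hc)).
  - by apply: mbm; exact: bmfM.
  - by apply: ae_imply WX => x h Ox; rewrite h.
have W1 := weak_form oOm bOm hchi hchi (mbm _ hVW) (bmf_integrable hVW) heq.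
have D1 : I e = - I (fun x => (v0 x - w0 x) * chi (Y x) + w0 x * (chi (Y x) - chi (X x))).
  rewrite /e bI_add; [|exact: bmfX|exact: bmfX].
  rewrite (_ : I (fun x => chi1 x ^+ 2) = I (fun x => chi1 x * chi1 x)); last by apply: eq_Rintegral => x _; rewrite expr2.
  rewrite (_ : I (fun x => chi2 x ^+ 2) = I (fun x => chi2 x * chi2 x)); last by apply: eq_Rintegral => x _; rewrite expr2.
  rewrite W1; congr (- _).
  transitivity (I (fun x => V x * chi x) - I (fun x => W x * chi x)).
    by rewrite -bI_sub; [apply: eq_Rintegral => x _; rewrite mulrBl|exact: bmfM|exact: bmfM].
  rewrite EV EW -bI_sub; [|exact: bmfM|exact: bmfM].
  by apply: eq_Rintegral => x _; ring.
have C0 : 0 <= C := le_trans (addr_ge0 ler01 (normr_ge0 _)) hC.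
pose F x := C * `|v0 x - w0 x| + (8 * M ^+ 2 + 4 * C * M) * P x + (1 / 8 * e (Y x) + 1 / 8 * e (X x)).
have bvw : bmf (fun x => `|v0 x - w0 x|) by apply/bmf_norm/bmfD => //; exact: bmfN.
have beY : bmf (fun x => e (Y x)) := bmY be.
have beX : bmf (fun x => e (X x)) := bmX be.
have bf1 : bmf (fun x => C * `|v0 x - w0 x|) by apply: bmfM => //; exact: bmf_cst.
have bf2 : bmf (fun x => (8 * M ^+ 2 + 4 * C * M) * P x) by apply: bmfM => //; exact: bmf_cst.
have bf3 : bmf (fun x => 1 / 8 * e (Y x)) by apply: bmfM => //; exact: bmf_cst.
have bf4 : bmf (fun x => 1 / 8 * e (X x)) by apply: bmfM => //; exact: bmf_cst.
have bg : bmf (fun x => (v0 x - w0 x) * chi (Y x) + w0 x * (chi (Y x) - chi (X x))).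
  apply: bmfD; apply: bmfM => //; apply: bmfD => //; exact: bmfN.
have young (a c : R) : M * (a * c) <= 4 * M ^+ 2 * a ^+ 2 + c ^+ 2 / 16.
  by have := sqr_ge0 (2 * M * a - c / 4); rewrite sqrrB !exprMn; lra.
have sq2 (a c : R) : (`|a| + `|c|) ^+ 2 <= 2 * (a ^+ 2 + c ^+ 2).
  by have := sqr_ge0 (`|a| - `|c|); rewrite sqrrB sqrrD !real_normK ?num_real//; lra.
have pw x : Om x -> - ((v0 x - w0 x) * chi (Y x) + w0 x * (chi (Y x) - chi (X x))) <= F x.
  move=> Ox; have Ox1 := YO Ox; have Ox2 := XO Ox.
  have [k1 _ _] := vel_bound vel Ox1.
  have t1 : `|(v0 x - w0 x) * chi (Y x)| <= C * `|v0 x - w0 x|.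
    by rewrite normrM mulrC ler_wpM2r.
  have inc := chi_increment oOm Or hC hchi vel Ox1 Ox2.
  have t2 : `|w0 x * (chi (Y x) - chi (X x))| <= M * (d x * (`|chi1 (Y x)| + `|chi2 (Y x)| + (`|chi1 (X x)| + `|chi2 (X x)|) + 4 * C * th C (d x))).
    by rewrite normrM; apply: ler_pM => //; exact: hw0.2.
  have y1 := young (d x) (`|chi1 (Y x)| + `|chi2 (Y x)|).
  have y2 := young (d x) (`|chi1 (X x)| + `|chi2 (X x)|).
  have s1 := sq2 (chi1 (Y x)) (chi2 (Y x)); have s2 := sq2 (chi1 (X x)) (chi2 (X x)).
  have p1 : 8 * M ^+ 2 * d x ^+ 2 <= 8 * M ^+ 2 * P x by rewrite ler_wpM2l ?P1// mulr_ge0// sqr_ge0.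
  have p2 : 4 * C * M * (d x * th C (d x)) <= 4 * C * M * P x by rewrite ler_wpM2l ?P2// !mulr_ge0.
  rewrite /F /e; move: t1 t2; rewrite !ler_norml => /andP[t1 _] /andP[t2 _].
  move: t1 t2 y1 y2 s1 s2 p1 p2.
  set A := (v0 x - w0 x) * _; set B := w0 x * _; set a1 := `|chi1 (Y x)| + _; set a2 := `|chi1 (X x)| + _.
  rewrite (_ : M * (d x * _) = M * (d x * a1) + M * (d x * a2) + 4 * C * M * (d x * th C (d x))); last by ring.
  set q1 := M * (_ * a1); set q2 := M * (_ * a2); set q3 := 4 * C * M * _; set q4 := 4 * C * M * _.
  set E1 := chi1 (Y x) ^+ 2 + _; set E2 := chi1 (X x) ^+ 2 + _.
  rewrite [(8 * M ^+ 2 + _) * P x]mulrDl -/q4.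
  set z1 := C * _; set z2 := 8 * M ^+ 2 * P x; set z3 := d x ^+ 2; set z4 := a1 ^+ 2; set z5 := a2 ^+ 2.
  rewrite (_ : 8 * M ^+ 2 * z3 = 2 * (4 * M ^+ 2 * z3)); last by ring.
  set z6 := 4 * M ^+ 2 * z3.
  by move=> *; lra.
have L : - I (fun x => (v0 x - w0 x) * chi (Y x) + w0 x * (chi (Y x) - chi (X x))) <= I F.
  rewrite -mulN1r -bI_scale//; apply: bI_le.
  - by apply: bmfM => //; exact: bmf_cst.
  - by apply: bmfD; apply: bmfD.
  - by move=> x Ox; rewrite mulN1r; exact: pw.
have IF : I F = C * I (fun x => `|v0 x - w0 x|) + (8 * M ^+ 2 + 4 * C * M) * I P + (1 / 8 * I e + 1 / 8 * I e).
  rewrite /F bI_add; [|exact: bmfD|exact: bmfD]; congr (_ + _).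
    by rewrite bI_add// !bI_scale.
  by rewrite bI_add// !bI_scale// (IX be) (IY be).
have e0 : 0 <= I e by apply: Rintegral_ge0 => x _; rewrite addr_ge0 ?sqr_ge0.
by move: L; rewrite -D1 IF => /energy_absorb; exact.
Qed.

Hypothesis r0 : 0 < r.
Hypothesis solv : forall g (N : R), bmeas Om g N -> exists f f1 f2, H10 Om f f1 f2 /\ distr_laplacian Om f g.
Hypothesis hvel : forall f f1 f2 g, H10 Om f f1 f2 -> bmeas Om g (2 * M) -> distr_laplacian Om f g ->
  velocity_bound Om f f1 f2 C.

Definition rate_cst := 4 * r * (4 * area + 1) + C + (2 + 4 * C) + 2 * (8 * M ^+ 2 + 4 * C * M).

(** The bound [N] of the approximating data must not enter the constant. Clamping [V] at [M] leaves
    a vorticity comparable to [W], to which the Dirichlet energy applies, and a remainder that is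
    only known to be small in L^1. The clamped vorticity need not be that of an Euler solution, so
    its potential is obtained from [solv]. *)
Lemma energy_rate v0 V phi phi1 phi2 psi psi1 psi2 (N e : R) : 0 < e -> e <= 1 / 4 ->
  bmeas Om v0 N -> bmeas Om V N -> {ae leb2 R, forall x, Om x -> V (Y x) = v0 x} ->
  H10 Om phi phi1 phi2 -> distr_laplacian Om phi V ->
  H10 Om psi psi1 psi2 -> distr_laplacian Om psi W ->
  I (fun x => `|v0 x - w0 x|) <= e / 2 ->
  I (fun x => 2 * d x * (`|phi1 (Y x) - psi1 (X x)| + `|phi2 (Y x) - psi2 (X x)|)) <=
    rate_cst * (Num.sqrt e + I P).
Proof.
move=> e0 e4 hv0 hV VY hphi ephi hpsi epsi Ie.
have bdat g h : bmeas Om g M -> bmeas Om h M -> bmeas Om (fun x => g x - h x) (2 * M).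
  move=> [mg hg] [mh hh]; split => [|x Ox]; first exact: measurable_funB.
  by apply: le_trans (ler_normB _ _) _; have := hg x Ox; have := hh x Ox; lra.
have b2 g : bmeas Om g M -> bmeas Om g (2 * M).
  by move=> [mg hg]; split => // x Ox; have := hg x Ox; have := M0; lra.
pose V' x := clamp M (V x); pose v0' x := clamp M (v0 x).
have hV' : bmeas Om V' M := bmeas_clamp M0 hV.1.
have hv0' : bmeas Om v0' M := bmeas_clamp M0 hv0.1.
have V'Y : {ae leb2 R, forall x, Om x -> V' (Y x) = v0' x}.
  by apply: ae_imply VY => x h Ox; rewrite /V' h.
have [f [f1 [f2 [hf ef]]]] := solv hV'.
have bmV : bmf V by exists N.
have bmV' : bmf V' by exists M.
have bmv0 : bmf v0 by exists N.
have bmv0' : bmf v0' by exists M.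
have bmw0 : bmf w0 by exists M.
have bmW : bmf W by exists M.
have [bphi bphi1 bphi2 _ _] := hphi; have [bf bf1 bf2 _ _] := hf; have [bpsi bpsi1 bpsi2 _ _] := hpsi.
have hchi := H10B hf hpsi.
have echi := distr_laplacianB bf bpsi bmV' bmW ef epsi.
have vchi := hvel hchi (bdat _ _ hV' hW) echi.
have vpsi := hvel hpsi (b2 _ hW) epsi.
have htheta := H10B hphi hf.
have etheta := distr_laplacianB bphi bf bmV bmV' ephi ef.
have bdiff g h : bmf g -> bmf h -> bmf (fun x => `|g x - h x|).
  by move=> hg hh; apply/bmf_norm/bmfD => //; exact: bmfN.
have mbm g : bmf g -> measurable_fun (Om : set (mplane R)) g by move=> [L []].
(* By measure preservation this is a statement about the data: clamping moves [v0] by at most twice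
   its distance to [w0], since [w0] takes values in the clamping interval. *)
have IV : I (fun x => `|V x - V' x|) <= e.
  rewrite -(IY (bdiff _ _ bmV bmV')) (@ae_I_eq _ _ oOm _ (fun x => `|v0 x - v0' x|)).
  - apply: (@le_trans _ _ (2 * I (fun x => `|v0 x - w0 x|))); last by lra.
    rewrite -bI_scale; last exact: bdiff.
    apply: bI_le; [exact: bdiff|by apply: bmfM; [exact: bmf_cst|exact: bdiff]|].
    move=> x Ox; have := clamp_lip (v0 x) (hw0.2 x Ox) => h.
    have -> : v0 x - v0' x = (v0 x - w0 x) - (v0' x - w0 x) by ring.
    by apply: le_trans (ler_normB _ _) _; rewrite /v0'; lra.
  - by apply: mbm; exact: (bmY (bdiff _ _ bmV bmV')).
  - by apply: mbm; exact: bdiff.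
  - by apply: ae_imply2 VY V'Y => x h1 h2 Ox; rewrite h1// h2.
have T := L1_data_gradient oOm bOm e0 e4 htheta _ etheta IV.
have [L hL] : bmf (fun x => V x - V' x) by apply: bmfD => //; exact: bmfN.
have {}T := T _ hL.
have D := dirichlet_energy hv0' hV' V'Y hchi vchi echi.
have Iv : I (fun x => `|v0' x - w0 x|) <= e / 2.
  apply: le_trans Ie; apply: bI_le; try exact: bdiff.
  by move=> x Ox; exact: clamp_lip (hw0.2 x Ox).
have C0 : 0 <= C := le_trans (addr_ge0 ler01 (normr_ge0 _)) hC.
have bm1 := bcont_bmf bphi1; have bm2 := bcont_bmf bphi2.
have bm3 := bcont_bmf bf1; have bm4 := bcont_bmf bf2.
have bm5 := bcont_bmf bpsi1; have bm6 := bcont_bmf bpsi2.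
pose th1 x := `|phi1 x - f1 x|; pose th2 x := `|phi2 x - f2 x|.
pose c1 x := f1 x - psi1 x; pose c2 x := f2 x - psi2 x.
pose E x := c1 x ^+ 2 + c2 x ^+ 2.
have bth : bmf (fun x => th1 x + th2 x) by apply: bmfD; exact: bdiff.
have bE : bmf E by apply: bmfD; apply: bmfX; apply: bmfD => //; exact: bmfN.
have bthY : bmf (fun x => th1 (Y x) + th2 (Y x)) := bmY bth.
have bEY : bmf (fun x => E (Y x)) := bmY bE.
pose F x := 4 * r * (th1 (Y x) + th2 (Y x)) + (E (Y x) + (2 + 4 * C) * P x).
have k1 : bmf (fun x => 4 * r * (th1 (Y x) + th2 (Y x))) by apply: bmfM => //; exact: bmf_cst.
have k2 : bmf (fun x => (2 + 4 * C) * P x) by apply: bmfM => //; exact: bmf_cst.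
have k3 : bmf (fun x => E (Y x) + (2 + 4 * C) * P x) by exact: bmfD.
have pw x : Om x -> 2 * d x * (`|phi1 (Y x) - psi1 (X x)| + `|phi2 (Y x) - psi2 (X x)|) <= F x.
  move=> Ox; have Ox1 := YO Ox; have Ox2 := XO Ox.
  have dr := dist_dom Or Ox1 Ox2.
  have m : `|psi1 (Y x) - psi1 (X x)| <= C * th C (d x) /\ `|psi2 (Y x) - psi2 (X x)| <= C * th C (d x).
    have [->|ne] := eqVneq (Y x) (X x); last exact: (vel_modulus vpsi).
    by rewrite !subrr !normr0 /th mul0r mulr0.
  have tri (a b c : R) : `|a - c| <= `|a - b| + `|b - c| by rewrite (le_trans _ (ler_normD _ _))// addrA subrK.
  (* Each velocity difference is split in three: the L^1 part at [Y x], the part controlled by the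
     energy at [Y x], and the increment of the limit velocity between [Y x] and [X x]. They are
     treated by the diameter bound, Young's inequality and the modulus respectively. *)
  have a1 : `|phi1 (Y x) - psi1 (X x)| <= th1 (Y x) + (`|c1 (Y x)| + C * th C (d x)).
    by apply: le_trans (tri _ (f1 (Y x)) _) _; rewrite lerD2l; apply: le_trans (tri _ (psi1 (Y x)) _) _; rewrite lerD2l m.1.
  have a2 : `|phi2 (Y x) - psi2 (X x)| <= th2 (Y x) + (`|c2 (Y x)| + C * th C (d x)).
    by apply: le_trans (tri _ (f2 (Y x)) _) _; rewrite lerD2l; apply: le_trans (tri _ (psi2 (Y x)) _) _; rewrite lerD2l m.2.
  have d2 : 0 <= 2 * d x by apply: mulr_ge0.
  have h1 := ler_wpM2l d2 (lerD a1 a2).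
  have h2 := mul_norm_le_sqr (d x) (c1 (Y x)); have h3 := mul_norm_le_sqr (d x) (c2 (Y x)).
  have t0 : 0 <= th1 (Y x) + th2 (Y x) by rewrite addr_ge0 ?normr_ge0.
  have h4 : 2 * d x * (th1 (Y x) + th2 (Y x)) <= 4 * r * (th1 (Y x) + th2 (Y x)).
    by apply: ler_wpM2r => //; rewrite (_ : 4 * r = 2 * (2 * r)) ?ler_wpM2l//; ring.
  have p1 := P1 Ox; have p2 : 4 * C * (d x * th C (d x)) <= 4 * C * P x by rewrite ler_wpM2l ?P2// mulr_ge0.
  exact: le_trans h1 (rate_split h2 h3 h4 p1 p2).
have bd : bmf (fun x => d x).
  have hX' : bmf (fun x => (X x).1) := bmX (bcont_bmf (bcont_continuous bOm (@continuous_fst R))).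
  have hX2 : bmf (fun x => (X x).2) := bmX (bcont_bmf (bcont_continuous bOm (@continuous_snd R))).
  have hY' : bmf (fun x => (Y x).1) := bmY (bcont_bmf (bcont_continuous bOm (@continuous_fst R))).
  have hY2 : bmf (fun x => (Y x).2) := bmY (bcont_bmf (bcont_continuous bOm (@continuous_snd R))).
  have [L1 [ml1 _]] := bdiff _ _ hY' hX'; have [L2 [ml2 _]] := bdiff _ _ hY2 hX2.
  exists (2 * r); split => [|x Ox]; last by rewrite normr_id; apply: (dist_dom Or); [exact: YO|exact: XO].
  by apply: (eq_measurable_fun (fun x => Num.max `|(Y x).1 - (X x).1| `|(Y x).2 - (X x).2|)) => [x _|]; [rewrite prod_normE|exact: measurable_maxr].
have bph1 : bmf (fun x => phi1 (Y x)) := bmY bm1.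
have bph2 : bmf (fun x => phi2 (Y x)) := bmY bm2.
have bps1 : bmf (fun x => psi1 (X x)) := bmX bm5.
have bps2 : bmf (fun x => psi2 (X x)) := bmX bm6.
have step : I (fun x => 2 * d x * (`|phi1 (Y x) - psi1 (X x)| + `|phi2 (Y x) - psi2 (X x)|)) <= I F.
  apply: bI_le => //; last exact: bmfD.
  apply: bmfM; first by apply: bmfM => //; exact: bmf_cst.
  by apply: bmfD; exact: bdiff.
have IF : I F = 4 * r * I (fun x => th1 (Y x) + th2 (Y x)) + (I (fun x => E (Y x)) + (2 + 4 * C) * I P).
  by rewrite /F (bI_add k1 k3) (bI_add bEY k2) (bI_scale _ bthY) (bI_scale _ hP).
apply: (le_trans step); rewrite IF.
have -> : I (fun x => th1 (Y x) + th2 (Y x)) = I (fun x => th1 x) + I (fun x => th2 x).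
  by rewrite -bI_add; [exact: (IY bth)|exact: bdiff|exact: bdiff].
have -> : I (fun x => E (Y x)) = I E := IY bE.
have se : e <= Num.sqrt e.
  have s1 : Num.sqrt e <= 1 by rewrite -[leRHS]sqrtr1 ler_sqrt// (le_trans e4)// ler_pdivrMr// mul1r ler1n.
  by rewrite -[leLHS]sqr_sqrtr ?(ltW e0)// expr2 ler_piMl ?sqrtr_ge0.
have IP0 : 0 <= I P.
  by apply: Rintegral_ge0 => x Ox; apply: le_trans (P1 Ox); exact: sqr_ge0.
have s0 : 0 <= Num.sqrt e := sqrtr_ge0 e.
have u1 : 4 * r * (I (fun x => th1 x) + I (fun x => th2 x)) <= 4 * r * ((4 * area + 1) * Num.sqrt e).
  by rewrite ler_wpM2l// mulr_ge0// ltW.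
have u2 : C * I (fun x => `|v0' x - w0 x|) <= C * (e / 2) by rewrite ler_wpM2l.
have u3 : C * e <= C * Num.sqrt e by rewrite ler_wpM2l.
have ar : 0 <= area := area_ge0 Om.
have w1 : 0 <= 4 * r * (4 * area + 1) * I P.
  by apply: mulr_ge0 => //; apply: mulr_ge0; [apply: mulr_ge0 => //; exact: ltW|rewrite addr_ge0// mulr_ge0].
have w2 : 0 <= C * I P by apply: mulr_ge0.
have w3 : 0 <= (2 + 4 * C) * Num.sqrt e by rewrite mulr_ge0// addr_ge0// mulr_ge0.
have w4 : 0 <= (8 * M ^+ 2 + 4 * C * M) * Num.sqrt e.
  apply: mulr_ge0 => //; apply: addr_ge0; first by apply: mulr_ge0 => //; exact: sqr_ge0.
  by rewrite !mulr_ge0.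
exact: rate_sum D u1 u2 u3 w1 w2 w3 w4.
Qed.

End fixed_time.

End energy.

(** * Osgood estimate for the mean squared distance of two flows *)

Section two_flows.
Context {R : realType}.
Variable Om : set (R * R).
Hypothesis oOm : open Om.
Hypothesis bOm : bounded_set Om.
Implicit Types (x y z : R * R).
Local Notation I h := (\int[leb2 R]_(x in Om) (h x)).
Local Notation area := (fine (leb2 R Om)).
Let mO : measurable (Om : set (mplane R)) := measurable_dom oOm.

Variables (r C M : R).
Hypothesis r0 : 0 < r.
Hypothesis Or : forall x, Om x -> `|x| <= r.
Hypothesis hC : 1 + `|ln (2 * r)| <= C.
Hypothesis M0 : 0 <= M.
Hypothesis solv : forall g (N : R), bmeas Om g N -> exists f f1 f2, H10 Om f f1 f2 /\ distr_laplacian Om f g.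
Hypothesis hvel : forall f f1 f2 g, H10 Om f f1 f2 -> bmeas Om g (2 * M) -> distr_laplacian Om f g ->
  velocity_bound Om f f1 f2 C.

Variables (w0 : R * R -> R) (W psi psi1 psi2 : R -> R * R -> R) (X : R -> R * R -> R * R).
Hypothesis efX : euler_flow Om w0 M W psi psi1 psi2 X.
Variables (v0 : R * R -> R) (N : R) (V phi phi1 phi2 : R -> R * R -> R) (Y : R -> R * R -> R * R).
Hypothesis efY : euler_flow Om v0 N V phi phi1 phi2 Y.
(** This bound depends on the approximating solution. It only justifies differentiating under the
    integral and does not occur in the resulting estimate. *)
Variable B : R.
Hypothesis vB : forall t, velocity_bound Om (phi t) (phi1 t) (phi2 t) B.

Local Notation q t x := (sqd (Y t x) (X t x)).
Local Notation d t x := (`|Y t x - X t x|).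

Let XO t x : Om x -> Om (X t x). Proof. exact: ef_dom efX t x. Qed.
Let YO t x : Om x -> Om (Y t x). Proof. exact: ef_dom efY t x. Qed.

Let bmX t (f : R * R -> R) : bmf Om f -> bmf Om (fun x => f (X t x)).
Proof.
move=> [K [mf hf]]; exists K; split => [|x Ox]; last by apply: hf; exact: XO.
exact: (mp_measurable oOm (ef_mp efX t) (@XO t) mf).
Qed.

Let bmY t (f : R * R -> R) : bmf Om f -> bmf Om (fun x => f (Y t x)).
Proof.
move=> [K [mf hf]]; exists K; split => [|x Ox]; last by apply: hf; exact: YO.
exact: (mp_measurable oOm (ef_mp efY t) (@YO t) mf).
Qed.

Let C1 : 1 <= C.
Proof. by have := hC; have := normr_ge0 (ln (2 * r)); lra. Qed.

Let vX t : velocity_bound Om (psi t) (psi1 t) (psi2 t) C.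
Proof.
apply: hvel (ef_H10 efX t) _ (ef_eq efX t); have [mW hW] := ef_W efX t.
by split => // x Ox; have := hW x Ox; have := M0; lra.
Qed.

Let dr t x : Om x -> d t x <= 2 * r.
Proof. by move=> Ox; apply: (dist_dom Or); [exact: YO|exact: XO]. Qed.

Let bm1 : bmf Om (fun x => x.1).
Proof. exact: (bcont_bmf oOm (bcont_continuous bOm (@continuous_fst R))). Qed.

Let bm2 : bmf Om (fun x => x.2).
Proof. exact: (bcont_bmf oOm (bcont_continuous bOm (@continuous_snd R))). Qed.

Let bB f g : bmf Om f -> bmf Om g -> bmf Om (fun x => f x - g x).
Proof. by move=> hf hg; apply: bmfD => //; exact: bmfN. Qed.

Let bq t : bmf Om (fun x => q t x).
Proof.
apply: bmfD; apply: bmfX; apply: bB.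
- exact: bmY bm1.
- exact: bmX bm1.
- exact: bmY bm2.
- exact: bmX bm2.
Qed.

Let dq t x := 2 * ((Y t x).1 - (X t x).1) * (- phi2 t (Y t x) - - psi2 t (X t x)) +
  2 * ((Y t x).2 - (X t x).2) * (phi1 t (Y t x) - psi1 t (X t x)).

Let dq_derive (t : R) x : Om x -> is_derive t 1 (fun s => q s x) (dq t x).
Proof. by move=> Ox; exact: sqd_derive (ef_ode efY t Ox) (ef_ode efX t Ox). Qed.

Let dq_le t x : Om x -> `|dq t x| <= 2 * d t x * (`|phi1 t (Y t x) - psi1 t (X t x)| + `|phi2 t (Y t x) - psi2 t (X t x)|).
Proof.
move=> Ox; apply: le_trans (sqd_derive_le _ _ _ _) _.
by rewrite -opprD normrN (addrC `|phi1 t _ - _|).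
Qed.

Let E t := I (fun x => q t x).

Let E_derive (t : R) : is_derive t 1 E (I (dq t)).
Proof.
have B0 x : Om x -> 0 <= B.
  by move=> Ox; have [h _ _] := vel_bound (vB t) Ox; exact: le_trans (normr_ge0 _) h.
pose G := 4 * r * (2 * (`|B| + C)).
have G0 : 0 <= G.
  by have := r0; have := C1; have := normr_ge0 B => h1 h2 h3; rewrite /G; apply: mulr_ge0; lra.
have bd s x : Om x -> `|dq s x| <= G.
  move=> Ox; apply: (le_trans (dq_le s Ox)).
  have [_ b1 b2] := vel_bound (vB s) (@YO s x Ox); have [_ b3 b4] := vel_bound (vX s) (@XO s x Ox).
  have lB := ler_norm B; have := dr s Ox => h.
  apply: ler_pM; [by apply: mulr_ge0|exact: addr_ge0|lra|].
  have h1 := ler_normB (phi1 s (Y s x)) (psi1 s (X s x)).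
  by have h2 := ler_normB (phi2 s (Y s x)) (psi2 s (X s x)); lra.
have Ia : `]t - 1, t + 1[%classic t by rewrite /= in_itv/=; apply/andP; split; lra.
have int s : `]t - 1, t + 1[%classic s -> (leb2 R).-integrable Om (EFin \o (fun x => q s x)).
  by move=> _; exact: (bmf_integrable oOm bOm (bq s)).
have der (s : R) x : `]t - 1, t + 1[%classic s -> Om x -> derivable (fun s => q s x) s 1.
  by move=> _ Ox; have [] := dq_derive s Ox.
have E1 (s : R) x : Om x -> partial1of2 (fun s x => q s x) s x = dq s x.
  by move=> Ox; rewrite partial1of2E; have [_] := dq_derive s Ox.
have ub s x : `]t - 1, t + 1[%classic s -> Om x -> `|partial1of2 (fun s x => q s x) s x| <= cst G x.
  by move=> _ Ox; rewrite E1//; exact: bd.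
have iG := bmf_integrable oOm bOm (bmf_cst Om G).
have D := @derivable_under_integral R _ (mplane R) (leb2 R) (fun s x => q s x) Om mO t (t - 1) (t + 1) Ia int der (cst G) (fun _ => G0) iG ub.
apply: (DeriveDef D).
have := @differentiation_under_integral R _ (mplane R) (leb2 R) (fun s x => q s x) Om mO t (t - 1) (t + 1) Ia int der (cst G) (fun _ => G0) iG ub.
rewrite derive1E => ->; apply: eq_Rintegral => x; rewrite inE => Ox; exact: E1.
Qed.

(** Large enough for both uses of [A]: [1 + ln F <= A] follows from [ln F <= F - 1] and the diameter
    bound of the squared distance, and [2 * C <= A] is the condition of [th_sq_le]. *)
Definition log_cst := 2 * C + 8 * r ^+ 2 * area + 1.
(** With [Q = F * (A - ln F)], the factor comes from [sqrt e <= Q] and from the bound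
    [(1 + area) / 2 * Q] for the integral of [P]. *)
Definition exp_cst := rate_cst Om r C M * (1 + (1 + area) / 2).

Lemma flow_distance (e : R) : 0 < e -> e <= 1 / 4 -> I (fun x => `|v0 x - w0 x|) <= e / 2 ->
  forall t, log_cst - ln (Num.sqrt e) <= (log_cst - ln (E t + Num.sqrt e)) * expR (exp_cst * `|t|).
Proof.
move=> e0 e4 Ie; set A := log_cst; set K := exp_cst.
have s0 : 0 < Num.sqrt e by rewrite sqrtr_gt0.
have s1 : Num.sqrt e <= 1 by rewrite -[leRHS]sqrtr1 ler_sqrt// (le_trans e4)// ler_pdivrMr// mul1r ler1n.
have ar : 0 <= area := area_ge0 Om.
have E0 t : 0 <= E t by apply: Rintegral_ge0 => x _; exact: sqd_ge0.
have EA t : E t <= 8 * r ^+ 2 * area.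
  rewrite -(I_cst oOm); apply: (bI_le oOm bOm) => //; first exact: bmf_cst.
  move=> x Ox; apply: le_trans (sqd_le_norm _ _) _.
  have h : d t x ^+ 2 <= (2 * r) ^+ 2.
    by rewrite lerXn2r ?nnegrE//; [have := r0; lra|exact: dr].
  by move: h; rewrite exprMn; lra.
pose F t := E t + Num.sqrt e.
have F0 t : 0 < F t by have := E0 t; rewrite /F; lra.
have FA t : 1 + ln (F t) <= A.
  have := le_ln1Dx (_ : -1 < F t - 1); rewrite addrCA subrr addr0.
  have := F0 t; have := EA t; have := C1; rewrite /A /log_cst /F => h1 h2 h3 h4.
  by have := h4 _; lra.
have dF (t : R) : is_derive t 1 F (I (dq t)).
  by apply: d_eq (dD (E_derive t) (dC (Num.sqrt e) t 1)) _; rewrite addr0.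
have bd t : `|I (dq t)| <= K * (F t * (A - ln (F t))).
  have lF : ln (F t) <= A by have := FA t; lra.
  (* The bound of [th_sq_le] with [l = F t], halved, and with the squared max norm replaced by [q].
     The parameter is the mean of the squared distance, so the pointwise concavity bound integrates
     to an expression in [F t] alone, as in Jensen's inequality. *)
  pose P x := 1 / 2 * (q t x * (A - ln (F t)) + F t).
  have Al : 0 <= A - ln (F t) by lra.
  have CA : 2 * C <= A.
    have := mulr_ge0 (mulr_ge0 (ler0n R 8) (sqr_ge0 r)) ar; rewrite /A /log_cst; lra.
  have bqA : bmf Om (fun x => q t x * (A - ln (F t))) by apply: bmfM => //; exact: bmf_cst.
  have bqF : bmf Om (fun x => q t x * (A - ln (F t)) + F t) by apply: bmfD => //; exact: bmf_cst.
  have bP : bmf Om P by apply: bmfM => //; exact: bmf_cst.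
  have P0 x : 0 <= P x.
    by have := mulr_ge0 (sqd_ge0 (Y t x) (X t x)) Al; have := F0 t; rewrite /P; lra.
  have P2 x : Om x -> d t x * th C (d t x) <= P x.
    move=> Ox; have [->|ne] := eqVneq (Y t x) (X t x); first by rewrite subrr normr0 mul0r.
    have d0 : 0 < d t x by rewrite normr_gt0 subr_eq0.
    have h := th_sq_le d0 (F0 t) CA lF; have h2 := ler_wpM2r Al (norm_le_sqd (Y t x) (X t x)).
    by rewrite /P; lra.
  have P1 x : Om x -> d t x ^+ 2 <= P x.
    move=> Ox; apply: le_trans (P2 x Ox); have [->|ne] := eqVneq (Y t x) (X t x).
      by rewrite subrr normr0 expr0n mul0r.
    have d0 : 0 < d t x by rewrite normr_gt0 subr_eq0.
    by rewrite expr2; apply: ler_wpM2l; [exact: ltW|apply: (th_ge hC d0); exact: dr].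
  have rate := energy_rate oOm bOm M0 Or hC (ef_mp efX t) (@XO t) (ef_mp efY t) (@YO t)
    (ef_w0 efX) (ef_W efX t) (ef_transport efX t) bP P1 P2 r0 solv hvel e0 e4 (ef_w0 efY) (ef_W efY t)
    (ef_transport efY t) (ef_H10 efY t) (ef_eq efY t) (ef_H10 efX t) (ef_eq efX t) Ie.
  have [_ c1 c2 _ _] := ef_H10 efY t; have [_ c3 c4 _ _] := ef_H10 efX t.
  have k1 := bmY t (bcont_bmf oOm c1); have k2 := bmY t (bcont_bmf oOm c2).
  have k3 := bmX t (bcont_bmf oOm c3); have k4 := bmX t (bcont_bmf oOm c4).
  have l1 := bB (bmY t bm1) (bmX t bm1); have l2 := bB (bmY t bm2) (bmX t bm2).
  have bdq : bmf Om (dq t).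
    apply: bmfD; apply: bmfM.
    - by apply: bmfM => //; exact: bmf_cst.
    - by apply: bB; exact: bmfN.
    - by apply: bmfM => //; exact: bmf_cst.
    - exact: bB.
  have bd : bmf Om (fun x => d t x).
    have [L1 [ml1 _]] := bmf_norm l1; have [L2 [ml2 _]] := bmf_norm l2.
    exists (2 * r); split => [|x Ox]; last by rewrite normr_id; exact: dr.
    by apply: (eq_measurable_fun (fun x => Num.max `|(Y t x).1 - (X t x).1| `|(Y t x).2 - (X t x).2|)) => [x _|]; [rewrite prod_normE|exact: measurable_maxr].
  have s2 : `|I (dq t)| <= rate_cst Om r C M * (Num.sqrt e + I P).
    apply: le_trans (le_normr_Rintegral mO (bmf_integrable oOm bOm bdq)) _.
    apply: le_trans rate; apply: (bI_le oOm bOm); first exact: bmf_norm.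
      apply: bmfM; first by apply: bmfM => //; exact: bmf_cst.
      by apply: bmfD; apply: bmf_norm; exact: bB.
    by move=> x Ox; exact: dq_le.
  apply: (le_trans s2).
  have IP : I P = 1 / 2 * (E t * (A - ln (F t)) + F t * area).
    rewrite /P (bI_scale oOm bOm _ bqF) (bI_add oOm bOm bqA (bmf_cst Om _)) (I_cst oOm); congr (_ * (_ + _)).
    rewrite mulrC -(bI_scale oOm bOm _ (bq t)); by apply: eq_Rintegral => x _; rewrite mulrC.
  have rc : 0 <= rate_cst Om r C M.
    have h1 : 0 <= 4 * r * (4 * area + 1) by rewrite mulr_ge0 ?addr_ge0 ?mulr_ge0// ltW.
    have h2 : 0 <= 8 * M ^+ 2 + 4 * C * M.
      have := sqr_ge0 M; have := mulr_ge0 (_ : 0 <= 4 * C) M0; have := C1 => a1 a2 a3.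
      by have := a2 _; lra.
    by have := C1; rewrite /rate_cst; lra.
  rewrite /K /exp_cst -mulrA ler_wpM2l//.
  set Q := F t * (A - ln (F t)).
  have FQ : F t <= Q by rewrite /Q ler_peMr ?(ltW (F0 t))// lerBrDr.
  have EQ : E t * (A - ln (F t)) <= Q by rewrite /Q ler_wpM2r// /F lerDl ltW.
  have FQa : F t * area <= Q * area by exact: ler_wpM2r.
  have sF : Num.sqrt e <= F t by rewrite /F lerDr.
  by rewrite IP; move: FQ EQ FQa sF; rewrite mulrDl mul1r; lra.
move=> t; have := osgood F0 FA dF bd 0 t.
rewrite sub0r normrN /F (_ : E 0 = 0) ?add0r//.
rewrite -[RHS](mul0r area) -(I_cst oOm) /E; apply: eq_Rintegral => x; rewrite inE => Ox.
by rewrite (ef_id efX Ox) (ef_id efY Ox) /sqd !subrr expr0n addr0.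
Qed.

End two_flows.

(** * Approximation of bounded measurable functions by Lipschitz functions *)

Section density.
Context {R : realType}.
Variable Om : set (R * R).
Hypothesis oOm : open Om.
Hypothesis bOm : bounded_set Om.
Implicit Types (x y z : R * R) (f g : R * R -> R) (A : set (R * R)).
Local Notation I h := (\int[leb2 R]_(x in Om) (h x)).
Local Notation area := (fine (leb2 R Om)).
Let mO : measurable (Om : set (mplane R)) := measurable_dom oOm.

Definition lip g := exists2 L : R, 0 <= L & forall x y, `|g x - g y| <= L * `|x - y|.

Lemma I_eq0 f : (forall x, Om x -> f x = 0) -> I f = 0.
Proof.
move=> f0; rewrite -[RHS](mul0r area) -(I_cst oOm); apply: eq_Rintegral => x; rewrite inE; exact: f0.
Qed.

Lemma lip_cst (c : R) : lip (fun=> c).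
Proof. by exists 0 => // x y; rewrite subrr normr0 mul0r. Qed.

Lemma lipD f g : lip f -> lip g -> lip (fun x => f x + g x).
Proof.
move=> [L L0 hL] [K K0 hK]; exists (L + K) => [|x y]; first exact: addr_ge0.
by rewrite opprD addrACA mulrDl; apply: le_trans (ler_normD _ _) _; apply: lerD.
Qed.

Lemma lipZ (c : R) f : lip f -> lip (fun x => c * f x).
Proof.
move=> [L L0 hL]; exists (`|c| * L) => [|x y]; first exact: mulr_ge0.
by rewrite -mulrBr normrM -mulrA ler_wpM2l.
Qed.

Lemma lip_continuous f : lip f -> continuous f.
Proof.
move=> [L L0 hL] x; apply/cvgrPdist_lt => e e0; apply: (nbhs_ballP x _).2.
have L1 : 0 < L + 1 by olra.
exists (e / (L + 1)) => /=; first exact: divr_gt0.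
move=> y; rewrite -ball_normE/= ltr_pdivlMr// => h; apply: le_lt_trans (hL x y) _.
by apply: le_lt_trans h; rewrite mulrC ler_wpM2l//; olra.
Qed.

Lemma lip_bmf f : lip f -> bmf Om f.
Proof. by move=> hf; apply: (bcont_bmf oOm); apply: (bcont_continuous bOm); exact: lip_continuous. Qed.

Definition lip_approx f := forall e : R, 0 < e -> exists2 g, lip g & I (fun x => `|f x - g x|) <= e.

(** Keeping the approximants between 0 and 1 is what allows [g + h - g * h] to approximate a
    union. *)
Definition set_approx A := measurable (A : set (mplane R)) /\ forall e : R, 0 < e ->
  exists2 g, lip g /\ (forall x, 0 <= g x <= 1) & I (fun x => `|\1_A x - g x|) <= e.

Let bB f g : bmf Om f -> bmf Om g -> bmf Om (fun x => `|f x - g x|).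
Proof. by move=> hf hg; apply/bmf_norm/bmfD => //; exact: bmfN. Qed.

Lemma bmf_indic A : measurable (A : set (mplane R)) -> bmf Om (\1_A : R * R -> R).
Proof.
move=> mA; exists 1; split => [|x _]; first by apply: measurable_funTS; exact: measurable_indic.
by rewrite indicE; case: (x \in A); rewrite ?normr1 ?normr0.
Qed.

Lemma indic_bound A x : 0 <= (\1_A x : R) <= 1.
Proof. by rewrite indicE; case: (x \in A); rewrite ?lexx ?ler01. Qed.

Lemma set_approx0 : set_approx set0.
Proof.
split => [|e e0]; first exact: measurable0.
exists (fun=> 0); first by split => [|x]; [exact: lip_cst|rewrite lexx ler01].
by rewrite I_eq0 ?(ltW e0)// => x _; rewrite indic0 subrr normr0.
Qed.

Lemma set_approxC A : set_approx A -> set_approx (~` A).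
Proof.
move=> [mA hA]; split => [|e e0]; first exact: measurableC.
have [g [lg g01] Ig] := hA e e0; exists (fun x => 1 + -1 * g x).
  split => [|x]; first by apply: lipD; [exact: lip_cst|exact: lipZ].
  by have := g01 x; olra.
apply: le_trans Ig; apply: (bI_le oOm bOm).
- by apply: bB; [apply: bmf_indic; exact: measurableC|apply: lip_bmf; apply: lipD; [exact: lip_cst|exact: lipZ]].
- by apply: bB; [exact: bmf_indic|exact: lip_bmf].
- move=> x _; rewrite -[leRHS]normrN (_ : - (_ - _) = \1_(~` A) x - (1 + -1 * g x))//.
  by rewrite !indicE in_setC; case: (x \in A) => /=; ring.
Qed.

Lemma set_approxU A B : set_approx A -> set_approx B -> set_approx (A `|` B).
Proof.
move=> [mA hA] [mB hB]; split => [|e e0]; first exact: measurableU.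
have e2 : 0 < e / 2 by rewrite divr_gt0.
have [g [lg g01] Ig] := hA _ e2; have [h [lh h01] Ih] := hB _ e2.
pose k x := g x + h x - g x * h x.
have lk : lip k.
  have [L L0 hL] := lg; have [K K0 hK] := lh; exists (L + K) => [|x y]; first exact: addr_ge0.
  have -> : k x - k y = (1 - h x) * (g x - g y) + (1 - g y) * (h x - h y) by rewrite /k; ring.
  apply: le_trans (ler_normD _ _) _; rewrite !normrM mulrDl.
  have n1 : `|1 - h x| <= 1 by have := h01 x => /andP[a b]; rewrite ger0_norm; olra.
  have n2 : `|1 - g y| <= 1 by have := g01 y => /andP[a b]; rewrite ger0_norm; olra.
  by apply: lerD; [apply: le_trans (hL x y)|apply: le_trans (hK x y)]; rewrite ler_piMl.
exists k.
  split => // x; have /andP[a1 a2] := g01 x; have /andP[b1 b2] := h01 x.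
  have n1 : 0 <= (1 - g x) * (1 - h x) by apply: mulr_ge0; olra.
  have n2 : 0 <= g x * (1 - h x) by apply: mulr_ge0; olra.
  by rewrite /k; apply/andP; split; olra.
have b1 : bmf Om (fun x => `|\1_A x - g x|) by apply: bB; [exact: bmf_indic|exact: lip_bmf].
have b2 : bmf Om (fun x => `|\1_B x - h x|) by apply: bB; [exact: bmf_indic|exact: lip_bmf].
apply: (@le_trans _ _ (I (fun x => `|\1_A x - g x| + `|\1_B x - h x|))).
  apply: (bI_le oOm bOm); [|exact: bmfD|].
    by apply: bB; [apply: bmf_indic; exact: measurableU|exact: lip_bmf].
  move=> x _; have /andP[a1 a2] := g01 x; have /andP[c1 c2] := h01 x.
  have AB : (\1_(A `|` B) x : R) = 1 - (1 - \1_A x) * (1 - \1_B x).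
    by rewrite !indicE in_setU; case: (x \in A); case: (x \in B) => /=; ring.
  have -> : \1_(A `|` B) x - k x = (1 - h x) * (\1_A x - g x) + (1 - \1_A x) * (\1_B x - h x).
    by rewrite AB /k; ring.
  have /andP[i1 i2] := indic_bound A x.
  apply: le_trans (ler_normD _ _) _; rewrite !normrM.
  by apply: lerD; apply: ler_piMl => //; rewrite ger0_norm; olra.
by rewrite (bI_add oOm bOm b1 b2); olra.
Qed.

(** Dominated convergence for functions between 0 and 1. It is used with finite unions increasing to
    a countable one, and with steepening ramps tending to the indicator of a half-plane. *)
Lemma set_approx_limit (A_ : nat -> set (R * R)) (h_ : nat -> R * R -> R) A :
  measurable (A : set (mplane R)) -> (forall n, bmf Om (h_ n)) -> (forall n x, 0 <= h_ n x <= 1) ->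
  (forall x, h_ n x @[n --> \oo] --> (\1_A x : R)) ->
  (forall n (e : R), 0 < e -> exists2 g, lip g /\ (forall x, 0 <= g x <= 1) & I (fun x => `|h_ n x - g x|) <= e) ->
  set_approx A.
Proof.
move=> mA bh h01 hA happ; split => // e e0; have e2 : 0 < e / 2 by rewrite divr_gt0.
have cv : I (fun x => `|\1_A x - h_ n x|) @[n --> \oo] --> I (fun=> 0).
  apply: (@Rdominated_cvg R Om oOm (fun n x => `|\1_A x - h_ n x|) (fun=> 0) (fun=> 1)).
  - by move=> n; have [K []] := bB (bmf_indic mA) (bh n).
  - exact: measurable_cst.
  - apply: aeW => x _; rewrite -(normr0 R) -(subrr (\1_A x : R)).
    by apply: cvg_norm; apply: cvgB; [exact: cvg_cst|exact: hA].
  - exact: (bmf_integrable oOm bOm (bmf_cst Om 1)).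
  - move=> n x _; rewrite normr_id; have /andP[a b] := h01 n x; have /andP[c d] := indic_bound A x.
    by rewrite ler_norml; apply/andP; split; olra.
move: cv; rewrite (I_cst oOm) mul0r => /cvgrPdist_lt /(_ _ e2)[n _ /(_ n (leqnn n))] /=.
rewrite sub0r normrN => hn; have [g [lg g01] Ig] := happ n _ e2.
exists g => //; have b1 := bB (bmf_indic mA) (bh n); have b2 := bB (bh n) (lip_bmf lg).
apply: (@le_trans _ _ (I (fun x => `|\1_A x - h_ n x| + `|h_ n x - g x|))).
  apply: (bI_le oOm bOm); [exact: (bB (bmf_indic mA) (lip_bmf lg))|exact: bmfD|].
  by move=> x _; rewrite (le_trans _ (ler_normD _ _))// addrA subrK.
rewrite (bI_add oOm bOm b1 b2); have := ler_norm (I (fun x => `|\1_A x - h_ n x|)); olra.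
Qed.

Lemma set_approx_bigcup (A_ : nat -> set (R * R)) : (forall n, set_approx (A_ n)) ->
  set_approx (\bigcup_n A_ n).
Proof.
move=> hA; pose U n := \big[setU/set0]_(i < n) A_ i.
have aU n : set_approx (U n).
  elim: n => [|n IH]; first by rewrite /U big_ord0; exact: set_approx0.
  by rewrite /U big_ord_recr/=; exact: set_approxU.
apply: (@set_approx_limit _ (fun n => \1_(U n))).
- exact: A_.
- by apply: bigcup_measurable => n _; have [] := hA n.
- by move=> n; apply: bmf_indic; have [] := aU n.
- by move=> n x; exact: indic_bound.
- move=> x; have [[k _ Ax]|nU] := pselect ((\bigcup_n A_ n) x).
    apply: cvg_near_cst; exists k.+1 => // n /= kn.
    have h1 : U n x by rewrite /U -bigcup_mkord; exists k.
    have h2 : (\bigcup_n A_ n) x by exists k.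
    by rewrite !indicE !mem_set.
  apply: cvg_near_cst; exists 0%N => // n _.
  have h1 : ~ U n x by rewrite /U -bigcup_mkord => -[k _ Ax]; apply: nU; exists k.
  by rewrite !indicE !memNset.
- by move=> n e e0; have [_] := aU n; apply.
Qed.

Lemma set_approx_halfspace (c : R * R -> R) (a : R) : (forall x y, `|c x - c y| <= `|x - y|) ->
  set_approx [set x | a < c x].
Proof.
move=> hc; have lc : lip c by exists 1 => // x y; rewrite mul1r.
pose h n x := Num.min 1 (Num.max 0 (n%:R * (c x - a))).
have h01 n x : 0 <= h n x <= 1.
  rewrite /h ge_min lexx le_min ler01 /= andbT le_max lexx//.
have lh n : lip (h n).
  exists n%:R => // x y; apply: (@le_trans _ _ `|n%:R * (c x - a) - n%:R * (c y - a)|); last first.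
    by rewrite -mulrBr normrM normr_nat ler_wpM2l// opprB addrA subrK.
  rewrite /h; set s := n%:R * (c x - a); set t := n%:R * (c y - a).
  have mx (u v w : R) : `|Num.max w u - Num.max w v| <= `|u - v|.
    by case: (leP w u) => h1; case: (leP w v) => h2; rewrite ler_norml; apply/andP; split; case: ger0P; olra.
  have mn (u v w : R) : `|Num.min w u - Num.min w v| <= `|u - v|.
    by case: (leP w u) => h1; case: (leP w v) => h2; rewrite ler_norml; apply/andP; split; case: ger0P; olra.
  by apply: le_trans (mn _ _ _) (mx _ _ _).
apply: (@set_approx_limit (fun=> set0) h).
- rewrite (_ : [set x | _] = setT `&` c @^-1` `]a, +oo[); last first.
    by apply/seteqP; split => x /=; rewrite in_itv/= andbT//; case.
  suff mc : measurable_fun [set: mplane R] c by apply: mc => //; exact: measurableT.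
  by apply: continuous_mplane_measurable => [|x _]; [exact: openT|exact: lip_continuous].
- by move=> n; exact: lip_bmf.
- exact: h01.
- move=> x; have [ax|xa] := ltP a (c x).
    apply: cvg_near_cst; have p : 0 < c x - a by rewrite subr_gt0.
    exists (Num.truncn (c x - a)^-1).+1 => // n /= kn; rewrite indicE mem_set// /h.
    have n1 : 1 <= n%:R * (c x - a).
      rewrite -ler_pdivrMr// div1r; apply: (@le_trans _ _ ((Num.truncn (c x - a)^-1).+1)%:R); last by rewrite ler_nat.
      by apply: ltW; apply: truncnS_gt.
    by rewrite (max_idPr _) ?(min_idPl n1)//; olra.
  apply: cvg_near_cst; exists 0%N => // n _; rewrite indicE memNset/=; last by apply/negP; rewrite -leNgt.
  rewrite /h (max_idPl _); last by apply: mulr_ge0_le0; rewrite ?ler0n ?subr_le0.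
  by apply/min_idPr.
- move=> n e e0; exists (h n) => //.
  by rewrite I_eq0 ?(ltW e0)// => x _; rewrite subrr normr0.
Qed.

Let sigma_approx (G : set (set (R * R))) : sigma_algebra setT set_approx.
Proof.
split; first exact: set_approx0.
  by move=> A hA; rewrite setTD; exact: set_approxC.
by move=> A hA; exact: set_approx_bigcup.
Qed.

Lemma set_approx_preimage (c : R * R -> R) (B : set (measurableTypeR R)) :
  (forall x y, `|c x - c y| <= `|x - y|) -> measurable B -> set_approx (c @^-1` B).
Proof.
move=> hc; rewrite (RGenOInfty.measurableE R) => mB.
suff : (RGenOInfty.G (R := R)).-sigma.-measurable `<=` [set B | set_approx (c @^-1` B)] by move=> /(_ B mB).
apply: smallest_sub.
  split; first by rewrite /= preimage_set0; exact: set_approx0.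
    by move=> A hA /=; rewrite setTD preimage_setC; exact: set_approxC.
  by move=> A hA /=; rewrite preimage_bigcup; exact: set_approx_bigcup.
move=> _ [a ->] /=; rewrite (_ : _ @^-1` _ = [set x | a < c x]); first exact: set_approx_halfspace.
by apply/seteqP; split => x /=; rewrite in_itv/= andbT.
Qed.

(** The approximable sets form a sigma-algebra, and the product sigma-algebra is generated by
    preimages under the coordinates, which are 1-Lipschitz for the max norm. *)
Lemma measurable_set_approx A : measurable (A : set (mplane R)) -> set_approx A.
Proof.
suff : (measurable : set (set (mplane R))) `<=` set_approx by apply.
apply: smallest_sub; first exact: (sigma_approx set0).
move=> _ [[B mB <-]|[B mB <-]]; rewrite setTI; apply: set_approx_preimage => // x y.
  exact: (norm_fst_le (x - y)).
exact: (norm_snd_le (x - y)).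
Qed.

Lemma lip_approxD f g : bmf Om f -> bmf Om g -> lip_approx f -> lip_approx g -> lip_approx (fun x => f x + g x).
Proof.
move=> bf bg hf hg e e0; have e2 : 0 < e / 2 by rewrite divr_gt0.
have [f' lf If] := hf _ e2; have [g' lg Ig] := hg _ e2.
exists (fun x => f' x + g' x); first exact: lipD.
have b1 := bB bf (lip_bmf lf); have b2 := bB bg (lip_bmf lg).
apply: (@le_trans _ _ (I (fun x => `|f x - f' x| + `|g x - g' x|))).
  apply: (bI_le oOm bOm); [by apply: bB; [exact: bmfD|apply: lip_bmf; exact: lipD]|exact: bmfD|].
  by move=> x _; rewrite opprD addrACA; exact: ler_normD.
by rewrite (bI_add oOm bOm b1 b2); olra.
Qed.

(** A discrete layer-cake formula: up to [h], a nonnegative number is [h] times the number of levels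
    it reaches. *)
Lemma staircase_error (h t : R) (K : nat) : 0 < h -> 0 <= t -> t <= h * K%:R ->
  `|t - h * \sum_(j < K) (h * j.+1%:R <= t)%R%:R| <= h.
Proof.
move=> h0 t0; elim: K => [|K IH] tK.
  by rewrite big_ord0 mulr0 subr0 ger0_norm//; move: tK; rewrite mulr0; olra.
have [tk|kt] := leP t (h * K%:R).
  rewrite big_ord_recr /= (_ : (h * K.+1%:R <= t) = false) ?addr0; first exact: IH.
  by apply/negbTE; rewrite -ltNge -natr1 mulrDr mulr1; olra.
rewrite big_ord_recr /= (eq_bigr (fun=> 1)); last first.
  move=> j _; suff -> : h * j.+1%:R <= t by [].
  by apply: le_trans (ltW kt); rewrite ler_wpM2l ?(ltW h0)// ler_nat.
rewrite sumr_const card_ord -natr1 mulrDr in tK *.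
by case: (leP (h * K%:R + h * 1) t) => k1; rewrite /= ?addr0 ler_norml; apply/andP; split; olra.
Qed.

Lemma bmf_lip_approx f : bmf Om f -> lip_approx f.
Proof.
move=> [M0 [mf fM0]] e e0; pose M := `|M0| + 1.
have M1 : 0 < M by rewrite /M; have := normr_ge0 M0; olra.
have fM x : Om x -> `|f x| <= M.
  by move=> /fM0 h; apply: (le_trans h); rewrite /M; have := ler_norm M0; olra.
have bf : bmf Om f by exists M.
have ar : 0 <= area := area_ge0 Om.
have a1 : 0 < area + 1 by olra.
(* The staircase error [h] costs at most [e / 2] in L^1; adding 1 to the area avoids a division by
   0. The number [K] of levels covers the range of [f + M]. *)
pose h := e / 2 / (area + 1); have h0 : 0 < h by rewrite !divr_gt0.
pose K := (Num.truncn (2 * M / h)).+1.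
have KM : 2 * M <= h * K%:R.
  by rewrite (mulrC h) -ler_pdivrMr// /K; apply: ltW; exact: truncnS_gt.
pose A j : set (mplane R) := Om `&` (fun x => f x + M) @^-1` `[h * j.+1%:R, +oo[.
have mA j : measurable (A j).
  suff : measurable_fun (Om : set (mplane R)) (fun x => f x + M) by apply.
  exact: measurable_funD.
pose s n x : R := \sum_(j < n) \1_(A j) x.
have bs n : bmf Om (s n).
  elim: n => [|n IH].
    by rewrite (_ : s 0%N = fun=> 0); [exact: bmf_cst|apply/funext => x; rewrite /s big_ord0].
  rewrite (_ : s n.+1 = fun x => s n x + \1_(A n) x); first by apply: bmfD => //; exact: bmf_indic.
  by apply/funext => x; rewrite /s big_ord_recr.
have as_ n : lip_approx (s n).
  elim: n => [|n IH].
    move=> d d0; exists (fun=> 0); first exact: lip_cst.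
    by rewrite I_eq0 ?(ltW d0)// => x _; rewrite /s big_ord0 subrr normr0.
  rewrite (_ : s n.+1 = fun x => s n x + \1_(A n) x).
    apply: lip_approxD => //; first exact: bmf_indic.
    by move=> d d0; have [_ /(_ d d0)[g [lg _] Ig]] := measurable_set_approx (mA n); exists g.
  by apply/funext => x; rewrite /s big_ord_recr.
have d0 : 0 < e / 2 / h by rewrite !divr_gt0.
have [g lg Ig] := as_ K _ d0.
have b1 := bB (bs K) (lip_bmf lg).
exists (fun x => - M + h * g x); first by apply: lipD; [exact: lip_cst|exact: lipZ].
apply: (@le_trans _ _ (I (fun x => h + h * `|s K x - g x|))).
  apply: (bI_le oOm bOm).
  - by apply: bB => //; apply: lip_bmf; apply: lipD; [exact: lip_cst|exact: lipZ].
  - by apply: bmfD; [exact: bmf_cst|apply: bmfM => //; exact: bmf_cst].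
  move=> x Ox; have -> : f x - (- M + h * g x) = (f x + M - h * s K x) + h * (s K x - g x) by ring.
  apply: le_trans (ler_normD _ _) _; rewrite normrM (gtr0_norm h0) lerD2r.
  have := fM x Ox; rewrite ler_norml => /andP[f1 f2].
  rewrite (_ : s K x = \sum_(j < K) (h * j.+1%:R <= f x + M)%R%:R).
    by apply: staircase_error => //; olra.
  apply: eq_bigr => j _; rewrite indicE; congr ((nat_of_bool _)%:R); apply/idP/idP.
    by rewrite inE => -[_ /=]; rewrite in_itv/= andbT.
  by move=> hj; rewrite inE; split => //=; rewrite in_itv/= andbT.
rewrite (bI_add oOm bOm (bmf_cst Om h)); last by apply: bmfM => //; exact: bmf_cst.
rewrite (I_cst oOm) (bI_scale oOm bOm _ b1).
have k1 : h * I (fun x => `|s K x - g x|) <= e / 2.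
  by rewrite mulrC -ler_pdivlMr.
have k2 : h * (area + 1) = e / 2 by rewrite /h -mulrA mulVf ?mulr1// gt_eqF.
by move: k2; rewrite mulrDr mulr1; olra.
Qed.

End density.

(** * Stability of the transported vorticity, in L^1 and then in L^p *)

Section stability.
Context {R : realType}.
Variable Om : set (R * R).
Hypothesis oOm : open Om.
Hypothesis bOm : bounded_set Om.
Implicit Types (x y z : R * R) (f g w : R * R -> R).
Local Notation I h := (\int[leb2 R]_(x in Om) (h x)).
Local Notation area := (fine (leb2 R Om)).
Let mO : measurable (Om : set (mplane R)) := measurable_dom oOm.

(** If [E] exceeded [e], the right side would be at most [b] for all the times considered, whereas
    the choice of [s] makes the left side at least [b + 1]. *)
Lemma log_small (A K T e : R) : 0 < e -> exists s : R, [/\ 0 < s, s <= 1 / 2 &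
  forall t E : R, `|t| <= T -> 0 < E -> A - ln s <= (A - ln E) * expR (K * `|t|) -> E <= e].
Proof.
move=> e0; pose b := `|A - ln e| * expR (`|K| * T).
exists (Num.min (1 / 2) (expR (A - b - 1))); split.
- by rewrite lt_min expR_gt0 divr_gt0.
- by rewrite ge_min lexx.
move=> t E tT E0 h; rewrite leNgt; apply/negP => eE.
have ls : ln (Num.min (1 / 2) (expR (A - b - 1))) <= A - b - 1.
  by rewrite -[leRHS]expRK ler_ln ?posrE ?expR_gt0 ?lt_min ?divr_gt0 ?expR_gt0// ge_min lexx orbT.
have lE : ln e < ln E by rewrite ltr_ln ?posrE.
have h1 : (A - ln E) * expR (K * `|t|) <= b.
  apply: (@le_trans _ _ (`|A - ln e| * expR (K * `|t|))).
    by rewrite ler_wpM2r ?expR_ge0//; have := ler_norm (A - ln e); lra.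
  rewrite ler_wpM2l// ler_expR; apply: (@le_trans _ _ (`|K| * `|t|)); last by rewrite ler_wpM2l.
  by rewrite ler_wpM2r// ler_norm.
by lra.
Qed.

Lemma norm_le_of_sqd x y (e : R) : 0 <= e -> sqd x y <= e ^+ 2 -> `|x - y| <= e.
Proof.
move=> e0 h; have := le_trans (norm_le_sqd x y) h.
by rewrite ler_sqr ?nnegrE.
Qed.

Variables (r C M T : R).
Hypothesis r0 : 0 < r.
Hypothesis Or : forall x, Om x -> `|x| <= r.
Hypothesis hC : 1 + `|ln (2 * r)| <= C.
Hypothesis M0 : 0 <= M.
Hypothesis solv : forall g (N : R), bmeas Om g N -> exists f f1 f2, H10 Om f f1 f2 /\ distr_laplacian Om f g.
Hypothesis hvel : forall f f1 f2 g, H10 Om f f1 f2 -> bmeas Om g (2 * M) -> distr_laplacian Om f g ->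
  velocity_bound Om f f1 f2 C.
Hypothesis hvelN : forall N : R, 0 <= N -> exists B : R, forall f f1 f2 g, H10 Om f f1 f2 -> bmeas Om g N ->
  distr_laplacian Om f g -> velocity_bound Om f f1 f2 B.

Variables (w0 : R * R -> R) (W psi psi1 psi2 : R -> R * R -> R) (X : R -> R * R -> R * R).
Hypothesis efX : euler_flow Om w0 M W psi psi1 psi2 X.

Let vX t : velocity_bound Om (psi t) (psi1 t) (psi2 t) C.
Proof.
apply: hvel (ef_H10 efX t) _ (ef_eq efX t); have [mW hW] := ef_W efX t.
by split => // x Ox; have := hW x Ox; have := M0; lra.
Qed.

Lemma inverse_flow_modulus (e : R) : 0 < e -> exists2 s : R, 0 < s &
  forall t x y, `|t| <= T -> Om x -> Om y -> sqd (X t x) (X t y) <= s -> `|x - y| <= e.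
Proof.
move=> e0; have e2 : 0 < e ^+ 2 by exact: exprn_gt0.
have [s [s0 _ hs]] := log_small (2 * C + 2) (4 * C) T e2; exists s => // t x y tT Ox Oy h.
have [->|ne] := eqVneq x y; first by rewrite subrr normr0 ltW.
have q0 x' y' : x' != y' -> 0 < sqd x' y'.
  move=> ne'; apply: lt_le_trans (norm_le_sqd _ _); rewrite exprn_gt0// normr_gt0 subr_eq0//.
have neX : X t x != X t y.
  by apply/eqP => hX; move/eqP: ne; apply; have [_ inj _] := ef_bij efX t; apply: inj hX; rewrite inE.
apply: norm_le_of_sqd; first exact: ltW.
apply: (hs t) => //; first exact: q0.
apply: le_trans (flow_modulus Or hC efX vX t Ox Oy ne).
by rewrite lerD2l lerN2 ler_ln ?posrE ?q0.
Qed.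

Lemma small_distance (e : R) : 0 < e -> exists2 d : R, 0 < d &
  forall v0 (N : R) V phi phi1 phi2 Y, 0 <= N -> euler_flow Om v0 N V phi phi1 phi2 Y ->
    I (fun x => `|v0 x - w0 x|) <= d -> forall t, `|t| <= T -> I (fun x => sqd (Y t x) (X t x)) <= e.
Proof.
move=> e0; have [s [s0 s2 hs]] := log_small (log_cst Om r C) (exp_cst Om r C M) T e0.
(* [flow_distance] is applied with [e = s^2], whose square root is [s]; it asks for data within
   [e / 2] in L^1, and [s <= 1 / 2] gives [e <= 1 / 4]. *)
exists (s ^+ 2 / 2); first by rewrite divr_gt0// exprn_gt0.
move=> v0 N V phi phi1 phi2 Y N0 efY Id t tT.
have [B hB] := hvelN N0.
have vB u : velocity_bound Om (phi u) (phi1 u) (phi2 u) B := hB _ _ _ _ (ef_H10 efY u) (ef_W efY u) (ef_eq efY u).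
have p0 : 0 < s ^+ 2 by exact: exprn_gt0.
have p1 : s ^+ 2 <= 1 / 4.
  have h : s ^+ 2 <= (1 / 2) ^+ 2 by rewrite lerXn2r ?nnegrE ?divr_ge0// ltW.
  by move: h; rewrite expr2; lra.
have := flow_distance oOm bOm r0 Or hC M0 solv hvel efX efY vB p0 p1 Id t.
rewrite sqrtr_sqr (gtr0_norm s0) /= => h.
have E0 : 0 <= I (fun x => sqd (Y t x) (X t x)) by apply: Rintegral_ge0 => x _; exact: sqd_ge0.
have := hs t _ tT _ h; rewrite ltr_wpDl//; lra.
Qed.

(** Let [g] be a Lipschitz approximation of [w0] and [h] its transport by [X t]. The differences
    [w0 - g] and [h - W t] at [Y t x] have absolute values with the same integral, by measure
    preservation of both flows. The remaining [g x - h (Y t x)] is small where the flows are close,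
    by the modulus of the inverse flow; elsewhere it is bounded and Chebyshev's inequality
    applies. *)
Lemma transported_L1 (e : R) : 0 < e -> exists2 d : R, 0 < d &
  forall v0 (N : R) V phi phi1 phi2 Y, 0 <= N -> euler_flow Om v0 N V phi phi1 phi2 Y ->
    I (fun x => `|v0 x - w0 x|) <= d -> forall t, `|t| <= T -> I (fun x => `|w0 x - W t (Y t x)|) <= e.
Proof.
move=> e0; have ar : 0 <= area := area_ge0 Om.
have bw0 : bmf Om w0 by exists M; exact: ef_w0 efX.
have e4 : 0 < e / 4 by rewrite divr_gt0.
have [g lg Ig] := bmf_lip_approx oOm bOm bw0 e4.
have bg := lip_bmf oOm bOm lg; have [G0 [mg gG0]] := bg.
have [L L0 hL] := lg.
pose G := `|G0| + 1; have GG : 0 < G by rewrite /G; have := normr_ge0 G0; lra.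
have gG x : Om x -> `|g x| <= G.
  by move=> /gG0 h; apply: (le_trans h); rewrite /G; have := ler_norm G0; lra.
pose k := e / 4 / (area + 1) / (L + 1).
have k0 : 0 < k by rewrite !divr_gt0//; lra.
have [s s0 hs] := inverse_flow_modulus k0.
(* The threshold for the mean squared distance is set so that the Chebyshev factor [2 * G / s] turns
   it into [e / 4]. *)
have d0 : 0 < e / 4 * s / (2 * G) by rewrite divr_gt0 ?mulr_gt0.
have [d dpos hd] := small_distance d0.
exists d => // v0 N V phi phi1 phi2 Y N0 efY Id t tT.
have Ed := hd _ _ _ _ _ _ _ N0 efY Id t tT.
have XO x : Om x -> Om (X t x) := @ef_dom _ _ _ _ _ _ _ _ _ efX t x.
have YO x : Om x -> Om (Y t x) := @ef_dom _ _ _ _ _ _ _ _ _ efY t x.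
have [_ inj surj] := ef_bij efX t.
(* [Z] is the inverse of [X t] on the domain, with an arbitrary value outside. *)
have /choice[Z hZ] : forall y, exists x, Om y -> Om x /\ X t x = y.
  move=> y; have [Oy|nO] := pselect (Om y); last by exists y.
  by have [x Ox xy] := surj y Oy; exists x.
have ZX x : Om x -> Z (X t x) = x.
  by move=> Ox; have [Z1 E1] := hZ _ (XO x Ox); apply: inj E1; rewrite inE.
pose h y := g (Z y).
(* Continuity of the inverse flow makes [h] continuous, hence measurable. *)
have bh : bcont Om h.
  split => [y Oy|]; last by exists G => y Oy; apply: gG; have [] := hZ y Oy.
  apply/cvgrPdist_lt => c c0; have L1 : 0 < L + 1 := ltr_wpDl L0 ltr01.
  have c1 : 0 < c / (L + 1) / 2 by rewrite !divr_gt0.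
  have [u u0 hu] := inverse_flow_modulus c1.
  have su : 0 < Num.sqrt (u / 2) by rewrite sqrtr_gt0 divr_gt0.
  have [a /= a0 Ha] := (nbhs_ballP y _).1 (open_nbhs_nbhs (conj oOm Oy)).
  apply: (nbhs_ballP y _).2; exists (Num.min a (Num.sqrt (u / 2))) => /=; first by rewrite lt_min a0.
  move=> z; rewrite -ball_normE/= lt_min => /andP[za zu].
  have Oz : Om z by apply: Ha; rewrite -ball_normE.
  have [Z1 E1] := hZ y Oy; have [Z2 E2] := hZ z Oz.
  have dz : `|Z y - Z z| <= c / (L + 1) / 2.
    apply: (hu t) => //; rewrite E1 E2; apply: le_trans (sqd_le_norm _ _) _.
    rewrite mulrC -ler_pdivlMr// -[leRHS]sqr_sqrtr; last by rewrite ltW// divr_gt0.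
    by rewrite lerXn2r ?nnegrE ?sqrtr_ge0// ltW.
  apply: le_lt_trans (hL _ _) _; apply: (@le_lt_trans _ _ ((L + 1) * (c / (L + 1) / 2))).
    by apply: ler_pM => //; rewrite lerDl.
  by rewrite mulrA mulrCA mulfV ?gt_eqF// mulr1 ltr_pdivrMr// ltr_pMr// ltr1n.
have bmh := bcont_bmf oOm bh.
have bX f : bmf Om f -> bmf Om (fun x => f (X t x)).
  move=> [K [mf hf]]; exists K; split => [|x Ox]; last by apply: hf; exact: XO.
  exact: (mp_measurable oOm (ef_mp efX t) XO mf).
have bY f : bmf Om f -> bmf Om (fun x => f (Y t x)).
  move=> [K [mf hf]]; exists K; split => [|x Ox]; last by apply: hf; exact: YO.
  exact: (mp_measurable oOm (ef_mp efY t) YO mf).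
have bW : bmf Om (W t) by exists M; exact: ef_W efX t.
have bB f f' : bmf Om f -> bmf Om f' -> bmf Om (fun x => `|f x - f' x|).
  by move=> hf hf'; apply/bmf_norm/bmfD => //; exact: bmfN.
have mbm f : bmf Om f -> measurable_fun (Om : set (mplane R)) f by move=> [K []].
have I3 : I (fun x => `|h (Y t x) - W t (Y t x)|) <= e / 4.
  have [K hK] := bB _ _ bmh bW.
  rewrite [leLHS](mp_I oOm bOm (ef_mp efY t) YO hK) -(mp_I oOm bOm (ef_mp efX t) XO hK).
  rewrite (@ae_I_eq _ _ oOm _ (fun x => `|w0 x - g x|))//.
  - by apply: mbm; exact: bX (bB _ _ bmh bW).
  - by apply: mbm; exact: bB.
  - apply: ae_imply (ef_transport efX t) => x hx Ox /=.
    by rewrite hx// /h ZX// distrC.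
have bq : bmf Om (fun x => sqd (Y t x) (X t x)).
  have c1 := bcont_bmf oOm (bcont_continuous bOm (@continuous_fst R)).
  have c2 := bcont_bmf oOm (bcont_continuous bOm (@continuous_snd R)).
  by apply: bmfD; apply: bmfX; apply: bmfD; rewrite ?(bmfN)//; [exact: bY c1|apply: bmfN; exact: bX c1|exact: bY c2|apply: bmfN; exact: bX c2].
have I2 : I (fun x => `|g x - h (Y t x)|) <= e / 4 + e / 4.
  have bc : bmf Om (fun x => 2 * G / s * sqd (Y t x) (X t x)) by apply: bmfM => //; exact: bmf_cst.
  apply: (@le_trans _ _ (I (fun x => L * k + 2 * G / s * sqd (Y t x) (X t x)))).
    apply: (bI_le oOm bOm).
    - by apply: bB => //; exact: bY.
    - by apply: bmfD => //; exact: bmf_cst.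
    - move=> x Ox; have gs : 0 < 2 * G / s by rewrite divr_gt0// mulr_gt0.
      have [Z1 E1] := hZ _ (YO x Ox).
      have [le_s|gt_s] := leP (sqd (Y t x) (X t x)) s.
        have zx : `|Z (Y t x) - x| <= k by apply: (hs t) => //; rewrite E1.
        apply: le_trans (hL _ _) _; rewrite distrC.
        by apply: le_trans (ler_wpM2l L0 zx) _; rewrite lerDl mulr_ge0 ?sqd_ge0// ltW.
      apply: le_trans (ler_normB _ _) _; have g1 := gG x Ox; have g2 := gG _ Z1.
      have : 2 * G / s * s <= 2 * G / s * sqd (Y t x) (X t x) by rewrite ler_wpM2l// ltW.
      rewrite mulfVK ?gt_eqF// => h2; apply: le_trans (lerD g1 g2) _.
      by rewrite (_ : G + G = 2 * G); [apply: le_trans h2 _; rewrite lerDr mulr_ge0// ltW|ring].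
  rewrite (bI_add oOm bOm (bmf_cst Om _) bc) (I_cst oOm) (bI_scale oOm bOm _ bq).
  apply: lerD.
    have h1 : L * k * area <= (L + 1) * k * (area + 1).
      apply: ler_pM => //; first by rewrite mulr_ge0// ltW.
        by rewrite ler_wpM2r ?(ltW k0)// lerDl.
      by rewrite lerDl.
    by apply: (le_trans h1); rewrite /k (mulrC (L + 1)) divfK ?divfK//; rewrite gt_eqF// ltr_wpDl.
  have := ler_wpM2l (_ : 0 <= 2 * G / s) Ed; rewrite divr_ge0 ?mulr_ge0 ?(ltW s0) ?(ltW GG)// => /(_ isT).
  rewrite (_ : 2 * G / s * (e / 4 * s / (2 * G)) = e / 4)//; field.
  by rewrite !gt_eqF.
have b1 := bB _ _ bw0 bg; have b2 := bB _ _ bg (bY _ bmh); have b3 := bB _ _ (bY _ bmh) (bY _ bW).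
have b23 := bmfD b2 b3.
apply: (@le_trans _ _ (I (fun x => `|w0 x - g x| + (`|g x - h (Y t x)| + `|h (Y t x) - W t (Y t x)|)))).
  apply: (bI_le oOm bOm); [exact: bB _ _ bw0 (bY _ bW)|exact: bmfD|].
  move=> x _; have -> : w0 x - W t (Y t x) = (w0 x - g x) + ((g x - h (Y t x)) + (h (Y t x) - W t (Y t x))) by ring.
  by apply: le_trans (ler_normD _ _) _; rewrite lerD2l ler_normD.
rewrite (bI_add oOm bOm b1 b23) (bI_add oOm bOm b2 b3); apply: le_trans (lerD Ig (lerD I2 I3)) _.
by rewrite le_eqVlt; apply/orP; left; apply/eqP; field.
Qed.

Variable p : R.
Hypothesis hp : 1 <= p.
Let p0 : 0 < p. Proof. exact: lt_le_trans hp. Qed.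
Let pm : 0 <= p - 1. Proof. by rewrite subr_ge0. Qed.

Lemma bmf_powR f : bmf Om f -> bmf Om (fun x => `|f x| `^ p).
Proof.
move=> [K [mf hf]]; exists (`|K| `^ p); split.
  apply: (measurableT_comp (measurable_powR p)); exact: measurableT_comp.
move=> x Ox; rewrite ger0_norm ?powR_ge0//; apply: ge0_ler_powR; rewrite ?nnegrE ?(ltW p0)//.
by apply: le_trans (hf x Ox) (ler_norm K).
Qed.

Lemma powR_add_le (a b : R) : 0 <= a -> 0 <= b -> (a + b) `^ p <= 2 `^ p * (a `^ p + b `^ p).
Proof.
move=> a0 b0.
have H (u v : R) : 0 <= u -> u <= v -> (u + v) `^ p <= 2 `^ p * (u `^ p + v `^ p).
  move=> u0 uv; apply: (@le_trans _ _ ((2 * v) `^ p)).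
    by apply: ge0_ler_powR; rewrite ?nnegrE ?(ltW p0)//; lra.
  by rewrite powRM//; [rewrite ler_wpM2l ?powR_ge0// lerDr powR_ge0|lra].
by have [/H|/ltW/H] := leP a b; [exact|rewrite addrC (addrC (b `^ p)); exact].
Qed.

Lemma le_powR_bounded (u B : R) : 0 <= u -> u <= B -> u `^ p <= B `^ (p - 1) * u.
Proof.
move=> u0 uB; rewrite -mulr_powRB1//.
rewrite mulrC ler_wpM2r//; apply: ge0_ler_powR; rewrite ?nnegrE//; exact: le_trans uB.
Qed.

(** A pointwise substitute for Hölder's inequality on a set of finite measure, valid also for
    [p = 1]: either [u <= h], or the factor [(u / h)^(p - 1)] is at least 1. *)
Lemma le_powR_small (u h : R) : 0 <= u -> 0 < h -> u <= h + (h `^ (p - 1))^-1 * u `^ p.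
Proof.
move=> u0 h0; have hh : 0 < h `^ (p - 1) by exact: powR_gt0.
have n0 : 0 <= (h `^ (p - 1))^-1 * u `^ p by rewrite mulr_ge0 ?powR_ge0// invr_ge0 ltW.
have [uh|hu] := leP u h; first by lra.
suff : u <= (h `^ (p - 1))^-1 * u `^ p by lra.
rewrite -(mulr_powRB1 u0 p0).
rewrite mulrCA ler_peMr// mulrC ler_pdivlMr// mul1r.
by apply: ge0_ler_powR; rewrite ?nnegrE//; exact: ltW.
Qed.

(** Composition with [Y t] turns [V t] into [v0]. The difference [v0 - w0], which has no uniform
    bound, is measured directly in L^p; what remains, [w0 - W t (Y t x)], is bounded by [2 * M], so
    its p-th power is controlled by its L^1 norm. *)
Lemma powR_stability (e : R) : 0 < e -> exists2 d : R, 0 < d &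
  forall v0 (N : R) V phi phi1 phi2 Y, 0 <= N -> euler_flow Om v0 N V phi phi1 phi2 Y ->
    I (fun x => `|v0 x - w0 x| `^ p) <= d -> forall t, `|t| <= T ->
    I (fun x => `|V t x - W t x| `^ p) <= e.
Proof.
move=> e0; have ar : 0 <= area := area_ge0 Om.
have q0 : 0 < 2 `^ p :> R by exact: powR_gt0.
(* Adding 1 keeps [c] positive even when [M = 0]. *)
pose c := (2 * M + 1) `^ (p - 1); have c0 : 0 < c by apply: powR_gt0; have := M0; lra.
have e1 : 0 < e / 2 / 2 `^ p / c by rewrite !divr_gt0.
have [d d0 hd] := transported_L1 e1.
pose h := d / 2 / (area + 1); have h0 : 0 < h by rewrite !divr_gt0//; lra.
pose b := h `^ (p - 1); have b0 : 0 < b by exact: powR_gt0.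
exists (Num.min (e / 2 / 2 `^ p) (d / 2 * b)); first by rewrite lt_min !divr_gt0// mulr_gt0// divr_gt0.
move=> v0 N V phi phi1 phi2 Y N0 efY J0 t tT.
have [J1 J2] := andP (etrans (esym (le_min _ _ _)) J0).
have YO x : Om x -> Om (Y t x) := @ef_dom _ _ _ _ _ _ _ _ _ efY t x.
have bw0 : bmf Om w0 by exists M; exact: ef_w0 efX.
have bv0 : bmf Om v0 by exists N; exact: ef_w0 efY.
have bW : bmf Om (W t) by exists M; exact: ef_W efX t.
have bV : bmf Om (V t) by exists N; exact: ef_W efY t.
have bB f f' : bmf Om f -> bmf Om f' -> bmf Om (fun x => f x - f' x).
  by move=> hf hf'; apply: bmfD => //; exact: bmfN.
have bY f : bmf Om f -> bmf Om (fun x => f (Y t x)).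
  move=> [K [mf hf]]; exists K; split => [|x Ox]; last by apply: hf; exact: YO.
  exact: (mp_measurable oOm (ef_mp efY t) YO mf).
have mbm f : bmf Om f -> measurable_fun (Om : set (mplane R)) f by move=> [K []].
have bp1 := bmf_powR (bB _ _ bv0 bw0).
have L1 : I (fun x => `|v0 x - w0 x|) <= d.
  apply: (@le_trans _ _ (I (fun x => h + b^-1 * `|v0 x - w0 x| `^ p))).
    apply: (bI_le oOm bOm); first by apply: bmf_norm; exact: bB.
      by apply: bmfD; [exact: bmf_cst|apply: bmfM => //; exact: bmf_cst].
    by move=> x Ox; exact: le_powR_small.
  rewrite (bI_add oOm bOm (bmf_cst Om h)); last by apply: bmfM => //; exact: bmf_cst.
  rewrite (I_cst oOm) (bI_scale oOm bOm _ bp1).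
  have k1 : b^-1 * I (fun x => `|v0 x - w0 x| `^ p) <= d / 2 by rewrite mulrC ler_pdivrMr.
  have k2 : h * (area + 1) = d / 2 by rewrite /h -mulrA mulVf ?mulr1// gt_eqF//; lra.
  by move: k2; rewrite mulrDr mulr1; lra.
have J := hd _ _ _ _ _ _ _ N0 efY L1 t tT.
have bVW := bmf_powR (bB _ _ bV bW); have [K hK] := bVW.
rewrite -[leLHS](mp_I oOm bOm (ef_mp efY t) YO hK).
rewrite (@ae_I_eq _ _ oOm _ (fun x => `|v0 x - W t (Y t x)| `^ p)).
- have bD := bB _ _ bw0 (bY _ bW).
  have bD1 : bmf Om (fun x => c * `|w0 x - W t (Y t x)|) by apply: bmfM; [exact: bmf_cst|exact: bmf_norm].
  have bS := bmfD bp1 bD1.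
  apply: (@le_trans _ _ (I (fun x => 2 `^ p * (`|v0 x - w0 x| `^ p + c * `|w0 x - W t (Y t x)|)))).
    apply: (bI_le oOm bOm); first exact: bmf_powR (bB _ _ bv0 (bY _ bW)).
      by apply: bmfM => //; exact: bmf_cst.
    move=> x Ox; apply: (@le_trans _ _ ((`|v0 x - w0 x| + `|w0 x - W t (Y t x)|) `^ p)).
      apply: ge0_ler_powR; rewrite ?nnegrE ?addr_ge0 ?(ltW p0)//.
      by rewrite (le_trans _ (ler_normD _ _))// addrA subrK.
    apply: le_trans (powR_add_le _ _) _ => //; rewrite ler_wpM2l ?(ltW q0)// lerD2l.
    apply: le_powR_bounded => //; apply: le_trans (ler_normB _ _) _.
    apply: le_trans (lerD ((ef_w0 efX).2 x Ox) ((ef_W efX t).2 _ (YO x Ox))) _.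
    by rewrite mulr_natl mulr2n lerDl.
  rewrite (bI_scale oOm bOm _ bS) (bI_add oOm bOm bp1 bD1) (bI_scale oOm bOm _ (bmf_norm bD)).
  rewrite mulrC -(ler_pdivlMr _ _ q0).
  have h1 : c * I (fun x => `|w0 x - W t (Y t x)|) <= e / 2 / 2 `^ p by rewrite mulrC -ler_pdivlMr.
  have e2 : e / 2 / 2 `^ p = e / 2 `^ p / 2 by rewrite mulrAC.
  by rewrite [leRHS]splitr -e2; exact: lerD.
- by apply: mbm; exact: bY bVW.
- by apply: mbm; exact: bmf_powR (bB _ _ bv0 (bY _ bW)).
- by apply: ae_imply (ef_transport efY t) => x hx Ox /=; rewrite hx.
Qed.

Lemma LpNormE f g : measurable_fun (Om : set (mplane R)) f -> bmf Om g ->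
  {ae leb2 R, forall x, Om x -> f x = g x} ->
  LpNorm Om p%:E f = ((I (fun x => `|g x| `^ p)) `^ p^-1)%:E.
Proof.
move=> mf bg fg; rewrite /LpNorm unlock.
have -> : (\int[leb2 R]_x (`|(EFin \o f \_ Om) x| `^ p) = \int[leb2 R]_(x in Om) (`|f x| `^ p)%:E)%E.
  rewrite [RHS]integral_mkcond; apply: eq_integral => x _; rewrite /= !patchE.
  by case: ifPn => _ //; rewrite -[LHS]/((`|0 : R| `^ p)%:E) normr0 powR0// gt_eqF.
have mp (h : R * R -> R) : measurable_fun (Om : set (mplane R)) h -> measurable_fun (Om : set (mplane R)) (fun x => (`|h x| `^ p)%:E).
  by move=> mh; apply/measurable_EFinP; apply: (measurableT_comp (measurable_powR p)); exact: measurableT_comp.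
rewrite (@ae_eq_integral _ _ _ (leb2 R) Om (fun x => (`|g x| `^ p)%:E))//; first last.
- by apply: ae_imply fg => x h Ox; rewrite h.
- by apply: mp; have [K []] := bg.
- exact: mp.
have := integrable_fin_num mO (bmf_integrable oOm bOm (bmf_powR bg)) => /fineK <-.
by rewrite poweR_EFin.
Qed.

End stability.

(** * From representatives back to the solution map, and the supremum over time *)

Theorem theorem1p3 (R : realType) (Omega : set (R * R))
    (hOmega : bounded_C2_domain Omega)
    (S : R -> (R * R -> R) -> (R * R -> R)) (hS : solution_map Omega S)
    (p : R) (hp : 1 <= p)
    (w0 : R * R -> R) (hw0 : in_Lp Omega +oo%E w0)
    (w0n : nat -> R * R -> R) (hw0n : forall n, in_Lp Omega +oo%E (w0n n))
    (hcvg : LpNorm Omega p%:E (w0n n \- w0) @[n --> \oo] --> 0%E)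
    (T : R) (hT : 0 < T) :
  ereal_sup [set LpNorm Omega p%:E (S t (w0n n) \- S t w0) | t in `[- T, T]]
    @[n --> \oo] --> 0%E.
Proof.
have [oOm _ _ bOm C2b] := hOmega; have p0 : 0 < p by exact: lt_le_trans hp.
have solv g (N : R) : bmeas Omega g N -> exists f f1 f2, H10 Omega f f1 f2 /\ distr_laplacian Omega f g.
  move=> hg; have [u [X Yu]] := hS g (bmeas_in_Loo oOm hg).
  have [M [W [v0 [psi [psi1 [psi2 [_ ef v0g _]]]]]]] := yudovich_flow oOm bOm (bmeas_in_Loo oOm hg) Yu.
  exists (psi 0), (psi1 0), (psi2 0); split; first exact: ef_H10 ef 0.
  apply: (distr_laplacian_ae oOm (ef_W ef 0).1 hg.1 _ (ef_eq ef 0)).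
  apply: ae_imply2 (ef_transport ef 0) v0g => x h1 h2 Ox.
  by rewrite -h2// -h1// (ef_id ef).
have [r r0 Or'] := dom_norm bOm; have Or x : Omega x -> `|x| <= r by move=> /Or'/ltW.
have [u [X Yu]] := hS w0 hw0.
have [M [W [v [psi [psi1 [psi2 [M0 ef vw0 hW]]]]]]] := yudovich_flow oOm bOm hw0 Yu.
(* The constant is taken for vorticities bounded by [2 * M], since it is applied to the difference
   of a clamped vorticity and the limit one. *)
have M2 : 0 <= 2 * M by rewrite mulr_ge0.
have [C hC hvel] := velocity_modulus oOm bOm C2b r0 Or M2.
have hvelN (N : R) : 0 <= N -> exists B : R, forall f f1 f2 g, H10 Omega f f1 f2 -> bmeas Omega g N ->
    distr_laplacian Omega f g -> velocity_bound Omega f f1 f2 B.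
  by move=> /(velocity_modulus oOm bOm C2b r0 Or)[B _ hB]; exists B.
have main (e : R) : 0 < e -> \forall n \near \oo, forall t, `|t| <= T ->
    (LpNorm Omega p%:E (S t (w0n n) \- S t w0)%R <= e%:E)%E.
  move=> e0; have ep : 0 < e `^ p by exact: powR_gt0.
  (* [powR_stability] concerns integrals of p-th powers: the target [e] is raised to the power [p],
     and the threshold for the norm of the data is the p-th root of [d]. *)
  have [d d0 hd] := powR_stability oOm bOm T r0 Or hC M0 solv hvel hvelN ef hp ep.
  have dp : 0 < d `^ p^-1 by exact: powR_gt0.
  have [_ /cvgrPdist_lt /(_ _ dp)] := (fine_cvgP _ _).1 hcvg.
  apply: filterS => n hn t tT; have [un [Xn Yn]] := hS _ (hw0n n).
  have [N [V [vn [phi [phi1 [phi2 [N0 efn vnw hV]]]]]]] := yudovich_flow oOm bOm (hw0n n) Yn.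
  have bB f g (K L : R) : bmeas Omega f K -> bmeas Omega g L -> bmf Omega (fun x => f x - g x).
    by move=> hf hg; apply: bmfD; [exists K|apply: bmfN; exists L].
  have J : \int[leb2 R]_(x in Omega) (`|vn x - v x| `^ p) <= d.
    move: hn; rewrite /comp (LpNormE oOm bOm hp (_ : measurable_fun (Omega : set (mplane R)) (w0n n \- w0))
      (bB _ _ _ _ (ef_w0 efn) (ef_w0 ef))).
    - rewrite sub0r normrN /= ger0_norm ?powR_ge0// => h; rewrite leNgt; apply/negP => dJ.
      have := ge0_ler_powR (_ : 0 <= p^-1) _ _ (ltW dJ); rewrite !nnegrE invr_ge0 (ltW p0) (ltW d0) => /(_ isT isT).
      by rewrite (le_trans (ltW d0) (ltW dJ)) => /(_ isT); rewrite leNgt h.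
    - have [m1 _] := in_Loo_ae_bounded oOm (hw0n n); have [m2 _] := in_Loo_ae_bounded oOm hw0.
      exact: measurable_funB.
    - by apply: ae_imply2 vnw vw0 => x h1 h2 Ox; rewrite h1// h2.
  have [m1 a1] := hV t; have [m2 a2] := hW t.
  rewrite (LpNormE oOm bOm hp (_ : measurable_fun (Omega : set (mplane R)) _) (bB _ _ _ _ (ef_W efn t) (ef_W ef t))).
  - rewrite lee_fin -[leRHS]powRr1 ?(ltW e0)// -(mulfV (lt0r_neq0 p0)) powRrM.
    have hI := hd _ _ _ _ _ _ _ N0 efn J t tT.
    apply: ge0_ler_powR; rewrite ?nnegrE ?invr_ge0 ?(ltW p0) ?powR_ge0//.
    by apply: Rintegral_ge0 => x _; exact: powR_ge0.
  - exact: measurable_funB.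
  - by apply: ae_imply2 a1 a2 => x h1 h2 Ox; rewrite h1// h2.
pose D n := [set LpNorm Omega p%:E (S t (w0n n) \- S t w0) | t in `[- T, T]].
(* A supremum over no times would be [-oo]; time 0 provides an element. *)
have sup0 n : (0 <= ereal_sup (D n))%E.
  apply: (@le_trans _ _ (LpNorm Omega p%:E (S 0 (w0n n) \- S 0 w0)%R)); first exact: Lnorm_ge0.
  by apply: ereal_sup_ubound; exists 0 => //=; rewrite in_itv/=; apply/andP; split; lra.
have sup_le (e : R) : 0 < e -> \forall n \near \oo,
    (ereal_sup (D n) <= e%:E)%E.
  move=> /main; apply: filterS => n hn; apply: ge_ereal_sup => _ [t /= tT <-]; apply: hn.
  by move: tT; rewrite in_itv/= ler_norml.
apply/fine_cvgP; split.
  apply: filterS (sup_le 1 ltr01) => n h1.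
  by rewrite -/(D n) (ge0_fin_numE (sup0 n)); apply: le_lt_trans h1 (ltry _).
apply/cvgrPdist_le => e /sup_le; apply: filterS => n h.
rewrite sub0r normrN /comp -/(D n) ger0_norm ?fine_ge0// -lee_fin fineK//.
by rewrite (ge0_fin_numE (sup0 n)); apply: le_lt_trans h (ltry _).
Qed.
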